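(* Let $k\in\mathbb N$, $r\in\mathbb N_0$, $1\le p\le\infty$, let $\alpha,\beta\in\mathbb R$ satisfy $r/2+\alpha\ge 0$ and $r/2+\beta\ge 0$, and let $f\in\mathbb B^r_p(w_{\alpha,\beta})$. Then, for all $0<t\le 2/k$, $$K^\varphi_{k,r}(f^{(r)},t^k)_{\alpha,\beta,p}\le c\,\omega_{k,r}^{*\varphi}(f^{(r)},t)_{\alpha,\beta,p}\le c\,\omega_{k,r}^{\varphi}(f^{(r)},t)_{\alpha,\beta,p}\le c\,K^\varphi_{k,r}(f^{(r)},t^k)_{\alpha,\beta,p},$$ where the constants $c$ (possibly different at each occurrence) depend only on $k,r,p,\alpha,\beta$.
   Context: Notation. $\mathbb N_0=\mathbb N\cup\{0\}$. For a measurable set $I\subseteq[-1,1]$ and measurable $f$, $\|f\|_{L_p(I)}=(\int_I|f|^p\,dx)^{1/p}$ for $0<p<\infty$ and $\|f\|_{L_\infty(I)}=\operatorname{ess\,sup}_{I}|f|$; $\|\cdot\|_p=\|\cdot\|_{L_p[-1,1]}$. For a weight $w$, $L_{w,p}=\{f:\|wf\|_p<\infty\}$. $\varphi(x)=\sqrt{1-x^2}$. $w_{\alpha,\beta}(x)=(1-x)^\alpha(1+x)^\beta$. Spaces: $\mathbb B^0_p(w)=L_{w,p}$ and, for $r\ge1$, $\mathbb B^r_p(w)=\{f: f^{(r-1)}\in AC_{loc}(-1,1)\text{ and }\varphi^rf^{(r)}\in L_{w,p}\}$, where $AC_{loc}(-1,1)$ is the set of functions locally absolutely continuous in $(-1,1)$.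 Differences: $\Delta_h^k(f,x)=\sum_{i=0}^k\binom ki(-1)^{k-i}f(x-\frac{kh}2+ih)$ if $[x-\frac{kh}2,x+\frac{kh}2]\subseteq[-1,1]$, and $\Delta_h^k(f,x)=0$ otherwise. Weights and domains: $\mathcal W_\delta^{\xi,\zeta}(x)=(1-x-\delta\varphi(x)/2)^\xi(1+x-\delta\varphi(x)/2)^\zeta$; for $\delta>0$, $\mathfrak D_\delta=\{x: 1-\delta\varphi(x)/2\ge|x|\}\setminus\{\pm1\}=\{x:|x|\le\frac{4-\delta^2}{4+\delta^2}\}$ (empty if $\delta>2$). Moduli: for $k\in\mathbb N$, $r\in\mathbb N_0$, $f\in\mathbb B^r_p(w_{\alpha,\beta})$, $0<p\le\infty$, $$\omega_{k,r}^\varphi(f^{(r)},t)_{\alpha,\beta,p}=\sup_{0<h\le t}\big\|\mathcal W_{kh}^{r/2+\alpha,r/2+\beta}(\cdot)\,\Delta^k_{h\varphi(\cdot)}(f^{(r)},\cdot)\big\|_{L_p(\mathfrak D_{kh})},$$ and, for $0<p<\infty$, $$\omega_{k,r}^{*\varphi}(f^{(r)},t)_{\alpha,\beta,p}=\Big(\frac1t\int_0^t\int_{\mathfrak D_{k\tau}}\big|\mathcal W_{k\tau}^{r/2+\alpha,r/2+\beta}(x)\Delta^k_{\tau\varphi(x)}(f^{(r)},x)\big|^p\,dx\,d\tau\Big)^{1/p},$$ with $\omega_{k,r}^{*\varphi}(f^{(r)},t)_{\alpha,\beta,\infty}=\omega_{k,r}^{\varphi}(f^{(r)},t)_{\alpha,\beta,\infty}$.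 $K$-functional: $$K^\varphi_{k,r}(f^{(r)},t^k)_{\alpha,\beta,p}=\inf_{g\in\mathbb B^{k+r}_p(w_{\alpha,\beta})}\{\|w_{\alpha,\beta}\varphi^r(f^{(r)}-g^{(r)})\|_p+t^k\|w_{\alpha,\beta}\varphi^{k+r}g^{(k+r)}\|_p\}.$$ *)

(* Defs.v *)
From HB Require Import structures.
From mathcomp Require Import all_boot all_order all_algebra.
From mathcomp Require Import all_classical all_reals all_analysis.
From mathcomp Require Import measurable_realfun.
Import Order.TTheory GRing.Theory Num.Theory.
Import numFieldNormedType.Exports.

Set Implicit Arguments.
Unset Strict Implicit.
Unset Printing Implicit Defensive.

Local Open Scope classical_set_scope.
Local Open Scope ring_scope.

Section Defs.
Context {R : realType}.
Implicit Types (f g F w : R -> R) (p : \bar R) (I : set R).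
Implicit Types (k r : nat) (x h t s delta xi zeta alpha beta : R).

(* Functions on [-1, 1] are represented by total functions R -> R, whose values
   outside [-1, 1] are never used. *)

(* Measurability with respect to the Lebesgue (completed) sigma-algebra, which
   is larger than the Borel one carried by default by R. *)
Definition lebesgue_measurable_fun I f :=
  @measurable_fun _ _
    (g_sigma_algebraType (completed_algebra_gen (@lebesgue_measure R)))
    (measurableTypeR R) I f.

(* [lebesgue_measure] lives on the Borel sigma-algebra, but the integral of a
   nonnegative function is a supremum over simple functions below it and
   [ess_sup] only uses negligible sets, so that the value is the usual one for
   Lebesgue measurable functions too.  For p = +oo, extending by 0 outside I
   does not change the essential supremum of |f|. *)
Definition Lpnorm I p f : \bar R :=
  Lnorm (@lebesgue_measure R) p (EFin \o (f \_ I)).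

Definition Lspace_wp w p f : Prop :=
  lebesgue_measurable_fun `[(-1), 1] f /\
  (Lpnorm `[(-1)%R, 1%R] p (fun x => (w x * f x)%R) < +oo)%E.

Definition phi x : R := Num.sqrt (1 - x ^+ 2).

Definition wjac alpha beta x : R := (1 - x) `^ alpha * (1 + x) `^ beta.

Definition abs_continuous (a b : R) f : Prop :=
  forall e : R, 0 < e -> exists2 d : R, 0 < d &
    forall (n : nat) (u v : 'I_n -> R),
      (forall i, a <= u i /\ u i <= v i /\ v i <= b) ->
      trivIset setT (fun i => `]u i, v i[%classic) ->
      \sum_(i < n) (v i - u i) < d ->
      \sum_(i < n) `|f (v i) - f (u i)| < e.

Definition ACloc f : Prop :=
  forall a b : R, -1 < a -> a <= b -> b < 1 -> abs_continuous a b f.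

(* [derive1n j f] is total (with junk value where the derivative does not exist), so
   the existence of f^(r-1) on (-1, 1) has to be required explicitly; f^(r) then
   exists almost everywhere by absolute continuity. *)
Definition Bspace r p w f : Prop :=
  match r with
  | 0 => Lspace_wp w p f
  | q.+1 =>
    [/\ forall j x, (j < q)%N -> -1 < x < 1 -> derivable (derive1n j f) x 1,
        ACloc (derive1n q f) &
        Lspace_wp w p (fun x => phi x ^+ q.+1 * (derive1n q.+1 f) x)]
  end.

Definition fdiff k h F x : R :=
  if `[< `[x - k%:R * h / 2, x + k%:R * h / 2] `<=` `[(-1), 1] >] then
    \sum_(i < k.+1)
      'C(k, i)%:R * (-1) ^+ (k - i) * F (x - k%:R * h / 2 + i%:R * h)
  else 0.

Definition Wdelta delta xi zeta x : R :=
  (1 - x - delta * phi x / 2) `^ xi * (1 + x - delta * phi x / 2) `^ zeta.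

Definition Ddom delta : set R :=
  [set x | `|x| <= 1 - delta * phi x / 2] `\` [set 1; -1].

(* The functions below take F = f^(r) as argument. *)

Definition wdiff k r alpha beta F h x : R :=
  Wdelta (k%:R * h) (r%:R / 2 + alpha) (r%:R / 2 + beta) x *
  fdiff k (h * phi x) F x.

Definition omega k r F t alpha beta p : \bar R :=
  ereal_sup [set Lpnorm (Ddom (k%:R * h)) p (wdiff k r alpha beta F h)
            | h in `]0, t]].

Definition omega_star k r F t alpha beta p : \bar R :=
  if p is q%:E then
    ((t^-1)%:E *
     \int[@lebesgue_measure R]_(tau in `[0%R, t])
       \int[@lebesgue_measure R]_(x in Ddom (k%:R * tau)%R)
         (`|wdiff k r alpha beta F tau x| `^ q)%:E) `^ q^-1
  else omega k r F t alpha beta p.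

(* The second argument s stands for t^k. *)
Definition Kfunctional k r F s alpha beta p : \bar R :=
  ereal_inf
    [set Lpnorm `[(-1)%R, 1%R] p
           (fun x => (wjac alpha beta x * phi x ^+ r * (F x - (derive1n r g) x))%R) +
         s%:E * Lpnorm `[(-1)%R, 1%R] p
           (fun x => (wjac alpha beta x * phi x ^+ (k + r) * (derive1n (k + r) g) x)%R)
    | g in Bspace (k + r)%N p (wjac alpha beta)]%E.

End Defs.

(* Main.v *)
(** Put a = r/2 + alpha, b = r/2 + beta and v = (1-x)^a (1+x)^b, which is the weight times phi^r
on (-1,1).  To treat 1 <= p < oo and p = oo together, norms are replaced by integrals of a convex
modular Phi: Phi s = s^p, or Phi s = max(0, s - M), whose integral vanishes iff the sup norm is at
most M.

K <= c omega*: on a partition of [-1,1] whose mesh near x is comparable to t phi(x), Whitney's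
inequality gives on each cell a polynomial of degree < k whose error is bounded by averages of k-th
differences of f^(r); for the two end cells the bound is carried over from the neighbouring cells by
differences with nodes inside [-1,1].  Gluing neighbouring polynomials with a polynomial smoothstep
gives a spline S which approximates f^(r) and whose k-th derivative is controlled by the same
averages; an r-fold antiderivative of S is the competitor in the K-functional.

omega <= c K: for a competitor g and G = g^(r), the difference of f^(r) - G is bounded by a change of
variables, since x -> x + c h phi(x) has slope at least 1/2 on D_kh for |c| <= k/2.  For G, Taylor's
formula with integral remainder (G^(k-1) is absolutely continuous, so it is the integral of its
almost everywhere derivative, by Radon-Nikodym) bounds the weighted difference at x by the integral
of (theta phi(u))^-1 theta^k v phi^k |G^(k)| over |u - x| <= theta phi(x) / 2, with theta = k h.
This kernel has bounded marginals, so that Jensen's inequality and Tonelli's theorem conclude. *)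

Require Import Defs.
From HB Require Import structures.
From mathcomp Require Import all_boot all_order all_algebra.
From mathcomp Require Import all_classical all_reals all_analysis.
From mathcomp Require Import measurable_realfun ess_sup_inf.
From mathcomp Require finmap qpoly.
From mathcomp Require Import ring lra.
Import Order.TTheory GRing.Theory Num.Theory.
Import numFieldNormedType.Exports.
Set Implicit Arguments.
Unset Strict Implicit.
Unset Printing Implicit Defensive.
Local Open Scope classical_set_scope.
Local Open Scope ring_scope.

(* [lra] tries to reify every hypothesis of the context, which is slow when the context contains
   integrals; only the (in)equalities between real numbers are kept. *)
Ltac real_lra :=
  repeat match goal with
  | H : ?T |- _ => lazymatch T with
    | is_true (@Order.le ring_display _ _ _) => fail
    | is_true (@Order.lt ring_display _ _ _) => fail
    | is_true (andb _ _) => fail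
    | @eq _ _ _ => fail
    | _ => clear H
    end
  end; lra.

(** * Modulars, finite differences and polynomials *)

Section change_of_variables.
Context {R : realType}.
Local Notation mu := (@lebesgue_measure R).
Local Open Scope ereal_scope.

(** Constants have to stay inside the modular: [Phi (C * s)] is not bounded by a multiple of [Phi s]
    when Phi s = max(0, s - M), so the estimates have the form Phi(E / C) <= sum of values of Phi.
    Bounding K by omega* forces averaged estimates: only integrals over tau are available, never a
    single step h, so Whitney's inequality is needed with a double integral over step and position,
    and tau is converted into a step w = tau phi(x) at fixed x. Neighbouring polynomials have to be
    compared on a common interval, so each polynomial is attached to a window of two cells,
    overlapping the next one. Near 1 and -1 the weight degenerates and centred differences have no
    room; intervals of length about t^2 are left there and reached from the inside. Finally f^(r) is
    only Lebesgue measurable, while Tonelli's theorem and changes of variables act on Borel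
    functions: the estimates are made for Borel representatives and transferred through null
    sets. *)

Lemma lebesgue_measure_le (nu : {measure set (measurableTypeR R) -> \bar R}) :
  (forall a b : R, (a <= b)%R -> nu `]a, b]%classic <= (b - a)%:E) ->
  forall A, measurable A -> nu A <= mu A.
Proof.
move=> nuI A mA; rewrite /lebesgue_measure /lebesgue_stieltjes_measure.
rewrite /measure_extension /=.
(* Lebesgue measure is an infimum of total lengths of covers by half-open intervals, so it suffices
   to bound [nu] by the total length of one such cover. *)
apply: le_ereal_inf_tmp => _ [B [mB AB] <-].
have nuB k : nu (B k) <= wlength idfun (B k).
  have [[x y] _ /= <-] := mB k.
  have [xy|yx] := leP x y; first by rewrite wlength_itv_bnd//; exact: nuI.
  have -> : `]x, y]%classic = set0 by rewrite set_itv_ge// bnd_simp -leNgt ltW.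
  by rewrite measure0 wlength0.
apply: (@le_trans _ _ (\sum_(k <oo) nu (B k))).
  have mB' k : measurable (B k : set (measurableTypeR R)).
    by have [[x y] _ /= <-] := mB k; exact: measurable_itv.
  exact: (measure_sigma_subadditive nu mB' mA AB).
by apply: lee_nneseries => // k _.
Qed.

(** If m expands distances by at least kappa, the preimage of an interval of length L has diameter
    at most L / kappa. So kappa times the image under m of Lebesgue measure on D is dominated by
    Lebesgue measure on intervals, hence on Borel sets. This one-sided inequality stands in for the
    change of variables formula. *)
Lemma ge0_integral_expansion (D : set (measurableTypeR R)) (m : measurableTypeR R -> measurableTypeR R)
    (kappa : R) (E : set (measurableTypeR R)) (f : measurableTypeR R -> \bar R) :
  measurable D -> measurable E -> measurable_fun setT m -> (0 < kappa)%R ->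
  (forall x y, D x -> D y -> (kappa * `|x - y| <= `|m x - m y|)%R) ->
  (forall x, D x -> E (m x)) ->
  measurable_fun setT f -> (forall x, 0 <= f x) ->
  kappa%:E * \int[mu]_(x in D) f (m x) <= \int[mu]_(y in E) f y.
Proof.
move=> mD mE mm k0 mexp DE mf f0.
unshelve epose (nu := (pushforward (mrestr mu mD) m : {measure set (measurableTypeR R) -> \bar R})); first exact: mm.
have nuE A : measurable A -> kappa%:E * nu A <= mu A.
  move=> mA.
  apply: (@lebesgue_measure_le (mscale (NngNum (ltW k0)) nu)) => // a b ab.
  pose S := (m @^-1` `]a, b]%classic) `&` D; change (kappa%:E * mu S <= (b - a)%:E).
  have mS : measurable S.
    apply: measurableI => //; rewrite -[X in measurable X]setTI.
    exact: (mm measurableT _ (measurable_itv _)).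
  have [->|/set0P[x0 Sx0]] := eqVneq S set0.
    by rewrite measure0 mule0 lee_fin subr_ge0.
  have bS x y : S x -> S y -> (x - y <= (b - a) / kappa)%R.
    move=> [/= mx Dx] [/= my Dy]; rewrite ler_pdivlMr// mulrC.
    apply: (@le_trans _ _ (kappa * `|x - y|)%R).
      by rewrite ler_pM2l// ler_norm.
    apply: (le_trans (mexp _ _ Dx Dy)).
    by move: mx my; rewrite !in_itv/= ler_norml => /andP[? ?] /andP[? ?]; real_lra.
  have hs : has_inf S.
    split; first by exists x0.
    exists (x0 - (b - a) / kappa)%R => y Sy.
    by have := bS _ _ Sx0 Sy; real_lra.
  pose l : R := inf S; pose u : R := (inf S + (b - a) / kappa)%R.
  apply: (@le_trans _ _ (kappa%:E * mu `[l, u]%classic)).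
    apply: lee_wpmul2l; first by rewrite lee_fin ltW.
    apply: le_measure; rewrite ?inE//.
    move=> y Sy /=; rewrite in_itv/=; apply/andP; split; first by apply: ge_inf => //; exact: hs.2.
    rewrite -lerBlDr; apply: lb_le_inf; first exact: hs.1.
    by move=> z Sz; have := bS _ _ Sy Sz; real_lra.
  rewrite lebesgue_measure_itv/= lte_fin /u /l ltrDl; case: ifPn => _.
    by rewrite -EFinB -EFinM lee_fin addrAC subrr add0r mulrCA divff ?mulr1// gt_eqF.
  by rewrite mule0 lee_fin subr_ge0.
pose nu' := mscale (NngNum (ltW k0)) nu.
have -> : \int[mu]_(x in D) f (m x) = \int[mrestr mu mD]_(x in D) f (m x).
  by apply: eq_measure_integral => A mA AD; rewrite -[in LHS](setIidl AD).
have mfm : measurable_fun setT (f \o m) by exact: measurableT_comp.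
have mDE : measurable (m @^-1` E).
  by rewrite -[X in measurable X]setTI; exact: (mm measurableT _ mE).
apply: (@le_trans _ _ (kappa%:E * \int[mrestr mu mD]_(x in m @^-1` E) f (m x))).
  apply: lee_wpmul2l; first by rewrite lee_fin ltW.
  by apply: ge0_subset_integral => //; exact: measurable_funTS.
rewrite -(ge0_integral_pushforward mm (mrestr mu mD) mE (measurable_funTS mf))//.
rewrite -(@ge0_integral_mscale _ _ _ nu _ mE (NngNum (ltW k0)))//; last exact: measurable_funTS.
exact: ge0_le_measure_integral.
Qed.

End change_of_variables.

Section convex_modulars.
Context {R : realType}.
Implicit Types Phi : R -> R.

(* [cm_sup]: Phi has at every m >= 0 a nondecreasing supporting line.  This is convexity in the only
   form which is used, and it implies that Phi is nonnegative and nondecreasing. *)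
Record convmod Phi : Prop := ConvMod {
  cm_meas : measurable_fun [set: R] Phi ;
  cm_0 : Phi 0 = 0 ;
  cm_sup : forall m : R, 0 <= m -> exists2 c : R, 0 <= c &
    forall s : R, 0 <= s -> Phi m + c * (s - m) <= Phi s }.

Lemma cm_ge0 Phi s : convmod Phi -> 0 <= s -> 0 <= Phi s.
Proof.
move=> PhiP s0; have [c c0 /(_ _ s0)] := cm_sup PhiP (lexx 0).
by apply: le_trans; rewrite cm_0// add0r subr0 mulr_ge0.
Qed.

Lemma cm_mono Phi s s' : convmod Phi -> 0 <= s -> s <= s' -> Phi s <= Phi s'.
Proof.
move=> PhiP s0 ss'; have [c c0 /(_ _ (le_trans s0 ss'))] := cm_sup PhiP s0.
by apply: le_trans; rewrite lerDl mulr_ge0// subr_ge0.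
Qed.

Lemma cm_scale Phi (k : R) : 0 <= k -> convmod Phi -> convmod (fun s => Phi (k * s)).
Proof.
move=> k0 PhiP; split.
- apply: measurableT_comp; first exact: cm_meas.
  exact: measurable_funM.
- by rewrite mulr0 cm_0.
- move=> m m0; have [c c0 H] := cm_sup PhiP (mulr_ge0 k0 m0).
  exists (c * k) => [|s s0]; first exact: mulr_ge0.
  by have := H _ (mulr_ge0 k0 s0); rewrite -mulrBr mulrA.
Qed.

(** Either some a i reaches E / C and monotonicity suffices, or all are smaller and their sum cannot
    reach E unless E = 0. This is the substitute for the triangle inequality, with the constant kept
    inside Phi. *)
Lemma cm_sum Phi n (a : 'I_n -> R) (E C : R) : convmod Phi ->
  (forall i, 0 <= a i) -> 0 <= E -> E <= \sum_(i < n) a i ->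
  0 < C -> n%:R <= C -> Phi (E / C) <= \sum_(i < n) Phi (a i).
Proof.
move=> PhiP a0 E0 Ea C0 nC.
have [[i Ei]|H] := pselect (exists i, E / C <= a i).
  rewrite (bigD1 i)//=; apply: (le_trans (cm_mono PhiP _ Ei)).
    by rewrite divr_ge0// ltW.
  by rewrite lerDl sumr_ge0// => j _; exact: cm_ge0.
suff -> : E = 0 by rewrite mul0r cm_0// sumr_ge0// => j _; exact: cm_ge0.
apply/eqP; rewrite eq_le E0 andbT.
case: n a a0 Ea nC H => [|n] a a0 Ea nC H; first by rewrite big_ord0 in Ea.
have aE i : a i < E / C by rewrite ltNge; apply/negP => ?; apply: H; exists i.
have h1 : \sum_(i < n.+1) a i < n.+1%:R * (E / C).
  rewrite mulr_natl -[in ltRHS](card_ord n.+1) -sumr_const.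
  by apply: ltr_sum => [|i _]; [apply/hasP; exists ord0; rewrite ?mem_index_enum|exact: aE].
have h2 : n.+1%:R * (E / C) <= E.
  by rewrite mulrCA ler_piMr// ler_pdivrMr// mul1r.
by have := lt_le_trans (le_lt_trans Ea h1) h2; rewrite ltxx.
Qed.

Lemma cm_add Phi (a b E C : R) : convmod Phi -> 0 <= a -> 0 <= b -> 0 <= E ->
  E <= a + b -> 2 <= C -> Phi (E / C) <= Phi a + Phi b.
Proof.
move=> PhiP a0 b0 E0 Eab C2.
have := @cm_sum Phi 2 (fun i => if i == 0 :> nat then a else b) E C PhiP.
rewrite !big_ord_recl !big_ord0 /= !addr0; apply => //; last real_lra.
by move=> i; case: ifP.
Qed.

(** The mass of K is only bounded by A, not equal to it. The supporting line of Phi at m = E / A is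
    integrated against K, and the missing mass is compensated by [Phi m <= c * m], which is the
    supporting line read at 0. *)
Lemma jensen Phi d (T : measurableType d) (mu : {measure set T -> \bar R})
    (D : set T) (K psi : T -> R) (A E : R) : convmod Phi ->
  measurable D -> measurable_fun D K -> measurable_fun D psi ->
  (forall x, D x -> 0 <= K x) -> (forall x, D x -> 0 <= psi x) -> 0 < A -> 0 <= E ->
  (\int[mu]_(x in D) (K x)%:E <= A%:E)%E ->
  (E%:E <= \int[mu]_(x in D) (K x * psi x)%:E)%E ->
  ((A * Phi (E / A))%:E <= \int[mu]_(x in D) (K x * Phi (psi x))%:E)%E.
Proof.
move=> PhiP mD mK mpsi K0 psi0 A0 E0 KA EKpsi.
set m := E / A; have m0 : 0 <= m by rewrite divr_ge0// ltW.
have [c c0 cP] := cm_sup PhiP m0.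
have mPhi : measurable_fun D (Phi \o psi).
  by apply: measurableT_comp => //; exact: cm_meas.
have PK0 : 0 <= Phi m by exact: cm_ge0.
set W := (X in (_ <= X)%E).
have W0 : (0 <= W)%E.
  by apply: integral_ge0 => x Dx; rewrite lee_fin mulr_ge0 ?K0 ?cm_ge0 ?psi0.
have [->|Wfin] := eqVneq W +oo%E; first by rewrite leey.
have [w Ww] : exists w, W = w%:E.
  by move: W0 Wfin; case: W => // w _ _; exists w.
set I := (X in (X <= A%:E)%E) in KA.
have I0 : (0 <= I)%E by apply: integral_ge0 => x Dx; rewrite lee_fin K0.
have [i Ii] : exists i, I = i%:E.
  by move: I0 KA; case: I => // i _ _; exists i.
(* The negative part of the supporting line is moved to the right, so that only nonnegative
   functions are integrated. *)
have : ((Phi m)%:E * I + c%:E * (\int[mu]_(x in D) (K x * psi x)%:E) <= W + (c * m)%:E * I)%E.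
  have cm0 : 0 <= c * m by exact: mulr_ge0.
  have mKp : measurable_fun D (fun x => (K x * psi x)%:E).
    by apply/measurable_EFinP; exact: measurable_funM.
  have mKP : measurable_fun D (fun x => (K x * Phi (psi x))%:E).
    by apply/measurable_EFinP; exact: measurable_funM.
  have mKE : measurable_fun D (fun x => (K x)%:E) by exact/measurable_EFinP.
  have KE0 x : D x -> (0 <= (K x)%:E)%E by move=> Dx; rewrite lee_fin K0.
  have KpE0 x : D x -> (0 <= (K x * psi x)%:E)%E.
    by move=> Dx; rewrite lee_fin mulr_ge0 ?K0 ?psi0.
  have KPE0 x : D x -> (0 <= (K x * Phi (psi x))%:E)%E.
    by move=> Dx; rewrite lee_fin mulr_ge0 ?K0 ?cm_ge0 ?psi0.
  rewrite /I /W -!ge0_integralZl_EFin// -!ge0_integralD//; first last.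
  - exact: measurable_funeM.
  - by move=> x Dx; rewrite mule_ge0 ?KE0.
  - exact: measurable_funeM.
  - by move=> x Dx; rewrite mule_ge0 ?KpE0.
  - exact: measurable_funeM.
  - by move=> x Dx; rewrite mule_ge0 ?KE0.
  apply: ge0_le_integral => //.
  - by move=> x Dx; rewrite adde_ge0// mule_ge0 ?KE0 ?KpE0.
  - by apply: emeasurable_funD; exact: measurable_funeM.
  - by apply: emeasurable_funD => //; exact: measurable_funeM.
  move=> x Dx; rewrite -!EFinM -!EFinD lee_fin.
  have := ler_wpM2l (K0 _ Dx) (cP _ (psi0 _ Dx)); real_lra.
rewrite Ww Ii -!EFinM -EFinD => H.
have {}H : (Phi m * i + c * E <= w + c * m * i).
  rewrite -lee_fin; apply: le_trans H; rewrite EFinD leeD2l// EFinM.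
  by rewrite lee_wpmul2l.
rewrite lee_fin.
have cm : Phi m <= c * m.
  by have := cP _ (lexx 0); rewrite cm_0//; nra.
have iA : i <= A by rewrite -lee_fin -Ii.
have EA : E = m * A by rewrite /m divfK// gt_eqF.
move: H; rewrite EA => H.
have := mulr_ge0 (_ : 0 <= c * m - Phi m) (_ : 0 <= A - i); rewrite !subr_ge0 => /(_ cm iA).
nra.
Qed.

End convex_modulars.

Section finite_differences.
Context {R : realType}.
Implicit Types (k : nat) (w x : R) (F : R -> R) (P Q : {poly R}).

(** Forward difference indexed by its leftmost node; [fdiff k h F x] is [nab k h F (x - k h / 2)] as
    soon as its nodes lie in [-1, 1]. *)
Definition nab k w F x : R :=
  \sum_(i < k.+1) 'C(k, i)%:R * (-1) ^+ (k - i) * F (x + i%:R * w).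

Lemma nabS k w F x : nab k.+1 w F x = nab k w F (x + w) - nab k w F x.
Proof.
rewrite /nab.
pose T j := (-1) ^+ (k.+1 - j) * F (x + j%:R * w).
have -> : \sum_(i < k.+1) 'C(k, i)%:R * (-1) ^+ (k - i) * F (x + w + i%:R * w) =
    \sum_(i < k.+1) 'C(k, i)%:R * T i.+1.
  apply: eq_bigr => i _; rewrite /T subSS -mulrA; congr (_ * (_ * F _)).
  by rewrite -natr1; ring.
have -> : \sum_(i < k.+1) 'C(k, i)%:R * (-1) ^+ (k - i) * F (x + i%:R * w) =
    - \sum_(i < k.+1) 'C(k, i)%:R * T i.
  rewrite -sumrN; apply: eq_bigr => i _; rewrite /T subSn; last by rewrite -ltnS.
  by rewrite exprS; ring.
rewrite opprK big_ord_recl /= bin0 mul1r.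
under eq_bigr do rewrite /bump /= add1n binS natrD 2!mulrDl.
rewrite big_split /= addrA addrC; congr (_ + _).
  by apply: eq_bigr => i _; rewrite mulrA.
rewrite [in RHS]big_ord_recl /= bin0 mul1r; congr (_ + _).
rewrite big_ord_recr /= bin_small// !mul0r addr0.
by apply: eq_bigr => i _; rewrite /bump /= add1n mulrA.
Qed.

Lemma eq_nab k w F G x :
  (forall i, (i <= k)%N -> F (x + i%:R * w) = G (x + i%:R * w)) -> nab k w F x = nab k w G x.
Proof. by move=> FG; apply: eq_bigr => i _; rewrite FG// -ltnS. Qed.

Lemma nabB k w F G x : nab k w (fun y => F y - G y) x = nab k w F x - nab k w G x.
Proof. by rewrite /nab -sumrB; apply: eq_bigr => i _; rewrite mulrBr. Qed.

Lemma nab_poly k w P x : (size P <= k)%N -> nab k w (horner P) x = 0.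
Proof.
elim: k P x => [|k IH] P x sP.
  by rewrite (size_poly_leq0P _ sP)// /nab big1// => i _; rewrite horner0 mulr0.
have [Q sQ PQ] : exists2 Q : {poly R}, (size Q <= k)%N & forall y, P.[y + w] - P.[y] = Q.[y].
  exists (\sum_(i < k) w ^+ i.+1 *: P^`N(i.+1)).
    apply: (leq_trans (size_sum _ _ _)); apply/bigmax_leqP => i _.
    apply: (leq_trans (size_scale_leq _ _)); apply/leq_sizeP => j kj.
    rewrite coef_nderivn nth_default ?mul0rn//; apply: (leq_trans sP).
    by rewrite addSn ltnS (leq_trans kj)// leq_addl.
  move=> y; rewrite (nderiv_taylor_wide (mulrC _ _) sP) big_ord_recl /= nderivn0 expr0 mulr1.
  rewrite addrC addKr horner_sum; apply: eq_bigr => i _.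
  by rewrite hornerZ mulrC.
rewrite nabS -(IH Q x sQ) /nab -sumrB; apply: eq_bigr => i _.
by rewrite -mulrBr -PQ; congr (_ * (horner _ _ - _)); ring.
Qed.

Lemma nab_norm_le k w F x :
  `|nab k w F x| <= 2 ^+ k * \sum_(i < k.+1) `|F (x + i%:R * w)|.
Proof.
apply: (le_trans (ler_norm_sum _ _ _)); rewrite mulr_sumr; apply: ler_sum => i _.
rewrite !normrM normrX normrN1 expr1n mulr1 ler_wpM2r// ger0_norm// -natrX ler_nat.
have ik : (i < k.+1)%N by [].
by rewrite -[2%N]/(1 + 1)%N expnDn (bigD1 (Ordinal ik))//= !exp1n !muln1 leq_addr.
Qed.

End finite_differences.

Section polynomials.
Import qpoly.
Context {R : realType}.
Implicit Types (P Q : {poly R}).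

Lemma horner_le P (r s : R) : `|s| <= r ->
  `|P.[s]| <= \sum_(i < size P) `|P`_i| * r ^+ i.
Proof.
move=> sr; rewrite horner_coef; apply: (le_trans (ler_norm_sum _ _ _)).
by apply: ler_sum => i _; rewrite normrM normrX ler_wpM2l// lerXn2r ?nnegrE// (le_trans _ sr).
Qed.

Lemma derivn_comp_affine Q (d y : R) m :
  (Q \Po (d *: 'X + y%:P))^`(m) = d ^+ m *: (Q^`(m) \Po (d *: 'X + y%:P)).
Proof.
elim: m => [|m IH]; first by rewrite expr0 scale1r.
rewrite derivnS IH derivZ deriv_comp derivD derivZ derivX derivC addr0.
by rewrite -derivnS mulr_algr scalerA exprSr.
Qed.

(** A Markov type inequality with sampled values. After the affine change of variable sending the
    nodes y + i d to 0, ..., N - 1, the polynomial is recovered by Lagrange interpolation at these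
    integers; C bounds the m-th derivatives of the Lagrange basis on [-r, r], whatever d and y. *)
Lemma poly_deriv_le (N m : nat) (r : R) : exists2 C : R, 0 < C &
  forall Q (d x y : R), (size Q <= N)%N -> 0 < d -> `|x - y| <= r * d ->
  d ^+ m * `|Q^`(m).[x]| <= C * \sum_(i < N) `|Q.[y + i%:R * d]|.
Proof.
case: N => [|N].
  exists 1 => // Q d x y sQ _ _.
  by rewrite derivn_poly0 ?(leq_trans sQ)// horner0 normr0 mulr0 big_ord0 mulr0.
pose X i : R := i%:R.
have Xinj : injective X by move=> i j /eqP; rewrite eqr_nat => /eqP.
pose l i := tnth (lagrange N.+1 X) i.
pose B i : R := \sum_(j < size (l i)^`(m)) `|(l i : {poly R})^`(m)`_j| * `|r| ^+ j.
have B0 i : 0 <= B i by apply: sumr_ge0 => j _; rewrite mulr_ge0// exprn_ge0.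
exists (1 + \sum_i B i) => [|Q d x y sQ d0 xy].
  by rewrite ltr_pwDl// sumr_ge0.
pose L := d *: 'X + y%:P : {poly R}.
pose q := Q \Po L.
have sL : size L = 2%N.
  rewrite size_polyDl ?size_scale ?size_polyX ?gt_eqF//.
  by apply: (leq_ltn_trans (size_polyC_leq1 _)).
have sq : (size q <= N.+1)%N.
  rewrite /q; have [Q0|Q0] := eqVneq Q 0; first by rewrite Q0 comp_poly0 size_poly0.
  by rewrite size_comp_poly2.
have dm : d ^+ m * Q^`(m).[x] = q^`(m).[(x - y) / d].
  rewrite /q derivn_comp_affine hornerZ horner_comp; congr (_ * horner _ _).
  by rewrite hornerD hornerZ hornerX hornerC mulrC divfK ?gt_eqF// subrK.
have -> : d ^+ m * `|Q^`(m).[x]| = `|q^`(m).[(x - y) / d]|.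
  by rewrite -dm normrM ger0_norm// exprn_ge0// ltW.
rewrite [q](lagrange_gen (ltn0Sn N) Xinj sq) linear_sum horner_sum.
apply: (le_trans (ler_norm_sum _ _ _)); rewrite mulr_sumr; apply: ler_sum => i _.
rewrite mul_polyC /= derivnZ hornerZ normrM /q horner_comp.
have -> : L.[X i] = y + i%:R * d by rewrite /L hornerD hornerZ hornerX hornerC addrC mulrC.
rewrite mulrC ler_wpM2r//.
apply: (le_trans (@horner_le _ `|r| _ _)).
  rewrite normrM normfV (gtr0_norm d0) ler_pdivrMr//.
  by apply: (le_trans xy); rewrite ler_wpM2r ?ler_norm// ltW.
rewrite -/(B i) (bigD1 i)//= addrCA lerDl addr_ge0// sumr_ge0//.
Qed.
End polynomials.

(** * Affine substitutions, primitives and Steklov averages *)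

Section affine_integral.
Context {R : realType}.
Local Notation mu := (@lebesgue_measure R).
Implicit Types (a b c v w x : R) (f g : R -> R).

Lemma measurable_affine (x c : R) : measurable_fun [set: R] (fun w : R => x + c * w).
Proof. by apply: measurable_funD => //; exact: measurable_funM. Qed.

Lemma itv_measureE a b : a <= b -> mu `[a, b]%classic = (b - a)%:E.
Proof.
rewrite le_eqVlt => /predU1P[->|ab]; first by rewrite set_itv1 lebesgue_measure_set1 subrr.
by rewrite lebesgue_measure_itv/= lte_fin ab.
Qed.

Lemma itv_measure_lty a b : (mu `[a, b]%classic < +oo)%E.
Proof.
have [ab|ba] := leP a b; first by rewrite itv_measureE// ltry.
by rewrite set_itv_ge ?measure0// bnd_simp -ltNge.
Qed.

(** Both inequalities are instances of [ge0_integral_expansion], one for the affine map and one for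
    its inverse. *)
Lemma ge0_integral_affine (f : R -> \bar R) x c a b : 0 < c ->
  measurable_fun [set: R] f -> (forall y, 0 <= f y)%E ->
  (c%:E * \int[mu]_(w in `[a, b]) f (x + c * w)%R =
  \int[mu]_(y in `[(x + c * a)%R, (x + c * b)%R]) f y)%E.
Proof.
move=> c0 mf f0; apply/eqP; rewrite eq_le; apply/andP; split.
  apply: (@ge0_integral_expansion _ _ (fun w => x + c * w)) => //.
  - exact: measurable_affine.
  - move=> w w' _ _; rewrite -[X in X * _](gtr0_norm c0) -normrM.
    by rewrite (_ : c * (w - w') = x + c * w - (x + c * w'))//; ring.
  - by move=> w /=; rewrite !in_itv/= => /andP[? ?]; rewrite !lerD2l !ler_pM2l//; apply/andP.
have c1 : (c%:E * c^-1%:E = 1)%E by rewrite -EFinM divff// gt_eqF.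
rewrite -[leLHS]mul1e -c1 -muleA.
rewrite lee_wpmul2l ?lee_fin ?(ltW c0)//.
rewrite (_ : \int[mu]_(y in _) f y = \int[mu]_(y in `[(x + c * a)%R, (x + c * b)%R])
   f (x + c * (- x / c + c^-1 * y)%R)%R)%E; last first.
  by apply: eq_integral => y _; congr (f _); field; rewrite gt_eqF.
apply: (@ge0_integral_expansion _ _ (fun y => - x / c + c^-1 * y) _ _
  (fun w => f (x + c * w)%R)) => //.
- exact: measurable_affine.
- by rewrite invr_gt0.
- move=> w w' _ _; rewrite -[X in X * _]gtr0_norm ?invr_gt0// -normrM.
  by rewrite (_ : c^-1 * (w - w') = - x / c + c^-1 * w - (- x / c + c^-1 * w'))//; ring.
- move=> w /=; rewrite !in_itv/= => /andP[h1 h2].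
  rewrite -(ler_pM2l c0) -[X in _ && X](ler_pM2l c0).
  have -> : c * (- x / c + c^-1 * w) = w - x by field; rewrite gt_eqF.
  by apply/andP; split; real_lra.
- by apply: measurableT_comp => //; exact: measurable_affine.
Qed.

(** Anchored at b: primitives start at b and averages only look to the right of their argument.
    Measurability is global so that compositions stay measurable. *)
Definition locint b f := measurable_fun [set: R] f /\
  forall c, mu.-integrable `[b, c] (EFin \o f).

Definition primitive b f x : R := (\int[mu]_(y in `[b, x]) f y)%R.

Lemma locint_integrable b f a c : locint b f -> b <= a -> mu.-integrable `[a, c] (EFin \o f).
Proof.
move=> [_ fi] ba; apply: integrableS (fi c) => //.
by apply: subset_itvr; rewrite bnd_simp.
Qed.

Lemma locint_bounded b f : measurable_fun [set: R] f ->
  (forall c, exists M, forall x, b <= x <= c -> `|f x| <= M) -> locint b f.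
Proof.
move=> mf fM; split=> // c; have [M fcM] := fM c.
apply: measurable_bounded_integrable => //.
- exact: itv_measure_lty.
- exact: measurable_funTS.
- exists M; split; first exact: num_real.
  move=> N MN x /=; rewrite in_itv/= => xbc.
  exact: le_trans (fcM _ xbc) (ltW MN).
Qed.

Lemma locintD b f g : locint b f -> locint b g -> locint b (fun x => f x + g x).
Proof.
move=> [mf fi] [mg gi]; split=> [|c]; first exact: measurable_funD.
exact: integrableD (fi c) (gi c).
Qed.

Lemma locintZ b f a : locint b f -> locint b (fun x => a * f x).
Proof.
move=> [mf fi]; split=> [|c]; first exact: measurable_funM.
exact: integrableZl (fi c).
Qed.

Lemma locint_cst b a : locint b (cst a).
Proof. by apply: locint_bounded => // c; exists `|a|. Qed.

Lemma locint_sum b n (F : 'I_n -> R -> R) : (forall i, locint b (F i)) ->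
  locint b (fun x => \sum_(i < n) F i x).
Proof.
elim: n F => [|n IH] F Fi.
  under eq_fun do rewrite big_ord0; exact: locint_cst.
by under eq_fun do rewrite big_ord_recr; apply: locintD => //; exact: IH.
Qed.

Lemma locint_norm b f : locint b f -> locint b (fun x => `|f x|).
Proof.
move=> [mf fi]; split=> [|c]; first exact: measurableT_comp.
exact: integrable_norm.
Qed.

Lemma locint_affine b b' f x c : 0 < c -> b <= x + c * b' -> locint b f ->
  locint b' (fun w => f (x + c * w)).
Proof.
move=> c0 bx [mf fi]; split=> [|d].
  by apply: measurableT_comp => //; exact: measurable_affine.
apply/integrableP; split.
  apply/measurable_EFinP/measurable_funTS; apply: measurableT_comp => //.
  exact: measurable_affine.
have /integrableP[_ fid] := @locint_integrable b f (x + c * b') (x + c * d) (conj mf fi) bx.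
have := @ge0_integral_affine (fun y => `|(f y)%:E|%E) x c b' d c0.
pose J := (\int[mu]_(w in `[b', d]) `|(f (x + c * w)%R)%:E|)%E.
change (\int[mu]_(w in `[b', d]) `|(EFin \o (fun w => f (x + c * w)%R)) w|)%E with J.
have -> : J = (c^-1%:E * (c%:E * J))%E.
  by rewrite muleA -EFinM mulVf ?gt_eqF// mul1e.
move=> ->//; last by apply: measurableT_comp => //; exact/measurable_EFinP.
by rewrite lte_mul_pinfty ?lee_fin ?invr_ge0 ?ltW.
Qed.

Lemma integral_affine f x c a b : 0 < c -> measurable_fun [set: R] f ->
  (c%:E * \int[mu]_(w in `[a, b]) (f (x + c * w)%R)%:E =
  \int[mu]_(y in `[(x + c * a)%R, (x + c * b)%R]) (f y)%:E)%E.
Proof.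
move=> c0 mf; have mf' : measurable_fun [set: R] (EFin \o f) by exact/measurable_EFinP.
rewrite integralE [RHS]integralE.
have -> (u v : \bar R) : (c%:E * (u - v) = c%:E * u - c%:E * v)%E.
  case: u => [u| |]; case: v => [v| |] //; rewrite ?(gt0_mulye, gt0_mulNye, gt0_muley, gt0_muleNy) ?lte_fin//.
  by rewrite -EFinB -!EFinM -EFinB mulrBr.
congr (_ - _)%E.
- rewrite -(ge0_integral_affine x a b c0 (measurable_funepos mf'))//.
  by congr (_ * _)%E; apply: eq_integral => w _; rewrite !funeposE.
- rewrite -(ge0_integral_affine x a b c0 (measurable_funeneg mf'))//.
  by congr (_ * _)%E; apply: eq_integral => w _; rewrite !funenegE.
Qed.

Lemma primitive_affine b f x c w : 0 < c -> locint b f -> b <= x -> 0 <= w ->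
  primitive 0 (fun s => f (x + c * s)) w = c^-1 * (primitive b f (x + c * w) - primitive b f x).
Proof.
move=> c0 fi bx w0; have [mf _] := fi.
rewrite /primitive Rintegral_itvB; first last.
- by rewrite bnd_simp lerDl mulr_ge0// ltW.
- by rewrite bnd_simp.
- exact: locint_integrable (lexx b).
rewrite Rintegral_itv_obnd_cbnd; last first.
  apply: integrableS (locint_integrable (x + c * w) fi bx) => //.
  by apply: subset_itvr; rewrite bnd_simp.
have := @integral_affine f x c 0 w c0 mf; rewrite mulr0 addr0 /Rintegral => <-.
rewrite fineM//; first by rewrite mulKf ?gt_eqF.
have mg : measurable_fun `[0, w] (fun s => f (x + c * s)).
  by apply/measurable_funTS; apply: measurableT_comp => //; exact: measurable_affine.
rewrite -integral_fin_num_abs//.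
have cx : b <= x + c * 0 by rewrite mulr0 addr0.
by have /integrableP[] := locint_integrable w (locint_affine c0 cx fi) (lexx 0).
Qed.

Lemma primitiveD b f g x : locint b f -> locint b g ->
  primitive b (fun y => f y + g y) x = primitive b f x + primitive b g x.
Proof. by move=> [_ fi] [_ gi]; rewrite /primitive RintegralD. Qed.

Lemma primitiveZ b f a x : locint b f -> primitive b (fun y => a * f y) x = a * primitive b f x.
Proof. by move=> [_ fi]; rewrite /primitive RintegralZl. Qed.

Lemma primitive_sum b n (F : 'I_n -> R -> R) x : (forall i, locint b (F i)) ->
  primitive b (fun y => \sum_(i < n) F i y) x = \sum_(i < n) primitive b (F i) x.
Proof.
elim: n F => [|n IH] F Fi.
  by under eq_fun do rewrite big_ord0; rewrite big_ord0 /primitive Rintegral_cst// mul0r.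
under eq_fun do rewrite big_ord_recr.
by rewrite primitiveD ?IH ?big_ord_recr//; apply: locint_sum => i.
Qed.

Lemma primitive_ext b f g x : (forall y, b <= y -> f y = g y) -> primitive b f x = primitive b g x.
Proof.
move=> fg; apply: eq_Rintegral => y; rewrite inE/= in_itv/= => /andP[by_ _].
exact: fg.
Qed.

Lemma le_primitive b f g x : locint b f -> locint b g ->
  (forall y, b <= y <= x -> f y <= g y) -> primitive b f x <= primitive b g x.
Proof.
move=> [_ fi] [_ gi] fg; exact: le_Rintegral.
Qed.

Lemma primitive_cst b a x : b <= x -> primitive b (cst a) x = a * (x - b).
Proof. by move=> bx; rewrite /primitive Rintegral_cst//= itv_measureE. Qed.

Lemma primitive_norm b f x : locint b f -> `|primitive b f x| <= primitive b (fun y => `|f y|) x.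
Proof. by move=> [_ fi]; exact: le_normr_Rintegral. Qed.

Lemma primitive_ge0 b f x : (forall y, 0 <= f y) -> 0 <= primitive b f x.
Proof. by move=> f0; apply: Rintegral_ge0. Qed.

Lemma ge0_le_primitive b f x y : (forall y, 0 <= f y) -> locint b f -> x <= y ->
  primitive b f x <= primitive b f y.
Proof.
move=> f0 [mf fi] xy; rewrite /primitive fine_le ?integrable_fin_num//.
apply: ge0_subset_integral => //; last by apply: subset_itvl; rewrite bnd_simp.
  by apply/measurable_EFinP/measurable_funTS.
by move=> z _; rewrite lee_fin.
Qed.

Lemma locint_primitive b f : locint b f -> locint b (primitive b f).
Proof.
move=> fi; have fi' := locint_norm fi.
pose g y := (`|f y| + f y); pose h y := (`|f y|).
have gi : locint b g by exact: locintD.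
have hgE : primitive b f = fun x => primitive b g x + -1 * primitive b h x.
  by apply/funext => x; rewrite /g /h primitiveD//; real_lra.
apply: locint_bounded.
  rewrite hgE; apply: measurable_funD.
    apply: nondecreasing_measurable => // x y xy; apply: ge0_le_primitive => // z.
    by rewrite /g; have := ler_norm (- f z); rewrite normrN; real_lra.
  apply: measurable_funM => //.
  by apply: nondecreasing_measurable => // x y xy; apply: ge0_le_primitive => // z; rewrite /h.
move=> c; exists (primitive b h c) => x /andP[bx xc].
apply: (le_trans (primitive_norm _ fi)); apply: ge0_le_primitive => //.
Qed.


(** Steklov mean of f over [x, x + v], written with the primitive so that iterated means can be
    compared with iterated primitives of differences. *)
Definition average b v f x : R := v^-1 * (primitive b f (x + v) - primitive b f x).

Lemma locint_average b v f : 0 <= v -> locint b f -> locint b (average b v f).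
Proof.
move=> v0 fi; apply: locintZ; have Fi := locint_primitive fi.
have -> : (fun x => primitive b f (x + v) - primitive b f x) =
    fun x => primitive b f (v + 1 * x) + -1 * primitive b f x.
  by apply/funext => x; rewrite mul1r mulN1r addrC [x + v]addrC addrC.
apply: locintD; last exact: locintZ.
by apply: (@locint_affine b) => //; rewrite mul1r lerDr.
Qed.

Lemma average_ext b v f g x : b <= x -> (forall y, b <= y -> f y = g y) ->
  average b v f x = average b v g x.
Proof. by move=> bx fg; rewrite /average !(primitive_ext _ fg). Qed.

Lemma average_norm_le b v f x M : 0 < v -> b <= x -> locint b f ->
  (forall y, x <= y <= x + v -> `|f y| <= M) -> `|average b v f x| <= M.
Proof.
move=> v0 bx fi fM; rewrite /average normrM gtr0_norm ?invr_gt0//.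
rewrite mulrC ler_pdivrMr//.
have E h : locint b h -> primitive b h (x + v) - primitive b h x = primitive x h (x + v).
  move=> hi; rewrite /primitive Rintegral_itvB; first last.
  - by rewrite bnd_simp lerDl ltW.
  - by rewrite bnd_simp.
  - exact: locint_integrable (lexx b).
  rewrite Rintegral_itv_obnd_cbnd//.
  by apply: integrableS (locint_integrable (x + v) hi bx) => //; apply: subset_itvr; rewrite bnd_simp.
rewrite E//.
have fix_ : locint x f by have [mf _] := fi; split=> // c; exact: locint_integrable fi bx.
apply: (le_trans (primitive_norm _ fix_)).
rewrite (_ : M * v = primitive x (cst M) (x + v)); last first.
  by rewrite primitive_cst ?lerDl ?ltW// addrAC subrr add0r.
by apply: le_primitive => //; [exact: locint_norm|exact: locint_cst].
Qed.

Lemma average_affine b u f x c w : 0 < c -> 0 < u -> locint b f -> b <= x -> 0 <= w ->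
  average 0 u (fun s => f (x + c * s)) w = average b (c * u) f (x + c * w).
Proof.
move=> c0 u0 fi bx w0; rewrite /average !(primitive_affine c0 fi bx)//; last by rewrite addr_ge0// ltW.
have -> : x + c * w + c * u = x + c * (w + u) by ring.
by rewrite invfM; ring.
Qed.

Lemma averageD b v f g x : locint b f -> locint b g ->
  average b v (fun y => f y + g y) x = average b v f x + average b v g x.
Proof. by move=> fi gi; rewrite /average !primitiveD//; ring. Qed.

Lemma averageZ b v f a x : locint b f ->
  average b v (fun y => a * f y) x = a * average b v f x.
Proof. by move=> fi; rewrite /average !primitiveZ//; ring. Qed.

Lemma average_cst b v a x : 0 < v -> b <= x -> average b v (cst a) x = a.
Proof.
move=> v0 bx; rewrite /average !primitive_cst//; last by rewrite ler_wpDr// ltW.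
by field; rewrite gt_eqF.
Qed.

Lemma locint_iter_average b v f j : 0 <= v -> locint b f -> locint b (iter j (average b v) f).
Proof. by move=> v0 fi; elim: j => //= j IH; exact: locint_average. Qed.

Lemma iter_average_ext b v f g j x : b <= x -> (forall y, b <= y -> f y = g y) ->
  iter j (average b v) f x = iter j (average b v) g x.
Proof.
move=> bx fg; elim: j x bx => [|j IH] x bx /=; first exact: fg.
exact: average_ext.
Qed.

Lemma iter_average_affine b u f x c j w : 0 < c -> 0 < u -> locint b f -> b <= x -> 0 <= w ->
  iter j (average 0 u) (fun s => f (x + c * s)) w = iter j (average b (c * u)) f (x + c * w).
Proof.
move=> c0 u0 fi bx; elim: j w => [//|j IH] w w0 /=.
have cu : 0 <= c * u by rewrite mulr_ge0// ltW.
rewrite -(average_affine c0 u0 (locint_iter_average j cu fi) bx w0).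
exact: average_ext.
Qed.

Lemma iter_averageD b v f g j x : 0 <= v -> b <= x -> locint b f -> locint b g ->
  iter j (average b v) (fun y => f y + g y) x = iter j (average b v) f x + iter j (average b v) g x.
Proof.
move=> v0 bx fi gi; elim: j x bx => [//|j IH] x bx /=.
rewrite -averageD; [|exact: locint_iter_average..].
exact: average_ext.
Qed.

Lemma iter_averageZ b v f a j x : 0 <= v -> b <= x -> locint b f ->
  iter j (average b v) (fun y => a * f y) x = a * iter j (average b v) f x.
Proof.
move=> v0 bx fi; elim: j x bx => [//|j IH] x bx /=.
rewrite -averageZ; last exact: locint_iter_average.
exact: average_ext.
Qed.

Lemma iter_average_cst b v a j x : 0 < v -> b <= x -> iter j (average b v) (cst a) x = a.
Proof.
move=> v0 bx; elim: j x bx => [//|j IH] x bx /=.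
by rewrite -[RHS](average_cst a v0 bx); exact: average_ext.
Qed.

Lemma iter_average_sum b v n (F : 'I_n -> R -> R) j x : 0 < v -> b <= x -> (forall i, locint b (F i)) ->
  iter j (average b v) (fun y => \sum_(i < n) F i y) x = \sum_(i < n) iter j (average b v) (F i) x.
Proof.
move=> v0 bx; elim: n F => [|n IH] F Fi.
  by under eq_fun do rewrite big_ord0; rewrite big_ord0 iter_average_cst.
under eq_fun do rewrite big_ord_recr.
rewrite iter_averageD ?(ltW v0)//; last exact: locint_sum.
by rewrite IH// big_ord_recr.
Qed.

(** The first average turns values into an L1 norm; each further average preserves a uniform
    bound. *)
Lemma iter_average_le_primitive u psi k : 0 < u -> locint 0 psi ->
  `|iter k.+1 (average 0 u) psi 0| <= u^-1 * primitive 0 (fun y => `|psi y|) (k.+1%:R * u).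
Proof.
move=> u0 psii; set M := _ * _.
have psii' := locint_norm psii.
(* After j + 1 averages the value at w only depends on [w, w + (j + 1) u], which stays inside
   [0, (k + 1) u] when w <= (k - j) u. *)
suff H : forall j w, (j <= k)%N -> 0 <= w <= (k - j)%:R * u -> `|iter j.+1 (average 0 u) psi w| <= M.
  by apply: H => //; rewrite subnn mul0r lexx.
elim => [|j IH] w.
  move=> _.
  rewrite subn0 => /andP[w0 wk] /=.
  rewrite /average normrM gtr0_norm ?invr_gt0// ler_pM2l ?invr_gt0//.
  rewrite /primitive Rintegral_itvB; first last.
  - by rewrite bnd_simp lerDl ltW.
  - by rewrite bnd_simp.
  - exact: locint_integrable (lexx _).
  have mI : mu.-integrable `]w, (w + u)] (EFin \o psi).
    apply: integrableS (locint_integrable (w + u) psii (lexx 0)) => //.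
    by apply: subset_itvr; rewrite bnd_simp.
  apply: (le_trans (le_normr_Rintegral _ mI)) => //.
  rewrite fine_le ?integrable_fin_num//.
  - by apply: integrable_norm.
  - exact: locint_integrable psii' (lexx 0).
  apply: ge0_subset_integral => //.
  - by have [+ _] := psii' => m; apply/measurable_EFinP/measurable_funTS.
  - move=> z /=; rewrite !in_itv/= => /andP[h1 h2]; apply/andP; split; first real_lra.
    by apply: (le_trans h2); rewrite -natr1; real_lra.
move=> jk /andP[w0 wk].
have e : (k - j)%:R = (k - j.+1)%:R + 1 :> R by rewrite natr1 subnSK.
rewrite iterS; apply: average_norm_le => //; first by apply: locint_iter_average => //; exact: ltW.
move=> y /andP[wy yw]; apply: IH; first exact: ltnW.
by rewrite (le_trans w0 wy)/= e mulrDl; real_lra.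
Qed.

Lemma iter_primitive_norm_le b c f j x : locint b f -> b <= x <= c ->
  `|iter j.+1 (primitive b) f x| <= (c - b) ^+ j * primitive b (fun y => `|f y|) c.
Proof.
move=> fi; have fi' := locint_norm fi; elim: j x => [|j IH] x /andP[bx xc].
  rewrite expr0 mul1r /=; apply: (le_trans (primitive_norm _ fi)).
  exact: ge0_le_primitive.
have li i : locint b (iter i (primitive b) f) by elim: i => //= i; exact: locint_primitive.
rewrite iterS; apply: (le_trans (primitive_norm _ (li _))).
set M := (X in _ <= X).
have M0 : 0 <= primitive b (fun y => `|f y|) c by exact: primitive_ge0.
have cb : 0 <= c - b by real_lra.
apply: (@le_trans _ _ (primitive b (cst ((c - b) ^+ j * primitive b (fun y => `|f y|) c)) x)).
  apply: le_primitive; [exact: locint_norm (li _)|exact: locint_cst|].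
  by move=> y /andP[by_ yx]; apply: IH; real_lra.
rewrite primitive_cst// /M exprSr mulrAC ler_wpM2r// ler_wpM2l ?exprn_ge0//; real_lra.
Qed.

End affine_integral.

Section polynomial_primitive.
Context {R : realType}.
Implicit Types (Q : {poly R}) (b v x a : R) (f F : R -> R).

Definition polyprim Q : {poly R} := \poly_(i < (size Q).+1) (Q`_i.-1 *+ (i != 0%N) / i%:R).

Lemma size_polyprim Q : (size (polyprim Q) <= (size Q).+1)%N.
Proof. exact: size_poly. Qed.

Lemma deriv_polyprim Q : (polyprim Q)^`() = Q.
Proof.
apply/polyP => i; rewrite coef_deriv coef_poly ltnS.
case: ltnP => iQ /=; last by rewrite nth_default// mul0rn.
by rewrite mulr1n -[LHS]mulr_natr divfK// pnatr_eq0.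
Qed.

Lemma integral_deriv_poly Q a b : a <= b ->
  \int[@lebesgue_measure R]_(x in `[a, b]) Q^`().[x] = Q.[b] - Q.[a].
Proof.
rewrite le_eqVlt => /predU1P[<-|ab].
  by rewrite set_itv1 Rintegral_set1 subrr.
rewrite /Rintegral (@continuous_FTC2 _ (horner Q^`()) (horner Q))//.
- exact/continuous_subspaceT/continuous_horner.
- split => [y _||]; first exact: derivable_horner.
  + by apply: cvg_at_right_filter; exact: continuous_horner.
  + by apply: cvg_at_left_filter; exact: continuous_horner.
- by move=> y _; rewrite derivE.
Qed.

Lemma primitive_poly b Q : exists2 P : {poly R}, (size P <= (size Q).+1)%N &
  forall x, b <= x -> primitive b (horner Q) x = P.[x].
Proof.
exists (polyprim Q - (polyprim Q).[b]%:P).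
  rewrite -polyCN (leq_trans (size_polyD _ _))// geq_max size_polyprim/=.
  by rewrite (leq_trans (size_polyC_leq1 _)).
move=> x bx; rewrite hornerD hornerN hornerC -integral_deriv_poly// deriv_polyprim.
by [].
Qed.

Lemma measurable_horner Q : measurable_fun [set: R] (horner Q).
Proof. by apply: continuous_measurable_fun; exact: continuous_horner. Qed.

Lemma locint_poly b Q : locint b (horner Q).
Proof.
apply: locint_bounded => [|c]; first exact: measurable_horner.
exists (\sum_(i < size Q) `|Q`_i| * (`|b| + `|c|) ^+ i) => x /andP[bx xc].
apply: horner_le; rewrite ler_norml; apply/andP; split.
  by have := ler_norm (- b); rewrite normrN; have := normr_ge0 c; real_lra.
by have := ler_norm c; have := normr_ge0 b; real_lra.
Qed.

Lemma locint_nab b k w f : 0 <= w -> locint b f -> locint b (nab k w f).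
Proof.
move=> w0 fi; apply: locint_sum => i; apply: locintZ.
rewrite (_ : (fun x => _) = fun x => f (i%:R * w + 1 * x)); last first.
  by apply/funext => x; rewrite mul1r addrC.
by apply: (@locint_affine _ b) => //; rewrite mul1r lerDr mulr_ge0.
Qed.

Lemma locint_iter_primitive b j f : locint b f -> locint b (iter j (primitive b) f).
Proof. by move=> fi; elim: j => //= j IH; exact: locint_primitive. Qed.

Lemma iter_primitive_ext b f g j x : b <= x -> (forall y, b <= y -> f y = g y) ->
  iter j (primitive b) f x = iter j (primitive b) g x.
Proof.
move=> bx fg; elim: j x bx => [|j IH] x bx /=; first exact: fg.
exact: primitive_ext.
Qed.

Lemma iter_primitive_affine b j f a c : locint b f ->
  exists2 P : {poly R}, (size P <= j.+1)%N & forall x, b <= x ->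
    iter j (primitive b) (fun y => a * f y + c) x = a * iter j (primitive b) f x + P.[x].
Proof.
move=> fi; elim: j => [|j [P sP IH]].
  by exists c%:P => [|x _]; rewrite ?size_polyC_leq1// hornerC.
have [P' sP' PP'] := primitive_poly b P.
exists P' => [|x bx]; first exact: leq_trans sP' _.
rewrite !iterS (primitive_ext _ IH) primitiveD; last exact: locint_poly.
  by rewrite primitiveZ ?PP'//; exact: locint_iter_primitive.
by apply: locintZ; exact: locint_iter_primitive.
Qed.

Lemma primitive_shift b f v x : 0 <= v -> b <= x -> locint b f ->
  primitive b (fun y => f (y + v)) x = primitive b f (x + v) - primitive b f (b + v).
Proof.
move=> v0 bx fi; have [mf _] := fi.
rewrite /primitive Rintegral_itvB; first last.
- by rewrite bnd_simp lerD2r.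
- by rewrite bnd_simp lerDl.
- exact: locint_integrable (lexx b).
rewrite Rintegral_itv_obnd_cbnd; last first.
  apply: integrableS (locint_integrable (x + v) fi (lexx b)) => //.
  by apply: subset_itvr; rewrite bnd_simp lerDl.
have := @integral_affine R f v 1 b x ltr01 mf; rewrite !mul1e !mul1r ![v + _]addrC => E.
by rewrite /Rintegral -E; congr fine; apply: eq_integral => y _; rewrite mul1r addrC.
Qed.

Lemma nab_primitive b j v f : 0 <= v -> locint b f -> exists c, forall x, b <= x ->
  nab j v (primitive b f) x = primitive b (nab j v f) x + c.
Proof.
move=> v0 fi.
exists (\sum_(i < j.+1) 'C(j, i)%:R * (-1) ^+ (j - i) * primitive b f (b + i%:R * v)).
move=> x bx; rewrite /nab primitive_sum; last first.
  move=> i; apply: locintZ.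
  rewrite (_ : (fun x => _) = fun x => f (i%:R * v + 1 * x)); last first.
    by apply/funext => y; rewrite mul1r addrC.
  by apply: (@locint_affine _ b) => //; rewrite mul1r lerDr mulr_ge0.
rewrite -big_split; apply: eq_bigr => i _ /=.
have iv : 0 <= i%:R * v by rewrite mulr_ge0.
rewrite primitiveZ; last first.
  rewrite (_ : (fun x => _) = fun x => f (i%:R * v + 1 * x)); last first.
    by apply/funext => y; rewrite mul1r addrC.
  by apply: (@locint_affine _ b) => //; rewrite mul1r lerDr.
by rewrite primitive_shift//; ring.
Qed.

Lemma nab_nab1 j v f x : nab j v (fun y => f (y + v) - f y) x = nab j.+1 v f x.
Proof.
rewrite nabB nabS; congr (_ - _); apply: eq_bigr => i _; congr (_ * f _); ring.
Qed.

(** One average of f is, up to a constant, v^-1 times the primitive of the first difference of f.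
    Iterating, the constants are integrated again and accumulate in a polynomial of degree less than
    j. *)
Lemma iter_averageE b j v f : 0 < v -> locint b f ->
  exists2 P : {poly R}, (size P <= j)%N & forall x, b <= x ->
    iter j (average b v) f x = v ^- j * iter j (primitive b) (nab j v f) x + P.[x].
Proof.
move=> v0; have v0' := ltW v0; elim: j f => [|j IH] f fi.
  exists 0; rewrite ?size_poly0// => x _.
  by rewrite /= horner0 addr0 expr0 invr1 mul1r /nab big_ord1 bin0 subn0 expr0 !mul1r mul0r addr0.
have Afi := locint_average v0' fi.
have [P sP PE] := IH _ Afi.
pose h y := f (y + v) - f y.
have hi : locint b h.
  apply: locintD; last by under eq_fun do rewrite -mulN1r; exact: locintZ.
  rewrite (_ : (fun x => _) = fun x => f (v + 1 * x)); last first.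
    by apply/funext => y; rewrite mul1r addrC.
  by apply: (@locint_affine _ b) => //; rewrite mul1r lerDr.
have AE x : b <= x -> average b v f x = v^-1 * primitive b h x + v^-1 * primitive b f (b + v).
  move=> bx; rewrite /average /h -mulrDr; congr (_ * _).
  rewrite (_ : (fun y => f (y + v) - f y) = fun y => f (y + v) + -1 * f y); last first.
    by apply/funext => y; rewrite mulN1r.
  rewrite primitiveD; last exact: locintZ; last first.
    rewrite (_ : (fun x => _) = fun x => f (v + 1 * x)); last first.
      by apply/funext => y; rewrite mul1r addrC.
    by apply: (@locint_affine _ b) => //; rewrite mul1r lerDr.
  by rewrite primitiveZ// primitive_shift//; ring.
have [c cE] := nab_primitive j v0' hi.
have nE x : b <= x -> nab j v (average b v f) x =
    v^-1 * primitive b (nab j.+1 v f) x +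
    (v^-1 * c + nab j v (cst (v^-1 * primitive b f (b + v))) x).
  move=> bx.
  rewrite (@eq_nab _ _ _ _ (fun y => v^-1 * primitive b h y - (cst (- (v^-1 * primitive b f (b + v)))) y)).
    rewrite nabB (_ : nab j v (fun y => _) x = v^-1 * nab j v (primitive b h) x); last first.
      by rewrite /nab mulr_sumr; apply: eq_bigr => i _; ring.
    rewrite cE// mulrDr -addrA; congr (_ * _ + (_ + _)).
      by apply: primitive_ext => y _; rewrite /h nab_nab1.
    by rewrite /nab -sumrN; apply: eq_bigr => i _; rewrite /=; ring.
  by move=> i _; rewrite /= opprK AE// ler_wpDr// mulr_ge0.
set k := (nab j v (cst _)) in nE.
have kE x : k x = k b by [].
have ni : locint b (nab j.+1 v f) by exact: locint_nab.
have [P' sP' P'E] := @iter_primitive_affine b j _ (v^-1) (v^-1 * c + k b) (locint_primitive ni).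
exists (v ^- j *: P' + P).
  rewrite (leq_trans (size_polyD _ _))// geq_max (leq_trans (size_scale_leq _ _))//=.
  exact: leqW.
move=> x bx; rewrite iterSr PE// hornerD hornerZ addrA; congr (_ + _).
rewrite (@iter_primitive_ext _ _ (fun y => v^-1 * primitive b (nab j.+1 v f) y + (v^-1 * c + k b)))//.
rewrite P'E// mulrDr; congr (_ + _); rewrite mulrA; congr (_ * _); last by rewrite -iterSr.
by rewrite exprSr invfM mulrC.
Qed.

End polynomial_primitive.

Lemma sume_cst (R : realType) n (x : \bar R) : (0 <= x)%E -> (\sum_(i < n) x = n%:R%:E * x)%E.
Proof.
move=> x0; elim: n => [|n IH]; first by rewrite big_ord0 mul0e.
by rewrite big_ord_recr /= IH -natr1 EFinD ge0_muleDl ?lee_fin// mul1e.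
Qed.

(** * Tonelli's theorem on rectangles and a mean value selection *)

Section tonelli.
Context {R : realType}.
Local Notation mu := (@lebesgue_measure R).
Local Notation TR := (measurableTypeR R).

Lemma measurable_section (G : TR * TR -> R) (x : TR) :
  measurable_fun setT G -> measurable_fun setT (fun y : TR => G (x, y)).
Proof. by move=> mG; apply: measurableT_comp => //; exact: measurable_fun_pair. Qed.

Lemma measurable_section2 (G : TR * TR -> R) (y : TR) :
  measurable_fun setT G -> measurable_fun setT (fun x : TR => G (x, y)).
Proof. by move=> mG; apply: measurableT_comp => //; exact: measurable_fun_pair. Qed.

(** Moves the restriction to D1 x D2 into the integrand, so that the product theorem on the whole
    plane applies. *)
Let restr (D1 D2 : set TR) (G : TR * TR -> R) p : R := G p * \1_D1 p.1 * \1_D2 p.2.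

Let restrE (D1 D2 : set TR) (G : TR * TR -> R) : measurable D2 ->
  ((fun x => \int[mu]_(y in D2) (G (x, y))%:E) \_ D1 = fun x => \int[mu]_y (restr D1 D2 G (x, y))%:E)%E.
Proof.
move=> mD2; apply/funext => z; rewrite patchE; case: ifPn => zD.
  rewrite integral_mkcond; apply: eq_integral => y _; rewrite patchE /restr /= indicE zD mulr1 indicE.
  by case: ifPn => _; rewrite ?mulr1 ?mulr0.
by rewrite integral0_eq// => y _; rewrite /restr /= indicE (negbTE zD) mulr0 mul0r.
Qed.

Let measurable_restr D1 D2 G : measurable D1 -> measurable D2 -> measurable_fun setT G ->
  measurable_fun setT (restr D1 D2 G).
Proof.
move=> m1 m2 mG; apply: measurable_funM; first apply: measurable_funM => //.
  by apply: measurableT_comp => //; exact: measurable_indic.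
by apply: measurableT_comp => //; exact: measurable_indic.
Qed.

Lemma measurable_inner (G : TR * TR -> R) (D : set TR) : measurable D ->
  measurable_fun setT G -> (forall p, 0 <= G p) ->
  measurable_fun setT (fun x => \int[mu]_(y in D) (G (x, y))%:E)%E.
Proof.
move=> mD mG G0.
have := @measurable_fun_fubini_tonelli_F _ _ TR TR R mu (EFin \o restr setT D G).
rewrite /fubini_F (_ : (fun x => _) = (fun x => (\int[mu]_(y in D) (G (x, y))%:E)%E) \_ setT); last first.
  by rewrite restrE.
rewrite patch_setT; apply.
  by apply/measurable_EFinP; apply: measurable_restr.
by move=> p; rewrite lee_fin /restr !mulr_ge0.
Qed.

Lemma tonelli (G : TR * TR -> R) (D1 D2 : set TR) : measurable D1 -> measurable D2 ->
  measurable_fun setT G -> (forall p, 0 <= G p) ->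
  (\int[mu]_(x in D1) \int[mu]_(y in D2) (G (x, y))%:E =
   \int[mu]_(y in D2) \int[mu]_(x in D1) (G (x, y))%:E)%E.
Proof.
move=> m1 m2 mG G0.
rewrite [LHS]integral_mkcond (restrE _ _ m2) [RHS]integral_mkcond.
pose G' (p : TR * TR) := G (p.2, p.1).
rewrite (_ : (fun y => _) \_ D2 = fun y => (\int[mu]_x (restr D2 D1 G' (y, x))%:E)%E); last first.
  by rewrite -restrE.
rewrite (_ : (\int[mu]_x \int[mu]_y (restr D2 D1 G' (x, y))%:E =
  \int[mu]_y \int[mu]_x (EFin \o restr D1 D2 G) (x, y))%E); last first.
  by apply: eq_integral => y _; apply: eq_integral => x _; rewrite /restr /G' /= -mulrA (mulrC (\1_D2 _)) mulrA.
rewrite -fubini_tonelli//.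
- by apply/measurable_EFinP; apply: measurable_restr.
- by move=> p; rewrite lee_fin /restr !mulr_ge0.
Qed.

Lemma exists_le_mean (g : TR -> \bar R) (c d K : R) : c < d ->
  measurable_fun setT g -> (forall x, 0 <= g x)%E -> 0 <= K ->
  (\int[mu]_(x in `[c, d]) g x <= (K * (d - c))%:E)%E -> exists2 u, c <= u <= d & (g u <= K%:E)%E.
Proof.
move=> cd mg g0 K0 gK; apply: contrapT => H.
have gt u : `[c, d]%classic u -> (K%:E < g u)%E.
  by rewrite /= in_itv/= => ucd; rewrite ltNge; apply/negP => gu; apply: H; exists u.
(* If g > K everywhere on [c, d], the excess h over K is positive there but has integral 0, which
   contradicts the positive length of [c, d]. *)
pose h u := (maxe (g u - K%:E) 0)%E.
have mh : measurable_fun setT h.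
  by apply: measurable_maxe => //; apply: emeasurable_funB.
have h0 u : (0 <= h u)%E by rewrite /h le_max lexx orbT.
have gE u : `[c, d]%classic u -> (g u = K%:E + h u)%E.
  move=> ucd; rewrite /h max_l ?sube_ge0 ?(ltW (gt _ ucd))//.
  by rewrite addeC subeK.
have hI : (\int[mu]_(x in `[c, d]) h x = 0)%E.
  apply/eqP; rewrite eq_le integral_ge0 ?andbT//.
  move: gK; rewrite (eq_integral (fun u => (K%:E + h u)%E)); last first.
    by move=> u; rewrite inE => /gE.
  rewrite ge0_integralD//; last exact: measurable_funTS.
  rewrite integral_cst//= itv_measureE ?(ltW cd)// -EFinM.
  by rewrite -[leRHS]adde0 leeD2lE.
have := (@ae_eq_integral_abs _ _ R mu _ (measurable_itv `[c, d]) h (measurable_funTS mh)).1.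
rewrite (eq_integral h) => [/(_ hI)|u _]; last by rewrite gee0_abs.
move=> [N [mN N0 hN]].
have : (mu `[c, d]%classic <= mu N)%E.
  apply: (@le_measure _ _ _ mu); rewrite ?inE//.
  move=> u ucd; apply: hN => /= /(_ ucd) hu0.
  by have := gt _ ucd; rewrite gE// hu0 adde0 ltxx.
by rewrite N0 itv_measureE ?(ltW cd)// lee_fin leNgt subr_gt0 cd.
Qed.

End tonelli.

(** * Extending a polynomial approximation to the right *)

Section extension.
Context {R : realType}.
Local Notation mu := (@lebesgue_measure R).
Local Notation TR := (measurableTypeR R).

Lemma measurable_nab disp (T : measurableType disp) k (F : R -> R) (d e : T -> R) :
  measurable_fun setT F -> measurable_fun setT d -> measurable_fun setT e ->
  measurable_fun setT (fun p : T => nab k (d p) F (e p)).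
Proof.
move=> mF md me; apply: measurable_sum => i; apply: measurable_funM => //.
apply: measurableT_comp => //; apply: measurable_funD => //.
exact: measurable_funM.
Qed.

(** Let theta = B - B' and theta <= w <= 2 theta. For y in [B', B] the nodes y - j w, 1 <= j <= k,
    lie in [A, B']. As P has degree less than k, the k-th difference is the same for F and for F -
    P, so the error at y is a difference of F combined with errors at points of [A, B']. These
    points lie to the left of y, where W is at least as large. The inequality is then integrated
    over w. *)
Lemma extend_right Phi k (A B' B : R) (W F : R -> R) (P : {poly R}) :
  convmod Phi -> B' < B -> A + 2 * k%:R * (B - B') <= B' ->
  measurable_fun setT F -> measurable_fun setT W -> (forall x, 0 <= W x) ->
  (forall y z, A <= z -> z <= y -> y <= B -> W y <= W z) -> (size P <= k)%N ->
  ((B - B')%:E * \int[mu]_(y in `[B', B]) (Phi (W y * `|F y - P.[y]| / (k.+1%:R * 2 ^+ k)))%:E <=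
  \int[mu]_(w in `[(B - B')%R, (2 * (B - B'))%R]) \int[mu]_(y in `[B', B])
      (Phi (W y * `|nab k w F (y - k%:R * w)|))%:E +
  (k%:R * (B - B'))%:E * \int[mu]_(x in `[A, B']) (Phi (W x * `|F x - P.[x]|))%:E)%E.
Proof.
move=> PhiP B'B AB mF mW W0 Wmono sP.
set th := B - B'; have th0 : 0 < th by rewrite subr_gt0.
pose E x := F x - P.[x].
have mE : measurable_fun setT E by apply: measurable_funB => //; exact: measurable_horner.
pose G (p : TR * TR) := Phi (W p.2 * `|nab k p.1 F (p.2 - k%:R * p.1)|).
have mPhi := cm_meas PhiP.
have mG : measurable_fun setT G.
  apply: measurableT_comp => //; apply: measurable_funM; first exact: measurableT_comp.
  apply: measurableT_comp => //; apply: measurable_nab => //.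
  by apply: measurable_funB => //; exact: measurable_funM.
have G0 p : 0 <= G p by rewrite /G cm_ge0// mulr_ge0.
pose h x := Phi (W x * `|E x|).
have mh : measurable_fun setT h.
  by apply: measurableT_comp => //; apply: measurable_funM => //; exact: measurableT_comp.
have h0 x : 0 <= h x by rewrite /h cm_ge0// mulr_ge0.
pose l y := Phi (W y * `|E y| / (k.+1%:R * 2 ^+ k)).
have ml : measurable_fun setT l.
  apply: measurableT_comp => //; apply: measurable_funM => //; apply: measurable_funM => //.
  exact: measurableT_comp.
have l0 x : 0 <= l x by rewrite /l cm_ge0// divr_ge0// mulr_ge0.
have key w y : th <= w <= 2 * th -> B' <= y <= B ->
    l y <= G (w, y) + \sum_(i < k) h (y + - ((k - i)%:R * w)).
  move=> /andP[w1 w2] /andP[y1 y2].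
  have yE : E y = nab k w F (y - k%:R * w) -
     \sum_(i < k) 'C(k, i)%:R * (-1) ^+ (k - i) * E (y - (k - i)%:R * w).
    have <- : nab k w E (y - k%:R * w) = nab k w F (y - k%:R * w).
      by rewrite /E nabB nab_poly// subr0.
    have -> : nab k w E (y - k%:R * w) =
        \sum_(i < k) 'C(k, i)%:R * (-1) ^+ (k - i) * E (y - (k - i)%:R * w) + E y.
      rewrite /nab big_ord_recr /= binn subnn expr0 !mul1r subrK; congr (_ + _).
      apply: eq_bigr => i _; congr (_ * E _); rewrite natrB; first ring.
      exact: ltnW.
    by rewrite addrAC subrr add0r.
  (* Index 0 carries the difference and the others the k earlier nodes, so that [cm_sum] applies to
     k + 1 terms. *)
  pose a (i : 'I_k.+1) := if unlift ord0 i is Some j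
    then W (y - (k - j)%:R * w) * `|E (y - (k - j)%:R * w)|
    else W y * `|nab k w F (y - k%:R * w)|.
  have a0 i : 0 <= a i by rewrite /a; case: unlift => [j|]; rewrite mulr_ge0.
  have aS (H : R -> R) : \sum_(i < k.+1) H (a i) = H (W y * `|nab k w F (y - k%:R * w)|) +
      \sum_(i < k) H (W (y - (k - i)%:R * w) * `|E (y - (k - i)%:R * w)|).
    by rewrite big_ord_recl /a unlift_none; congr (_ + _); apply: eq_bigr => i _; rewrite liftK.
  have := @cm_sum _ Phi k.+1 a (W y * `|E y| / 2 ^+ k) k.+1%:R PhiP a0.
  have -> : W y * `|E y| / 2 ^+ k / k.+1%:R = W y * `|E y| / (k.+1%:R * 2 ^+ k).
    by rewrite invfM mulrA [RHS]mulrAC.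
  move=> H; rewrite /l.
  apply: (le_trans (H _ _ _ _)) => //; last by rewrite aS.
    by rewrite divr_ge0// mulr_ge0.
  rewrite (aS idfun) /= ler_pdivrMr ?exprn_gt0// mulrDl.
  apply: (@le_trans _ _ (W y * (`|nab k w F (y - k%:R * w)| +
     \sum_(i < k) `|E (y - (k - i)%:R * w)| * 2 ^+ k))).
    rewrite ler_wpM2l// yE (le_trans (ler_normB _ _))// lerD2l.
    apply: (le_trans (ler_norm_sum _ _ _)); apply: ler_sum => i _.
    rewrite !normrM normrX normrN1 expr1n mulr1 mulrC ler_wpM2l// ger0_norm// -natrX ler_nat.
    have ik : (i < k.+1)%N by rewrite ltnS ltnW.
    by rewrite -[2%N]/(1 + 1)%N expnDn (bigD1 (Ordinal ik))//= !exp1n !muln1 leq_addr.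
  rewrite mulrDr lerD//.
    by rewrite ler_peMr ?mulr_ge0// exprn_ege1// ler1n.
  rewrite mulr_sumr mulr_suml; apply: ler_sum => i _; rewrite mulrA.
  rewrite ler_wpM2r// ?exprn_ge0// ler_wpM2r//.
  have ki : 1 <= (k - i)%:R :> R by rewrite ler1n subn_gt0.
  have ki' : (k - i)%:R <= k%:R :> R by rewrite ler_nat leq_subr.
  by apply: Wmono => //; rewrite -/th in AB; nra.
have mGi : measurable_fun setT (fun w => \int[mu]_(y in `[B', B]) (G (w, y))%:E)%E.
  exact: measurable_inner.
set I := (\int[mu]_(x in `[A, B']) _)%E.
have I0 : (0 <= I)%E by apply: integral_ge0 => x _; rewrite lee_fin; exact: h0.
(* Quantities independent of w are written as integrals over [theta, 2 theta], an interval of length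
   theta. *)
have -> : (th%:E * \int[mu]_(y in `[B', B]) (Phi (W y * `|F y - P.[y]| / (k.+1%:R * 2 ^+ k)))%:E =
    \int[mu]_(w in `[th, (2 * th)%R]) (cst (\int[mu]_(y in `[B', B]) (l y)%:E) w))%E.
  rewrite integral_cst// muleC; congr (_ * _)%E.
  by rewrite /= itv_measureE; [congr EFin; ring|real_lra].
have -> : ((k%:R * th)%:E * I = \int[mu]_(w in `[th, (2 * th)%R]) (cst (k%:R%:E * I) w))%E.
  rewrite integral_cst// muleAC; congr (_ * _)%E.
  by rewrite /= itv_measureE; [rewrite -EFinM; congr EFin; ring|real_lra].
rewrite -ge0_integralD//; first last.
- by move=> w _; rewrite /cst mule_ge0.
- exact: measurable_funTS.
- by move=> w _; apply: integral_ge0 => y _; rewrite lee_fin; first [exact: l0|exact: (G0 (w, y))|exact: h0].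
apply: ge0_le_integral => //.
- by move=> w _; apply: integral_ge0 => y _; rewrite lee_fin; first [exact: l0|exact: (G0 (w, y))|exact: h0].
- by apply: emeasurable_funD => //; exact: measurable_funTS.
move=> w; rewrite /= in_itv/= => wth.
have mhs i : measurable_fun `[B', B] (fun y : TR => (h (y + - ((k - i)%:R * w)))%:E).
  by apply/measurable_EFinP/measurable_funTS; apply: measurableT_comp => //; exact: measurable_funD.
apply: (@le_trans _ _ (\int[mu]_(y in `[B', B]) ((G (w, y))%:E +
    \sum_(i < k) (h (y + - ((k - i)%:R * w)))%:E))%E).
  apply: ge0_le_integral => //.
  - by move=> y _; rewrite lee_fin; first [exact: l0|exact: (G0 (w, y))|exact: h0].
  - by apply/measurable_EFinP/measurable_funTS.
  - apply: emeasurable_funD; last by apply: emeasurable_sum => i; exact: mhs.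
    by apply/measurable_EFinP/measurable_funTS; exact: measurable_section.
  - by move=> y; rewrite /= in_itv/= => yB; rewrite sumEFin -EFinD lee_fin key.
rewrite ge0_integralD//; first last.
- by apply: emeasurable_sum => i; exact: mhs.
- by move=> y _; apply: sume_ge0 => i _; rewrite lee_fin; first [exact: l0|exact: (G0 (w, y))|exact: h0].
- by apply/measurable_EFinP/measurable_funTS; exact: measurable_section.
- by move=> y _; rewrite lee_fin; first [exact: l0|exact: (G0 (w, y))|exact: h0].
apply: leeD => //.
rewrite ge0_integral_sum//; last by move=> i y _; rewrite lee_fin; first [exact: l0|exact: (G0 (w, y))|exact: h0].
rewrite -sume_cst//; apply: lee_sum => i _.
rewrite -[leLHS]mul1e.
apply: (@ge0_integral_expansion _ _ (fun y => y + - ((k - i)%:R * w)) 1 _ (fun y => (h y)%:E)) => //.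
- exact: measurable_funD.
- by move=> x y _ _; rewrite mul1r opprD opprK addrACA addNr addr0.
- move=> y; rewrite /= !in_itv/= => /andP[y1 y2].
  have ki : 1 <= (k - i)%:R :> R by rewrite ler1n subn_gt0.
  have ki' : (k - i)%:R <= k%:R :> R by rewrite ler_nat leq_subr.
  by move: wth => /andP[w1 w2]; rewrite -/th in AB; apply/andP; split; rewrite /th in w1 w2 th0 AB *; nra.
- exact/measurable_EFinP.
by move=> i; exact: mhs.
Qed.

End extension.

(** * Whitney's inequality *)

Section whitney.
Context {R : realType}.
Local Notation mu := (@lebesgue_measure R).
Local Notation TR := (measurableTypeR R).

(* The sum is a Steklov-type smoothing of f: by [iter_averageE] it is, up to a polynomial, a k-fold
   primitive of differences of f. *)
Lemma steklov_difference k u A x (f : R -> R) : 0 < u -> A <= x -> locint A f ->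
  f x - \sum_(i < k) (-1) ^+ i * 'C(k, i.+1)%:R * iter k (average A (i.+1%:R * u)) f x =
  iter k (average 0 u) (fun w => (-1) ^+ k * nab k w f x) 0.
Proof.
move=> u0 Ax fi.
have fii (i : 'I_k.+1) : locint 0 (fun w => f (x + i%:R * w)).
  case: i => [[|i] ik] /=.
    by rewrite (_ : (fun w => _) = cst (f x)); [exact: locint_cst|apply/funext => w; rewrite mul0r addr0].
  by apply: (@locint_affine _ A) => //; rewrite mulr0 addr0.
transitivity (iter k (average 0 u)
   (fun w => \sum_(i < k.+1) ((-1) ^+ i * 'C(k, i)%:R) * f (x + i%:R * w)) 0); last first.
  apply: iter_average_ext => // w w0; rewrite /nab mulr_sumr; apply: eq_bigr => i _.
  have ik : (i <= k)%N by rewrite -ltnS.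
  have <- : (-1) ^+ k * (-1) ^+ (k - i) = (-1) ^+ i :> R.
    by rewrite -exprD -signr_odd oddD oddB// addbA addbb signr_odd.
  by move: ((-1) ^+ k) ((-1) ^+ (k - i)) => s1 s2; ring.
rewrite iter_average_sum//; last by move=> i; exact: locintZ.
rewrite big_ord_recl (iter_averageZ _ _ (ltW u0) (lexx 0) (fii ord0)).
rewrite expr0 bin0 mulr1 mul1r; congr (_ + _).
  rewrite (@iter_average_ext _ _ _ _ (cst (f x))) ?iter_average_cst// => w _.
  by rewrite mul0r addr0.
rewrite -sumrN; apply: eq_bigr => i _ /=.
rewrite (iter_averageZ _ _ (ltW u0) (lexx 0) (fii (lift ord0 i))).
rewrite /bump /= add1n exprS mulN1r !mulNr; congr (- (_ * _)).
by rewrite (@iter_average_affine _ A)// mulr0 addr0.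
Qed.

Lemma ge0_integral_itv_le (f : R -> \bar R) (A M B : R) : A <= M -> M <= B ->
  measurable_fun setT f -> (forall x, 0 <= f x)%E ->
  (\int[mu]_(x in `[A, B]) f x <= \int[mu]_(x in `[A, M]) f x + \int[mu]_(x in `[M, B]) f x)%E.
Proof.
move=> AM MB mf f0.
have -> : `[A, B]%classic = `[A, M]%classic `|` `]M, B]%classic.
  by rewrite -itv_bndbnd_setU// bnd_simp.
rewrite ge0_integral_setU//=; last 2 first.
- exact: measurable_funTS.
- apply/disj_setPS => x [/=]; rewrite !in_itv/= => /andP[_ xM] /andP[Mx _].
  by have := lt_le_trans Mx xM; rewrite ltxx.
rewrite leeD2l//; apply: ge0_subset_integral => //; first exact: measurable_funTS.
by apply: subset_itvr; rewrite bnd_simp.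
Qed.


Lemma bin_le_exp k i : ('C(k, i) <= 2 ^ k)%N.
Proof.
have [ik|ki] := leqP i k; last by rewrite bin_small.
have ik' : (i < k.+1)%N by [].
by rewrite -[2%N]/(1 + 1)%N expnDn (bigD1 (Ordinal ik'))//= !exp1n !muln1 leq_addr.
Qed.

(** By [iter_averageE] every term of the smoothing is a k-fold primitive of a k-th difference plus a
    polynomial; P collects these polynomials with their signs. The two terms of the bound are the
    smoothing error, which averages differences over the step, and the k-fold primitives, which
    involve the k fixed steps (i + 1) u. *)
Lemma steklov_polynomial k u A B (f : R -> R) : (0 < k)%N -> 0 < u -> A <= B -> locint A f ->
  exists2 P : {poly R}, (size P <= k)%N & forall x, A <= x <= B ->
    `|f x - P.[x]| <= u^-1 * primitive 0 (fun w => `|nab k w f x|) (k%:R * u) +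
      \sum_(i < k) 2 ^+ k * ((i.+1%:R * u) ^- k *
        ((B - A) ^+ k.-1 * primitive A (fun y => `|nab k (i.+1%:R * u) f y|) B)).
Proof.
move=> k0 u0 AB fi.
have v0 (i : 'I_k) : 0 < i.+1%:R * u by rewrite mulr_gt0// ltr0n.
have Pex (i : 'I_k) : {P : {poly R} | (size P <= k)%N & forall x, A <= x ->
    iter k (average A (i.+1%:R * u)) f x = (i.+1%:R * u) ^- k *
      iter k (primitive A) (nab k (i.+1%:R * u) f) x + P.[x]}.
  by apply: cid2; apply: iter_averageE.
exists (\sum_(i < k) ((-1) ^+ i * 'C(k, i.+1)%:R) *: s2val (Pex i)).
  apply: (leq_trans (size_sum _ _ _)); apply/bigmax_leqP => i _.
  by apply: (leq_trans (size_scale_leq _ _)); exact: (s2valP (Pex i)).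
move=> x /andP[Ax xB].
pose e x := iter k (average 0 u) (fun w => (-1) ^+ k * nab k w f x) 0.
have -> : f x - (\sum_(i < k) ((-1) ^+ i * 'C(k, i.+1)%:R) *: s2val (Pex i)).[x] =
    e x + \sum_(i < k) ((-1) ^+ i * 'C(k, i.+1)%:R) *
      ((i.+1%:R * u) ^- k * iter k (primitive A) (nab k (i.+1%:R * u) f) x).
  rewrite /e -(@steklov_difference _ _ A)// -addrA; congr (_ + _).
  rewrite horner_sum -!sumrN -big_split; apply: eq_bigr => i _.
  by rewrite /= hornerZ (s2valP' (Pex i) _ Ax) mulrDr opprD addrAC addNr add0r.
have ni : locint 0 (fun w => (-1) ^+ k * nab k w f x).
  apply: locintZ; apply: locint_sum => i; apply: locintZ.
  case: i => [[|i] ik] /=.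
    by rewrite (_ : (fun w => _) = cst (f x)); [exact: locint_cst|apply/funext => w; rewrite mul0r addr0].
  by apply: (@locint_affine _ A) => //; rewrite mulr0 addr0.
apply: (le_trans (ler_normD _ _)); apply: lerD.
  case: k k0 ni @e {v0 Pex} => // k _ ni e; rewrite /e.
  apply: (le_trans (iter_average_le_primitive _ u0 ni)).
  rewrite ler_pM2l ?invr_gt0// /primitive.
  rewrite (@eq_Rintegral _ _ _ mu _ (fun w => `|nab k.+1 w f x|))// => w _.
  by rewrite normrM normrX normrN1 expr1n mul1r.
apply: (le_trans (ler_norm_sum _ _ _)); apply: ler_sum => i _.
rewrite normrM ler_pM//.
  rewrite normrM normrX normrN1 expr1n mul1r ger0_norm// -natrX ler_nat.
  exact: bin_le_exp.
rewrite normrM ger0_norm ?invr_ge0 ?exprn_ge0 ?(ltW (v0 i))//.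
rewrite ler_wpM2l ?invr_ge0 ?exprn_ge0 ?(ltW (v0 i))//.
have nj : locint A (nab k (i.+1%:R * u) f) by apply: locint_nab => //; exact: ltW.
have := @iter_primitive_norm_le _ A B _ k.-1 x nj; rewrite prednK//.
by apply; rewrite Ax.
Qed.

(** [steklov_polynomial] uses differences with the fixed steps u, 2 u, ..., k u, whereas only an
    integral over all steps is controlled. Averaging over u in [u0 / 2, u0] yields one u for which
    the k steps are good simultaneously. *)
Lemma good_step (psi : TR -> \bar R) k u0 q : (0 < k)%N -> 0 < u0 -> 0 <= q ->
  measurable_fun setT psi -> (forall w, 0 <= psi w)%E ->
  (\int[mu]_(w in `[0%R, (k%:R * u0)%R]) psi w <= q%:E)%E ->
  exists2 u, u0 / 2 <= u <= u0 &
    (\sum_(i < k) psi (i.+1%:R * u)%R <= (2 * k%:R / u0 * q)%:E)%E.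
Proof.
move=> k0 u00 q0 mpsi psi0 Jq.
have mp i : measurable_fun setT (fun u : TR => psi (i.+1%:R * u)%R).
  by apply: measurableT_comp => //; exact: measurable_funM.
apply: exists_le_mean.
- real_lra.
- by apply: emeasurable_sum => i; exact: mp.
- by move=> x; apply: sume_ge0.
- by rewrite mulr_ge0// divr_ge0 ?mulr_ge0// ltW.
rewrite ge0_integral_sum//; last by move=> i; exact: measurable_funTS.
have -> : (2 * k%:R / u0 * q * (u0 - u0 / 2)) = k%:R * q by field; real_lra.
rewrite EFinM -sume_cst ?lee_fin//; apply: lee_sum => i _.
apply: le_trans Jq.
have i1 : 1 <= i.+1%:R :> R by rewrite ler1n.
apply: (@le_trans _ _ (i.+1%:R%:E * \int[mu]_(x in `[(u0 / 2)%R, u0]) psi (i.+1%:R * x)%R)%E).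
  by apply: lee_pemull; [exact: integral_ge0|rewrite lee_fin].
apply: (@ge0_integral_expansion _ _ (fun x => i.+1%:R * x)) => //.
- exact: measurable_funM.
- by move=> x y _ _; rewrite -mulrBr normrM ger0_norm.
move=> x; rewrite /= !in_itv/= => /andP[x1 x2].
have ik : i.+1%:R <= k%:R :> R by rewrite ler_nat.
apply/andP; split; first by rewrite mulr_ge0//; real_lra.
by rewrite ler_pM//; real_lra.
Qed.

Lemma jensen_primitive Phi (c : R) b x (g : R -> R) : convmod Phi -> 0 < c -> b < x ->
  x - b <= c -> locint b g -> (forall y, 0 <= g y) ->
  ((Phi (c^-1 * primitive b g x))%:E <= c^-1%:E * \int[mu]_(y in `[b, x]) (Phi (g y))%:E)%E.
Proof.
move=> PhiP c0 bx xc gi g0; have [mg _] := gi.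
have ci : 0 <= c^-1 by rewrite invr_ge0 ltW.
have mPg : measurable_fun `[b, x] (fun y => (Phi (g y))%:E).
  apply/measurable_EFinP/measurable_funTS; apply: measurableT_comp => //.
  exact: cm_meas.
rewrite -ge0_integralZl_EFin//; last by move=> y _; rewrite lee_fin cm_ge0.
have := @jensen _ Phi _ _ mu `[b, x] (cst c^-1) g 1 (c^-1 * primitive b g x) PhiP.
rewrite divr1 mul1r; apply => //.
- exact: measurable_funTS.
- by rewrite mulr_ge0// primitive_ge0.
- apply: (@le_trans _ _ (\int[mu]_(y in `[b, x]) cst c^-1%:E y)%E) => //.
  by rewrite integral_cst//= itv_measureE ?(ltW bx)// -EFinM lee_fin mulrC ler_pdivrMr// mul1r.
rewrite EFinM /primitive fineK; last by apply: integrable_fin_num => //; exact: locint_integrable gi (lexx b).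
rewrite -ge0_integralZl_EFin//.
- by move=> y _; rewrite lee_fin.
- exact/measurable_EFinP/measurable_funTS.
Qed.

Lemma exprV_mul_le k (v L c D : R) : (0 < k)%N -> 0 < v -> 0 < L -> 0 <= c ->
  L <= c * v -> 0 <= D <= L -> v ^- k * D ^+ k.-1 <= c ^+ k / L.
Proof.
case: k => // k _ v0 L0 c0 Lcv /andP[D0 DL] /=.
have h1 : D ^+ k <= L ^+ k by rewrite lerXn2r ?nnegrE ?(ltW L0).
have h2 : L ^+ k.+1 <= c ^+ k.+1 * v ^+ k.+1.
  by rewrite -exprMn lerXn2r ?nnegrE ?mulr_ge0 ?(ltW L0) ?(ltW v0).
rewrite ler_pdivlMr// -mulrA mulrC ler_pdivrMr ?exprn_gt0//.
by apply: le_trans h2; rewrite exprSr ler_wpM2r ?(ltW L0).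
Qed.

(** An averaged modulus of smoothness, not normalised by the length; the test on y + k w keeps all
    nodes in [A, B]. *)
Definition whitney_rhs Phi k (F : R -> R) (A B : R) : \bar R :=
  (\int[mu]_(w in `[0%R, (B - A)%R]) \int[mu]_(y in `[A, B])
     (if y + k%:R * w <= B then Phi `|nab k w F y| else 0)%:E)%E.

(** Forward differences need room to their right, so the estimate is first proved on [A, B'],
    leaving an interval of length (B - A) / (4 k). *)
Lemma whitney_left k : (0 < k)%N -> exists2 C : R, 1 <= C &
  forall Phi (A B' B : R) (F : R -> R), convmod Phi -> A < B' -> B' < B ->
  B - A = 4 * k%:R * (B - B') -> measurable_fun setT F ->
  mu.-integrable `[A, B] (EFin \o F) -> (whitney_rhs Phi k F A B < +oo)%E ->
  exists2 P : {poly R}, (size P <= k)%N &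
  (\int[mu]_(x in `[A, B']) (Phi (`|F x - P.[x]| / C))%:E <=
   (C / (B - A))%:E * whitney_rhs Phi k F A B)%E.
Proof.
move=> k0.
have k1 : 1 <= k%:R :> R by rewrite ler1n.
(* The binomials are at most 2^k, and B - A <= 8 k^3 (i + 1) u because u >= u0 / 2 = (B - A) / (8
   k^3). *)
pose C1 : R := 2 ^+ k * (8 * k%:R ^+ 3) ^+ k.
have C10 : 0 <= C1 by rewrite mulr_ge0// exprn_ge0// mulr_ge0// exprn_ge0.
have k30 : 0 <= k%:R ^+ 3 :> R by rewrite exprn_ge0.
pose C2 : R := k.+1%:R * (k%:R + C1).
have C21 : 1 <= C2 by rewrite /C2 mulr_ege1 ?ler1n//; real_lra.
(* The terms 8 k^3 and 8 k^4 serve as outer constants: after division by B - A they bound 1 / (k u)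
   and equal 2 k / u0 respectively. *)
exists (C2 + 8 * k%:R ^+ 3 + 8 * k%:R ^+ 4) => [|Phi A B' B F PhiP AB' B'B LE mF Fi Qfin].
  have : 0 <= k%:R ^+ 4 :> R by rewrite exprn_ge0.
  real_lra.
set C := C2 + _ + _.
have C2C : C2 <= C.
  have : 0 <= k%:R ^+ 4 :> R by rewrite exprn_ge0.
  by rewrite /C; real_lra.
have C0 : 0 < C by real_lra.
set L := B - A; have L0 : 0 < L by rewrite subr_gt0 (lt_trans AB').
have mPhi := cm_meas PhiP.
pose G (p : TR * TR) := if p.2 + k%:R * p.1 <= B then Phi `|nab k p.1 F p.2| else 0.
have mG : measurable_fun setT G.
  apply: measurable_fun_ifT => //.
    apply: measurable_fun_ler => //; apply: measurable_funD => //.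
    exact: measurable_funM.
  by do 2 apply: measurableT_comp => //; exact: measurable_nab.
have G0 p : 0 <= G p by rewrite /G; case: ifP => // _; rewrite cm_ge0.
set Q := whitney_rhs _ _ _ _ _ in Qfin *.
have QE : Q = (\int[mu]_(w in `[0%R, L]) \int[mu]_(y in `[A, B]) (G (w, y))%:E)%E by [].
have Q0 : (0 <= Q)%E.
  by rewrite QE; apply: integral_ge0 => w _; apply: integral_ge0 => y _; rewrite lee_fin.
have [q Qq] : exists q, Q = q%:E.
  by move: Q0 Qfin; case: Q {QE} => // q _ _; exists q.
have q0 : 0 <= q by rewrite -lee_fin -Qq.
(* F is only integrable on [A, B]; extending it by 0 makes it integrable on every [A, c] and does
   not affect differences with nodes in [A, B]. *)
pose f := F \_ `[A, B].
have fE x : A <= x <= B -> f x = F x by move=> xAB; rewrite /f patchE mem_set.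
have mf : measurable_fun setT f.
  by apply/(measurable_restrictT _ _).1 => //; exact: measurable_funTS.
have fi : locint A f.
  split=> // c.
  have : mu.-integrable setT (EFin \o f).
    by rewrite /f -restrict_EFin; apply/(integrable_mkcond _ _).1.
  exact: integrableS.
have nabE w x : A <= x -> 0 <= w -> x + k%:R * w <= B -> nab k w f x = nab k w F x.
  move=> Ax w0 xB; apply: eq_nab => i ik; rewrite fE//.
  have ik' : i%:R <= k%:R :> R by rewrite ler_nat.
  have : i%:R * w <= k%:R * w by rewrite ler_wpM2r.
  have : 0 <= i%:R * w by rewrite mulr_ge0.
  real_lra.
pose th := B - B'; have th0 : 0 < th by rewrite subr_gt0.
have k0' : 0 < k%:R :> R by real_lra.
(* The steps used are at most k u0, and k (k u0) = theta keeps x + k w <= B for every x <= B'. *)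
pose u0 := th / k%:R ^+ 2; have u00 : 0 < u0 by rewrite divr_gt0// exprn_gt0.
have k2u : k%:R * (k%:R * u0) = th by rewrite /u0; field; real_lra.
have u0E : u0 = L / (4 * k%:R ^+ 3) by rewrite /u0 /L LE /th; field; real_lra.
pose psi (w : TR) := (\int[mu]_(x in `[A, B']) (G (w, x))%:E)%E.
have mpsi : measurable_fun setT psi by exact: measurable_inner.
have psi0 w : (0 <= psi w)%E by apply: integral_ge0 => x _; rewrite lee_fin.
have ku0 : k%:R * u0 <= L.
  have thL : th <= L by rewrite /L LE -/th ler_peMl ?(ltW th0)//; real_lra.
  apply: le_trans thL; rewrite -k2u.
  by rewrite ler_peMl// mulr_ge0// ltW.
have Jq : (\int[mu]_(w in `[0%R, (k%:R * u0)%R]) psi w <= q%:E)%E.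
  rewrite -Qq QE; apply: (@le_trans _ _ (\int[mu]_(w in `[0%R, L]) psi w)%E).
    apply: ge0_subset_integral => //; first exact: measurable_funTS.
    by apply: subset_itvl; rewrite bnd_simp.
  apply: ge0_le_integral => //; first exact: measurable_funTS.
    by apply: measurable_funTS; exact: (@measurable_inner _ G).
  move=> w _; apply: ge0_subset_integral => //.
  - by apply/measurable_EFinP/measurable_funTS; exact: measurable_section.
  - by move=> x _; rewrite lee_fin.
  - by apply: subset_itvl; rewrite bnd_simp ltW.
have [u /andP[u1 u2] uP] := good_step k0 u00 q0 mpsi psi0 Jq.
have u_gt0 : 0 < u by real_lra.
have [P sP FP] := steklov_polynomial k0 u_gt0 (ltW AB') fi.
exists P => //.
have inB w x : A <= x <= B' -> 0 <= w <= k%:R * u0 -> x + k%:R * w <= B.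
  move=> /andP[Ax xB'] /andP[w0 wk].
  have : k%:R * w <= th by rewrite -k2u ler_wpM2l.
  by rewrite /th; real_lra.
have GE w x : A <= x <= B' -> 0 <= w <= k%:R * u0 -> G (w, x) = Phi `|nab k w f x|.
  move=> xAB' wk; rewrite /G /= (inB _ _ xAB' wk) nabE ?(inB _ _ xAB' wk)//.
    by case/andP: xAB'.
  by case/andP: wk.
have ku_le : k%:R * u <= k%:R * u0 by rewrite ler_pM2l.
have ku_gt0 : 0 < k%:R * u by rewrite mulr_gt0.
have e_le x : A <= x <= B' -> ((Phi ((k%:R * u)^-1 * primitive 0 (fun w => `|nab k w f x|) (k%:R * u)))%:E <=
    (k%:R * u)^-1%:E * \int[mu]_(w in `[0%R, (k%:R * u)%R]) (G (w, x))%:E)%E.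
  move=> xAB'.
  rewrite (@eq_integral _ _ _ mu _ (fun w => (Phi `|nab k w f x|)%:E)); last first.
    by move=> w; rewrite inE/= in_itv/= => /andP[w1 w2]; rewrite GE// w1 (le_trans w2).
  apply: jensen_primitive => //; first by rewrite subr0.
  apply: locint_norm; apply: locint_sum => i; apply: locintZ.
  case: i => [[|i] ik] /=.
    by rewrite (_ : (fun w => _) = cst (f x)); [exact: locint_cst|apply/funext => w; rewrite mul0r addr0].
  by apply: (@locint_affine _ A) => //; rewrite mulr0 addr0; case/andP: xAB'.
have v_le (i : 'I_k) : 0 <= i.+1%:R * u <= k%:R * u0.
  have ik : i.+1%:R <= k%:R :> R by rewrite ler_nat.
  by rewrite mulr_ge0//= ?ler_pM// ltW.
pose m (i : 'I_k) : R := L^-1 * primitive A (fun y => `|nab k (i.+1%:R * u) f y|) B'.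
have m_le i : ((Phi (m i))%:E <= L^-1%:E * psi (i.+1%:R * u)%R)%E.
  rewrite /psi (@eq_integral _ _ _ mu _ (fun y => (Phi `|nab k (i.+1%:R * u) f y|)%:E)); last first.
    by move=> x; rewrite inE/= in_itv/= => xAB'; rewrite GE.
  apply: jensen_primitive => //; first by rewrite /L lerD2r ltW.
  apply: locint_norm; apply: locint_nab => //.
  by case/andP: (v_le i).
have m0 i : 0 <= m i by rewrite /m mulr_ge0 ?invr_ge0 ?(ltW L0)// primitive_ge0.
pose e x : R := (k%:R * u)^-1 * primitive 0 (fun w => `|nab k w f x|) (k%:R * u).
have e0 x : 0 <= e x by rewrite /e mulr_ge0 ?invr_ge0 ?(ltW ku_gt0)// primitive_ge0.
have FP' x : A <= x <= B' -> `|F x - P.[x]| <= (k%:R + C1) * (e x + \sum_(i < k) m i).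
  move=> xAB'; have xAB : A <= x <= B by case/andP: xAB' => -> ?; rewrite /= (le_trans _ (ltW B'B)).
  rewrite -(fE _ xAB); apply: (le_trans (FP _ xAB')).
  have -> : u^-1 * primitive 0 (fun w => `|nab k w f x|) (k%:R * u) = k%:R * e x.
    by rewrite /e; field; rewrite !gt_eqF.
  rewrite mulrDr; apply: lerD; first by rewrite ler_wpM2r// lerDl.
  rewrite mulr_sumr; apply: ler_sum => i _.
  apply: (@le_trans _ _ (C1 * m i)); last by rewrite ler_wpM2r// lerDr.
  rewrite /C1 -mulrA ler_wpM2l ?exprn_ge0// /m mulrA mulrA ler_wpM2r ?primitive_ge0//.
  have vi : 0 < i.+1%:R * u by rewrite mulr_gt0// ltr0n.
  apply: exprV_mul_le => //.
  - have LE2 : L = 8 * k%:R ^+ 3 * (u0 / 2) by rewrite u0E; field; rewrite gt_eqF.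
    rewrite [leLHS]LE2 ler_wpM2l ?mulr_ge0//; apply: (le_trans u1).
    by rewrite ler_peMl ?ler1n// ltW.
  - by rewrite subr_ge0 ltW//= /L lerD2r ltW.
have FPhi x : A <= x <= B' -> Phi (`|F x - P.[x]| / C) <= Phi (e x) + \sum_(i < k) Phi (m i).
  move=> xAB'.
  pose a (i : 'I_k.+1) := if unlift ord0 i is Some j then m j else e x.
  have aS (H : R -> R) : \sum_(i < k.+1) H (a i) = H (e x) + \sum_(i < k) H (m i).
    by rewrite big_ord_recl /a unlift_none; congr (_ + _); apply: eq_bigr => i _; rewrite liftK.
  have kC : 0 < k%:R + C1 by real_lra.
  have := @cm_sum _ Phi k.+1 a (`|F x - P.[x]| / (k%:R + C1)) (C / (k%:R + C1)) PhiP.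
  rewrite (aS Phi) (aS idfun) /=.
  have -> : `|F x - P.[x]| / (k%:R + C1) / (C / (k%:R + C1)) = `|F x - P.[x]| / C.
    by field; rewrite !gt_eqF.
  apply.
  - by move=> i; rewrite /a; case: unlift.
  - by rewrite divr_ge0// ltW.
  - by rewrite ler_pdivrMr// mulrC FP'.
  - by rewrite divr_gt0.
  - by rewrite ler_pdivlMr.
pose Gs (p : TR * TR) := G (p.2, p.1).
have mGs : measurable_fun setT Gs.
  by apply: measurableT_comp => //; exact: measurable_fun_pair.
have minn : measurable_fun setT (fun x => \int[mu]_(w in `[0%R, (k%:R * u)%R]) (G (w, x))%:E)%E.
  by apply: (@measurable_inner _ Gs) => // p; exact: G0.
have inn0 x : (0 <= \int[mu]_(w in `[0%R, (k%:R * u)%R]) (G (w, x))%:E)%E.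
  by apply: integral_ge0 => w _; rewrite lee_fin.
have kui : 0 <= (k%:R * u)^-1 by rewrite invr_ge0 ltW.
have S0 : (0 <= \sum_(i < k) L^-1%:E * psi (i.+1%:R * u)%R)%E.
  by apply: sume_ge0 => i _; rewrite mule_ge0// lee_fin invr_ge0 ltW.
apply: (@le_trans _ _ (\int[mu]_(x in `[A, B'])
    ((k%:R * u)^-1%:E * (\int[mu]_(w in `[0%R, (k%:R * u)%R]) (G (w, x))%:E) +
     cst (\sum_(i < k) L^-1%:E * psi (i.+1%:R * u)%R) x))%E).
  apply: ge0_le_integral => //.
  - by move=> x _; rewrite lee_fin cm_ge0// divr_ge0// ltW.
  - apply/measurable_EFinP/measurable_funTS; apply: measurableT_comp => //.
    apply: measurable_funM => //; apply: measurableT_comp => //.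
    by apply: measurable_funB => //; exact: measurable_horner.
  - apply: emeasurable_funD => //; apply: measurable_funeM; exact: measurable_funTS.
  move=> x; rewrite /= in_itv/= => xAB'.
  apply: (@le_trans _ _ (Phi (e x) + \sum_(i < k) Phi (m i))%:E); first by rewrite lee_fin FPhi.
  rewrite EFinD leeD ?e_le// -sumEFin; apply: lee_sum => i _; exact: m_le.
rewrite ge0_integralD//; last 2 first.
- by move=> x _; rewrite mule_ge0.
- by apply: measurable_funeM; exact: measurable_funTS.
rewrite ge0_integralZl_EFin//; last exact: measurable_funTS.
rewrite integral_cst//= itv_measureE ?(ltW AB')// -ge0_sume_distrr; last by move=> i _; exact: psi0.
have -> : (\int[mu]_(x in `[A, B']) \int[mu]_(w in `[0%R, (k%:R * u)%R]) (G (w, x))%:E =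
    \int[mu]_(w in `[0%R, (k%:R * u)%R]) psi w)%E.
  exact: (tonelli (measurable_itv _) (measurable_itv _) mGs (fun p => G0 _)).
apply: (@le_trans _ _ ((8 * k%:R ^+ 3 / L)%:E * q%:E + (8 * k%:R ^+ 4 / L * q)%:E)%E); last first.
  rewrite Qq -!EFinM -EFinD lee_fin -mulrDl -mulrDl ler_wpM2r// ler_wpM2r ?invr_ge0 ?(ltW L0)//.
  by rewrite /C; real_lra.
apply: leeD.
  apply: lee_pmul.
  - by rewrite lee_fin.
  - by apply: integral_ge0.
  - have -> : 8 * k%:R ^+ 3 / L = (u0 / 2)^-1 by rewrite u0E; field; rewrite !gt_eqF.
    have u20 : 0 < u0 / 2 by real_lra.
    rewrite lee_fin lef_pV2 ?posrE//.
    by apply: (le_trans u1); rewrite ler_peMl// ltW.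
  - apply: le_trans Jq; apply: ge0_subset_integral => //; first exact: measurable_funTS.
    by apply: subset_itvl; rewrite bnd_simp.
apply: (@le_trans _ _ (\sum_(i < k) psi (i.+1%:R * u)%R)%E); last first.
  apply: (le_trans uP); rewrite lee_fin ler_wpM2r//.
  by rewrite u0E le_eqVlt; apply/orP; left; apply/eqP; field; rewrite !gt_eqF.
rewrite muleAC -EFinM -[leRHS]mul1e lee_wpmul2r//.
  by apply: sume_ge0.
by rewrite lee_fin mulrC ler_pdivrMr// mul1r /L lerD2r ltW.
Qed.

End whitney.

Section whitney.
Context {R : realType}.
Local Notation mu := (@lebesgue_measure R).
Local Notation TR := (measurableTypeR R).

Let whitney_arith (th L C2 q k : R) : 0 < th -> 0 < k -> L = 4 * (k * th) ->
  th^-1 * (q + k * th * (C2 / L * q)) = (k * C2 + 4 * k) / L * q.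
Proof. by move=> th0 k0 ->; field; rewrite !gt_eqF. Qed.

(** The polynomial of [whitney_left] also works on the remaining right part, by [extend_right] with
    constant weight. *)
Theorem whitney k : (0 < k)%N -> exists2 C : R, 1 <= C &
  forall Phi (A B : R) (F : R -> R), convmod Phi -> A < B -> measurable_fun setT F ->
  mu.-integrable `[A, B] (EFin \o F) ->
  exists2 P : {poly R}, (size P <= k)%N &
  (\int[mu]_(x in `[A, B]) (Phi (`|F x - P.[x]| / C))%:E <=
   (C / (B - A))%:E * whitney_rhs Phi k F A B)%E.
Proof.
move=> k0; have [C2 C21 left] := @whitney_left R k k0.
have k1 : 1 <= k%:R :> R by rewrite ler1n.
pose C3 : R := k.+1%:R * 2 ^+ k.
have C31 : 1 <= C3 by rewrite /C3 mulr_ege1 ?ler1n// exprn_ege1// ler1n.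
exists (C2 * C3 + (k%:R + 1) * C2 + 4 * k%:R) => [|Phi A B F PhiP AB mF Fi].
  have : 1 <= C2 * C3 by rewrite mulr_ege1.
  have : 0 <= (k%:R + 1) * C2 by rewrite mulr_ge0//; real_lra.
  real_lra.
set C := _ + _ + _.
have C230 : 1 <= C2 * C3 by rewrite mulr_ege1.
have kC2 : 0 <= (k%:R + 1) * C2 by rewrite mulr_ge0//; real_lra.
have C2C3 : C2 * C3 <= C by rewrite /C; real_lra.
have C2C : C2 <= C by apply: le_trans C2C3; rewrite ler_peMr//; real_lra.
have C0 : 0 < C by real_lra.
set L := B - A; have L0 : 0 < L by rewrite subr_gt0.
pose G (p : TR * TR) := if p.2 + k%:R * p.1 <= B then Phi `|nab k p.1 F p.2| else 0.
have mPhi := cm_meas PhiP.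
have mG : measurable_fun setT G.
  apply: measurable_fun_ifT => //.
    apply: measurable_fun_ler => //; apply: measurable_funD => //.
    exact: measurable_funM.
  by do 2 apply: measurableT_comp => //; exact: measurable_nab.
have G0 p : 0 <= G p by rewrite /G; case: ifP => // _; rewrite cm_ge0.
have Q0 : (0 <= whitney_rhs Phi k F A B)%E.
  by apply: integral_ge0 => w _; apply: integral_ge0 => y _; rewrite lee_fin; exact: (G0 (w, y)).
have [Qy|Qfin] := eqVneq (whitney_rhs Phi k F A B) +oo%E.
  (* An infinite right-hand side leaves nothing to prove; afterwards it is a real number q. *)
  exists 0; rewrite ?size_poly0//.
  by rewrite Qy gt0_muley ?leey// lte_fin divr_gt0.
have [q Qq] : exists q, whitney_rhs Phi k F A B = q%:E.
  by move: Q0 Qfin; case: whitney_rhs => // q _ _; exists q.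
have q0 : 0 <= q by rewrite -lee_fin -Qq.
pose th := L / (4 * k%:R); pose B' := B - th.
have k0' : 0 < k%:R :> R by real_lra.
have th0 : 0 < th by rewrite divr_gt0// mulr_gt0.
have thL : L = 4 * (k%:R * th) by rewrite /th; field; rewrite gt_eqF.
have kth : th <= k%:R * th by rewrite ler_peMl// ltW.
have BB' : B - B' = th by rewrite /B'; real_lra.
have AB' : A < B' by rewrite /B'; move: thL; rewrite /L; real_lra.
have B'B : B' < B by rewrite /B'; real_lra.
have LE : B - A = 4 * k%:R * (B - B') by rewrite BB' -mulrA -thL.
have Qlt : (whitney_rhs Phi k F A B < +oo)%E by rewrite Qq ltry.
have [P sP leftP] := left Phi A B' B F PhiP AB' B'B LE mF Fi Qlt.
exists P => //.
have mFP : measurable_fun setT (fun x => `|F x - P.[x]|).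
  by apply: measurableT_comp => //; apply: measurable_funB => //; exact: measurable_horner.
have mPFP (c : R) : measurable_fun setT (fun x => (Phi (`|F x - P.[x]| / c))%:E).
  apply/measurable_EFinP; apply: measurableT_comp => //; exact: measurable_funM.
have PFP0 (c : R) x : 0 <= c -> (0 <= (Phi (`|F x - P.[x]| / c))%:E)%E.
  by move=> c0; rewrite lee_fin cm_ge0// divr_ge0.
pose c := C2^-1; have c0 : 0 <= c by rewrite invr_ge0; real_lra.
have c1 : c <= 1 by rewrite /c invf_le1//; real_lra.
(* On [A, B'] the error is controlled only after division by C2, so the extension is run with a
   modular that contains this division. *)
pose Phi2 s := Phi (c * s).
have Phi2P : convmod Phi2 by exact: cm_scale.
have cond : A + 2 * k%:R * (B - B') <= B'.
  by rewrite BB' /B' -mulrA; move: thL; rewrite /L; real_lra.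
have := @extend_right R Phi2 k A B' B (cst 1) F P Phi2P B'B cond mF (measurable_cst _)
  (fun=> ler01) (fun _ _ _ _ _ => lexx 1) sP.
rewrite BB' /Phi2 -/C3.
set I2 := (\int[mu]_(y in `[B', B]) _)%E; set I3 := (\int[mu]_(w in _) _)%E.
set I1 := (\int[mu]_(x in `[A, B']) _)%E => ext.
have I1q : (I1 <= (C2 / L * q)%:E)%E.
  rewrite EFinM -Qq; apply: le_trans leftP.
  rewrite le_eqVlt; apply/orP; left; apply/eqP; apply: eq_integral => x _.
  by rewrite /= mul1r mulrC.
have I3q : (I3 <= q%:E)%E.
  rewrite -Qq; apply: (@le_trans _ _ (\int[mu]_(w in `[th, (2 * th)%R]) \int[mu]_(y in `[A, B]) (G (w, y))%:E)%E).
    apply: ge0_le_integral => //.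
    - by move=> w _; apply: integral_ge0 => y _; rewrite lee_fin cm_ge0// !mulr_ge0.
    - apply: measurable_funTS.
      apply: (@measurable_inner _ (fun p : TR * TR => Phi (c * (cst 1 p.2 * `|nab k p.1 F (p.2 - k%:R * p.1)|)))) => //.
        apply: measurableT_comp => //; apply: measurable_funM => //; apply: measurable_funM => //.
        apply: measurableT_comp => //; apply: measurable_nab => //.
        by apply: measurable_funB => //; exact: measurable_funM.
      by move=> p; rewrite cm_ge0// !mulr_ge0.
    - by apply: measurable_funTS; exact: measurable_inner.
    move=> w; rewrite /= in_itv/= => /andP[w1 w2].
    apply: (@le_trans _ _ (\int[mu]_(y in `[B', B]) (G (w, y + - (k%:R * w)))%:E)%E).
      apply: ge0_le_integral => //.
      - by move=> y _; rewrite lee_fin cm_ge0// !mulr_ge0.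
      - apply/measurable_EFinP/measurable_funTS; apply: measurableT_comp => //.
        apply: measurable_funM => //; apply: measurable_funM => //; apply: measurableT_comp => //.
        apply: measurable_nab => //; exact: measurable_funD.
      - apply/measurable_EFinP/measurable_funTS; apply: measurableT_comp => //.
        by apply: measurable_fun_pair => //; exact: measurable_funD.
      move=> y; rewrite /= in_itv/= => /andP[y1 y2].
      rewrite lee_fin /G /= subrK y2 cm_mono// ?mulr_ge0//.
      by rewrite mul1r ler_piMl.
    rewrite -[leLHS]mul1e.
    apply: (@ge0_integral_expansion _ _ (fun y => y + - (k%:R * w)) 1 _ (fun y => (G (w, y))%:E)) => //.
    - exact: measurable_funD.
    - by move=> x y _ _; rewrite mul1r opprD opprK addrACA addNr addr0.
    - move=> y; rewrite /= !in_itv/= => /andP[y1 y2].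
      have : k%:R * w <= k%:R * (2 * th) by rewrite ler_wpM2l.
      have : 0 <= k%:R * w by rewrite mulr_ge0//; real_lra.
      by move: thL; rewrite /L => thL *; apply/andP; split; rewrite /B' in y1; real_lra.
    - by apply/measurable_EFinP; exact: measurable_section.
    - by move=> y; rewrite lee_fin.
  apply: ge0_subset_integral => //.
  - by apply: measurable_funTS; exact: (@measurable_inner _ G).
  - by move=> w _; apply: integral_ge0 => y _; rewrite lee_fin; exact: (G0 (w, y)).
  - move=> w; rewrite /= !in_itv/= => /andP[w1 w2]; apply/andP; split; first real_lra.
    by move: thL; rewrite /L; real_lra.
have I2q : (I2 <= ((k%:R * C2 + 4 * k%:R) / L * q)%:E)%E.
  have thi : (th^-1%:E * th%:E = 1)%E by rewrite -EFinM mulVf// gt_eqF.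
  rewrite -[I2]mul1e -thi -muleA.
  apply: (@le_trans _ _ (th^-1%:E * (q%:E + (k%:R * th)%:E * (C2 / L * q)%:E))%E).
    apply: lee_wpmul2l; first by rewrite lee_fin invr_ge0 ltW.
    apply: (le_trans ext); apply: leeD => //; apply: lee_wpmul2l => //.
    by rewrite lee_fin mulr_ge0// ltW.
  have -> : ((k%:R * th)%:E * (C2 / L * q)%:E = (k%:R * th * (C2 / L * q))%:E)%E by rewrite EFinM.
  rewrite -EFinD -EFinM lee_fin le_eqVlt; apply/orP; left; apply/eqP.
  exact: whitney_arith.
apply: (@le_trans _ _ (\int[mu]_(x in `[A, B']) (Phi (`|F x - P.[x]| / C))%:E +
   \int[mu]_(x in `[B', B]) (Phi (`|F x - P.[x]| / C))%:E)%E).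
  apply: ge0_integral_itv_le => //; try exact: ltW.
  by move=> x; rewrite PFP0// ltW.
apply: (@le_trans _ _ ((C2 / L * q)%:E + ((k%:R * C2 + 4 * k%:R) / L * q)%:E)%E); last first.
  rewrite Qq -EFinM -EFinD lee_fin -mulrDl ler_wpM2r// -mulrDl ler_wpM2r ?invr_ge0 ?(ltW L0)//.
  by rewrite /C; move: C230; real_lra.
have mono x (d : R) : 0 < d -> d <= C -> Phi (`|F x - P.[x]| / C) <= Phi (`|F x - P.[x]| / d).
  move=> d0 dC; apply: cm_mono => //; first by rewrite divr_ge0// ltW.
  by rewrite ler_wpM2l// lef_pV2 ?posrE.
apply: leeD.
  apply: le_trans I1q; apply: ge0_le_integral => //.
  - by move=> x _; rewrite PFP0// ltW.
  - exact: measurable_funTS (mPFP C).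
  - apply/measurable_EFinP/measurable_funTS; apply: measurableT_comp => //.
    by do 2 apply: measurable_funM => //.
  move=> x _; rewrite lee_fin.
  have -> : c * (cst 1 x * `|F x - P.[x]|) = `|F x - P.[x]| / C2 by rewrite /= mul1r mulrC.
  by rewrite mono//; real_lra.
apply: le_trans I2q; apply: ge0_le_integral => //.
- by move=> x _; rewrite PFP0// ltW.
- exact: measurable_funTS (mPFP C).
- apply/measurable_EFinP/measurable_funTS; apply: measurableT_comp => //.
  by do 3 apply: measurable_funM => //.
move=> x _; rewrite lee_fin /= mul1r.
have -> : c * (`|F x - P.[x]| / C3) = `|F x - P.[x]| / (C2 * C3) by rewrite mulrCA -invfM.
by rewrite mono//; real_lra.
Qed.

End whitney.

(** * Splines *)

Section splines.
Context {R : realType}.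
Implicit Types (c x : R) (P Q : {poly R}) (s : seq (R * {poly R})).

(** The knot belongs to the right-hand branch, so the cells of a spline are half-open on the
    right. *)
Definition truncated_poly c Q x : R := if x < c then 0 else Q.[x].

(** A double zero at c makes Q and its derivative vanish there, so the difference quotients from
    both sides of the knot tend to 0. *)
Lemma is_derive_truncated c Q x : ('X - c%:P) ^+ 2 %| Q ->
  is_derive x 1 (truncated_poly c Q) (truncated_poly c Q^`() x).
Proof.
move=> cQ; have /dvdpP[S QE] := cQ.
have [xc|cx] := ltP x c.
  rewrite /truncated_poly xc.
  apply: (@near_eq_is_derive _ _ _ (cst 0)); rewrite ?oner_eq0//.
  have : \forall y \near x, y < c by exact: lt_nbhsl.
  by apply: filterS => y /= ->.
rewrite {2}/truncated_poly ltNge cx /=.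
move: cx; rewrite le_eqVlt => /predU1P[cx|cx]; last first.
  apply: (@near_eq_is_derive _ _ _ (horner Q)); rewrite ?oner_eq0//.
  have : \forall y \near x, c < y by exact: lt_nbhsr.
  by apply: filterS => y /= cy; rewrite /truncated_poly ltNge (ltW cy).
subst x.
have Qc : Q.[c] = 0 by rewrite QE hornerM horner_exp hornerXsubC subrr expr0n mulr0.
have Q'c : Q^`().[c] = 0.
  by rewrite QE expr2 !derivM derivXsubC !(hornerXsubC,hornerM,hornerD,hornerC) subrr; ring.
have Qd : is_derive c 1 (horner Q) 0 by rewrite -[X in is_derive _ _ _ X]Q'c; exact: is_derive_poly.
rewrite Q'c.
have {Qd} [/cvg_ex[/= l Ql] Ql0] := Qd.
have l0 : l = 0 by rewrite -Ql0 /derive; apply/esym/cvg_lim.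
have H : h^-1 *: (truncated_poly c Q (h *: 1 + c) - truncated_poly c Q c) @[h --> 0^'] --> (0 : R).
  rewrite l0 in Ql; apply/cvgrPdist_le => e e0.
  move/cvgrPdist_le : Ql => /(_ _ e0); apply: filterS => h.
  rewrite !sub0r !normrN /= => hQ.
  rewrite /truncated_poly ltxx Qc subr0.
  case: ifP => _; first by rewrite scaler0 normr0 ltW.
  by move: hQ; rewrite Qc subr0.
apply: DeriveDef; first by apply/cvg_ex; exists 0.
exact/cvg_lim.
Qed.

(** A polynomial plus jumps at knots, rather than a piecewise formula: derivatives and
    antiderivatives are then taken term by term. *)
Definition spline P s x : R := P.[x] + \sum_(q <- s) truncated_poly q.1 q.2 x.

(** A zero of order K of each jump at its own knot means that the spline is of class C^(K-1). *)
Definition spline_wf K s := all (fun q : R * {poly R} => ('X - q.1%:P) ^+ K %| q.2) s.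

Definition spline_deriv s := [seq (q.1, q.2^`()) | q <- s].

Lemma spline_wf_deriv K s : spline_wf K.+1 s -> spline_wf K (spline_deriv s).
Proof.
rewrite /spline_wf all_map; apply: sub_all => -[c Q] /= /dvdpP[S ->].
rewrite derivM dvdp_add//.
  by rewrite dvdp_mull// exprS dvdp_mulIr.
by apply: dvdp_mull; rewrite deriv_exp derivXsubC mul1r /= -scaler_nat dvdpZr ?pnatr_eq0.
Qed.

Lemma spline_wf_le K K' s : (K' <= K)%N -> spline_wf K s -> spline_wf K' s.
Proof. by move=> KK'; apply: sub_all => q; apply: dvdp_trans; exact: dvdp_exp2l. Qed.

Lemma is_derive_spline P s x : spline_wf 2 s ->
  is_derive x 1 (spline P s) (spline P^`() (spline_deriv s) x).
Proof.
move=> swf.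
rewrite [X in is_derive _ _ _ X]/spline /spline_deriv big_map.
have -> : spline P s = horner P + (fun x => \sum_(q <- s) truncated_poly q.1 q.2 x).
  by apply/funext.
apply: is_deriveD.
elim: s swf => [_|[c Q] s IH /= /andP[cQ swf]].
  rewrite big_nil (_ : (fun _ => _) = cst 0); last by apply/funext => y; rewrite big_nil.
  exact: is_derive_cst.
rewrite big_cons (_ : (fun _ => _) = truncated_poly c Q + (fun x => \sum_(q <- s) truncated_poly q.1 q.2 x)); last first.
  by apply/funext => y; rewrite big_cons.
apply: is_deriveD; first exact: is_derive_truncated.
exact: IH.
Qed.

Lemma derive1_spline P s : spline_wf 2 s -> derive1 (spline P s) = spline P^`() (spline_deriv s).
Proof.
move=> swf; apply/funext => x; rewrite derive1E.
by have [] := is_derive_spline P x swf.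
Qed.

Lemma derive1n_spline j K P s : spline_wf K s -> (j < K)%N ->
  derive1n j (spline P s) = spline P^`(j) (iter j spline_deriv s).
Proof.
elim: j K P s => [//|j IH] [//|K] P s swf jK.
rewrite derive1nS (IH K.+1 P s swf)//; last exact: ltnW.
have swf' : spline_wf 2 (iter j spline_deriv s).
  have : spline_wf (K.+1 - j) (iter j spline_deriv s).
    elim: j {IH} jK => [|j IH] jK; first by rewrite subn0.
    have jK' : (j < K)%N by rewrite -ltnS ltnW.
    by rewrite iterS; apply: spline_wf_deriv; rewrite (@subnSK j K.+1 (leqW jK')); apply: IH; exact: ltnW.
  by apply: spline_wf_le; rewrite ltn_subRL addn1.
by rewrite derive1_spline// derivnS.
Qed.

Lemma measurable_spline P s : measurable_fun [set: R] (spline P s).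
Proof.
apply: measurable_funD; first exact: measurable_horner.
elim: s => [|q s IH].
  by under eq_fun do rewrite big_nil; exact: measurable_cst.
under eq_fun do rewrite big_cons; apply: measurable_funD => //.
apply: measurable_fun_ifT => //; last exact: measurable_horner.
by apply: measurable_fun_ltr.
Qed.

Lemma spline_bounded P s (a b : R) : exists2 M : R, 0 < M & forall x, a <= x <= b -> `|spline P s x| <= M.
Proof.
have polyM Q : exists2 M : R, 0 <= M & forall x, a <= x <= b -> `|Q.[x]| <= M.
  exists (\sum_(i < size Q) `|Q`_i| * (`|a| + `|b|) ^+ i).
    by apply: sumr_ge0 => i _; rewrite mulr_ge0// exprn_ge0// addr_ge0.
  move=> x /andP[bx xc]; apply: horner_le; rewrite ler_norml; apply/andP; split.
    by have := ler_norm (- a); rewrite normrN; have := normr_ge0 b; real_lra.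
  by have := ler_norm b; have := normr_ge0 a; real_lra.
have [M0 M00 PM] := polyM P.
suff [M1 M10 sM] : exists2 M : R, 0 <= M & forall x, a <= x <= b -> `|\sum_(q <- s) truncated_poly q.1 q.2 x| <= M.
  exists (M0 + M1 + 1) => [|x xab]; first real_lra.
  by apply: (le_trans (ler_normD _ _)); have := PM _ xab; have := sM _ xab; real_lra.
elim: s => [|[c Q] s [M M_0 IH]]; first by exists 0 => // x _; rewrite big_nil normr0.
have [M' M'0 QM] := polyM Q.
exists (M' + M) => [|x xab]; first by rewrite addr_ge0.
rewrite big_cons; apply: (le_trans (ler_normD _ _)); apply: lerD; last exact: IH.
by rewrite /truncated_poly /=; case: ifP => _; rewrite ?normr0// QM.
Qed.

(** Q is expanded in powers of X - c, starting from order K, and integrated termwise; this fixes the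
    integration constant so that the order of the zero increases by one. *)
Lemma antiderivative_dvdp K c Q : ('X - c%:P) ^+ K %| Q ->
  exists2 T : {poly R}, ('X - c%:P) ^+ K.+1 %| T & T^`() = Q.
Proof.
move=> /dvdpP[S QE]; pose V := S \Po ('X + c%:P).
have SE : S = \sum_(i < size V) V`_i *: ('X - c%:P) ^+ i.
  by rewrite -comp_polyE /V -comp_polyA comp_polyD comp_polyX comp_polyC subrK comp_polyXr.
exists (\sum_(i < size V) (V`_i / (i + K).+1%:R) *: ('X - c%:P) ^+ (i + K).+1).
  elim/big_ind: _ => [|p q|i _]; [exact: dvdp0|exact: dvdp_add|].
  by rewrite -mul_polyC dvdp_mull// dvdp_exp2l// ltnS leq_addl.
rewrite QE SE mulr_suml linear_sum; apply: eq_bigr => i _ /=.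
rewrite derivZ deriv_exp derivXsubC mul1r /= -scalerMnr scalerMnl -mulr_natr divfK ?pnatr_eq0//.
by rewrite exprD scalerAl.
Qed.

Lemma spline_antiderivative K P s : spline_wf K s ->
  exists P' s', [/\ spline_wf K.+1 s', P'^`() = P & spline_deriv s' = s].
Proof.
move=> swf; exists (polyprim P).
suff [s' [s'wf s'E]] : exists s', spline_wf K.+1 s' /\ spline_deriv s' = s.
  by exists s'; split => //; exact: deriv_polyprim.
elim: s swf => [_|[c Q] s IH /= /andP[cQ /IH[s' [s'wf s'E]]]]; first by exists [::].
have [T cT TQ] := antiderivative_dvdp cQ.
exists ((c, T) :: s'); split; first by rewrite /= cT.
by rewrite /spline_deriv /= TQ -/(spline_deriv _) s'E.
Qed.

Lemma spline_iter_antiderivative r K P s : spline_wf K s ->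
  exists P' s', [/\ spline_wf (r + K) s', P'^`(r) = P & iter r spline_deriv s' = s].
Proof.
elim: r K P s => [|r IH] K P s swf; first by exists P, s.
have [P1 [s1 [wf1 P1E s1E]]] := spline_antiderivative P swf.
have [P2 [s2 [wf2 P2E s2E]]] := IH _ P1 s1 wf1.
exists P2, s2; split; first by rewrite addSnnS.
  by rewrite derivnS P2E.
by rewrite iterS s2E.
Qed.

Lemma ACloc_spline P s : spline_wf 2 s -> ACloc (spline P s).
Proof.
move=> swf a b _ ab _ e e0.
have [M M0 bM] := spline_bounded P^`() (spline_deriv s) a b.
exists (e / M) => [|n u v uv _ suv]; first by rewrite divr_gt0.
apply: (@le_lt_trans _ _ (\sum_(i < n) M * (v i - u i))); last first.
  by rewrite -mulr_sumr mulrC -ltr_pdivlMr.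
apply: ler_sum => i _; have [au [uvi vb]] := uv i.
move: uvi; rewrite le_eqVlt => /predU1P[->|uvi]; first by rewrite !subrr normr0 mulr0.
have [x xuv ->] := @MVT _ (spline P s) _ _ _ uvi (fun x _ => is_derive_spline P x swf)
  (derivable_within_continuous (fun x _ => @ex_derive _ _ _ _ _ _ _ (is_derive_spline P x swf))).
rewrite normrM [X in _ * X]gtr0_norm ?subr_gt0// ler_wpM2r ?subr_ge0 ?(ltW uvi)//.
by apply: bM; move: xuv; rewrite in_itv/= => /andP[ux xv]; real_lra.
Qed.

End splines.

(** * Nodes adapted to phi *)

Section nodes.
Context {R : realType}.
Implicit Types (s x z : R).

(* The derivative of [node] at s is comparable to phi (node s), so that equidistant points are mapped
   to a partition adapted to phi. *)
Definition node s := s * (3 - s ^+ 2) / 2.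

(** The double zeros at s = -1 and s = 1 make 1 + node s and 1 - node s comparable to (1 + s)^2 and
    (1 - s)^2 on (-1, 1), as they would be for x = sin(pi s / 2). All comparisons between nodes and
    phi below follow from this. *)
Lemma node_add1 s : 1 + node s = (1 + s) ^+ 2 * (2 - s) / 2.
Proof. by rewrite /node; field. Qed.

Lemma node_sub1 s : 1 - node s = (1 - s) ^+ 2 * (2 + s) / 2.
Proof. by rewrite /node; field. Qed.

Lemma nodeN s : node (- s) = - node s.
Proof. by rewrite /node; field. Qed.

Lemma node_add1_ge s : -1 < s -> s < 1 -> (1 + s) ^+ 2 / 2 <= 1 + node s.
Proof.
by move=> *; rewrite node_add1 -[leLHS]mulr1 mulrAC ler_pM2r ?invr_gt0// ler_pM2l ?exprn_gt0//; real_lra.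
Qed.

Lemma node_sub1_ge s : -1 < s -> s < 1 -> (1 - s) ^+ 2 / 2 <= 1 - node s.
Proof.
by move=> *; rewrite node_sub1 -[leLHS]mulr1 mulrAC ler_pM2r ?invr_gt0// ler_pM2l ?exprn_gt0//; real_lra.
Qed.

Lemma node_add1_le s : -1 < s -> s < 1 -> 1 + node s <= 3 * (1 + s) ^+ 2 / 2.
Proof.
by move=> *; rewrite node_add1 ler_pM2r ?invr_gt0// mulrC ler_pM2r ?exprn_gt0//; real_lra.
Qed.

Lemma node_sub1_le s : -1 < s -> s < 1 -> 1 - node s <= 3 * (1 - s) ^+ 2 / 2.
Proof.
by move=> *; rewrite node_sub1 ler_pM2r ?invr_gt0// mulrC ler_pM2r ?exprn_gt0//; real_lra.
Qed.

Lemma node_diff s s' : node s' - node s =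
  (s' - s) / 2 * ((1 - s) * (1 + s) + (1 - s') * (1 + s') + ((1 - s) * (1 + s') + (1 + s) * (1 - s')) / 2).
Proof. by rewrite /node; field. Qed.

Lemma node_diff_ge s s' : -1 < s -> s < s' -> s' < 1 ->
  (s' - s) * (3 / 2) * ((1 - s') * (1 + s)) <= node s' - node s.
Proof.
move=> s1 ss' s'1; rewrite node_diff.
rewrite [leLHS](_ : _ = (s' - s) / 2 * (3 * ((1 - s') * (1 + s)))); last by field.
rewrite ler_pM2l; last real_lra.
have a1 : (1 - s') * (1 + s) <= (1 - s) * (1 + s) by rewrite ler_wpM2r//; real_lra.
have a2 : (1 - s') * (1 + s) <= (1 - s') * (1 + s') by rewrite ler_wpM2l//; real_lra.
have a3 : (1 - s') * (1 + s) <= (1 - s) * (1 + s') by rewrite ler_pM//; real_lra.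
real_lra.
Qed.

Lemma node_diff_le s s' : -1 < s -> s < s' -> s' < 1 ->
  node s' - node s <= (s' - s) * (3 / 2) * ((1 - s) * (1 + s')).
Proof.
move=> s1 ss' s'1; rewrite node_diff.
rewrite [leRHS](_ : _ = (s' - s) / 2 * (3 * ((1 - s) * (1 + s')))); last by field.
rewrite ler_pM2l; last real_lra.
have a1 : (1 - s) * (1 + s) <= (1 - s) * (1 + s') by rewrite ler_wpM2l//; real_lra.
have a2 : (1 - s') * (1 + s') <= (1 - s) * (1 + s') by rewrite ler_wpM2r//; real_lra.
have a3 : (1 - s') * (1 + s) <= (1 - s) * (1 + s') by rewrite ler_pM//; real_lra.
real_lra.
Qed.

Lemma phi_prod x : phi x = Num.sqrt ((1 - x) * (1 + x)).
Proof. by rewrite /phi; congr Num.sqrt; ring. Qed.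

Lemma node_phi_ge s s' z : -1 < s -> s < s' -> s' < 1 ->
  node s <= z <= node s' -> (1 - s') * (1 + s) / 2 <= phi z.
Proof.
move=> s1 ss' s'1 /andP[sz zs].
have p0 : 0 <= (1 - s') * (1 + s) / 2 by rewrite divr_ge0// mulr_ge0//; real_lra.
rewrite -[leLHS]ger0_norm// -sqrtr_sqr phi_prod ler_wsqrtr//.
rewrite (_ : _ ^+ 2 = (1 - s') ^+ 2 / 2 * ((1 + s) ^+ 2 / 2)); last by field.
apply: ler_pM; rewrite ?divr_ge0 ?sqr_ge0//.
  by have := node_sub1_ge (lt_trans s1 ss') s'1; real_lra.
by have := node_add1_ge s1 (lt_trans ss' s'1); real_lra.
Qed.

Lemma node_phi_le s s' z : -1 < s -> s < s' -> s' < 1 ->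
  node s <= z <= node s' -> phi z <= 3 / 2 * ((1 - s) * (1 + s')).
Proof.
move=> s1 ss' s'1 /andP[sz zs].
have p0 : 0 <= 3 / 2 * ((1 - s) * (1 + s')) by rewrite mulr_ge0// mulr_ge0//; real_lra.
rewrite -[leRHS]ger0_norm// -sqrtr_sqr phi_prod ler_wsqrtr//.
rewrite (_ : _ ^+ 2 = (3 * (1 - s) ^+ 2 / 2) * (3 * (1 + s') ^+ 2 / 2)); last by field.
have := node_sub1_ge (lt_trans s1 ss') s'1; have := node_add1_ge s1 (lt_trans ss' s'1);
  have := node_sub1_le s1 (lt_trans ss' s'1); have := node_add1_le (lt_trans s1 ss') s'1.
have := sqr_ge0 (1 - s'); have := sqr_ge0 (1 + s).
by move=> *; apply: ler_pM; real_lra.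
Qed.

Lemma node_ratio s s' (Q z z' : R) : -1 < s -> s < s' -> s' < 1 ->
  0 <= Q -> 1 - s <= Q * (1 - s') -> 1 + s' <= Q * (1 + s) ->
  node s <= z <= node s' -> node s <= z' <= node s' ->
  1 - z <= 3 * Q ^+ 2 * (1 - z') /\ 1 + z <= 3 * Q ^+ 2 * (1 + z').
Proof.
move=> s1 ss' s'1 Q0 Q1 Q2 /andP[sz zs] /andP[sz' zs'].
have e1 : (1 - s) ^+ 2 <= Q ^+ 2 * (1 - s') ^+ 2 by rewrite -exprMn ler_sqr ?nnegrE; real_lra.
have e2 : (1 + s') ^+ 2 <= Q ^+ 2 * (1 + s) ^+ 2 by rewrite -exprMn ler_sqr ?nnegrE; real_lra.
have Q20 : 0 <= Q ^+ 2 by exact: sqr_ge0.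
have f1 : Q ^+ 2 * ((1 - s') ^+ 2 / 2) <= Q ^+ 2 * (1 - z').
  by rewrite ler_wpM2l//; have := node_sub1_ge (lt_trans s1 ss') s'1; real_lra.
have f2 : Q ^+ 2 * ((1 + s) ^+ 2 / 2) <= Q ^+ 2 * (1 + z').
  by rewrite ler_wpM2l//; have := node_add1_ge s1 (lt_trans ss' s'1); real_lra.
by have := node_sub1_le s1 (lt_trans ss' s'1); have := node_add1_le (lt_trans s1 ss') s'1; split; real_lra.
Qed.

(** Conditions are imposed on windows [y i, y i.+2], which carry the local polynomials. [nd_ratio]
    makes the weight almost constant on a window; [nd_le_phi] lets every step w up to the window
    length be written tau phi(x) with tau <= t; [nd_ge_phi] is the reverse comparison. [nd_gap]
    gives [extend_right] room for k nodes inside the last window, [nd_end_ge] and [nd_end_le] make 1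
    - y m comparable to t^2, and [nd_prev] keeps the last window away from -1. [nd_sym] transfers
    these end conditions to the left. *)
Record adapted_nodes k (M t : R) m (y : nat -> R) : Prop := {
  nd_size : (2 <= m)%N ;
  nd_lt : forall i, (i < m)%N -> y i < y i.+1 ;
  nd_lo : -1 < y 0%N ;
  nd_hi : y m < 1 ;
  nd_ratio : forall i z z', (i.+2 <= m)%N -> y i <= z <= y i.+2 -> y i <= z' <= y i.+2 ->
    1 - z <= M * (1 - z') /\ 1 + z <= M * (1 + z') ;
  nd_le_phi : forall i z, (i.+2 <= m)%N -> y i <= z <= y i.+2 -> y i.+2 - y i <= t * phi z ;
  nd_ge_phi : forall i z, (i < m)%N -> y i <= z <= y i.+1 -> t * phi z <= M * (y i.+1 - y i) ;
  nd_gap : y m.-2 + 2 * k%:R * (1 - y m) <= y m ;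
  nd_end_ge : t ^+ 2 <= M * (1 - y m) ;
  nd_end_le : 8 * (1 - y m) <= t ^+ 2 * (1 + y m.-2) ;
  nd_prev : 1 <= M * (1 + y m.-2) ;
  nd_sym : forall i, (i <= m)%N -> y (m - i)%N = - y i }.

Lemma adapted_nodes_exist k : (0 < k)%N -> exists2 M : R, 1 <= M &
  forall t, 0 < t -> t <= 2 -> exists m y, adapted_nodes k M t m y.
Proof.
move=> k0.
have k1 : 1 <= k%:R :> R by rewrite ler1n.
(* Q equals (2 + ep) / ep for the ep = 1 / (2 k) below, the largest value of (1 + s i.+2) / (1 + s
   i), attained at i = 0. *)
pose Q : R := 1 + 4 * k%:R.
have Q5 : 5 <= Q by rewrite /Q; real_lra.
pose M := 36 * Q ^+ 6.
have Q2 : 25 <= Q ^+ 2 by rewrite (_ : 25 = 5 ^+ 2); [rewrite ler_sqr ?nnegrE; real_lra|ring].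
have Q4 : 25 * Q ^+ 2 <= Q ^+ 4.
  by rewrite (_ : Q ^+ 4 = Q ^+ 2 * Q ^+ 2) ?ler_wpM2r//; [real_lra|ring].
have Q6 : 25 * Q ^+ 4 <= Q ^+ 6.
  by rewrite (_ : Q ^+ 6 = Q ^+ 2 * Q ^+ 4) ?ler_wpM2r//; [real_lra|ring].
exists M => [|t t0 t2]; first by rewrite /M; real_lra.
(* Chosen for [nd_le_phi]: it absorbs the factor 6 Q^2 lost when a window length is compared with
   phi. *)
pose c0 : R := (6 * Q ^+ 2)^-1.
have Q20 : 0 < 6 * Q ^+ 2 by real_lra.
have c00 : 0 < c0 by rewrite invr_gt0.
have c01 : c0 <= 150^-1 by rewrite lef_pV2 ?posrE//; real_lra.
have cE : c0 * (6 * Q ^+ 2) = 1 by rewrite mulVf// gt_eqF.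
pose v := 2 / (c0 * t).
have ct0 : 0 < c0 * t by rewrite mulr_gt0.
have ct : c0 * t <= 75^-1.
  by apply: (@le_trans _ _ (150^-1 * 2)); [rewrite ler_pM//; exact: ltW|real_lra].
have vE : v * (c0 * t) = 2 by rewrite divfK// gt_eqF.
have v0 : 0 < v by rewrite divr_gt0.
have v150 : 150 <= v by rewrite ler_pdivlMr//; real_lra.
have [m [mv vm]] : exists m : nat, v <= m%:R /\ m%:R <= v + 1.
  exists (Num.truncn v).+1; have /andP[a b] := truncn_itv (ltW v0).
  by split; [exact: ltW|rewrite -natr1; real_lra].
(* The distance from -1 to the first parameter, in units of [del]. Its smallness, of order 1 / k,
   makes the end interval short compared with the last window, which gives [nd_gap]. *)
pose ep : R := (2 * k%:R)^-1.
have epE : ep * (2 * k%:R) = 1 by rewrite mulVf// gt_eqF//; real_lra.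
have ep0 : 0 < ep by rewrite invr_gt0; real_lra.
have ep12 : ep <= 2^-1 by rewrite lef_pV2 ?posrE; real_lra.
have QE : Q * ep = 2 + ep  by move: epE; rewrite /Q; clearbody ep => epE; real_lra.
have QK : Q = 1 + 4 * k%:R by [].
clearbody c0 v ep Q.
(* This spacing makes the parameters symmetric: s 0 = -1 + del ep and s m = 1 - del ep. *)
pose del := 2 / (m%:R + 2 * ep).
have dd0 : 0 < m%:R + 2 * ep by real_lra.
have dE : del * (m%:R + 2 * ep) = 2 by rewrite divfK// gt_eqF.
have d0 : 0 < del by rewrite divr_gt0.
clearbody del.
have dct : del <= c0 * t.
  rewrite -(ler_pM2r dd0) dE -[leLHS]vE mulrC ler_pM2l//; real_lra.
have dct2 : c0 * t <= 2 * del.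
  have : c0 * t * (m%:R + 2 * ep) <= c0 * t * (v + 2) by rewrite ler_pM2l//; real_lra.
  rewrite [leRHS](_ : _ = v * (c0 * t) + 2 * (c0 * t)); last by ring.
  rewrite vE => h.
  have e4 : 2 * del * (m%:R + 2 * ep) = 4 by rewrite -[LHS]mulrA dE; ring.
  by rewrite -(ler_pM2r dd0) e4; real_lra.
pose s (i : nat) : R := -1 + del * (i%:R + ep).
have sS i : s i.+1 = s i + del by rewrite /s -natr1; ring.
have s_sym i : (i <= m)%N -> s (m - i)%N = - s i.
  by move=> im; rewrite /s natrB//; have := dE; rewrite mulrDr; real_lra.
have s_lo i : -1 < s i.
  by rewrite /s ltrDl mulr_gt0// ltr_wpDl.
have s_hi i : (i <= m)%N -> s i < 1.
  by move=> im; have := s_lo (m - i)%N; rewrite s_sym//; real_lra.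
have s_add i : 1 + s i = del * (i%:R + ep) by rewrite /s; ring.
clearbody s.
have Qadd i : 1 + s i.+2 <= Q * (1 + s i).
  rewrite !s_add mulrCA ler_pM2l// mulrDr QE -!natr1.
  have : (0 : R) <= i%:R by []. 
  have : i%:R <= Q * i%:R by rewrite ler_peMl//; real_lra.
  real_lra.
have Qsub i : (i.+2 <= m)%N -> 1 - s i <= Q * (1 - s i.+2).
  move=> im; have := Qadd (m - i.+2)%N.
  by rewrite s_sym// (subnSK im) (subnSK (ltnW im)) s_sym ?opprK// ltnW// ltnW.
have Qadd1 i : 1 + s i.+1 <= Q * (1 + s i) by have := Qadd i; rewrite !sS; real_lra.
have Qsub1 i : (i.+1 <= m)%N -> 1 - s i <= Q * (1 - s i.+1).
  move=> im; have := Qadd1 (m - i.+1)%N.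
  by rewrite s_sym// (subnSK im) s_sym ?opprK// ltnW.
have m2 : (2 <= m)%N by rewrite -(@ler_nat R); real_lra.
have mm : m.-2.+2 = m by case: m m2 {mv vm dd0 del dE d0 dct dct2 s sS s_sym s_lo s_hi s_add Qadd Qsub Qadd1 Qsub1} => [|[|]].
have sm : 1 - s m = del * ep.
  by have := s_sym 0%N; rewrite subn0 => ->//; rewrite opprK s_add add0r.
have sm2 : 1 - s m.-2 = del * (2 + ep).
  by move: sm; rewrite -{1}mm !sS => sm; rewrite mulrDr -sm; ring.
have dep : del * ep <= c0 * t / 2.
  by clear - d0 ep0 dct ep12; rewrite ler_pM// ltW.
have th1 : (del * ep) ^+ 2 <= 1 - node (s m).
  rewrite node_sub1 sm -mulrA ler_peMr ?sqr_ge0//; real_lra.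
have th2 : 1 - node (s m) <= 3 / 2 * (del * ep) ^+ 2.
  by have := node_sub1_le (s_lo m) (s_hi m (leqnn m)); rewrite sm; real_lra.
have d2ep : del * (2 + ep) <= 1.
  clear - d0 ep0 dct ct ep12; apply: (@le_trans _ _ (75^-1 * 3)); last real_lra.
  by apply: ler_pM; real_lra.
have pm2 : 2^-1 <= 1 + node (s m.-2).
  have -> : 1 + node (s m.-2) = (1 + s m.-2) ^+ 2 * (2 - s m.-2) / 2 by rewrite node_add1.
  rewrite ler_pdivlMr// mulVf//; apply: mulr_ege1.
    by rewrite exprn_ege1//; real_lra.
  by have := mulr_gt0 d0 ep0; real_lra.
exists m, (node \o s); split => //=.
- clear - s_lo s_hi sS d0; move=> i im; rewrite -subr_gt0; apply: lt_le_trans; last first.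
    by apply: node_diff_ge => //; [rewrite sS; real_lra|exact: s_hi].
  rewrite !mulr_gt0// ?sS//; [real_lra| |have := s_lo i; real_lra].
  by have := s_hi _ im; rewrite sS; real_lra.
- clear - s_lo s_hi; have := node_add1_ge (s_lo 0%N) (s_hi 0%N isT).
  have : 0 < (1 + s 0%N) ^+ 2 by rewrite exprn_gt0//; have := s_lo 0%N; real_lra.
  real_lra.
- by clear - d0 ep0 th1; have := exprn_gt0 2 (mulr_gt0 d0 ep0); real_lra.
- clear - s_lo s_hi sS d0 Qsub Qadd Q2 Q4 Q6 Q5; move=> i z z' im zi zi'.
  have si : s i < s i.+2 by rewrite !sS; real_lra.
  have [] := @node_ratio _ _ Q z z' (s_lo i) si (s_hi _ im) _ (Qsub i im) (Qadd i) zi zi'.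
    real_lra.
  move=> a b; split; [apply: (le_trans a)|apply: (le_trans b)].
    apply: ler_wpM2r; last by rewrite /M; real_lra.
    have := node_sub1_ge (s_lo i.+2) (s_hi _ im); have := sqr_ge0 (1 - s i.+2).
    by case/andP: zi' => _ ? ? ?; real_lra.
  apply: ler_wpM2r; last by rewrite /M; real_lra.
  have := node_add1_ge (s_lo i) (s_hi i (ltnW (ltnW im))); have := sqr_ge0 (1 + s i).
  by case/andP: zi' => ? _ ? ?; real_lra.
- clear - s_lo s_hi sS d0 Qsub Qadd Q5 Q2 cE dct t0; move=> i z im zi.
  have si : s i < s i.+2 by rewrite !sS; real_lra.
  have := node_phi_ge (s_lo i) si (s_hi _ im) zi.
  have := node_diff_le (s_lo i) si (s_hi _ im).
  set p := (1 - s i.+2) * (1 + s i) => h1 h2.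
  apply: (le_trans h1).
  have h3 : (1 - s i) * (1 + s i.+2) <= Q ^+ 2 * p.
    rewrite (_ : Q ^+ 2 * p = (Q * (1 - s i.+2)) * (Q * (1 + s i))); last by rewrite /p; ring.
    by apply: ler_pM => //; [have := s_hi i (ltnW (ltnW im)); real_lra|have := s_lo i.+2; real_lra|exact: Qsub].
  have p0 : 0 < p by rewrite mulr_gt0//; [have := s_hi _ im; real_lra|have := s_lo i; real_lra].
  apply: (@le_trans _ _ (del * 3 * (Q ^+ 2 * p))).
    have -> : s i.+2 - s i = 2 * del by rewrite !sS; ring.
    have -> : 2 * del * (3 / 2) = del * 3 by field.
    by apply: ler_wpM2l; [real_lra|].
  apply: (@le_trans _ _ (c0 * t * 3 * (Q ^+ 2 * p))).
    by apply: ler_wpM2r; [rewrite mulr_ge0 ?sqr_ge0// ltW|real_lra].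
  rewrite (_ : c0 * t * 3 * (Q ^+ 2 * p) = (c0 * (6 * Q ^+ 2)) * (t * (p / 2))); last by field.
  by rewrite cE mul1r ler_pM2l.
- clear - s_lo s_hi sS d0 Qsub1 Qadd1 Q5 Q2 Q4 Q6 cE dct2 t0 c00; move=> i z im zi.
  have si : s i < s i.+1 by rewrite !sS; real_lra.
  have := node_phi_le (s_lo i) si (s_hi _ im) zi.
  have := node_diff_ge (s_lo i) si (s_hi _ im).
  set p := (1 - s i.+1) * (1 + s i) => h1 h2.
  have h3 : (1 - s i) * (1 + s i.+1) <= Q ^+ 2 * p.
    rewrite (_ : Q ^+ 2 * p = (Q * (1 - s i.+1)) * (Q * (1 + s i))); last by rewrite /p; ring.
    by apply: ler_pM => //; [have := s_hi i (ltnW im); real_lra|have := s_lo i.+1; real_lra|exact: Qsub1].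
  have p0 : 0 < p by rewrite mulr_gt0//; [have := s_hi _ im; real_lra|have := s_lo i; real_lra].
  apply: (@le_trans _ _ (t * (3 / 2 * (Q ^+ 2 * p)))).
    by rewrite ler_pM2l//; real_lra.
  apply: (@le_trans _ _ (12 * Q ^+ 4 * (del * (3 / 2) * p))); last first.
    have p0' : 0 <= del * (3 / 2) * p by rewrite mulr_ge0// ?(ltW p0)//; real_lra.
    apply: ler_pM => //; [real_lra|rewrite /M; real_lra|].
    by move: h1; rewrite sS addrAC subrr add0r.
  rewrite (_ : t * _ = (c0 * (6 * Q ^+ 2)) * (t * (3 / 2 * (Q ^+ 2 * p)))); last by rewrite cE mul1r.
  rewrite (_ : c0 * _ * _ = (c0 * t) * (9 * Q ^+ 4 * p)); last by field.
  rewrite (_ : 12 * _ * _ = (2 * del) * (9 * Q ^+ 4 * p)); last by field.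
  by apply: ler_wpM2r => //; rewrite mulr_ge0 ?(ltW p0)//; real_lra.
- clear - sm2 th2 QE QK d0 ep0 Q5 k1 d2ep; have h1 : 2^-1 * (del * (2 + ep)) ^+ 2 <= 1 - node (s m.-2).
    rewrite node_sub1 sm2 mulrC -mulrA ler_wpM2l ?sqr_ge0//; real_lra.
  have h2 : (del * (2 + ep)) ^+ 2 = Q ^+ 2 * (del * ep) ^+ 2 by rewrite -QE; ring.
  have h3 : (1 + 2 * k%:R) * (1 - node (s m)) <= (1 + 2 * k%:R) * (3 / 2 * (del * ep) ^+ 2).
    by rewrite ler_wpM2l//; real_lra.
  have h4 : 2^-1 * Q ^+ 2 * (del * ep) ^+ 2 >= (1 + 2 * k%:R) * (3 / 2) * (del * ep) ^+ 2.
    rewrite ler_wpM2r ?sqr_ge0//.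
    have : Q ^+ 2 >= 5 * Q by rewrite expr2 ler_wpM2r//; real_lra.
    real_lra.
  real_lra.
- clear - Q2 Q4 Q6 d0 ep0 ct0 QE Q5 cE th1 dct2; apply: (@le_trans _ _ (M * (del * ep) ^+ 2)); last by rewrite ler_wpM2l// /M; real_lra.
  have h1 : (c0 * t * ep / 2) ^+ 2 <= (del * ep) ^+ 2.
    have e0 : 0 <= ep by real_lra.
    have le1 : c0 * t * ep / 2 <= del * ep by rewrite mulrAC; apply: ler_wpM2r => //; real_lra.
    have b0 : 0 <= c0 * t * ep / 2 by rewrite divr_ge0// mulr_ge0// ltW.
    by rewrite ler_sqr// nnegrE// (le_trans b0).
  apply: (@le_trans _ _ (M * (c0 * t * ep / 2) ^+ 2)); last by rewrite ler_wpM2l// /M; real_lra.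
  have : (Q * ep) ^+ 2 >= 2 ^+ 2 by rewrite ler_sqr ?nnegrE; real_lra.
  move=> h2.
  rewrite (_ : M * _ = (c0 * (6 * Q ^+ 2)) ^+ 2 * t ^+ 2 * ((Q * ep) ^+ 2 / 4)); last by rewrite /M; field.
  by rewrite cE expr1n mul1r ler_peMr ?sqr_ge0//; real_lra.
- clear - dep d0 ep0 ct0 pm2 c01 c00 th2; have h1 : (del * ep) ^+ 2 <= (c0 * t / 2) ^+ 2.
    have b0 : 0 <= del * ep by rewrite mulr_ge0// ltW.
    by rewrite ler_sqr// nnegrE// (le_trans b0).
  have h2 : t ^+ 2 * 2^-1 <= t ^+ 2 * (1 + node (s m.-2)) by rewrite ler_wpM2l ?sqr_ge0.
  have h3 : (c0 * t / 2) ^+ 2 <= t ^+ 2 * 400^-1.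
    rewrite (_ : c0 * t / 2 = t * (c0 / 2)); last by ring.
    rewrite [leLHS]exprMn ler_wpM2l ?sqr_ge0//; apply: (@le_trans _ _ (20^-1 * 20^-1)); last real_lra.
    by rewrite expr2; apply: ler_pM; real_lra.
  have := sqr_ge0 t; real_lra.
- clear - pm2 Q2 Q4 Q6; have : M * 2^-1 <= M * (1 + node (s m.-2)) by rewrite ler_wpM2l// /M; real_lra.
  by rewrite /M; real_lra.
- by move=> i im; rewrite s_sym// nodeN.
Qed.

End nodes.

(** * Local polynomial approximation *)

Section comparison.
Context {R : realType}.
Local Notation mu := (@lebesgue_measure R).
Local Notation TR := (measurableTypeR R).

(** The alternative [f x <= 0] serves integrands cut off by a condition: where they vanish, neither
    membership in E nor the comparison with g has to be checked. *)
Lemma le_integral_fin (D E : set TR) (f g : TR -> R) : measurable D -> measurable E ->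
  measurable_fun setT f -> measurable_fun setT g -> (forall x, 0 <= f x) -> (forall x, 0 <= g x) ->
  (forall x, D x -> (E x /\ f x <= g x) \/ f x <= 0) ->
  (\int[mu]_(x in D) (f x)%:E <= \int[mu]_(x in E) (g x)%:E)%E.
Proof.
move=> mD mE mf mg f0 g0 fg; rewrite integral_mkcond [leRHS]integral_mkcond.
apply: ge0_le_integral => //.
- by move=> x _; rewrite patchE; case: ifP; rewrite ?lee_fin.
- by apply/(measurable_restrictT _ mD)/measurable_EFinP/measurable_funTS.
- by apply/(measurable_restrictT _ mE)/measurable_EFinP/measurable_funTS.
move=> x _; rewrite !patchE; have [|xD] := boolP (x \in D); last first.
  by case: ifP => _; rewrite lee_fin.
rewrite inE => /fg[[Ex fgx]|fx0].
  by rewrite ifT ?inE// lee_fin.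
by case: ifP => _; rewrite lee_fin// (le_trans fx0).
Qed.

Lemma le_integral2 (D1 E1 D2 E2 : set TR) (G H : TR * TR -> R) :
  measurable D1 -> measurable E1 -> measurable D2 -> measurable E2 ->
  measurable_fun setT G -> measurable_fun setT H -> (forall p, 0 <= G p) -> (forall p, 0 <= H p) ->
  D1 `<=` E1 -> (forall x y, D1 x -> D2 y -> (E2 y /\ G (x, y) <= H (x, y)) \/ G (x, y) <= 0) ->
  (\int[mu]_(x in D1) \int[mu]_(y in D2) (G (x, y))%:E <=
   \int[mu]_(x in E1) \int[mu]_(y in E2) (H (x, y))%:E)%E.
Proof.
move=> mD1 mE1 mD2 mE2 mG mH G0 H0 DE1 GH.
apply: (@le_trans _ _ (\int[mu]_(x in D1) \int[mu]_(y in E2) (H (x, y))%:E)%E).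
  apply: ge0_le_integral => //.
  - by move=> x _; apply: integral_ge0 => y _; rewrite lee_fin.
  - by apply: measurable_funTS; exact: measurable_inner.
  - by apply: measurable_funTS; exact: measurable_inner.
  move=> x Dx; apply: (@le_integral_fin D2 E2 (fun y => G (x, y)) (fun y => H (x, y))) => //.
  + exact: measurable_section.
  + exact: measurable_section.
  + by move=> y Dy; exact: GH.
apply: ge0_subset_integral => //.
- by apply: measurable_funTS; exact: measurable_inner.
- by move=> x _; apply: integral_ge0 => y _; rewrite lee_fin.
Qed.

Lemma integral_itvco (f : TR -> R) (a b : R) : measurable_fun setT f ->
  (\int[mu]_(x in `[a, b[) (f x)%:E = \int[mu]_(x in `[a, b]) (f x)%:E)%E.
Proof. by move=> mf; apply: integral_itv_bndo_bndc; apply/measurable_EFinP/measurable_funTS. Qed.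

Lemma measurable_phi : measurable_fun setT (@phi R).
Proof.
apply: measurableT_comp; last exact: measurable_funB.
by apply: continuous_measurable_fun; exact: sqrt_continuous.
Qed.

Lemma phi_gt0 (x : R) : -1 < x -> x < 1 -> 0 < phi x.
Proof.
move=> x1 x2; rewrite sqrtr_gt0 (_ : 1 - x ^+ 2 = (1 - x) * (1 + x)); last by ring.
by rewrite mulr_gt0//; real_lra.
Qed.

Lemma phi_ge0 (x : R) : 0 <= phi x. Proof. exact: sqrtr_ge0. Qed.

Lemma phiN (x : R) : phi (- x) = phi x. Proof. by rewrite /phi sqrrN. Qed.

Lemma powR_ratio (a M p q : R) : 0 <= a -> 0 <= p -> 0 <= q -> 0 <= M -> p <= M * q ->
  p `^ a <= M `^ a * q `^ a.
Proof.
by move=> a0 p0 q0 M0 pq; rewrite -powRM//; apply: ge0_ler_powR => //; rewrite nnegrE ?mulr_ge0.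
Qed.

Lemma measurable_wjac (a b : R) : measurable_fun setT (wjac a b).
Proof.
apply: measurable_funM; apply: (@measurableT_comp _ _ _ _ _ _ ((@powR R)^~ _)).
- exact: measurable_powR.
- exact: measurable_funB.
- exact: measurable_powR.
- exact: measurable_funD.
Qed.

Lemma wjac_ge0 (a b x : R) : 0 <= wjac a b x.
Proof. by rewrite mulr_ge0 ?powR_ge0. Qed.

Lemma wjac_ratio (a b M z z' : R) : 0 <= a -> 0 <= b -> 0 <= M -> -1 <= z <= 1 -> -1 <= z' <= 1 ->
  1 - z <= M * (1 - z') -> 1 + z <= M * (1 + z') -> wjac a b z <= M `^ a * M `^ b * wjac a b z'.
Proof.
move=> a0 b0 M0 /andP[z1 z2] /andP[z'1 z'2] zz1 zz2; rewrite /wjac mulrACA.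
by apply: ler_pM; rewrite ?powR_ge0//; apply: powR_ratio => //; real_lra.
Qed.

Lemma wjacN (a b x : R) : wjac a b (- x) = wjac b a x.
Proof. by rewrite /wjac opprK mulrC. Qed.

(** After Tonelli's theorem, x is fixed and w = tau phi(x) is an affine substitution with Jacobian
    phi(x) <= N; the condition w2 <= t phi(x) ensures that tau stays below t. *)
Lemma rescaled_integral_le (H G : TR * TR -> R) (w1 w2 t N A B : R) :
  measurable_fun setT H -> measurable_fun setT G -> (forall p, 0 <= H p) -> (forall p, 0 <= G p) ->
  0 <= w1 -> 0 <= N ->
  (forall x, A <= x <= B -> [/\ 0 < phi x, w2 <= t * phi x & phi x <= N]) ->
  (forall x tau, A <= x <= B -> 0 <= tau <= t -> w1 <= tau * phi x <= w2 ->
    H (tau * phi x, x) <= G (tau, x)) ->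
  (\int[mu]_(w in `[w1, w2]) \int[mu]_(x in `[A, B]) (H (w, x))%:E <=
   N%:E * \int[mu]_(tau in `[0%R, t]) \int[mu]_(x in `[A, B]) (G (tau, x))%:E)%E.
Proof.
move=> mH mG H0 G0 w10 N0 phiP HG.
have m12 : measurable (`[w1, w2]%classic : set TR) by exact: measurable_itv.
have mAB : measurable (`[A, B]%classic : set TR) by exact: measurable_itv.
have m0t : measurable (`[0, t]%classic : set TR) by exact: measurable_itv.
pose G' (p : TR * TR) := G (p.2, p.1).
pose H' (p : TR * TR) := H (p.2, p.1).
have mG' : measurable_fun setT G' by apply: measurableT_comp => //; exact: measurable_fun_pair.
have mH' : measurable_fun setT H' by apply: measurableT_comp => //; exact: measurable_fun_pair.
rewrite (tonelli m12 mAB mH H0) (tonelli m0t mAB mG G0).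
rewrite -ge0_integralZl_EFin//; last 2 first.
- by move=> x _; apply: integral_ge0 => y _; rewrite lee_fin.
- by apply: measurable_funTS; exact: (measurable_inner m0t mG' (fun p => G0 (p.2, p.1))).
apply: ge0_le_integral => //.
- by move=> x _; apply: integral_ge0 => y _; rewrite lee_fin.
- by apply: measurable_funTS; exact: (measurable_inner m12 mH' (fun p => H0 (p.2, p.1))).
- by apply: measurable_funTS; apply: measurable_funeM; exact: (measurable_inner m0t mG' (fun p => G0 (p.2, p.1))).
move=> x; rewrite /= in_itv/= => xAB.
have [p0 w2t pN] := phiP _ xAB.
have mHx : measurable_fun setT (fun w : TR => (H (w, x))%:E).
  by apply/measurable_EFinP; exact: measurable_section2.
have := @ge0_integral_affine R (fun w : TR => (H (w, x))%:E) 0 (phi x) (w1 / phi x) (w2 / phi x) p0 mHx.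
rewrite !add0r ![phi x * (_ / _)]mulrC !divfK ?gt_eqF// => <-; last by move=> w; rewrite lee_fin.
have mHx' : measurable_fun setT (fun tau : TR => H (0 + phi x * tau, x)).
  apply: measurableT_comp => //; apply: measurable_fun_pair => //.
  by apply: measurable_funD => //; exact: measurable_funM.
apply: (@le_trans _ _ ((phi x)%:E * \int[mu]_(tau in `[0%R, t]) (G (tau, x))%:E)%E).
  rewrite lee_wpmul2l ?lee_fin ?(ltW p0)//.
  apply: (@le_integral_fin _ _ (fun tau => H (0 + phi x * tau, x)) (fun tau => G (tau, x))) => //.
  - exact: measurable_section2.
  - move=> tau; rewrite /= in_itv/= => /andP[h1 h2].
    have tau0 : 0 <= tau by apply: le_trans h1; rewrite divr_ge0// ltW.
    have taut : tau <= t by apply: (le_trans h2); rewrite ler_pdivrMr.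
    left; split; first by rewrite in_itv/= tau0.
    rewrite add0r [phi x * _]mulrC; apply: HG => //; first by rewrite tau0.
    by rewrite -ler_pdivrMr// h1 -ler_pdivlMr.
rewrite lee_wpmul2r ?lee_fin//.
by apply: integral_ge0 => tau _; rewrite lee_fin.
Qed.

End comparison.

(** * Weighted differences and approximation on one interior window *)

Section local.
Context {R : realType}.
Local Notation mu := (@lebesgue_measure R).
Local Notation TR := (measurableTypeR R).
Implicit Types (Phi F : R -> R).

Definition in_domain k (p : TR * TR) : bool :=
  [&& -1 < p.2, p.2 < 1 & `|p.2| <= 1 - k%:R * p.1 * phi p.2 / 2].

Definition weighted_diff k (a b : R) F (p : TR * TR) : R :=
  Wdelta (k%:R * p.1) a b p.2 * nab k (p.1 * phi p.2) F (p.2 - k%:R * (p.1 * phi p.2) / 2).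

(** The domain of the modulus is encoded as a cut-off of the integrand, which makes it jointly
    measurable in (tau, x) and lets the x-interval vary freely. *)
Definition modulus_integrand Phi k (a b : R) F (p : TR * TR) : R :=
  if in_domain k p then Phi `|weighted_diff k a b F p| else 0.

Lemma measurable_weighted_diff k (a b : R) F : measurable_fun setT F ->
  measurable_fun setT (weighted_diff k a b F).
Proof.
move=> mF.
have mp1 : measurable_fun setT (fst : TR * TR -> TR) by exact: measurable_fst.
have mp2 : measurable_fun setT (snd : TR * TR -> TR) by exact: measurable_snd.
have mphi : measurable_fun setT (fun p : TR * TR => phi (p.2 : R)).
  by apply: measurableT_comp => //; exact: measurable_phi.
apply: measurable_funM.
  apply: measurable_funM; apply: (@measurableT_comp _ _ _ _ _ _ ((@powR R)^~ _));
    try exact: measurable_powR.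
  - apply: measurable_funB; first exact: measurable_funB.
    by apply: measurable_funM => //; apply: measurable_funM => //; exact: measurable_funM.
  - apply: measurable_funB; first exact: measurable_funD.
    by apply: measurable_funM => //; apply: measurable_funM => //; exact: measurable_funM.
apply: measurable_nab => //; first exact: measurable_funM.
apply: measurable_funB => //; apply: measurable_funM => //; apply: measurable_funM => //.
exact: measurable_funM.
Qed.

Lemma measurable_in_domain k : measurable_fun setT (in_domain k).
Proof.
have mp1 : measurable_fun setT (fst : TR * TR -> TR) by exact: measurable_fst.
have mp2 : measurable_fun setT (snd : TR * TR -> TR) by exact: measurable_snd.
have mphi : measurable_fun setT (fun p : TR * TR => phi (p.2 : R)).
  by apply: measurableT_comp => //; exact: measurable_phi.
apply: measurable_and; first exact: measurable_fun_ltr.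
apply: measurable_and; first exact: measurable_fun_ltr.
apply: measurable_fun_ler; first exact: measurableT_comp.
apply: measurable_funB => //; apply: measurable_funM => //; apply: measurable_funM => //.
exact: measurable_funM.
Qed.

Lemma measurable_modulus_integrand Phi k (a b : R) F : convmod Phi -> measurable_fun setT F ->
  measurable_fun setT (modulus_integrand Phi k a b F).
Proof.
move=> PhiP mF; apply: measurable_fun_ifT => //; first exact: measurable_in_domain.
apply: measurableT_comp; first exact: cm_meas.
by apply: measurableT_comp => //; exact: measurable_weighted_diff.
Qed.

Lemma modulus_integrand_ge0 Phi k (a b : R) F p : convmod Phi ->
  0 <= modulus_integrand Phi k a b F p.
Proof. by move=> PhiP; rewrite /modulus_integrand; case: ifP => // _; exact: cm_ge0. Qed.

(** Translation by k w / 2 at fixed w: Whitney's inequality uses forward differences, the moduli use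
    centred ones. *)
Lemma whitney_rhs_centered Phi k F (A B : R) : convmod Phi -> measurable_fun setT F ->
  (whitney_rhs Phi k F A B <= \int[mu]_(w in `[0%R, (B - A)%R]) \int[mu]_(x in `[A, B])
     (if (A <= x - k%:R * w / 2) && (x + k%:R * w / 2 <= B)
      then Phi `|nab k w F (x - k%:R * w / 2)| else 0)%:E)%E.
Proof.
move=> PhiP mF; rewrite /whitney_rhs.
pose G (p : TR * TR) : R := if p.2 + k%:R * p.1 <= B then Phi `|nab k p.1 F p.2| else 0.
pose H (p : TR * TR) : R := if (A <= p.2 - k%:R * p.1 / 2) && (p.2 + k%:R * p.1 / 2 <= B)
      then Phi `|nab k p.1 F (p.2 - k%:R * p.1 / 2)| else 0.
have mp1 : measurable_fun setT (fst : TR * TR -> TR) by exact: measurable_fst.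
have mp2 : measurable_fun setT (snd : TR * TR -> TR) by exact: measurable_snd.
have mk : measurable_fun setT (fun p : TR * TR => k%:R * (p.1 : R) / 2).
  by apply: measurable_funM => //; exact: measurable_funM.
have mG : measurable_fun setT G.
  apply: measurable_fun_ifT => //.
    apply: measurable_fun_ler => //; apply: measurable_funD => //; exact: measurable_funM.
  by apply: measurableT_comp; [exact: cm_meas|apply: measurableT_comp => //; exact: measurable_nab].
have mH : measurable_fun setT H.
  apply: measurable_fun_ifT => //.
    apply: measurable_and; apply: measurable_fun_ler => //; first exact: measurable_funB.
    exact: measurable_funD.
  apply: measurableT_comp; [exact: cm_meas|apply: measurableT_comp => //; apply: measurable_nab => //].
  exact: measurable_funB.
have G0 p : 0 <= G p by rewrite /G; case: ifP => // _; exact: cm_ge0.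
have H0 p : 0 <= H p by rewrite /H; case: ifP => // _; exact: cm_ge0.
apply: (@ge0_le_integral _ _ _ mu `[0%R, (B - A)%R] _ (fun w => \int[mu]_(y in `[A, B]) (G (w, y))%:E)%E
  (fun w => \int[mu]_(x in `[A, B]) (H (w, x))%:E)%E) => //.
- by move=> w _; apply: integral_ge0 => y _; rewrite lee_fin.
- by apply: measurable_funTS; exact: measurable_inner.
- by apply: measurable_funTS; exact: measurable_inner.
move=> w; rewrite /= in_itv/= => /andP[w0 _].
have mHw : measurable_fun setT (fun y : TR => H (w, y)) by exact: measurable_section.
have := @ge0_integral_affine R (fun x : TR => (H (w, x))%:E) (k%:R * w / 2) 1 A B ltr01.
rewrite !mul1e !mul1r => /(_ _ _)/wrap[]; first exact/measurable_EFinP.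
  by move=> x; rewrite lee_fin.
have -> : (\int[mu]_(y in `[A, B]) (H (w, (k%:R * w / 2 + 1 * y)%R))%:E =
    \int[mu]_(y in `[A, B]) (G (w, y))%:E)%E.
  apply: eq_integral => y; rewrite inE/= in_itv/= => /andP[Ay yB]; congr EFin.
  rewrite /H /G /= mul1r addrAC subrr add0r Ay /=.
  by rewrite (_ : k%:R * w / 2 + y + k%:R * w / 2 = y + k%:R * w)//; field.
move=> ->; apply: (@le_integral_fin _ _ _ (fun x => H (w, x)) (fun x => H (w, x))) => //.
move=> x _; rewrite {3}/H /=; case: ifP => [/andP[h1 h2]|]; [left|by right].
split => //; rewrite /= in_itv/=.
have kw : 0 <= k%:R * w / 2 by rewrite divr_ge0// mulr_ge0.
by apply/andP; split; [apply: (le_trans h1); rewrite gerBl|apply: le_trans h2; rewrite lerDl].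
Qed.

End local.

Section local.
Context {R : realType}.
Local Notation mu := (@lebesgue_measure R).
Local Notation TR := (measurableTypeR R).
Implicit Types (Phi F : R -> R).

Definition local_modulus Phi k (a b : R) F (t A B : R) : \bar R :=
  (\int[mu]_(tau in `[0%R, t]) \int[mu]_(x in `[A, B]) (modulus_integrand Phi k a b F (tau, x))%:E)%E.

Lemma local_modulus_ge0 Phi k (a b : R) F (t A B : R) : convmod Phi ->
  (0 <= local_modulus Phi k a b F t A B)%E.
Proof.
move=> PhiP; apply: integral_ge0 => tau _; apply: integral_ge0 => x _.
by rewrite lee_fin modulus_integrand_ge0.
Qed.

Lemma le_local_modulus Phi Phi' k (a b : R) F (t A B A' B' : R) : convmod Phi -> convmod Phi' ->
  measurable_fun setT F -> A' <= A -> B <= B' -> (forall s, 0 <= s -> Phi s <= Phi' s) ->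
  (local_modulus Phi k a b F t A B <= local_modulus Phi' k a b F t A' B')%E.
Proof.
move=> PhiP Phi'P mF A'A BB' le; apply: le_integral2 => //.
- exact: measurable_modulus_integrand.
- exact: measurable_modulus_integrand.
- by move=> p; exact: modulus_integrand_ge0.
- by move=> p; exact: modulus_integrand_ge0.
move=> tau x _; rewrite /= !in_itv/= => /andP[Ax xB]; left; split.
  by rewrite (le_trans A'A)// (le_trans xB).
by rewrite /modulus_integrand; case: ifP => // _; exact: le.
Qed.

Lemma in_domain_interval k (tau x : R) : 0 <= k%:R * (tau * phi x) / 2 ->
  -1 < x - k%:R * (tau * phi x) / 2 -> x + k%:R * (tau * phi x) / 2 <= 1 -> x < 1 ->
  in_domain k (tau, x).
Proof.
rewrite /in_domain /= -!(mulrA k%:R tau) => h0 h1 h2 ->; rewrite ler_norml/=.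
by apply/andP; split; [real_lra|apply/andP; split; real_lra].
Qed.

Lemma WdeltaE (k : nat) (a b tau x : R) : Wdelta (k%:R * tau) a b x =
  (1 - (x + k%:R * (tau * phi x) / 2)) `^ a * (1 + (x - k%:R * (tau * phi x) / 2)) `^ b.
Proof. by rewrite /Wdelta opprD !addrA -!(mulrA k%:R tau). Qed.

Lemma measurable_error Phi (W F : R -> R) (P : {poly R}) (C : R) : convmod Phi ->
  measurable_fun setT W -> measurable_fun setT F ->
  measurable_fun setT (fun x => Phi (W x * `|F x - P.[x]| / C)).
Proof.
move=> PhiP mW mF; apply: measurableT_comp; first exact: cm_meas.
apply: measurable_funM => //; apply: measurable_funM => //; apply: measurableT_comp => //.
by apply: measurable_funB => //; exact: measurable_horner.
Qed.

Lemma powR_ge1 (x c : R) : 1 <= x -> 0 <= c -> 1 <= x `^ c.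
Proof. by move=> x1 c0; rewrite -(powRr0 x); exact: ler_powR. Qed.

(** The weight is nearly constant on [A, B], so Whitney's inequality is applied with a constant
    weight absorbed in the modular; the bounds on t phi then allow w to be replaced by tau
    phi(x). *)
Lemma interior_local k (a b M : R) : (0 < k)%N -> 0 <= a -> 0 <= b -> 1 <= M ->
  exists2 C : R, 1 <= C & forall Phi F (t A B : R), convmod Phi -> measurable_fun setT F ->
  0 < t -> -1 < A -> A < B -> B < 1 -> mu.-integrable `[A, B] (EFin \o F) ->
  (forall z z', A <= z <= B -> A <= z' <= B -> 1 - z <= M * (1 - z') /\ 1 + z <= M * (1 + z')) ->
  (forall z, A <= z <= B -> B - A <= t * phi z) ->
  (forall z, A <= z <= B -> t * phi z <= M * (B - A)) ->
  exists2 P : {poly R}, (size P <= k)%N &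
  (\int[mu]_(x in `[A, B]) (Phi (wjac a b x * `|F x - P.[x]| / C))%:E <=
   (C / t)%:E * local_modulus Phi k a b F t A B)%E.
Proof.
move=> k0 a0 b0 M1; have [Cw Cw1 HW] := @whitney R k k0.
pose Mab := M `^ a * M `^ b.
have M0 : 0 <= M by real_lra.
have Mab1 : 1 <= Mab by rewrite mulr_ege1// powR_ge1.
have MabE : Mab = M `^ a * M `^ b by [].
clearbody Mab.
(* One factor [Mab] compares the weight at x with the weight at A, the other compares the weight at
   A with [Wdelta]; M bounds t phi by the length of the interval. *)
pose C := Cw * M * (Mab * Mab).
have CwM : 1 <= Cw * M by rewrite mulr_ege1.
have C1 : 1 <= C by rewrite mulr_ege1// mulr_ege1.
have CE : C = Cw * M * (Mab * Mab) by [].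
clearbody C.
have C0 : 0 < C by real_lra.
exists C => // Phi F t A B PhiP mF t0 A1 AB B1 Fi ratio len lenM.
pose cJ := wjac a b A / Mab.
have Mab0 : 0 < Mab by real_lra.
have cJ0 : 0 <= cJ by rewrite divr_ge0 ?wjac_ge0// ltW.
have PhiJ : convmod (fun s => Phi (cJ * s)) by exact: cm_scale.
have cJE : Mab * cJ = wjac a b A by rewrite /cJ mulrCA divff ?mulr1 ?gt_eqF.
clearbody cJ.
have [P sP PW] := HW (fun s => Phi (cJ * s)) A B F PhiJ AB mF Fi; exists P => //.
apply: (@le_trans _ _ (\int[mu]_(x in `[A, B]) (Phi (cJ * (`|F x - P.[x]| / Cw)))%:E)%E).
  apply: (@le_integral_fin R _ _ (fun x => Phi (wjac a b x * `|F x - P.[x]| / C))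
     (fun x => Phi (cJ * (`|F x - P.[x]| / Cw)))).
  - exact: measurable_itv.
  - exact: measurable_itv.
  - by apply: measurable_error => //; exact: measurable_wjac.
  - rewrite (_ : (fun x => _) = (fun x => Phi ((cst cJ x) * `|F x - P.[x]| / Cw))); last first.
      by apply/funext => x; rewrite mulrA.
    exact: measurable_error.
  - by move=> x; rewrite cm_ge0// divr_ge0 ?(ltW C0)// mulr_ge0// wjac_ge0.
  - by move=> x; rewrite cm_ge0// mulr_ge0// divr_ge0//; real_lra.
  move=> x; rewrite /= in_itv/= => xAB; left; split => //.
  have vx : wjac a b x <= Mab * (Mab * cJ).
    rewrite cJE MabE.
    have AA : A <= A <= B by rewrite lexx ltW.
    have [r1 r2] := ratio x A xAB AA; case/andP: xAB => h1 h2.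
    by apply: wjac_ratio => //; apply/andP; split; real_lra.
  apply: cm_mono => //.
    by rewrite divr_ge0 ?(ltW C0)// mulr_ge0// wjac_ge0.
  have Cw0 : 0 < Cw by real_lra.
  rewrite mulrA ler_pdivlMr// mulrAC ler_pdivrMr// CE.
  apply: (@le_trans _ _ (Mab * (Mab * cJ) * `|F x - P.[x]| * Cw)).
    by apply: ler_wpM2r; [real_lra|apply: ler_wpM2r].
  rewrite (_ : _ * Cw = cJ * `|F x - P.[x]| * (Cw * (Mab * Mab)) * 1); last by ring.
  rewrite (_ : _ * (Cw * M * _) = cJ * `|F x - P.[x]| * (Cw * (Mab * Mab)) * M); last by ring.
  by apply: ler_wpM2l => //; rewrite !mulr_ge0//; real_lra.
apply: (le_trans PW).
have BA0 : 0 < B - A by real_lra.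
apply: (@le_trans _ _ ((Cw / (B - A))%:E * ((M * (B - A) / t)%:E *
    local_modulus Phi k a b F t A B)))%E; last first.
  rewrite muleA -EFinM lee_wpmul2r ?local_modulus_ge0// lee_fin.
  rewrite (_ : Cw / (B - A) * _ = Cw * M / t); last by field; rewrite !gt_eqF.
  rewrite ler_pM2r ?invr_gt0// CE ler_peMr//; [real_lra|exact: mulr_ege1].
rewrite lee_wpmul2l ?lee_fin ?divr_ge0 ?(ltW BA0)//; first real_lra.
apply: (le_trans (whitney_rhs_centered _ _ _ PhiJ mF)).
pose H (p : TR * TR) : R := if (A <= p.2 - k%:R * p.1 / 2) && (p.2 + k%:R * p.1 / 2 <= B)
      then Phi (cJ * `|nab k p.1 F (p.2 - k%:R * p.1 / 2)|) else 0.
apply: (@rescaled_integral_le R H (modulus_integrand Phi k a b F)).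
- have mp1 : measurable_fun setT (fst : TR * TR -> TR) by exact: measurable_fst.
  have mp2 : measurable_fun setT (snd : TR * TR -> TR) by exact: measurable_snd.
  have mk : measurable_fun setT (fun p : TR * TR => k%:R * (p.1 : R) / 2).
    by apply: measurable_funM => //; exact: measurable_funM.
  apply: measurable_fun_ifT => //.
    apply: measurable_and; apply: measurable_fun_ler => //; first exact: measurable_funB.
    exact: measurable_funD.
  apply: measurableT_comp; [exact: cm_meas|apply: measurable_funM => //].
  by apply: measurableT_comp => //; apply: measurable_nab => //; exact: measurable_funB.
- exact: measurable_modulus_integrand.
- by move=> p; rewrite /H; case: ifP => // _; rewrite cm_ge0// mulr_ge0.
- by move=> p; exact: modulus_integrand_ge0.
- by [].
- by rewrite divr_ge0 ?mulr_ge0//; real_lra.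
- move=> x xAB; split; first by apply: phi_gt0; real_lra.
    exact: len.
  by rewrite ler_pdivlMr// mulrC lenM.
move=> x tau xAB /andP[tau0 _] _; rewrite /H /=.
set w := tau * phi x; case: ifP => [/andP[h1 h2]|_]; last exact: modulus_integrand_ge0.
have kw : 0 <= k%:R * w / 2 by rewrite divr_ge0// mulr_ge0// mulr_ge0// phi_ge0.
rewrite /modulus_integrand in_domain_interval -/w//; [|real_lra|real_lra|real_lra].
apply: cm_mono => //; first by rewrite mulr_ge0.
rewrite /weighted_diff /= normrM -/w ler_wpM2r// WdeltaE -/w.
rewrite ger0_norm ?mulr_ge0 ?powR_ge0//.
rewrite -(ler_pM2l Mab0) cJE MabE /wjac mulrACA.
have AA : A <= A <= B by rewrite lexx ltW.
(* [Wdelta] takes its two factors at different points, the right and left extreme nodes x + k w / 2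
   and x - k w / 2. Both lie in [A, B], so each factor is compared with A separately. *)
have [r1 _] : 1 - A <= M * (1 - (x + k%:R * w / 2)) /\ 1 + A <= M * (1 + (x + k%:R * w / 2)).
  by apply: ratio => //; apply/andP; split => //; real_lra.
have [_ r2] : 1 - A <= M * (1 - (x - k%:R * w / 2)) /\ 1 + A <= M * (1 + (x - k%:R * w / 2)).
  by apply: ratio => //; apply/andP; split => //; real_lra.
by apply: ler_pM; rewrite ?powR_ge0//; apply: powR_ratio => //; real_lra.
Qed.

End local.

(** * The intervals adjacent to the endpoints *)

Section ends.
Context {R : realType}.
Local Notation mu := (@lebesgue_measure R).
Local Notation TR := (measurableTypeR R).
Implicit Types (Phi F : R -> R).

Lemma measurable_error1 Phi (W F : R -> R) (P : {poly R}) : convmod Phi ->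
  measurable_fun setT W -> measurable_fun setT F ->
  measurable_fun setT (fun x => Phi (W x * `|F x - P.[x]|)).
Proof.
move=> PhiP mW mF; rewrite (_ : (fun x => _) = (fun x => Phi (W x * `|F x - P.[x]| / 1))).
  exact: measurable_error.
by apply/funext => x; rewrite divr1.
Qed.

Lemma sqr_phi (x : R) : -1 <= x -> x <= 1 -> phi x ^+ 2 = (1 - x) * (1 + x).
Proof.
move=> x1 x2; have e : 1 - x ^+ 2 = (1 - x) * (1 + x) by ring.
by rewrite /phi sqr_sqrtr e// mulr_ge0//; real_lra.
Qed.

(** At distance about theta from 1, with theta comparable to t^2, phi(x) is comparable to t. Hence t
    phi(x) is comparable to theta, and steps up to 2 theta correspond to tau <= t. *)
Lemma phi_end_bounds (K M t A x th : R) : 1 <= K -> 1 <= M -> 0 < th -> 0 < t -> -1 < A ->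
  A <= x -> K * th / 2 <= 1 - x -> 1 - x <= (1 + K) * th ->
  t ^+ 2 <= M * th -> 8 * th <= t ^+ 2 * (1 + A) ->
  [/\ 0 < phi x, 2 * th <= t * phi x & t * phi x <= 2 * (1 + K) * M * th].
Proof.
move=> K1 M1 th0 t0 A1 Ax x1 x2 tM tA.
have Kth : th <= K * th by rewrite ler_peMl//; real_lra.
have px : 0 < phi x by apply: phi_gt0; real_lra.
have f2 : phi x ^+ 2 = (1 - x) * (1 + x) by apply: sqr_phi; real_lra.
have tp : 0 <= t * phi x by rewrite mulr_ge0// ltW.
have tp2 : (t * phi x) ^+ 2 = (1 - x) * (t ^+ 2 * (1 + x)) by rewrite exprMn f2 mulrCA.
have C1 : 1 <= 2 * (1 + K) * M by rewrite mulr_ege1//; real_lra.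
have C0 : 0 <= 2 * (1 + K) * M * th by rewrite mulr_ge0//; real_lra.
split => //.
  rewrite -ler_sqr ?nnegrE//; last real_lra.
  have -> : (2 * th) ^+ 2 = th / 2 * (8 * th) by field.
  rewrite tp2; apply: ler_pM; [real_lra|real_lra|real_lra|].
  by apply: (le_trans tA); apply: ler_wpM2l; rewrite ?sqr_ge0//; real_lra.
rewrite -ler_sqr ?nnegrE// tp2.
apply: (@le_trans _ _ ((1 + K) * th * (M * th * 2))).
  apply: ler_pM => //; [real_lra|rewrite mulr_ge0 ?sqr_ge0//; real_lra|].
  by apply: ler_pM; rewrite ?sqr_ge0//; real_lra.
rewrite [leLHS](_ : _ = (2 * (1 + K) * M) * th ^+ 2); last by ring.
by rewrite [leRHS]exprMn ler_wpM2r ?sqr_ge0// expr2 ler_peMl//; real_lra.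
Qed.

(** Bounds the difference term produced by [extend_right] at the endpoint 1. In terms of the centre
    x = y - k w / 2 the right node is y and the left one is at least A, so the weight (1 - y)^a (1 +
    A)^b is at most [Wdelta]. The centre stays away from 1 because the step is at least 1 - B. *)
Lemma end_modulus k (a b M : R) Phi F (t A B : R) : (0 < k)%N -> 0 <= a -> 0 <= b -> 1 <= M ->
  convmod Phi -> measurable_fun setT F ->
  0 < t -> -1 < A -> A + 2 * k%:R * (1 - B) <= B -> B < 1 ->
  t ^+ 2 <= M * (1 - B) -> 8 * (1 - B) <= t ^+ 2 * (1 + A) ->
  (\int[mu]_(w in `[(1 - B)%R, (2 * (1 - B))%R]) \int[mu]_(y in `[B, 1%R])
   (Phi ((1 - y) `^ a * (1 + A) `^ b * `|nab k w F (y - k%:R * w)|))%:E <=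
   (2 * (1 + k%:R) * M * (1 - B) / t)%:E * local_modulus Phi k a b F t A 1)%E.
Proof.
move=> k0 a0 b0 M1 PhiP mF t0 A1 AB B1 tM thA.
have k1 : 1 <= k%:R :> R by rewrite ler1n.
have C'0 : 0 <= 2 * (1 + k%:R) * M by rewrite !mulr_ge0//; real_lra.
set C' := 2 * (1 + k%:R) * M in C'0 *.
have [th thE] : exists th, th = 1 - B by exists (1 - B).
rewrite -thE in AB tM thA *; have th0 : 0 < th by rewrite thE; real_lra.
have Cth : 0 <= C' * th / t by apply: divr_ge0; [apply: mulr_ge0|]; rewrite ?C'0 ?(ltW th0) ?(ltW t0).
have kth : k%:R * th >= th by rewrite ler_peMl//; real_lra.
pose W (y : R) : R := (1 - y) `^ a * (1 + A) `^ b.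
have W0 y : 0 <= W y by rewrite mulr_ge0 ?powR_ge0.
have mW : measurable_fun setT W.
  apply: measurable_funM => //; apply: (@measurableT_comp _ _ _ _ _ _ ((@powR R)^~ _)).
    exact: measurable_powR.
  exact: measurable_funB.
have Bk : A + 2 * k%:R * th <= B by [].
pose G (p : TR * TR) : R := Phi (W p.2 * `|nab k p.1 F (p.2 - k%:R * p.1)|).
pose H (p : TR * TR) : R := if (B <= p.2 + k%:R * p.1 / 2) && (p.2 + k%:R * p.1 / 2 <= 1)
   then if p.1 <= 2 * th then Phi (W (p.2 + k%:R * p.1 / 2) * `|nab k p.1 F (p.2 - k%:R * p.1 / 2)|) else 0 else 0.
have mp1 : measurable_fun setT (fst : TR * TR -> TR) by exact: measurable_fst.
have mp2 : measurable_fun setT (snd : TR * TR -> TR) by exact: measurable_snd.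
have mk1 : measurable_fun setT (fun p : TR * TR => k%:R * (p.1 : R)) by exact: measurable_funM.
have mk : measurable_fun setT (fun p : TR * TR => k%:R * (p.1 : R) / 2) by exact: measurable_funM.
have mpk : measurable_fun setT (fun p : TR * TR => (p.2 : R) + k%:R * (p.1 : R) / 2).
  exact: measurable_funD.
have mG : measurable_fun setT G.
  apply: measurableT_comp; [exact: cm_meas|apply: measurable_funM].
    exact: measurableT_comp.
  by apply: measurableT_comp => //; apply: measurable_nab => //; exact: measurable_funB.
have mH : measurable_fun setT H.
  apply: measurable_fun_ifT => //.
    by apply: measurable_and; exact: measurable_fun_ler.
  apply: measurable_fun_ifT => //; first exact: measurable_fun_ler.
  apply: measurableT_comp; [exact: cm_meas|apply: measurable_funM].
    exact: measurableT_comp.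
  by apply: measurableT_comp => //; apply: measurable_nab => //; exact: measurable_funB.
have G0 p : 0 <= G p by rewrite cm_ge0// mulr_ge0.
have H0 p : 0 <= H p.
  by rewrite /H; case: ifP => // _; case: ifP => // _; rewrite cm_ge0// mulr_ge0.
apply: (@le_trans _ _ (\int[mu]_(w in `[th, (2 * th)%R])
   \int[mu]_(x in `[(B - k%:R * th)%R, (1 - k%:R * th / 2)%R]) (H (w, x))%:E)%E).
  apply: (@ge0_le_integral _ _ _ mu `[th, (2 * th)%R] _ (fun w => \int[mu]_(y in `[B, 1%R]) (G (w, y))%:E)%E
    (fun w => \int[mu]_(x in `[(B - k%:R * th)%R, (1 - k%:R * th / 2)%R]) (H (w, x))%:E)%E) => //.
  - by move=> w _; apply: integral_ge0 => y _; rewrite lee_fin.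
  - by apply: measurable_funTS; exact: measurable_inner.
  - by apply: measurable_funTS; exact: measurable_inner.
  move=> w; rewrite /= in_itv/= => /andP[w1 w2].
  have mGw : measurable_fun setT (fun y : TR => G (w, y)) by exact: measurable_section.
  have := @ge0_integral_affine R (fun x : TR => (G (w, x))%:E) (k%:R * w / 2) 1
     (B - k%:R * w / 2) (1 - k%:R * w / 2) ltr01.
  rewrite mul1e !mul1r !subrKC => /(_ _ _)/wrap[]; first exact/measurable_EFinP.
    by move=> x; rewrite lee_fin.
  move=> <-.
  have mGw' : measurable_fun setT (fun x : TR => G (w, k%:R * w / 2 + 1 * x)).
    apply: (@measurableT_comp _ _ _ _ _ _ (fun y : TR => G (w, y))) => //.
    by apply: measurable_funD => //; exact: measurable_funM.
  apply: (@le_integral_fin R _ _ (fun x => G (w, k%:R * w / 2 + 1 * x)) (fun x => H (w, x))) => //.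
    exact: measurable_section.
  have kw1 : k%:R * th <= k%:R * w by rewrite ler_wpM2l.
  have kw2 : k%:R * w <= k%:R * (2 * th) by rewrite ler_wpM2l.
  move=> x; rewrite /= !in_itv/= mul1r => /andP[h1 h2]; left; split.
    by apply/andP; split; real_lra.
  rewrite /H /= w2 ifT; last by apply/andP; split; real_lra.
  rewrite /G /= [k%:R * w / 2 + x]addrC (_ : x + k%:R * w / 2 - k%:R * w = x - k%:R * w / 2)//.
  by field.
have MK := measurable_modulus_integrand k a b PhiP mF.
have := @rescaled_integral_le R H (modulus_integrand Phi k a b F) th (2 * th) t (C' * th / t)
  (B - k%:R * th) (1 - k%:R * th / 2) mH MK H0 (fun p => modulus_integrand_ge0 k a b F p PhiP) (ltW th0).
move=> /(_ _ _ _)/wrap[].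
- exact: Cth.
- move=> x /andP[x1 x2].
  have [|||p0 p1 p2] := @phi_end_bounds k%:R M t A x th k1 M1 th0 t0 A1 _ _ _ tM thA.
  + by clear - x1 Bk th0 kth; real_lra.
  + by clear - x2; real_lra.
  + by clear - x1 thE; real_lra.
  by split => //; rewrite ler_pdivlMr// mulrC.
- move=> x tau /andP[x1 x2] /andP[tau0 _] _; rewrite /H /=.
  set w := tau * phi x; case: ifP => [/andP[h1 h2]|_]; last exact: modulus_integrand_ge0.
  case: ifP => [w2|_]; last exact: modulus_integrand_ge0.
  have kw : 0 <= k%:R * w / 2 by rewrite divr_ge0// mulr_ge0// mulr_ge0// phi_ge0.
  have kw2 : k%:R * w <= k%:R * (2 * th) by rewrite ler_wpM2l.
  rewrite /modulus_integrand in_domain_interval -/w//; [|real_lra|real_lra].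
  apply: cm_mono => //; first by rewrite mulr_ge0.
  rewrite /weighted_diff /= normrM -/w ler_wpM2r// WdeltaE -/w.
  rewrite ger0_norm ?mulr_ge0 ?powR_ge0// /W ler_wpM2l ?powR_ge0//.
  by apply: ge0_ler_powR => //; rewrite ?nnegrE; real_lra.
move=> h; apply: (le_trans h); clear h; apply: lee_wpmul2l; first by rewrite lee_fin; exact: Cth.
by apply: le_local_modulus => //; clear - Bk kth th0; real_lra.
Qed.

(** [extend_right] requires a nonincreasing weight, so the factor (1 + x)^b is frozen at A in W.
    Since 1 + x <= 2 <= 2 M (1 + A), this costs only the constant (2 M)^b. *)
Lemma end_right k (a b M : R) : (0 < k)%N -> 0 <= a -> 0 <= b -> 1 <= M ->
  exists2 C : R, 1 <= C & forall Phi F (P : {poly R}) (t A B : R), convmod Phi ->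
  measurable_fun setT F -> (size P <= k)%N ->
  0 < t -> -1 < A -> A + 2 * k%:R * (1 - B) <= B -> B < 1 ->
  t ^+ 2 <= M * (1 - B) -> 8 * (1 - B) <= t ^+ 2 * (1 + A) -> 1 <= M * (1 + A) ->
  (\int[mu]_(x in `[B, 1%R]) (Phi (wjac a b x * `|F x - P.[x]| / C))%:E <=
   (C / t)%:E * local_modulus Phi k a b F t A 1 +
   C%:E * \int[mu]_(x in `[A, B]) (Phi (wjac a b x * `|F x - P.[x]|))%:E)%E.
Proof.
move=> k0 a0 b0 M1.
have k1 : 1 <= k%:R :> R by rewrite ler1n.
pose c1 : R := k.+1%:R * 2 ^+ k.
have c11 : 1 <= c1 by rewrite /c1 mulr_ege1 ?ler1n// exprn_ege1// ler1n.
have M2 : 1 <= (2 * M) `^ b by apply: powR_ge1 => //; real_lra.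
pose C' := 2 * (1 + k%:R) * M.
have C'1 : 1 <= C' by rewrite /C' mulr_ege1//; real_lra.
have Mc : 1 <= (2 * M) `^ b * c1 by rewrite mulr_ege1.
pose C := (2 * M) `^ b * c1 + C' + k%:R.
exists C => [|Phi F P t A B PhiP mF sP t0 A1 AB B1 tM thA MA]; first by rewrite /C; real_lra.
pose th := 1 - B; have th0 : 0 < th by rewrite /th; real_lra.
pose W (y : R) : R := (1 - y) `^ a * (1 + A) `^ b.
have W0 y : 0 <= W y by rewrite mulr_ge0 ?powR_ge0.
have mW : measurable_fun setT W.
  apply: measurable_funM => //; apply: (@measurableT_comp _ _ _ _ _ _ ((@powR R)^~ _)).
    exact: measurable_powR.
  exact: measurable_funB.
have Wmono y z : A <= z -> z <= y -> y <= 1 -> W y <= W z.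
  move=> Az zy y1; rewrite ler_wpM2r ?powR_ge0//; apply: ge0_ler_powR => //; rewrite ?nnegrE; real_lra.
have kth : k%:R * th >= th by rewrite ler_peMl//; real_lra.
have Bk : A + 2 * k%:R * th <= B by [].
have c10 : 0 < c1 by real_lra.
pose I1 := (\int[mu]_(y in `[B, 1%R]) (Phi (W y * `|F y - P.[y]| / c1))%:E)%E.
pose I2 := (\int[mu]_(w in `[th, (2 * th)%R]) \int[mu]_(y in `[B, 1%R])
   (Phi (W y * `|nab k w F (y - k%:R * w)|))%:E)%E.
pose I3 := (\int[mu]_(x in `[A, B]) (Phi (W x * `|F x - P.[x]|))%:E)%E.
have ext : (th%:E * I1 <= I2 + (k%:R * th)%:E * I3)%E.
  exact: (@extend_right R Phi k A B 1 W F P PhiP B1 Bk mF mW W0 Wmono sP).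
have I10 : (0 <= I1)%E.
  by apply: integral_ge0 => y _; rewrite lee_fin cm_ge0// divr_ge0 ?(ltW c10)// mulr_ge0.
have I30 : (0 <= I3)%E by apply: integral_ge0 => y _; rewrite lee_fin cm_ge0// mulr_ge0.
have I2le : (I2 <= (C' * th / t)%:E * local_modulus Phi k a b F t A 1)%E.
  exact: end_modulus.
have I1le : (I1 <= (C' / t)%:E * local_modulus Phi k a b F t A 1 + k%:R%:E * I3)%E.
  have thV : (th^-1%:E * th%:E = 1)%E by rewrite -EFinM mulVf// gt_eqF.
  rewrite -[leLHS]mul1e -thV -muleA.
  apply: (@le_trans _ _ (th^-1%:E * ((C' * th / t)%:E * local_modulus Phi k a b F t A 1 +
      (k%:R * th)%:E * I3))%E).
    rewrite lee_wpmul2l ?lee_fin ?invr_ge0 ?(ltW th0)//.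
    by apply: (le_trans ext); rewrite leeD2r.
  rewrite ge0_muleDr; last 2 first.
  - by apply: mule_ge0; rewrite ?local_modulus_ge0// lee_fin divr_ge0 ?(ltW t0)// mulr_ge0 ?(ltW th0)//; real_lra.
  - by apply: mule_ge0; rewrite ?lee_fin// mulr_ge0 ?(ltW th0).
  rewrite !muleA -!EFinM (_ : th^-1 * (C' * th / t) = C' / t); last by field; rewrite !gt_eqF.
  by rewrite (_ : th^-1 * (k%:R * th) = k%:R)//; field; rewrite gt_eqF.
have C0 : 0 < C by rewrite /C; real_lra.
apply: (@le_trans _ _ I1).
  apply: (@le_integral_fin R _ _ (fun x => Phi (wjac a b x * `|F x - P.[x]| / C))
     (fun x => Phi (W x * `|F x - P.[x]| / c1))).
  - exact: measurable_itv.
  - exact: measurable_itv.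
  - by apply: measurable_error => //; exact: measurable_wjac.
  - exact: measurable_error.
  - by move=> x; rewrite cm_ge0// divr_ge0 ?(ltW C0)// mulr_ge0// wjac_ge0.
  - by move=> x; rewrite cm_ge0// divr_ge0 ?(ltW c10)// mulr_ge0.
  move=> x; rewrite /= in_itv/= => /andP[Bx x1]; left; split; first by rewrite Bx.
  apply: cm_mono => //; first by rewrite divr_ge0 ?(ltW C0)// mulr_ge0// wjac_ge0.
  rewrite ler_pdivlMr; last real_lra.
  rewrite mulrAC ler_pdivrMr//.
  have vW : wjac a b x <= (2 * M) `^ b * W x.
    rewrite /W mulrCA; apply: ler_wpM2l; first exact: powR_ge0.
    by apply: powR_ratio => //; real_lra.
  rewrite -[leRHS]mulrA mulrAC [leRHS]mulrCA [leRHS]mulrC; apply: ler_wpM2r => //.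
  apply: (@le_trans _ _ ((2 * M) `^ b * W x * c1)); first by rewrite ler_wpM2r//; real_lra.
  rewrite mulrAC mulrC ler_wpM2l// /C; real_lra.
apply: (le_trans I1le); apply: leeD.
  rewrite lee_wpmul2r ?local_modulus_ge0// lee_fin ler_pM2r ?invr_gt0// /C; real_lra.
have kC : k%:R <= C by clear - Mc C'1; rewrite /C; real_lra.
clear I1le I2le I10; apply: lee_pmul.
- by rewrite lee_fin.
- exact: I30.
- by rewrite lee_fin.
apply: (@le_integral_fin R _ _ (fun x => Phi (W x * `|F x - P.[x]|))
     (fun x => Phi (wjac a b x * `|F x - P.[x]|))).
- exact: measurable_itv.
- exact: measurable_itv.
- exact: measurable_error1.
- by apply: measurable_error1 => //; exact: measurable_wjac.
- by move=> x; rewrite cm_ge0// mulr_ge0.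
- by move=> x; rewrite cm_ge0// mulr_ge0// wjac_ge0.
move=> x; rewrite /= in_itv/= => /andP[Ax xB]; left; split; first by rewrite Ax.
apply: cm_mono => //; first by rewrite mulr_ge0.
rewrite ler_wpM2r// /W /wjac ler_wpM2l ?powR_ge0//.
by apply: ge0_ler_powR => //; rewrite ?nnegrE; real_lra.
Qed.

End ends.

Section ends.
Context {R : realType}.
Local Notation mu := (@lebesgue_measure R).
Local Notation TR := (measurableTypeR R).
Implicit Types (Phi F : R -> R).

Lemma measurable_oppR : measurable_fun setT (fun y : R => - y).
Proof. by apply: continuous_measurable_fun; exact: opp_continuous. Qed.

Lemma ge0_integral_reflect (f : TR -> R) (c d : R) : measurable_fun setT f -> (forall x, 0 <= f x) ->
  (\int[mu]_(x in `[c, d]) (f (- x))%:E <= \int[mu]_(x in `[(- d)%R, (- c)%R]) (f x)%:E)%E.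
Proof.
move=> mf f0; rewrite -[leLHS]mul1e.
apply: (@ge0_integral_expansion R `[c, d] (fun x : TR => - x) 1 `[(- d)%R, (- c)%R] (fun x => (f x)%:E)) => //.
- exact: measurable_oppR.
- by move=> x y _ _; rewrite mul1r -opprD normrN.
- by move=> x; rewrite /= !in_itv/= !lerN2 andbC.
- exact/measurable_EFinP.
Qed.

Lemma nab_reflect k (w : R) F x : `|nab k w (fun y => F (- y)) x| = `|nab k w F (- x - k%:R * w)|.
Proof.
suff -> : nab k w (fun y => F (- y)) x = (-1) ^+ k * nab k w F (- x - k%:R * w).
  by rewrite normrM normrX normrN1 expr1n mul1r.
rewrite /nab mulr_sumr (reindex_inj rev_ord_inj)/=; apply: eq_bigr => i _.
have ik : (i <= k)%N by rewrite -ltnS.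
have e (j : nat) : (j <= k)%N -> (-1) ^+ (k - j) * (-1) ^+ k = (-1) ^+ j :> R.
  by move=> jk; rewrite -{2}(subnK jk) exprD mulrA -exprD addnn -signr_odd odd_double mul1r.
rewrite subSS bin_sub// subKn// mulrCA -(e _ ik) !mulrA.
by congr (_ * F _); rewrite natrB//; ring.
Qed.

Lemma modulus_integrand_reflect Phi k (a b : R) F (tau x : R) :
  modulus_integrand Phi k b a (fun y => F (- y)) (tau, x) = modulus_integrand Phi k a b F (tau, - x).
Proof.
rewrite /modulus_integrand /in_domain /= normrN phiN.
rewrite (_ : (-1 < - x) = (x < 1)); last by rewrite ltrN2.
rewrite (_ : (- x < 1) = (-1 < x)); last by rewrite ltrNl.
rewrite andbCA; case: ifP => // _; congr Phi.
rewrite /weighted_diff /= !normrM nab_reflect phiN; congr (_ * `|nab _ _ _ _|).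
  by rewrite opprK mulrC.
by field.
Qed.

Lemma local_modulus_reflect Phi k (a b : R) F (t c d : R) : convmod Phi -> measurable_fun setT F ->
  (local_modulus Phi k b a (fun y : R => F (- y)%R) t c d <= local_modulus Phi k a b F t (- d) (- c))%E.
Proof.
move=> PhiP mF.
have mF' : measurable_fun setT (fun y : R => F (- y)).
  by apply: measurableT_comp => //; exact: measurable_oppR.
apply: (@ge0_le_integral _ _ _ mu `[0%R, t] _
   (fun tau => \int[mu]_(x in `[c, d]) (modulus_integrand Phi k b a (fun y : R => F (- y)%R) (tau, x))%:E)%E
   (fun tau => \int[mu]_(x in `[(- d)%R, (- c)%R]) (modulus_integrand Phi k a b F (tau, x))%:E)%E) => //.
- by move=> x _; apply: integral_ge0 => y _; rewrite lee_fin modulus_integrand_ge0.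
- apply: measurable_funTS; apply: measurable_inner => //; first exact: measurable_modulus_integrand.
  by move=> p; exact: modulus_integrand_ge0.
- apply: measurable_funTS; apply: measurable_inner => //; first exact: measurable_modulus_integrand.
  by move=> p; exact: modulus_integrand_ge0.
move=> tau _; under eq_integral do rewrite modulus_integrand_reflect.
apply: (@ge0_integral_reflect (fun x => modulus_integrand Phi k a b F (tau, x))).
  by apply: measurable_section; exact: measurable_modulus_integrand.
by move=> x; exact: modulus_integrand_ge0.
Qed.

(** Reflection x -> -x of [end_right]; it exchanges the exponents a and b. *)
Lemma end_left k (a b M : R) : (0 < k)%N -> 0 <= a -> 0 <= b -> 1 <= M ->
  exists2 C : R, 1 <= C & forall Phi F (P : {poly R}) (t A B : R), convmod Phi ->
  measurable_fun setT F -> (size P <= k)%N ->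
  0 < t -> B < 1 -> A + 2 * k%:R * (1 + A) <= B -> -1 < A ->
  t ^+ 2 <= M * (1 + A) -> 8 * (1 + A) <= t ^+ 2 * (1 - B) -> 1 <= M * (1 - B) ->
  (\int[mu]_(x in `[(-1)%R, A]) (Phi (wjac a b x * `|F x - P.[x]| / C))%:E <=
   (C / t)%:E * local_modulus Phi k a b F t (-1) B +
   C%:E * \int[mu]_(x in `[A, B]) (Phi (wjac a b x * `|F x - P.[x]|))%:E)%E.
Proof.
move=> k0 a0 b0 M1; have [C C1 HC] := @end_right R k b a M k0 b0 a0 M1.
exists C => // Phi F P t A B PhiP mF sP t0 B1 AB A1 tM tA MA.
have mF' : measurable_fun setT (fun y : R => F (- y)).
  by apply: measurableT_comp => //; exact: measurable_oppR.
have C0 : 0 < C by real_lra.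
pose P' := P \Po (- 'X).
have P'E x : P'.[x] = P.[- x] by rewrite horner_comp !hornerE.
have sP' : (size P' <= k)%N.
  rewrite (leq_trans (size_comp_poly_leq _ _))// size_polyN size_polyX /= muln1.
  by case: (size P) sP.
have := HC Phi (fun y => F (- y)) P' t (- B) (- A) PhiP mF' sP' t0.
rewrite !opprK => /(_ _ _ _ tM tA MA)/wrap[]; [real_lra|real_lra|real_lra|] => H.
have e0 x : 0 <= Phi (wjac a b x * `|F x - P.[x]|) by rewrite cm_ge0// mulr_ge0// wjac_ge0.
have eC0 x : 0 <= Phi (wjac a b x * `|F x - P.[x]| / C).
  by rewrite cm_ge0// divr_ge0 ?(ltW C0)// mulr_ge0// wjac_ge0.
have me : measurable_fun setT (fun x => Phi (wjac a b x * `|F x - P.[x]|)).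
  by apply: measurable_error1 => //; exact: measurable_wjac.
have meC : measurable_fun setT (fun x => Phi (wjac a b x * `|F x - P.[x]| / C)).
  by apply: measurable_error => //; exact: measurable_wjac.
have step1 : (\int[mu]_(x in `[(-1)%R, A]) (Phi (wjac a b x * `|F x - P.[x]| / C))%:E <=
    \int[mu]_(x in `[(- A)%R, 1%R]) (Phi (wjac b a x * `|F (- x) - P'.[x]| / C))%:E)%E.
  have mg : measurable_fun setT (fun x : TR => Phi (wjac b a x * `|F (- x) - P'.[x]| / C)).
    by apply: (@measurable_error R Phi (wjac b a) (fun y => F (- y))) => //; exact: measurable_wjac.
  have g0 (x : TR) : 0 <= Phi (wjac b a x * `|F (- x) - P'.[x]| / C).
    by rewrite cm_ge0// divr_ge0 ?(ltW C0)// mulr_ge0// wjac_ge0.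
  have := @ge0_integral_reflect _ (-1) A mg g0.
  rewrite opprK; apply: le_trans; rewrite le_eqVlt; apply/orP; left; apply/eqP.
  by apply: eq_integral => x _; rewrite wjacN P'E !opprK.
apply: (le_trans step1); apply: (le_trans H); apply: leeD.
  apply: lee_wpmul2l; first by rewrite lee_fin divr_ge0// ltW.
  have := @local_modulus_reflect Phi k a b F t (- B) 1 PhiP mF.
  by rewrite opprK.
apply: lee_wpmul2l; first by rewrite lee_fin ltW.
have := @ge0_integral_reflect _ (- B) (- A) me e0.
rewrite !opprK; apply: le_trans; rewrite le_eqVlt; apply/orP; left; apply/eqP.
by apply: eq_integral => x _; rewrite wjacN P'E.
Qed.

Lemma scale_EFinD (x y : R) (T : \bar R) : 0 <= x -> 0 <= y ->
  (x%:E * T + y%:E * T = (x + y)%:E * T)%E.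
Proof. by move=> x0 y0; rewrite EFinD ge0_muleDl ?lee_fin. Qed.

(** The first and last nodes are replaced by -1 and 1, so that the end intervals [-1, y 0] and
    [y m, 1] belong to the extreme cells. *)
Definition cell_end (m : nat) (y : nat -> R) i : R :=
  if i == 0%N then -1 else if (m <= i)%N then 1 else y i.

(** The polynomial is found on the inner window [y i, y i.+2]; when the window touches an end, the
    same polynomial is shown to work up to the endpoint. For m = 2 a single window touches both
    ends. *)
Lemma local_approximation k (a b M : R) : (0 < k)%N -> 0 <= a -> 0 <= b -> 1 <= M ->
  exists2 C : R, 1 <= C & forall Phi F (t : R) m y, convmod Phi -> measurable_fun setT F ->
  0 < t -> (forall c d, -1 < c -> d < 1 -> mu.-integrable `[c, d] (EFin \o F)) ->
  adapted_nodes k M t m y ->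
  forall i, (i.+2 <= m)%N -> exists2 P : {poly R}, (size P <= k)%N &
  (\int[mu]_(x in `[cell_end m y i, cell_end m y i.+2])
      (Phi (wjac a b x * `|F x - P.[x]| / C))%:E <=
   (C / t)%:E * local_modulus Phi k a b F t (cell_end m y i) (cell_end m y i.+2))%E.
Proof.
move=> k0 a0 b0 M1.
have [Ci Ci1 Hi] := @interior_local R k a b M k0 a0 b0 M1.
have [Cr Cr1 Hr] := @end_right R k a b M k0 a0 b0 M1.
have [Cl Cl1 Hl] := @end_left k a b M k0 a0 b0 M1.
pose C := 3 * (Ci * Cr * Cl + Ci + Cr + Cl).
have Cir : 1 <= Ci * Cr by rewrite mulr_ege1.
have Cil : 1 <= Ci * Cl by rewrite mulr_ege1.
have Cirl : 1 <= Ci * Cr * Cl by rewrite mulr_ege1.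
have C1 : 1 <= C by rewrite /C; real_lra.
have CCi : Ci <= C by rewrite /C; real_lra.
have lCiCr : Ci * Cr <= Ci * Cr * Cl by rewrite ler_peMr//; real_lra.
have lCiCl : Ci * Cl <= Ci * Cr * Cl by rewrite mulrAC ler_peMr//; real_lra.
have CCir : Ci * Cr <= C by rewrite /C; real_lra.
have CCil : Ci * Cl <= C by rewrite /C; real_lra.
have Csum : Cl + Cl * Ci + (Ci + (Cr + Cr * Ci)) <= C.
  by rewrite [Cl * Ci]mulrC [Cr * Ci]mulrC /C; real_lra.
have Ci0 : 0 < Ci by real_lra.
have Cl0 : 0 < Cl by real_lra.
have Cr0 : 0 < Cr by real_lra.
have Cll : 0 < Cl + Cl * Ci by rewrite addr_gt0// mulr_gt0.
have Crr : 0 < Cr + Cr * Ci by rewrite addr_gt0// mulr_gt0.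
have Cil0 : 0 < Ci * Cl by rewrite mulr_gt0.
have Cir0 : 0 < Ci * Cr by rewrite mulr_gt0.
have C0 : 0 < C by real_lra.
clearbody C.
exists C => // Phi F t m y PhiP mF t0 Fi [m2 ylt y0 ym ratio len phil gap endge endle prev sym] i im.
have ymono i1 i2 : (i1 <= i2)%N -> (i2 <= m)%N -> y i1 <= y i2.
  move=> /subnK <-; elim: (i2 - i1)%N => [//|j IH] jm.
  by rewrite addSn (le_trans (IH _)) ?ltW ?ylt// ltnW.
have yl j : (j <= m)%N -> -1 < y j by move=> jm; apply: (lt_le_trans y0); exact: ymono.
have yr j : (j <= m)%N -> y j < 1 by move=> jm; apply: le_lt_trans ym; exact: ymono.
have im1 : (i.+1 < m)%N by [].
have yi : y i < y i.+2 by apply: (lt_trans (ylt _ (ltnW im1))); exact: ylt.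
set z := cell_end m y i; set z2 := cell_end m y i.+2.
have zi : z <= y i.
  by rewrite /z /cell_end; case: eqP => [_|_]; [rewrite ltW// yl// ltnW// ltnW|rewrite leqNgt ltnW].
have zi2 : y i.+2 <= z2.
  by rewrite /z2 /cell_end /=; case: ifP => // _; rewrite ltW// yr.
have phil' z0 : y i <= z0 <= y i.+2 -> t * phi z0 <= M * (y i.+2 - y i).
  move=> /andP[h1 h2]; have [zi1|iz1] := leP z0 (y i.+1).
    apply: (@le_trans _ _ (M * (y i.+1 - y i))).
      by apply: phil; [exact: ltnW|rewrite zi1 h1].
    by rewrite ler_wpM2l//; [real_lra|rewrite lerD2r ltW// ylt].
  apply: (@le_trans _ _ (M * (y i.+2 - y i.+1))).
    by apply: phil => //; rewrite (ltW iz1).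
  by rewrite ler_wpM2l//; [real_lra|rewrite lerD2l lerN2 ltW// ylt// ltnW].
have [P sP HP] := Hi Phi F t (y i) (y i.+2) PhiP mF t0 (yl i (ltnW (ltnW im))) yi (yr _ im)
  (Fi _ _ (yl i (ltnW (ltnW im))) (yr _ im)) (fun z z' => @ratio i z z' im) (fun z => @len i z im) phil'.
exists P; first exact: sP.
clear Hi.
(* The inner window controls the error only after division by Ci, so the end estimates are applied
   to the correspondingly scaled modular. *)
have Phi'P : convmod (fun s => Phi (Ci^-1 * s)) by apply: cm_scale => //; rewrite invr_ge0 ltW.
have Phi'le s : 0 <= s -> Phi (Ci^-1 * s) <= Phi s.
  move=> s0; apply: cm_mono => //; first by rewrite mulr_ge0// invr_ge0 ltW.
  by rewrite ler_piMl// invf_le1.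
set T := local_modulus Phi k a b F t z z2.
have T0 : (0 <= T)%E by exact: local_modulus_ge0.
have eC0 x : 0 <= Phi (wjac a b x * `|F x - P.[x]| / C).
  by rewrite cm_ge0// divr_ge0 ?(ltW C0)// mulr_ge0// wjac_ge0.
have meC : measurable_fun setT (fun x => Phi (wjac a b x * `|F x - P.[x]| / C)).
  by apply: measurable_error => //; exact: measurable_wjac.
have eleC D (c d : R) : 0 < D -> D <= C ->
    (\int[mu]_(x in `[c, d]) (Phi (wjac a b x * `|F x - P.[x]| / C))%:E <=
     \int[mu]_(x in `[c, d]) (Phi (wjac a b x * `|F x - P.[x]| / D))%:E)%E.
  move=> D0 DC; apply: (@le_integral_fin R _ _ (fun x => Phi (wjac a b x * `|F x - P.[x]| / C))
     (fun x => Phi (wjac a b x * `|F x - P.[x]| / D))) => //.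
  - by apply: measurable_error => //; exact: measurable_wjac.
  - by move=> x; rewrite cm_ge0// divr_ge0 ?(ltW D0)// mulr_ge0// wjac_ge0.
  move=> x xcd; left; split => //; apply: cm_mono => //.
    by rewrite divr_ge0 ?(ltW C0)// mulr_ge0// wjac_ge0.
  by rewrite ler_wpM2l ?lef_pV2// mulr_ge0// wjac_ge0.
have midle : (\int[mu]_(x in `[y i, y i.+2]) (Phi (wjac a b x * `|F x - P.[x]| / Ci))%:E <=
    (Ci / t)%:E * T)%E.
  apply: (le_trans HP); apply: lee_wpmul2l; first by rewrite lee_fin divr_ge0// ltW.
  exact: le_local_modulus.
have midE : (\int[mu]_(x in `[y i, y i.+2]) (Phi (Ci^-1 * (wjac a b x * `|F x - P.[x]|)))%:E =
    \int[mu]_(x in `[y i, y i.+2]) (Phi (wjac a b x * `|F x - P.[x]| / Ci))%:E)%E.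
  by apply: eq_integral => x _; rewrite mulrC.
have endE D (c d : R) : (\int[mu]_(x in `[c, d]) (Phi (Ci^-1 * (wjac a b x * `|F x - P.[x]| / D)))%:E =
    \int[mu]_(x in `[c, d]) (Phi (wjac a b x * `|F x - P.[x]| / (Ci * D)))%:E)%E.
  by apply: eq_integral => x _; congr EFin; congr Phi; rewrite invfM; ring.
have endle' D : 0 < D -> ((D / t)%:E * T + D%:E * ((Ci / t)%:E * T) = ((D + D * Ci) / t)%:E * T)%E.
  move=> D0; rewrite muleA -EFinM scale_EFinD; first by rewrite mulrDl mulrA.
    by rewrite divr_ge0// ltW.
  by rewrite mulr_ge0 ?divr_ge0// ltW.
have sing c : (\int[mu]_(x in `[c, c]) (Phi (wjac a b x * `|F x - P.[x]| / C))%:E = 0)%E.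
  by rewrite set_itv1 integral_set1.
have leftle : (\int[mu]_(x in `[z, y i]) (Phi (wjac a b x * `|F x - P.[x]| / C))%:E <=
    ((Cl + Cl * Ci) / t)%:E * T)%E.
  have [i0|i0] := eqVneq i 0%N; last first.
    have -> : z = y i by rewrite /z /cell_end (negbTE i0) leqNgt (ltnW im1).
    by rewrite sing; apply: mule_ge0 => //; rewrite lee_fin divr_ge0 ?(ltW t0)// ltW.
  have y0E : y 0%N = - y m by have := sym 0%N isT; rewrite subn0 => ->; rewrite opprK.
  have y2E : y 2%N = - y m.-2.
    by have := sym 2%N m2; rewrite subn2 => ->; rewrite opprK.
  have zE : z = -1 by rewrite /z /cell_end i0.
  rewrite zE i0; apply: (le_trans (eleC (Ci * Cl) _ _ Cil0 CCil)).
  rewrite -endE.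
  apply: (le_trans (Hl (fun s => Phi (Ci^-1 * s)) F P t (y 0%N) (y 2%N) Phi'P mF sP t0 _ _ y0 _ _ _)).
  - exact: yr.
  - by rewrite y0E y2E; real_lra.
  - by rewrite y0E.
  - by rewrite y0E y2E opprK.
  - by rewrite y2E opprK.
  rewrite -(endle' _ Cl0); apply: leeD; apply: lee_wpmul2l.
  - by rewrite lee_fin divr_ge0 ?(ltW t0)// ltW.
  - by apply: le_local_modulus => //; [rewrite zE|rewrite -i0].
  - by rewrite lee_fin ltW.
  - by move: midle; rewrite -midE i0.
have rightle : (\int[mu]_(x in `[y i.+2, z2]) (Phi (wjac a b x * `|F x - P.[x]| / C))%:E <=
    ((Cr + Cr * Ci) / t)%:E * T)%E.
  have [mi|mi] := leqP m i.+2; last first.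
    have -> : z2 = y i.+2 by rewrite /z2 /cell_end /= leqNgt mi.
    by rewrite sing; apply: mule_ge0 => //; rewrite lee_fin divr_ge0 ?(ltW t0)// ltW.
  have mE : m = i.+2 by apply/eqP; rewrite eqn_leq mi im.
  have zE : z2 = 1 by rewrite /z2 /cell_end /= mi.
  rewrite mE /= in gap endge endle prev.
  rewrite zE; apply: (le_trans (eleC (Ci * Cr) _ _ Cir0 CCir)).
  rewrite -endE.
  apply: (le_trans (Hr (fun s => Phi (Ci^-1 * s)) F P t (y i) (y i.+2) Phi'P mF sP t0 _ gap _ endge endle prev)).
  - by apply: yl; exact: ltnW (ltnW _).
  - exact: yr.
  rewrite -(endle' _ Cr0); apply: leeD; apply: lee_wpmul2l.
  - by rewrite lee_fin divr_ge0 ?(ltW t0)// ltW.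
  - by apply: le_local_modulus => //; rewrite zE.
  - by rewrite lee_fin ltW.
  - by rewrite midE.
have midC : (\int[mu]_(x in `[y i, y i.+2]) (Phi (wjac a b x * `|F x - P.[x]| / C))%:E <=
    (Ci / t)%:E * T)%E.
  by apply: le_trans midle; exact: eleC.
have me : measurable_fun setT (fun x => (Phi (wjac a b x * `|F x - P.[x]| / C))%:E).
  exact/measurable_EFinP.
have eC0e x : (0 <= (Phi (wjac a b x * `|F x - P.[x]| / C))%:E)%E by rewrite lee_fin.
apply: (le_trans (ge0_integral_itv_le zi (le_trans (ltW yi) zi2) me eC0e)).
apply: (@le_trans _ _ (((Cl + Cl * Ci) / t)%:E * T + ((Ci / t)%:E * T + ((Cr + Cr * Ci) / t)%:E * T)))%E.
  apply: leeD => //; apply: (le_trans (ge0_integral_itv_le (ltW yi) zi2 me eC0e)).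
  exact: leeD.
have q1 : 0 <= (Cl + Cl * Ci) / t by rewrite divr_ge0// ltW.
have q2 : 0 <= Ci / t by rewrite divr_ge0// ltW.
have q3 : 0 <= (Cr + Cr * Ci) / t by rewrite divr_ge0// ltW.
rewrite (scale_EFinD _ q2 q3) (scale_EFinD _ q1 (addr_ge0 q2 q3)).
apply: lee_wpmul2r; first exact: T0.
by rewrite lee_fin -!mulrDl ler_pM2r ?invr_gt0.
Qed.

End ends.

(** * Gluing *)

Section glue.
Context {R : realType}.
Local Notation mu := (@lebesgue_measure R).
Local Notation TR := (measurableTypeR R).
Implicit Types (Phi F : R -> R) (p q : {poly R}).

(** From a Bezout identity u X^K + v (X - 1)^K = 1, the polynomial u X^K is flat to order K with
    value 0 at 0 and value 1 at 1. *)
Lemma smoothstep K : exists chi : {poly R}, 'X^K %| chi /\ ('X - 1%:P) ^+ K %| chi - 1.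
Proof.
have /Bezout_eq1_coprimepP[[u v] /= uv] : coprimep 'X^K (('X - 1%:P) ^+ K : {poly R}).
  by rewrite coprimep_expl// coprimep_expr// coprimep_XsubC rootX oner_eq0.
exists (u * 'X^K); split; first by rewrite dvdp_mull.
by rewrite -uv opprD addNKr dvdpNr dvdp_mull.
Qed.

Lemma comp_smoothstep K (chi : {poly R}) (c l : R) : 0 < l -> 'X^K %| chi -> ('X - 1%:P) ^+ K %| chi - 1 ->
  let chi' := chi \Po (l^-1 *: ('X - c%:P)) in
  ('X - c%:P) ^+ K %| chi' /\ ('X - (c + l)%:P) ^+ K %| chi' - 1.
Proof.
move=> l0 /dvdpP[S SE] /dvdpP[S' S'E] /=; split.
  by rewrite SE comp_polyM rmorphXn /= comp_polyX exprZn -scalerAr dvdpZr ?dvdp_mull// expf_neq0// invr_neq0// gt_eqF.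
have -> : chi \Po (l^-1 *: ('X - c%:P)) - 1 = (chi - 1) \Po (l^-1 *: ('X - c%:P)).
  by rewrite comp_polyB comp_polyC.
rewrite S'E comp_polyM rmorphXn /= comp_polyB comp_polyX comp_polyC.
have -> : l^-1 *: ('X - c%:P) - 1%:P = l^-1 *: ('X - (c + l)%:P).
  rewrite !scalerBr -!mul_polyC -!polyCM mulrDr mulVf ?gt_eqF// polyCD opprD addrA.
  by [].
by rewrite exprZn -scalerAr dvdpZr ?dvdp_mull// expf_neq0// invr_neq0// gt_eqF.
Qed.

(** The passage from p i to p i.+1 takes place on [y i.+1, y i.+2]: the jump A i starts the blend at
    the first knot and B i completes it at the second, with A i + B i = p i.+1 - p i. *)
Definition knot_seq (y : nat -> R) (A B : nat -> {poly R}) n : seq (R * {poly R}) :=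
  flatten (mkseq (fun i => [:: (y i.+1, A i); (y i.+2, B i)]) n).

Lemma iter_deriv_knot_seq j y A B n :
  iter j spline_deriv (knot_seq y A B n) = knot_seq y (fun i => (A i)^`(j)) (fun i => (B i)^`(j)) n.
Proof.
elim: j => [//|j IH]; rewrite iterS IH /spline_deriv /knot_seq map_flatten /mkseq -!map_comp.
by congr flatten; apply: eq_map => i /=; rewrite !derivnS.
Qed.

Lemma knot_seq_wf K y A B n : (forall i, (i < n)%N -> ('X - (y i.+1)%:P) ^+ K %| A i) ->
  (forall i, (i < n)%N -> ('X - (y i.+2)%:P) ^+ K %| B i) -> spline_wf K (knot_seq y A B n).
Proof.
move=> HA HB; apply/allP => q /flattenP[l /mapP[i]]; rewrite mem_iota add0n => /= iN ->.
by rewrite !inE => /orP[/eqP->|/eqP->] /=; [exact: HA|exact: HB].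
Qed.

Lemma spline_knot_seq P y A B n x : spline P (knot_seq y A B n) x =
  P.[x] + \sum_(i < n) (truncated_poly (y i.+1) (A i) x + truncated_poly (y i.+2) (B i) x).
Proof.
rewrite /spline /knot_seq big_flatten /mkseq /= big_map; congr (_ + _).
rewrite -(big_mkord xpredT (fun i => truncated_poly (y i.+1) (A i) x + truncated_poly (y i.+2) (B i) x)).
rewrite /index_iota subn0; apply: eq_bigr => i _.
by rewrite !big_cons big_nil addr0.
Qed.

Lemma spline_first_cell P (y : nat -> R) A B n x : (forall i j, (i <= j <= n.+1)%N -> y i <= y j) ->
  x < y 1%N -> spline P (knot_seq y A B n) x = P.[x].
Proof.
move=> ymono xy; rewrite spline_knot_seq big1 ?addr0// => i _.
have h1 : x < y i.+1 by apply: (lt_le_trans xy); apply: ymono; exact: (leqW (ltn_ord i)).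
have h2 : x < y i.+2 by apply: (lt_le_trans xy); apply: ymono; exact: ltn_ord.
by rewrite /truncated_poly h1 h2 addr0.
Qed.

Lemma sum_jumps (p : nat -> {poly R}) A B n x : (forall i, (i < n)%N -> A i + B i = p i.+1 - p i) ->
  (p 0%N).[x] + \sum_(i < n) ((A i).[x] + (B i).[x]) = (p n).[x].
Proof.
elim: n => [|n IH] AB; first by rewrite big_ord0 addr0.
rewrite big_ord_recr /= addrA IH => [|i iN]; last by rewrite AB// ltnW.
by rewrite -hornerD AB// hornerD hornerN addrC subrK.
Qed.

Lemma spline_cell (p : nat -> {poly R}) (y : nat -> R) A B n j x :
  (forall i j, (i <= j <= n.+1)%N -> y i <= y j) ->
  (forall i, (i < n)%N -> A i + B i = p i.+1 - p i) -> (j < n)%N ->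
  y j.+1 <= x -> x < y j.+2 -> spline (p 0%N) (knot_seq y A B n) x = (p j + A j).[x].
Proof.
move=> ymono AB jn yx xy.
rewrite spline_knot_seq -(subnKC jn) big_split_ord /= [X in _ + (_ + X)]big1 ?addr0; last first.
  move=> i _; have ij : (j.+1 + i < n)%N by rewrite -ltn_subRL.
  have h1 : x < y (j.+1 + i).+1.
    by apply: (lt_le_trans xy); apply: ymono; rewrite ltnS addSn ltnS leq_addr /= ltnS ltnW.
  have h2 : x < y (j.+1 + i).+2.
    by apply: (lt_le_trans xy); apply: ymono; rewrite ltnS addSn ltnS leqW ?leq_addr.
  by rewrite /truncated_poly h1 h2 addr0.
rewrite big_ord_recr /= addrA hornerD; congr (_ + _).
  rewrite -(@sum_jumps p A B j x); last by move=> i ij; rewrite AB// (ltn_trans ij).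
  congr (_ + _); apply: eq_bigr => i _.
  have h1 : y i.+1 <= x by apply: le_trans yx; apply: ymono; rewrite ltnS ltnW//= ltnS ltnW.
  have h2 : y i.+2 <= x by apply: le_trans yx; apply: ymono; rewrite ltnS ltn_ord/= ltnS ltnW.
  by rewrite /truncated_poly !ltNge h1 h2.
by rewrite /truncated_poly ltNge yx xy addr0.
Qed.

Lemma spline_last_cell (p : nat -> {poly R}) (y : nat -> R) A B n x :
  (forall i j, (i <= j <= n.+1)%N -> y i <= y j) ->
  (forall i, (i < n)%N -> A i + B i = p i.+1 - p i) ->
  y n.+1 <= x -> spline (p 0%N) (knot_seq y A B n) x = (p n).[x].
Proof.
move=> ymono AB yx; rewrite spline_knot_seq -(sum_jumps _ AB); congr (_ + _); apply: eq_bigr => i _.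
have h1 : y i.+1 <= x by apply: le_trans yx; apply: ymono; rewrite ltnS ltnW/=.
have h2 : y i.+2 <= x by apply: le_trans yx; apply: ymono; rewrite ltnS ltn_ord/=.
by rewrite /truncated_poly !ltNge h1 h2.
Qed.

Lemma ge0_integral_itv_split (f : TR -> \bar R) (A M B : R) : A <= M -> M <= B ->
  measurable_fun setT f -> (forall x, 0 <= f x)%E ->
  (\int[mu]_(x in `[A, B]) f x = \int[mu]_(x in `[A, M]) f x + \int[mu]_(x in `[M, B]) f x)%E.
Proof.
move=> AM MB mf f0.
have -> : `[A, B]%classic = `[A, M]%classic `|` `]M, B]%classic.
  by rewrite -itv_bndbnd_setU// bnd_simp.
rewrite ge0_integral_setU//=; last 2 first.
- exact: measurable_funTS.
- apply/disj_setPS => x [/=]; rewrite !in_itv/= => /andP[_ xM] /andP[Mx _].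
  by have := lt_le_trans Mx xM; rewrite ltxx.
by congr (_ + _)%E; apply: integral_itv_obnd_cbnd; exact: measurable_funTS.
Qed.

Lemma local_modulusD Phi k (a b : R) F (t A M B : R) : convmod Phi -> measurable_fun setT F ->
  A <= M -> M <= B ->
  (local_modulus Phi k a b F t A B =
   local_modulus Phi k a b F t A M + local_modulus Phi k a b F t M B)%E.
Proof.
move=> PhiP mF AM MB; have mK := measurable_modulus_integrand k a b PhiP mF.
have K0 (q : TR * TR) := modulus_integrand_ge0 k a b F q PhiP.
rewrite /local_modulus -ge0_integralD//; first last.
- by apply: measurable_funTS; exact: measurable_inner.
- by move=> x _; apply: integral_ge0 => y _; rewrite lee_fin.
- by apply: measurable_funTS; exact: measurable_inner.
- by move=> x _; apply: integral_ge0 => y _; rewrite lee_fin.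
apply: eq_integral => tau _; apply: ge0_integral_itv_split => //.
  by apply/measurable_EFinP; exact: measurable_section.
by move=> x; rewrite lee_fin.
Qed.

Lemma integral_chain (f : TR -> \bar R) (z : nat -> R) n : (forall i, (i < n)%N -> z i <= z i.+1) ->
  measurable_fun setT f -> (forall x, 0 <= f x)%E ->
  (\int[mu]_(x in `[z 0%N, z n]) f x <= \sum_(i < n) \int[mu]_(x in `[z i, z i.+1]) f x)%E \/ n = 0%N.
Proof.
move=> zle mf f0; case: n zle => [|n] zle; [by right|left].
have mono j : (j <= n)%N -> z 0%N <= z j.
  elim: j => [//|j IH] jn; apply: (le_trans (IH (ltnW jn))); apply: zle; exact: ltnW.
elim: n zle mono => [|n IH] zle mono; first by rewrite big_ord1.
rewrite big_ord_recr /=; apply: (le_trans (ge0_integral_itv_le (mono n.+1 (leqnn _)) (zle _ _) mf f0)) => //.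
by apply: leeD => //; apply: IH => i h; [apply: zle; exact: ltnW|apply: mono; exact: ltnW].
Qed.

Lemma local_modulus_chain Phi k (a b : R) F (t : R) (z : nat -> R) n : convmod Phi ->
  measurable_fun setT F -> (forall i, (i < n.+1)%N -> z i <= z i.+1) ->
  (\sum_(i < n.+1) local_modulus Phi k a b F t (z i) (z i.+1) =
   local_modulus Phi k a b F t (z 0%N) (z n.+1))%E.
Proof.
move=> PhiP mF zle.
have mono j : (j <= n.+1)%N -> z 0%N <= z j.
  by elim: j => [//|j IH] jn; apply: (le_trans (IH (ltnW jn))); exact: zle.
elim: n zle mono => [|n IH] zle mono; first by rewrite big_ord1.
rewrite big_ord_recr /= (@local_modulusD Phi k a b F t (z 0%N) (z n.+1))//.
- by rewrite IH// => i h; [apply: zle; exact: ltnW|apply: mono; exact: ltnW].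
- by apply: mono; exact: ltnW.
- exact: zle.
Qed.

End glue.

Section glue.
Context {R : realType}.
Local Notation mu := (@lebesgue_measure R).
Local Notation TR := (measurableTypeR R).
Implicit Types (Phi F : R -> R) (p q : {poly R}).

Lemma poly_bounded (Q : {poly R}) (c d : R) : exists2 X : R, 1 <= X & forall x, c <= x <= d -> `|Q.[x]| <= X.
Proof.
have [X X0 HX] := spline_bounded Q [::] c d; exists (X + 1) => [|x xcd]; first real_lra.
have := HX x xcd; rewrite /spline big_nil addr0; real_lra.
Qed.

(** With h the value of the blend, the error is (F - p)(1 - h) + (F - q) h, and |h| is bounded on
    the transition cell. *)
Lemma glue_value (chi : {poly R}) : exists2 C : R, 1 <= C &
  forall Phi (W F : R -> R) p q (c l x : R), convmod Phi -> 0 <= W x -> 0 < l -> c <= x <= c + l ->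
  Phi (W x * `|F x - (p + (q - p) * (chi \Po (l^-1 *: ('X - c%:P)))).[x]| / C) <=
  Phi (W x * `|F x - p.[x]|) + Phi (W x * `|F x - q.[x]|).
Proof.
have [X X1 HX] := poly_bounded chi 0 1.
exists (2 * (1 + X)) => [|Phi W F p q c l x PhiP Wx l0 /andP[cx xc]]; first real_lra.
set h := chi.[l^-1 * (x - c)].
have hX : `|h| <= X.
  apply: HX; rewrite mulr_ge0 ?invr_ge0 ?(ltW l0)//=; last real_lra.
  by rewrite mulrC ler_pdivrMr//; real_lra.
have -> : (p + (q - p) * (chi \Po (l^-1 *: ('X - c%:P)))).[x] = p.[x] + (q.[x] - p.[x]) * h.
  by rewrite hornerD hornerM hornerD hornerN horner_comp hornerZ hornerXsubC.
rewrite (_ : 2 * (1 + X) = (1 + X) * 2); last by ring.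
rewrite invfM mulrA; apply: cm_add; rewrite ?mulr_ge0 ?invr_ge0//; first real_lra.
rewrite ler_pdivrMr; last real_lra.
rewrite -mulrDr -mulrA ler_wpM2l//.
have -> : F x - (p.[x] + (q.[x] - p.[x]) * h) = (F x - p.[x]) * (1 - h) + (F x - q.[x]) * h by ring.
apply: (le_trans (ler_normD _ _)); rewrite !normrM mulrDl.
apply: lerD; rewrite ler_wpM2l//; last real_lra.
by apply: (le_trans (ler_normB _ _)); rewrite normr1 lerD2l.
Qed.

(** The blend (q - p) chi is a polynomial of bounded degree, so [poly_deriv_le] bounds its k-th
    derivative by sampled values, where q - p = (F - p) - (F - q). The base point y is left free in
    the left half of the cell: all samples then stay in the cell, and y can be averaged out
    afterwards. *)
Lemma glue_derivative_pointwise k (chi : {poly R}) (a b M : R) : 0 <= a -> 0 <= b -> 1 <= M ->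
  exists (N : nat) (D : R), [/\ (0 < N)%N, 0 < D &
  forall F p q (t c l x y : R), 0 < t -> 0 < l -> (size p <= k)%N -> (size q <= k)%N ->
  -1 < c -> c + l < 1 ->
  (forall z z', c <= z <= c + l -> c <= z' <= c + l -> 1 - z <= M * (1 - z') /\ 1 + z <= M * (1 + z')) ->
  (forall z, c <= z <= c + l -> t * phi z <= M * l) ->
  c <= x <= c + l -> c <= y <= c + l / 2 ->
  t ^+ k * wjac a b x * phi x ^+ k * `|((q - p) * (chi \Po (l^-1 *: ('X - c%:P))))^`(k).[x]| <=
  D * \sum_(i < N) wjac a b (y + i%:R * (l / (2 * N%:R))) *
     (`|F (y + i%:R * (l / (2 * N%:R))) - p.[y + i%:R * (l / (2 * N%:R))]| +
      `|F (y + i%:R * (l / (2 * N%:R))) - q.[y + i%:R * (l / (2 * N%:R))]|)].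
Proof.
move=> a0 b0 M1; have [X X1 HX] := poly_bounded chi 0 1.
pose N := (k + size chi).+1.
have N0 : 0 < N%:R :> R by rewrite ltr0n.
have [C0 C00 HC0] := @poly_deriv_le R N k (2 * N%:R).
have [Mab [Mab1 MabE]] : exists Mab, 1 <= Mab /\ Mab = M `^ a * M `^ b.
  by exists (M `^ a * M `^ b); split=> //; rewrite mulr_ege1// powR_ge1.
exists N, (M ^+ k * (2 * N%:R) ^+ k * C0 * X * Mab); split => //.
  apply: mulr_gt0; last real_lra.
  apply: mulr_gt0; last real_lra.
  apply: mulr_gt0 => //.
  by apply: mulr_gt0; apply: exprn_gt0; real_lra.
move=> F p q t c l x y t0 l0 sp sq c1 cl1 ratio lenM xcl /andP[cy yc].
set A := (q - p) * _.
have sA : (size A <= N)%N.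
  apply: (leq_trans (size_polyMleq _ _)); rewrite /N.
  have s1 : (size (q - p)%R <= k)%N.
    by rewrite (leq_trans (size_polyD _ _))// geq_max sq size_polyN.
  have s2 : (size (chi \Po (l^-1 *: ('X - c%:P))) <= (size chi).+1)%N.
    apply: (leq_trans (size_comp_poly_leq _ _)); rewrite size_scale ?invr_neq0 ?gt_eqF// size_XsubC /=.
    by rewrite muln1 ltnS leq_pred.
  by rewrite (leq_trans (leq_pred _))// (leq_trans (leq_add s1 s2))// addnS.
set d := l / (2 * N%:R).
have d0 : 0 < d by rewrite divr_gt0//; real_lra.
have dN : 2 * N%:R * d = l by rewrite /d mulrC divfK// gt_eqF//; real_lra.
have zin (i : 'I_N) : c <= y + i%:R * d <= c + l.
  have i0 : 0 <= i%:R * d by rewrite mulr_ge0// ltW.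
  have iN : i%:R * d <= N%:R * d by rewrite ler_wpM2r ?(ltW d0)// ler_nat ltnW.
  by clearbody d; clear - i0 iN cy yc dN; apply/andP; split; real_lra.
have xy : `|x - y| <= 2 * N%:R * d.
  by rewrite dN ler_norml; case/andP: xcl => h1 h2; apply/andP; split; real_lra.
have HA := HC0 A d x y sA d0 xy.
have Abound (z : R) : c <= z <= c + l -> `|A.[z]| <= X * (`|F z - p.[z]| + `|F z - q.[z]|).
  move=> /andP[cz zc]; rewrite /A hornerM horner_comp hornerZ hornerXsubC normrM mulrC.
  apply: ler_pM => //.
    apply: HX; rewrite mulr_ge0 ?invr_ge0 ?(ltW l0)//=; last real_lra.
    by rewrite mulrC ler_pdivrMr//; real_lra.
  rewrite hornerD hornerN (_ : q.[z] - p.[z] = (F z - p.[z]) - (F z - q.[z])); last by ring.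
  exact: ler_normB.
clearbody d A.
set S := \sum_(i < N) _.
have tphi : (t * phi x) ^+ k <= M ^+ k * (2 * N%:R) ^+ k * d ^+ k.
  have tp0 : 0 <= t * phi x by rewrite mulr_ge0 ?phi_ge0// ltW.
  rewrite -!exprMn -mulrA dN; apply: lerXn2r; rewrite ?nnegrE//; last exact: lenM.
  by apply: (le_trans tp0); exact: lenM.
have -> : t ^+ k * wjac a b x * phi x ^+ k * `|A^`(k).[x]| =
    (t * phi x) ^+ k * (wjac a b x * `|A^`(k).[x]|) by rewrite exprMn; ring.
apply: (@le_trans _ _ (M ^+ k * (2 * N%:R) ^+ k * d ^+ k * (wjac a b x * `|A^`(k).[x]|))).
  by rewrite ler_wpM2r// mulr_ge0// wjac_ge0.
have -> : M ^+ k * (2 * N%:R) ^+ k * d ^+ k * (wjac a b x * `|A^`(k).[x]|) =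
    M ^+ k * (2 * N%:R) ^+ k * (wjac a b x * (d ^+ k * `|A^`(k).[x]|)) by ring.
have -> : M ^+ k * (2 * N%:R) ^+ k * C0 * X * Mab * S =
    M ^+ k * (2 * N%:R) ^+ k * (C0 * (X * (Mab * S))) by ring.
apply: ler_wpM2l; first by apply: mulr_ge0; apply: exprn_ge0; real_lra.
apply: (@le_trans _ _ (wjac a b x * (C0 * \sum_(i < N) `|A.[y + i%:R * d]|))).
  by rewrite ler_wpM2l// wjac_ge0.
rewrite mulrCA /S; apply: ler_wpM2l; first exact: ltW.
rewrite !mulr_sumr; apply: ler_sum => i _.
apply: (@le_trans _ _ (wjac a b x * (X * (`|F (y + i%:R * d) - p.[y + i%:R * d]| + `|F (y + i%:R * d) - q.[y + i%:R * d]|)))).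
  by apply: ler_wpM2l; [exact: wjac_ge0|exact: Abound].
rewrite mulrCA; apply: ler_wpM2l; first real_lra.
rewrite mulrA; apply: ler_wpM2r; first exact: addr_ge0.
have [r1 r2] := ratio x (y + i%:R * d) xcl (zin i).
case/andP: xcl => h1 h2; case/andP: (zin i) => h3 h4; rewrite MabE.
by clear - a0 b0 M1 r1 r2 h1 h2 h3 h4 c1 cl1; apply: wjac_ratio => //; try (apply/andP; split); real_lra.
Qed.

(** F - p is controlled in the mean only, never at given points. As the sampling bound holds for
    every base point y, averaging over y replaces each sample by an integral. *)
Lemma integral_le_average (I : R -> R) (psi : TR -> R) (N : nat) (c l : R) : 0 < l -> (0 < N)%N ->
  measurable_fun setT I -> (forall x, 0 <= I x) -> measurable_fun setT psi -> (forall x, 0 <= psi x) ->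
  (forall x y, c <= x <= c + l -> c <= y <= c + l / 2 ->
     I x <= \sum_(i < N) psi (y + i%:R * (l / (2 * N%:R)))) ->
  (\int[mu]_(x in `[c, (c + l)%R]) (I x)%:E <=
   (2 * N%:R)%:E * \int[mu]_(x in `[c, (c + l)%R]) (psi x)%:E)%E.
Proof.
move=> l0 N0 mI I0 mpsi psi0 pointwise.
have N0' : 0 < N%:R :> R by rewrite ltr0n.
have S0 : (0 <= \int[mu]_(x in `[c, (c + l)%R]) (psi x)%:E)%E.
  by apply: integral_ge0 => x _; rewrite lee_fin.
set S := (\int[mu]_(x in `[c, (c + l)%R]) (psi x)%:E)%E in S0 *.
set d := l / (2 * N%:R) in pointwise.
have d0 : 0 < d by rewrite divr_gt0//; real_lra.
have dN : 2 * N%:R * d = l by rewrite /d mulrC divfK// gt_eqF//; real_lra.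
clearbody d.
have mpsiE : measurable_fun setT (fun y : TR => (psi y)%:E) by exact/measurable_EFinP.
have mshift (i : nat) : measurable_fun setT (fun y : TR => psi (y + i%:R * d)).
  by apply: measurableT_comp => //; exact: measurable_funD.
have shift_le (i : 'I_N) : (\int[mu]_(y in `[c, (c + l / 2)%R]) (psi (y + i%:R * d)%R)%:E <= S)%E.
  have := @ge0_integral_affine R (fun y : TR => (psi y)%:E) (i%:R * d) 1 c (c + l / 2) ltr01 mpsiE.
  rewrite mul1e !mul1r => /(_ _)/wrap[]; first by move=> y; rewrite lee_fin.
  under eq_integral do rewrite mul1r addrC.
  move=> ->; apply: ge0_subset_integral => //.
  - exact: measurable_funTS.
  - by move=> y _; rewrite lee_fin.
  have i0 : 0 <= i%:R * d by rewrite mulr_ge0// ltW.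
  have iN : i%:R * d <= N%:R * d by rewrite ler_wpM2r ?(ltW d0)// ler_nat ltnW.
  by apply: subset_itv; rewrite bnd_simp; real_lra.
have avg x : c <= x <= c + l -> ((I x)%:E <= (2 * N%:R / l)%:E * S)%E.
  move=> xcl.
  have l20 : 0 < l / 2 by real_lra.
  have h1 : ((l / 2)%:E * (I x)%:E <= N%:R%:E * S)%E.
    have -> : ((l / 2)%:E * (I x)%:E = \int[mu]_(y in `[c, (c + l / 2)%R]) (cst (I x)%:E) y)%E.
      rewrite integral_cst//= itv_measureE; last real_lra.
      by rewrite muleC; congr (_ * _%:E)%E; ring.
    apply: (@le_trans _ _ (\int[mu]_(y in `[c, (c + l / 2)%R]) (\sum_(i < N) (psi (y + i%:R * d)%R)%:E))%E).
      apply: ge0_le_integral => //.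
      - by move=> y _; rewrite lee_fin.
      - by apply: emeasurable_sum => i; apply/measurable_EFinP/measurable_funTS.
      - by move=> y; rewrite /= in_itv/= => ycl; rewrite sumEFin lee_fin pointwise.
    rewrite ge0_integral_sum//; last 2 first.
    - by move=> i; apply/measurable_EFinP/measurable_funTS.
    - by move=> i y _; rewrite lee_fin.
    by rewrite -sume_cst//; apply: lee_sum => i _; exact: shift_le.
  have e1 : ((2 / l)%:E * (l / 2)%:E = 1)%E.
    by rewrite -EFinM; congr EFin; field; rewrite gt_eqF.
  rewrite -[leLHS]mul1e -e1 -muleA.
  have -> : ((2 * N%:R / l)%:E * S = (2 / l)%:E * (N%:R%:E * S))%E.
    by rewrite muleA -EFinM; congr (_%:E * _)%E; ring.
  by apply: lee_wpmul2l h1; rewrite lee_fin divr_ge0// ltW.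
apply: (@le_trans _ _ (\int[mu]_(x in `[c, (c + l)%R]) (cst ((2 * N%:R / l)%:E * S) x))%E).
  apply: ge0_le_integral => //.
  - by move=> x _; rewrite lee_fin.
  - exact/measurable_EFinP/measurable_funTS.
rewrite integral_cst//= itv_measureE; last real_lra.
rewrite muleAC -EFinM; apply: lee_wpmul2r; first exact: S0.
rewrite lee_fin (_ : 2 * N%:R / l * (c + l - c) = 2 * N%:R)//.
by field; rewrite gt_eqF.
Qed.

Lemma glue_derivative k (chi : {poly R}) (a b M : R) : 0 <= a -> 0 <= b -> 1 <= M ->
  exists2 C : R, 1 <= C &
  forall Phi F p q (t c l : R), convmod Phi -> measurable_fun setT F -> 0 < t -> 0 < l ->
  (size p <= k)%N -> (size q <= k)%N -> -1 < c -> c + l < 1 ->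
  (forall z z', c <= z <= c + l -> c <= z' <= c + l -> 1 - z <= M * (1 - z') /\ 1 + z <= M * (1 + z')) ->
  (forall z, c <= z <= c + l -> t * phi z <= M * l) ->
  (\int[mu]_(x in `[c, (c + l)%R]) (Phi (t ^+ k * wjac a b x * phi x ^+ k *
     `|((q - p) * (chi \Po (l^-1 *: ('X - c%:P))))^`(k).[x]| / C))%:E <=
   C%:E * \int[mu]_(x in `[c, (c + l)%R])
      (Phi (wjac a b x * `|F x - p.[x]|) + Phi (wjac a b x * `|F x - q.[x]|))%:E)%E.
Proof.
move=> a0 b0 M1; have [N [D [N0 D0 HD]]] := @glue_derivative_pointwise k chi a b M a0 b0 M1.
have N0' : 0 < N%:R :> R by rewrite ltr0n.
have N1 : 1 <= N%:R :> R by rewrite ler1n.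
have DN0 : 0 < 2 * D * N%:R by apply: mulr_gt0; real_lra.
pose C := 2 * D * N%:R + 2 * N%:R.
have C1 : 1 <= C by rewrite /C; real_lra.
have CN : 2 * N%:R <= C by rewrite /C; real_lra.
have CD : 2 * D * N%:R <= C by rewrite /C; real_lra.
have Cgt0 : 0 < C by real_lra.
clearbody C.
exists C => // Phi F p q t c l PhiP mF t0 l0 sp sq c1 cl1 ratio lenM.
pose psi x := Phi (wjac a b x * `|F x - p.[x]|) + Phi (wjac a b x * `|F x - q.[x]|).
have psi0 x : 0 <= psi x by rewrite addr_ge0// cm_ge0// mulr_ge0// wjac_ge0.
have mpsi : measurable_fun setT psi.
  by apply: measurable_funD; apply: measurable_error1 => //; exact: measurable_wjac.
set A := (q - p) * _.
pose E x := t ^+ k * wjac a b x * phi x ^+ k * `|A^`(k).[x]|.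
have E0 x : 0 <= E x.
  rewrite /E; apply: mulr_ge0 => //; apply: mulr_ge0; last by rewrite exprn_ge0// phi_ge0.
  by rewrite mulr_ge0 ?wjac_ge0// exprn_ge0// ltW.
have EC0 x : 0 <= E x / C by rewrite divr_ge0// ltW.
apply: (@le_trans _ _ ((2 * N%:R)%:E * \int[mu]_(x in `[c, (c + l)%R]) (psi x)%:E))%E; last first.
  by apply: lee_wpmul2r; [apply: integral_ge0 => x _|]; rewrite lee_fin.
apply: (@integral_le_average (fun x => Phi (E x / C))) => //.
- apply: measurableT_comp; first exact: cm_meas.
  apply: measurable_funM => //; apply: measurable_funM; last first.
    by apply: measurableT_comp => //; exact: measurable_horner.
  apply: measurable_funM; first by apply: measurable_funM => //; exact: measurable_wjac.
  by apply: measurable_funX; exact: measurable_phi.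
- by move=> x; rewrite cm_ge0.
move=> x y xcl ycl.
have := HD F p q t c l x y t0 l0 sp sq c1 cl1 ratio lenM xcl ycl.
rewrite -/A -/(E x); set d := l / (2 * N%:R).
pose eps (i : 'I_N) : R := wjac a b (y + i%:R * d) *
     (`|F (y + i%:R * d) - p.[y + i%:R * d]| + `|F (y + i%:R * d) - q.[y + i%:R * d]|).
have eps0 i : 0 <= eps i by rewrite mulr_ge0 ?wjac_ge0// addr_ge0.
move=> EE; have {}EE : E x <= D * \sum_(i < N) eps i by [].
apply: (@le_trans _ _ (\sum_(i < N) Phi (eps i / 2))); last first.
  apply: ler_sum => i _; apply: cm_add => //; try (by rewrite mulr_ge0// wjac_ge0).
  by rewrite /eps mulrDr.
apply: (@le_trans _ _ (Phi (E x / (2 * D) / N%:R))).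
  apply: cm_mono => //.
  by rewrite -mulrA -invfM ler_wpM2l// lef_pV2.
have D2 : 0 < 2 * D by real_lra.
apply: cm_sum => //.
- by move=> i; rewrite divr_ge0.
- by rewrite divr_ge0// ltW.
- rewrite -mulr_suml ler_pdivrMr//.
  by rewrite (_ : _ / 2 * (2 * D) = D * \sum_(i < N) eps i)//; field.
Qed.

End glue.

(** * Assembling the global spline *)

Section inverse.
Context {R : realType}.
Local Notation mu := (@lebesgue_measure R).
Local Notation TR := (measurableTypeR R).
Implicit Types (Phi F : R -> R).

(** Here h is attached to cells, e to windows and T holds the cell moduli. Cell j meets windows j -
    1 and j, clipped to the range 0, ..., n; window i consists of cells i and i + 1. The sum of all
    e is counted at most 4 times and the sum of all T twice, hence the factor 8. *)
Lemma cell_sum (h e T : nat -> \bar R) n (K c : R) : 0 <= K -> 0 <= c ->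
  (forall i, 0 <= e i)%E -> (forall i, 0 <= T i)%E ->
  (forall j, (j < n.+2)%N -> h j <= K%:E * (e j.-1 + e (minn j n)))%E ->
  (forall i, (i <= n)%N -> e i <= c%:E * (T i + T i.+1))%E ->
  (\sum_(j < n.+2) h j <= (8 * K * c)%:E * \sum_(j < n.+2) T j)%E.
Proof.
move=> K0 c0 e0 T0 hle ele.
have dbl (x : \bar R) : (0 <= x)%E -> (x + x = 2%:E * x)%E.
  by move=> x0; rewrite -{1 2}(mul1e x) scale_EFinD.
set Tt := (\sum_(j < n.+2) T j)%E.
have Tt0 : (0 <= Tt)%E by exact: sume_ge0.
pose S := (\sum_(i < n.+1) e i)%E.
have S0 : (0 <= S)%E by exact: sume_ge0.
have Sle : (S <= (2 * c)%:E * Tt)%E.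
  apply: (@le_trans _ _ (\sum_(i < n.+1) c%:E * (T i + T i.+1))%E).
    by apply: lee_sum => i _; apply: ele; rewrite -ltnS.
  rewrite -ge0_sume_distrr; last by move=> i _; exact: adde_ge0.
  rewrite mulrC EFinM -muleA; apply: lee_wpmul2l; first by rewrite lee_fin.
  rewrite big_split /= -dbl//; apply: leeD.
    by rewrite /Tt [leRHS]big_ord_recr /=; apply: leeDl.
  by rewrite /Tt [leRHS]big_ord_recl /=; apply: leeDr.
apply: (@le_trans _ _ (\sum_(j < n.+2) K%:E * (e j.-1 + e (minn j n)))%E).
  by apply: lee_sum => j _; exact: hle.
rewrite -ge0_sume_distrr; last by move=> i _; exact: adde_ge0.
rewrite (_ : 8 * K * c = K * (2 * 2 * (2 * c))); last by ring.
rewrite EFinM -muleA; apply: lee_wpmul2l; first by rewrite lee_fin.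
apply: (@le_trans _ _ ((2 * 2)%:E * S)%E); last first.
  by rewrite (EFinM (2 * 2)) -muleA; apply: lee_wpmul2l; rewrite ?lee_fin.
rewrite big_split /= EFinM -muleA -dbl ?mule_ge0// -dbl//; apply: leeD.
  rewrite big_ord_recl /=; apply: leeD; last by rewrite /S; apply: lee_sum.
  by rewrite /S big_ord_recl; apply: leeDl; exact: sume_ge0.
rewrite big_ord_recr /= (minn_idPr (leqnSn n)); apply: leeD.
  by rewrite /S; apply: lee_sum => i _; rewrite (minn_idPl _)// -ltnS.
by rewrite /S big_ord_recr /=; apply: leeDr; exact: sume_ge0.
Qed.

Theorem spline_approximation k (a b : R) : (0 < k)%N -> 0 <= a -> 0 <= b ->
  exists2 C : R, 1 <= C & forall Phi F (t : R), convmod Phi -> measurable_fun setT F ->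
  (forall c d, -1 < c -> d < 1 -> mu.-integrable `[c, d] (EFin \o F)) -> 0 < t -> t <= 2 ->
  exists P s, [/\ spline_wf k.+2 s,
    (\int[mu]_(x in `[(-1)%R, 1%R]) (Phi (wjac a b x * `|F x - spline P s x| / C))%:E <=
       (C / t)%:E * local_modulus Phi k a b F t (-1) 1)%E &
    (\int[mu]_(x in `[(-1)%R, 1%R]) (Phi (t ^+ k * wjac a b x * phi x ^+ k *
        `|spline P^`(k) (iter k spline_deriv s) x| / C))%:E <=
       (C / t)%:E * local_modulus Phi k a b F t (-1) 1)%E].
Proof.
move=> k0 a0 b0.
have [M M1 HM] := @adapted_nodes_exist R k k0.
have [C1 C11 HC1] := @local_approximation R k a b M k0 a0 b0 M1.
(* Order k + 2 leaves a double zero after k derivations, so the k-th derivative of the spline is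
   still of class C^1. *)
have [chi [chi0 chi1]] := @smoothstep R k.+2.
have [Cv Cv1 HCv] := @glue_value R chi.
have [Cd Cd1 HCd] := @glue_derivative R k chi a b M a0 b0 M1.
(* The 8 comes from [cell_sum]; Cv + Cd is a common constant for the gluing of values and of
   derivatives. *)
pose C := 8 * (Cv + Cd) * C1.
have C10 : 0 < C1 by real_lra.
have CC1 : C1 <= C by rewrite /C ler_peMl//; real_lra.
have CCv : C1 * Cv <= C by rewrite /C mulrC ler_wpM2r//; real_lra.
have CCd : C1 * Cd <= C by rewrite /C mulrC ler_wpM2r//; real_lra.
have C1' : 1 <= C by real_lra.
have C0 : 0 < C by real_lra.
have CE : C = 8 * (Cv + Cd) * C1 by [].
clearbody C.
exists C => // Phi F t PhiP mF Fi t0 t2.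
have [m [y nodes]] := HM t t0 t2.
have [m2 ylt y0 ym ratio len phil gap endge endle prev sym] := nodes.
have [n mE] : exists n, m = n.+2 by exists m.-2; case: (m) m2 => [|[|]].
subst m; clear gap endge endle prev sym HM.
set z := cell_end n.+2 y.
have z0E : z 0%N = -1 by [].
have znE : z n.+2 = 1 by rewrite /z /cell_end /= leqnn.
have zE j : (j < n.+1)%N -> z j.+1 = y j.+1 by move=> jn; rewrite /z /cell_end /= leqNgt ltnS jn.
have ymono i j : (i <= j <= n.+2)%N -> y i <= y j.
  case/andP => /subnK <-; elim: (j - i)%N => [//|l IH] jm.
  by rewrite addSn (le_trans (IH _)) ?ltW ?ylt// ltnW.
have ymono' i j : (i <= j <= n.+1)%N -> y i <= y j.
  by case/andP => ij jn; apply: ymono; rewrite ij leqW.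
have yl j : (j <= n.+2)%N -> -1 < y j by move=> jm; apply: (lt_le_trans y0); apply: ymono.
have yr j : (j <= n.+2)%N -> y j < 1 by move=> jm; apply: le_lt_trans ym; apply: ymono; rewrite jm leqnn.
have zmono i : (i < n.+2)%N -> z i <= z i.+1.
  case: i => [_|i]; first by rewrite z0E zE// ltW// yl.
  rewrite ltnS leq_eqVlt => /predU1P[[->]|iN].
    by rewrite znE zE// ltW// yr.
  rewrite zE; last exact: ltnW.
  by rewrite zE// ltW// ylt// ltnW.
have mv : measurable_fun setT (wjac a b) by exact: measurable_wjac.
have v0 x : 0 <= wjac a b x by exact: wjac_ge0.
have /choice[p Hp] : forall i : nat, exists P : {poly R}, (i <= n)%N -> (size P <= k)%N /\
  (\int[mu]_(x in `[z i, z i.+2]) (Phi (wjac a b x * `|F x - P.[x]| / C1))%:E <=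
   (C1 / t)%:E * local_modulus Phi k a b F t (z i) (z i.+2))%E.
  move=> i; have [iN|iN] := leqP i n; last by exists 0.
  by have [P sP HP] := HC1 Phi F t n.+2 y PhiP mF t0 Fi nodes i iN; exists P.
clear HC1 nodes.
pose l i := y i.+2 - y i.+1.
have l0 i : (i < n)%N -> 0 < l i by move=> iN; rewrite subr_gt0 ylt// ltnS ltnW.
have lE i : y i.+1 + l i = y i.+2 by rewrite /l addrC subrK.
pose A i := (p i.+1 - p i) * (chi \Po ((l i)^-1 *: ('X - (y i.+1)%:P))).
pose B i := (p i.+1 - p i) - A i.
have AB i : A i + B i = p i.+1 - p i by rewrite /B addrC subrK.
have wf : spline_wf k.+2 (knot_seq y A B n).
  apply: knot_seq_wf => i iN; have [d1 d2] := comp_smoothstep (y i.+1) (l0 i iN) chi0 chi1.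
    by rewrite /A dvdp_mull.
  rewrite lE in d2.
  have -> : B i = - ((p i.+1 - p i) * (chi \Po ((l i)^-1 *: ('X - (y i.+1)%:P)) - 1)).
    by rewrite /B /A mulrBr mulr1 opprB.
  by rewrite dvdpNr dvdp_mull.
exists (p 0%N), (knot_seq y A B n).
set G := spline (p 0%N) (knot_seq y A B n).
rewrite iter_deriv_knot_seq.
pose p' i := (p i)^`(k).
pose A' i := (A i)^`(k).
pose B' i := (B i)^`(k).
set Gk := spline (p 0%N)^`(k) _.
have AB' i : A' i + B' i = p' i.+1 - p' i by rewrite /A' /B' -derivnD AB derivnB.
(* The local polynomials have degree less than k, so only the blends contribute to the k-th
   derivative, which vanishes on the two extreme cells. *)
have p'0 i : (i <= n)%N -> p' i = 0 by move=> iN; apply: derivn_poly0; have [] := Hp i iN.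
have mG : measurable_fun setT G by exact: measurable_spline.
have mGk : measurable_fun setT Gk by exact: measurable_spline.
(* The window errors are controlled after division by C1; this division is put into the modular
   before gluing. *)
pose Phi1 s := Phi (C1^-1 * s).
have Phi1P : convmod Phi1 by apply: cm_scale => //; rewrite invr_ge0 ltW.
pose psi i (x : R) := Phi1 (wjac a b x * `|F x - (p i).[x]|).
have psi0 i x : 0 <= psi i x by rewrite /psi cm_ge0// mulr_ge0.
have mpsi i : measurable_fun setT (psi i) by exact: (measurable_error1 (p i) Phi1P mv mF).
pose e i := (\int[mu]_(x in `[z i, z i.+2]) (psi i x)%:E)%E.
have e0 i : (0 <= e i)%E by apply: integral_ge0 => x _; rewrite lee_fin.
pose T i := local_modulus Phi k a b F t (z i) (z i.+1).
have T0 i : (0 <= T i)%E by exact: local_modulus_ge0.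
have ele i : (i <= n)%N -> (e i <= (C1 / t)%:E * (T i + T i.+1))%E.
  move=> iN; have [_] := Hp i iN; rewrite (@local_modulusD _ Phi k a b F t (z i) (z i.+1))//; last 2 first.
  - by apply: zmono; rewrite ltnS ltnW.
  - exact: zmono.
  by apply: le_trans; rewrite /e /psi /Phi1; under eq_integral do rewrite mulrC.
have chain : (\sum_(j < n.+2) T j = local_modulus Phi k a b F t (-1) 1)%E.
  rewrite -z0E -znE; exact: (@local_modulus_chain R Phi k a b F t z n.+1 PhiP mF zmono).
have ct0 : 0 <= C1 / t by rewrite divr_ge0// ltW.
have finish (h : R -> R) (K : R) : measurable_fun setT h -> (forall x, 0 <= h x) -> 1 <= K ->
    8 * K * C1 <= C ->
    (\int[mu]_(x in `[z 0%N, z 1%N]) (h x)%:E <= e 0%N)%E ->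
    (\int[mu]_(x in `[z n.+1, z n.+2]) (h x)%:E <= e n)%E ->
    (forall i, (i < n)%N -> \int[mu]_(x in `[z i.+1, z i.+2]) (h x)%:E <= K%:E * (e i + e i.+1))%E ->
    (\int[mu]_(x in `[(-1)%R, 1%R]) (h x)%:E <= (C / t)%:E * local_modulus Phi k a b F t (-1) 1)%E.
  move=> mh h0 K1 KC first_cell last_cell cells.
  have mhE : measurable_fun setT (fun x : TR => (h x)%:E) by exact/measurable_EFinP.
  have h0E x : (0 <= (h x)%:E)%E by rewrite lee_fin.
  have [hc|//] := @integral_chain R (fun x => (h x)%:E) z n.+2 zmono mhE h0E.
  rewrite -z0E -znE; apply: (le_trans hc); rewrite z0E znE; clear hc.
  have K0 : 0 <= K by real_lra.
  have leK x : (0 <= x -> x <= K%:E * (x + x))%E.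
    move=> x0; apply: (@le_trans _ _ (x + x)%E); first by rewrite leeDl.
    by apply: lee_pemull; rewrite ?adde_ge0// lee_fin.
  apply: (@le_trans _ _ ((8 * K * (C1 / t))%:E * \sum_(j < n.+2) T j)%E).
    apply: (@cell_sum (fun j => \int[mu]_(x in `[z j, z j.+1]) (h x)%:E)%E e T n K (C1 / t)) => //.
    case=> [_|j] /=; first by rewrite min0n; apply: (le_trans first_cell); exact: leK.
    rewrite ltnS leq_eqVlt => /predU1P[[->]|jn].
      by rewrite (minn_idPr (leqnSn n)); apply: (le_trans last_cell); exact: leK.
    by rewrite (minn_idPl _)//; exact: cells.
  rewrite chain; apply: lee_wpmul2r; first exact: local_modulus_ge0.
  by rewrite lee_fin mulrA ler_pM2r ?invr_gt0.
have celle i : (i <= n)%N -> (\int[mu]_(x in `[z i, z i.+1]) (psi i x)%:E <= e i)%E.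
  move=> iN; apply: (@le_integral_fin R _ _ (psi i) (psi i) (measurable_itv _) (measurable_itv _)
    (mpsi i) (mpsi i) (psi0 i) (psi0 i)) => x; rewrite /= !in_itv/= => /andP[h1 h2].
  by left; split => //; rewrite h1 (le_trans h2)// zmono.
have celle' i : (i <= n)%N -> (\int[mu]_(x in `[z i.+1, z i.+2]) (psi i x)%:E <= e i)%E.
  move=> iN; apply: (@le_integral_fin R _ _ (psi i) (psi i) (measurable_itv _) (measurable_itv _)
    (mpsi i) (mpsi i) (psi0 i) (psi0 i)) => x; rewrite /= !in_itv/= => /andP[h1 h2].
  by left; split => //; rewrite h2 andbT (le_trans _ h1)// zmono// ltnS ltnW.
(* The formulas for the spline hold on half-open cells, so pointwise comparison is only required
   away from the right end of the cell. *)
have cello (h g : R -> R) (c d : R) : measurable_fun setT h -> measurable_fun setT g ->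
    (forall x, 0 <= h x) -> (forall x, 0 <= g x) -> (forall x, c <= x -> x < d -> h x <= g x) ->
    (\int[mu]_(x in `[c, d]) (h x)%:E <= \int[mu]_(x in `[c, d]) (g x)%:E)%E.
  move=> mh mg h0 g0 hg; rewrite -integral_itvco//.
  apply: (@le_integral_fin R _ _ h g) => // x; rewrite /= !in_itv/= => /andP[h1 h2].
  by left; split; [rewrite h1 ltW|exact: hg].
have Phile X D : 0 <= X -> 0 < D -> C1 * D <= C -> Phi (X / C) <= Phi1 (X / D).
  move=> X0 D0 DC; rewrite /Phi1; apply: cm_mono => //; first by rewrite divr_ge0// ltW.
  by rewrite mulrCA -invfM ler_wpM2l// lef_pV2// posrE mulr_gt0.
have Cv0 : 0 < Cv by real_lra.
have Cd0 : 0 < Cd by real_lra.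
pose h1 x := Phi (wjac a b x * `|F x - G x| / C).
have E10 x : 0 <= wjac a b x * `|F x - G x| by rewrite mulr_ge0.
have h10 x : 0 <= h1 x by rewrite /h1 cm_ge0// divr_ge0// ltW.
have mh1 : measurable_fun setT h1.
  apply: measurableT_comp; first exact: cm_meas.
  apply: measurable_funM => //; apply: measurable_funM => //.
  by apply: measurableT_comp => //; exact: measurable_funB.
pose E2 x := t ^+ k * wjac a b x * phi x ^+ k * `|Gk x|.
have E20 x : 0 <= E2 x.
  rewrite /E2; apply: mulr_ge0 => //; apply: mulr_ge0; last by rewrite exprn_ge0// phi_ge0.
  by rewrite mulr_ge0// exprn_ge0// ltW.
pose h2 x := Phi (E2 x / C).
have h20 x : 0 <= h2 x by rewrite /h2 cm_ge0// divr_ge0// ltW.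
have mh2 : measurable_fun setT h2.
  apply: measurableT_comp; first exact: cm_meas.
  apply: measurable_funM => //; apply: measurable_funM; last exact: measurableT_comp.
  apply: measurable_funM; first exact: measurable_funM.
  by apply: measurable_funX; exact: measurable_phi.
have psi_le i x : G x = (p i).[x] -> h1 x <= psi i x.
  move=> Gx; rewrite /h1 /psi -[X in Phi1 X]divr1 Gx; apply: Phile => //; last by rewrite mulr1.
  by rewrite mulr_ge0.
have h2_0 x : Gk x = 0 -> h2 x = 0 by move=> Gx; rewrite /h2 /E2 Gx normr0 mulr0 mul0r cm_0.
have G_first x : x < y 1%N -> G x = (p 0%N).[x] by exact: spline_first_cell.
have Gk_first x : x < y 1%N -> Gk x = 0.
  move=> xy; rewrite /Gk (@spline_first_cell R _ y A' B' n)//.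
  by rewrite -/(p' 0%N) p'0// horner0.
have G_last x : y n.+1 <= x -> G x = (p n).[x] by exact: spline_last_cell.
have Gk_last x : y n.+1 <= x -> Gk x = 0.
  move=> xy; rewrite /Gk (@spline_last_cell R p' y A' B' n)//.
  by rewrite p'0// horner0.
have G_cell i x : (i < n)%N -> y i.+1 <= x -> x < y i.+2 -> G x = (p i + A i).[x].
  exact: spline_cell.
have Gk_cell i x : (i < n)%N -> y i.+1 <= x -> x < y i.+2 -> Gk x = (A' i).[x].
  move=> iN yx xy; rewrite /Gk (@spline_cell R p' y A' B' n i)//.
  by rewrite p'0 ?add0r// ltnW.
have sump i : (i < n)%N ->
   (\int[mu]_(x in `[z i.+1, z i.+2]) (psi i x + psi i.+1 x)%:E <= e i + e i.+1)%E.
  move=> iN; under eq_integral do rewrite EFinD.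
  rewrite ge0_integralD//.
  - apply: leeD; first by apply: celle'; exact: ltnW.
    by apply: celle.
  - by move=> x _; rewrite lee_fin.
  - by apply/measurable_EFinP/measurable_funTS; exact: mpsi.
  - by move=> x _; rewrite lee_fin.
  - by apply/measurable_EFinP/measurable_funTS; exact: mpsi.
have psiD0 i x : 0 <= psi i x + psi i.+1 x by rewrite addr_ge0.
have mpsiD i : measurable_fun setT (fun x => psi i x + psi i.+1 x) by exact: measurable_funD.
have zi1 i : (i < n)%N -> z i.+1 = y i.+1 by move=> iN; apply: zE; exact: ltnW.
have zi2 i : (i < n)%N -> z i.+2 = y i.+2 by move=> iN; exact: zE.
split => //.
  apply: (finish h1 (Cv + Cd)) => //; [real_lra|by rewrite CE| | | ].
  - apply: le_trans (celle 0%N (leq0n n)); apply: cello => // x _; rewrite zE// => xy.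
    by apply: psi_le; exact: G_first.
  - apply: le_trans (celle' n (leqnn n)); apply: cello => // x; rewrite zE// => yx _.
    by apply: psi_le; exact: G_last.
  move=> i iN; apply: (@le_trans _ _ (e i + e i.+1)%E); last first.
    by apply: lee_pemull; [exact: adde_ge0|rewrite lee_fin; real_lra].
  apply: le_trans (sump i iN); apply: cello => // x; rewrite zi1// zi2// => yx xy.
  rewrite /h1; apply: (le_trans (Phile _ Cv _ _ _)) => //.
  rewrite (G_cell i)//.
  by apply: HCv => //; [exact: l0|rewrite yx lE ltW].
apply: (finish h2 (Cv + Cd)) => //; [real_lra|by rewrite CE| | | ].
- apply: le_trans (celle 0%N (leq0n n)); apply: cello => // x _; rewrite zE// => xy.
  by rewrite h2_0// Gk_first.
- apply: le_trans (celle' n (leqnn n)); apply: cello => // x; rewrite zE// => yx _.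
  by rewrite h2_0// Gk_last.
move=> i iN; apply: (@le_trans _ _ (Cd%:E * (e i + e i.+1))%E); last first.
  by apply: lee_wpmul2r; [exact: adde_ge0|rewrite lee_fin; real_lra].
apply: (@le_trans _ _ (Cd%:E * \int[mu]_(x in `[z i.+1, z i.+2]) (psi i x + psi i.+1 x)%:E)%E); last first.
  by apply: lee_wpmul2l; [rewrite lee_fin ltW|exact: sump].
have [spi _] := Hp i (ltnW iN).
have [spi1 _] := Hp i.+1 iN.
have in2 : (i.+2 <= n.+2)%N by rewrite ltnS ltnW// ltnW.
have := HCd Phi1 F (p i) (p i.+1) t (y i.+1) (l i) Phi1P mF t0 (l0 i iN) spi spi1
  (yl i.+1 _) _ _ _.
rewrite lE => /(_ _ _ _ _)/wrap[].
- by rewrite ltnS ltnW// ltnW.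
- by apply: yr.
- move=> w w' /andP[w1 w2] /andP[w1' w2'].
  have yy : y i <= y i.+1 by rewrite ltW// ylt// ltnW.
  by apply: (ratio i) => //; rewrite ?w2 ?w2' andbT; [apply: le_trans w1|apply: le_trans w1'].
- by move=> w wi; apply: phil.
rewrite -zi1// -zi2//; apply: le_trans; apply: cello => //.
- apply: measurableT_comp; first exact: cm_meas.
  apply: measurable_funM => //; apply: measurable_funM; last first.
    by apply: measurableT_comp => //; exact: measurable_horner.
  apply: measurable_funM; first exact: measurable_funM.
  by apply: measurable_funX; exact: measurable_phi.
- move=> x; rewrite cm_ge0// divr_ge0 ?(ltW Cd0)//; apply: mulr_ge0 => //; apply: mulr_ge0.
    by rewrite mulr_ge0// exprn_ge0// ltW.
  by rewrite exprn_ge0// phi_ge0.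
move=> x; rewrite zi1// zi2// => yx xy.
by rewrite /h2; apply: (le_trans (Phile _ Cd _ _ _)) => //; rewrite /E2 (Gk_cell i).
Qed.

End inverse.

(** * Absolutely continuous functions *)

Section absolute_continuity.
Context {R : realType}.
Implicit Types (a b c d e : R) (f g : R -> R).

(** An arbitrary finite index type is needed because refined families are indexed by dependent
    pairs, and unions of intervals by finite sets. *)
Lemma abs_continuous_fin a b f : abs_continuous a b f -> forall e, 0 < e ->
  exists2 d, 0 < d & forall (T : finType) (u v : T -> R),
  (forall i, a <= u i /\ u i <= v i /\ v i <= b) ->
  trivIset setT (fun i => `]u i, v i[%classic) ->
  \sum_i (v i - u i) < d -> \sum_i `|f (v i) - f (u i)| < e.
Proof.
move=> fac e /fac[d d0 H]; exists d => // T u v uv triv s.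
have := H #|T| (u \o enum_val) (v \o enum_val).
rewrite -(big_enum_val (A := T) (fun i => v i - u i)) -(big_enum_val (A := T) (fun i => `|f (v i) - f (u i)|)).
apply=> //.
- by move=> i; exact: uv.
- by move=> i j _ _ ij; apply: enum_val_inj; apply: triv.
Qed.

Section partition.
Variables (c e : R) (s : seq R).
Hypothesis cs : itv_partition c e s.

Let pt i := nth e (c :: s) i.

Lemma partition_step i : (i < size s)%N -> pt i <= pt i.+1.
Proof.
by move=> iN; have [/(pathP e) h _] := cs; exact: ltW (h i iN).
Qed.

Lemma partition_mono i j : (i <= j)%N -> (j <= size s)%N -> pt i <= pt j.
Proof.
move=> /subnK <-; elim: (j - i)%N => [//|l IH]; rewrite addSn => h.
by rewrite (le_trans (IH (ltnW h)))// partition_step.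
Qed.

Lemma partition_sum : \sum_(i < size s) (pt i.+1 - pt i) = e - c.
Proof.
rewrite -(big_mkord xpredT (fun i => pt i.+1 - pt i)) telescope_sumr//.
by congr (_ - _); exact: itv_partition_nth_size cs.
Qed.

Lemma partition_disjoint : trivIset setT (fun i : 'I_(size s) => `]pt i, pt i.+1[%classic).
Proof.
move=> i j _ _ [x []]; rewrite /= !in_itv/= => /andP[h1 h2] /andP[h3 h4].
apply/val_inj/eqP; rewrite eq_sym; case: (ltngtP i j) => // ij.
  have := partition_mono ij (ltnW (ltn_ord j)).
  by move/(lt_le_trans h2)/lt_trans => /(_ _ h3); rewrite ltxx.
have := partition_mono ij (ltnW (ltn_ord i)).
by move/(lt_le_trans h4)/lt_trans => /(_ _ h1); rewrite ltxx.
Qed.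

End partition.

(** Subdividing each interval keeps the family disjoint and does not change its total length, so
    absolute continuity bounds sums of variations and not just sums of increments. *)
Lemma abs_continuous_partitions a b f : abs_continuous a b f -> forall e, 0 < e ->
  exists2 d, 0 < d & forall n (u v : 'I_n -> R) (s : 'I_n -> seq R),
  (forall i, a <= u i /\ u i <= v i /\ v i <= b) ->
  trivIset setT (fun i => `]u i, v i[%classic) ->
  \sum_(i < n) (v i - u i) < d -> (forall i, itv_partition (u i) (v i) (s i)) ->
  \sum_(i < n) variation (u i) (v i) f (s i) < e.
Proof.
move=> fac e e0; have [d d0 H] := abs_continuous_fin fac e0; exists d => // n u v s uv triv duv us.
pose pt i j := nth (v i) (u i :: s i) j.
pose T := {i : 'I_n & 'I_(size (s i))}.
pose U (p : T) := pt (tag p) (tagged p).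
pose V (p : T) := pt (tag p) (tagged p).+1.
have ptlo i j : (j <= size (s i))%N -> u i <= pt i j.
  by move=> js; exact: (itv_partition_nth_ge _ (us i)).
have pthi i j : (j <= size (s i))%N -> pt i j <= v i.
  by move=> js; exact: (itv_partition_nth_le _ (us i)).
have sumE (F : forall i : 'I_n, 'I_(size (s i)) -> R) :
  \sum_(i < n) \sum_(j < size (s i)) F i j = \sum_(p : T) F (tag p) (tagged p) by rewrite sig_big_dep.
have := H T U V.
have -> : \sum_p (V p - U p) = \sum_(i < n) (v i - u i).
  rewrite -(sumE (fun i j => pt i j.+1 - pt i j)).
  by apply: eq_bigr => i _; exact: partition_sum.
have -> : \sum_p `|f (V p) - f (U p)| = \sum_(i < n) variation (u i) (v i) f (s i).
  rewrite -(sumE (fun i j => `|f (pt i j.+1) - f (pt i j)|)).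
  by apply: eq_bigr => i _; rewrite /variation big_mkord.
apply => //.
- move=> [i j]; rewrite /U /V /=; have [u1 [u2 u3]] := uv i; split; [|split].
  + by apply: (le_trans u1); apply: ptlo; exact: ltnW.
  + by apply: partition_step.
  + by apply: le_trans u3; apply: pthi.
move=> [i j] [i' j'] _ _ [x []]; rewrite /U /V /= !in_itv/= => /andP[h1 h2] /andP[h3 h4].
have ii' : i = i'.
  apply: triv => //; exists x; split; rewrite /= in_itv/=.
    by rewrite (le_lt_trans (ptlo i j (ltnW _)))//= (lt_le_trans h2)// pthi.
  by rewrite (le_lt_trans (ptlo i' j' (ltnW _)))//= (lt_le_trans h4)// pthi.
subst i'; congr existT; apply: (partition_disjoint (us i)) => //.
by exists x; split; rewrite /= in_itv/= ?h1 ?h3.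
Qed.

Lemma abs_continuous_fin_num a b f : abs_continuous a b f ->
  forall x, a <= x -> x <= b -> total_variation a x f \is a fin_num.
Proof.
move=> fac x ax xb; have [d d0 H] := abs_continuous_partitions fac ltr01.
have small c e : a <= c -> c <= e -> e <= b -> e - c < d -> total_variation c e f \is a fin_num.
  move=> ac ce eb ecd; rewrite ge0_fin_numE ?total_variation_ge0//.
  apply: (@le_lt_trans _ _ 1%E); last exact: ltry.
  apply: ub_ereal_sup => _ [_ [s cs <-] <-]; rewrite lee_fin ltW//.
  have := H 1%N (fun _ => c) (fun _ => e) (fun _ => s).
  rewrite !big_ord1; apply => //.
  by move=> i j _ _ _; rewrite !ord1.
(* A variation over a length below d is at most 1; additivity then reaches x in finitely many steps
   of length d / 2. *)
have : exists n : nat, x - a <= n%:R * (d / 2).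
  exists (Num.truncn ((x - a) / (d / 2))).+1; have d20 : 0 < d / 2 by real_lra.
  rewrite -ler_pdivrMr//.
  have q0 : 0 <= (x - a) / (d / 2) by rewrite divr_ge0 ?subr_ge0// ltW.
  by have /andP[_ h] := truncn_itv q0; exact: ltW.
move=> [n]; elim: n x ax xb => [|n IH] x ax xb xn.
  have -> : x = a by apply/eqP; rewrite eq_le ax andbT; move: xn; rewrite mul0r subr_le0.
  by rewrite total_variationxx.
have [xd|xd] := leP x (a + d / 2); first by apply: small => //; real_lra.
rewrite (@total_variationD _ a x (x - d / 2)); [|real_lra|real_lra].
rewrite fin_numD IH/=; [|real_lra|real_lra|by move: xn; rewrite -natr1 mulrDl mul1r; real_lra].
by apply: small; real_lra.
Qed.

Lemma variation_approx c e f eta : c <= e -> 0 < eta -> total_variation c e f \is a fin_num ->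
  exists2 s, itv_partition c e s & fine (total_variation c e f) < variation c e f s + eta.
Proof.
move=> ce eta0 fin.
have : (total_variation c e f - eta%:E < total_variation c e f)%E.
  by rewrite -(fineK fin) -EFinB lte_fin; real_lra.
move/ereal_sup_gt => [_ [_ [s cs <-] <-]] h; exists s => //.
by move: h; rewrite -(fineK fin) -EFinB lte_fin; real_lra.
Qed.

Lemma abs_continuous_variation a b f : abs_continuous a b f ->
  abs_continuous a b (fun x => fine (total_variation a x f)).
Proof.
move=> fac e e0; have e20 : 0 < e / 2 by real_lra.
have [d d0 H] := abs_continuous_partitions fac e20; exists d => // n u v uv triv duv.
have uv' i : a <= u i /\ u i <= v i /\ v i <= b by exact: uv.
have fin1 i : total_variation a (u i) f \is a fin_num.
  by have [h1 [h2 h3]] := uv i; apply: (abs_continuous_fin_num fac) => //; exact: le_trans h3.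
have fin2 i : total_variation a (v i) f \is a fin_num.
  by have [h1 [h2 h3]] := uv i; apply: (abs_continuous_fin_num fac) => //; exact: le_trans h2.
have tvD i : total_variation a (v i) f = (total_variation a (u i) f + total_variation (u i) (v i) f)%E.
  by have [h1 [h2 h3]] := uv i; exact: total_variationD.
have fin3 i : total_variation (u i) (v i) f \is a fin_num.
  by have := fin2 i; rewrite tvD fin_numD => /andP[].
(* Each variation is approached within eta by a partition; the n errors add up to at most e / 2. *)
pose eta := e / 2 / n.+1%:R.
have eta0 : 0 < eta by rewrite divr_gt0.
have /choice[s Hs] : forall i : 'I_n, exists s, itv_partition (u i) (v i) s /\
    fine (total_variation (u i) (v i) f) < variation (u i) (v i) f s + eta.
  move=> i; have [h1 [h2 h3]] := uv i.
  by have [s s1 s2] := variation_approx h2 eta0 (fin3 i); exists s.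
have := H n u v s uv triv duv (fun i => (Hs i).1) => Hlt.
apply: (@le_lt_trans _ _ (\sum_(i < n) (variation (u i) (v i) f (s i) + eta))).
  apply: ler_sum => i _; have [h1 [h2 h3]] := uv i.
  rewrite tvD fineD// addrAC subrr add0r ger0_norm; first by exact: ltW (Hs i).2.
  by rewrite fine_ge0// total_variation_ge0.
rewrite big_split /= sumr_const card_ord -mulr_natr.
have : eta * n%:R <= e / 2.
  by rewrite /eta mulrAC ler_pdivrMr// ler_wpM2l ?ler_nat// ltW.
real_lra.
Qed.

Lemma abs_continuousD a b f g : abs_continuous a b f -> abs_continuous a b g ->
  abs_continuous a b (fun x => f x + g x).
Proof.
move=> fac gac e e0; have e20 : 0 < e / 2 by real_lra.
have [d1 d10 H1] := fac _ e20; have [d2 d20 H2] := gac _ e20.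
exists (Num.min d1 d2) => [|n u v uv triv]; first by rewrite lt_min d10.
rewrite lt_min => /andP[s1 s2].
apply: (@le_lt_trans _ _ (\sum_(i < n) (`|f (v i) - f (u i)| + `|g (v i) - g (u i)|))).
  apply: ler_sum => i _; apply: le_trans (ler_normD _ _); rewrite le_eqVlt; apply/orP; left.
  by apply/eqP; congr `|_|; ring.
by rewrite big_split /=; have := H1 n u v uv triv s1; have := H2 n u v uv triv s2; real_lra.
Qed.

Lemma abs_continuousN a b f : abs_continuous a b f -> abs_continuous a b (fun x => - f x).
Proof.
move=> fac e /fac[d d0 H]; exists d => // n u v uv triv s.
by under eq_bigr do rewrite -opprD normrN; exact: H.
Qed.

(** With V the variation function, V + f and V - f are nondecreasing and still absolutely
    continuous. This reduces densities to the monotone case, where a Stieltjes measure exists. *)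
Lemma abs_continuous_jordan a b f : abs_continuous a b f -> exists W1 W2 : R -> R,
  [/\ abs_continuous a b W1, abs_continuous a b W2,
      forall x y, a <= x -> x <= y -> y <= b -> W1 x <= W1 y /\ W2 x <= W2 y &
      forall x, f x = (W1 x - W2 x) / 2].
Proof.
move=> fac; pose V x := fine (total_variation a x f).
have Vac : abs_continuous a b V by exact: abs_continuous_variation.
exists (fun x => V x + f x), (fun x => V x - f x); split.
- exact: abs_continuousD.
- by apply: abs_continuousD => //; exact: abs_continuousN.
- move=> x y ax xy yb.
  have fx := abs_continuous_fin_num fac ax (le_trans xy yb).
  have fy := abs_continuous_fin_num fac (le_trans ax xy) yb.
  have D := total_variationD f ax xy.
  have fxy : total_variation x y f \is a fin_num by move: fy; rewrite D fin_numD => /andP[].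
  have VE : V y = V x + fine (total_variation x y f) by rewrite /V D fineD.
  have := total_variation_ge f xy; rewrite -(fineK fxy) lee_fin => h.
  have := ler_norm (f y - f x); have := ler_norm (- (f y - f x)); rewrite normrN.
  by split; real_lra.
- by move=> x; field.
Qed.

End absolute_continuity.

(** * Densities of absolutely continuous functions *)

Section density.
Import finmap.
Context {R : realType}.
Local Notation mu := (@lebesgue_measure R).
Local Notation TR := (measurableTypeR R).
Implicit Types (a b c d e : R) (f g : R -> R).

(** Composition with it extends a function on [a, b] by constants, giving a distribution function on
    the whole line. *)
Definition clamp a b (x : R) : R := Num.max a (Num.min b x).

Lemma clamp_itv a b x : a <= b -> a <= clamp a b x <= b.
Proof. by move=> ab; rewrite /clamp le_max lexx ge_max ab ge_min lexx. Qed.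

Lemma clamp_id a b x : a <= x -> x <= b -> clamp a b x = x.
Proof. by move=> ax xb; rewrite /clamp (min_idPr xb) (max_idPr ax). Qed.

Lemma clamp_mono a b x y : x <= y -> clamp a b x <= clamp a b y.
Proof.
move=> xy; rewrite /clamp.
by case: (leP b x) => bx; case: (leP b y) => yb; case: (leP a b) => h0;
  case: (leP a x) => h1; case: (leP a y) => h2; real_lra.
Qed.

Lemma clamp_lip a b x y : a <= b -> x <= y -> clamp a b y - clamp a b x <= y - x.
Proof.
move=> ab xy; rewrite /clamp.
by case: (leP b x) => bx; case: (leP b y) => yb; case: (leP a b) => h0;
  case: (leP a x) => h1; case: (leP a y) => h2; real_lra.
Qed.

Lemma abs_continuous_clamp a b f : a <= b -> abs_continuous a b f -> forall e, 0 < e ->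
  exists2 d, 0 < d & forall (T : finType) (u v : T -> R), (forall i, u i <= v i) ->
  trivIset setT (fun i => `]u i, v i[%classic) -> \sum_i (v i - u i) < d ->
  \sum_i `|f (clamp a b (v i)) - f (clamp a b (u i))| < e.
Proof.
move=> ab fac e e0; have [d d0 H] := abs_continuous_fin fac e0; exists d => // T u v uv triv duv.
apply: (H T (clamp a b \o u) (clamp a b \o v)).
- move=> i /=; have /andP[h1 _] := clamp_itv (u i) ab; have /andP[_ h2] := clamp_itv (v i) ab.
  by split => //; split => //; exact: clamp_mono.
- move=> i j _ _ [x []]; rewrite /= !in_itv/= => /andP[h1 h2] /andP[h3 h4].
  have /andP[ai _] := clamp_itv (u i) ab; have /andP[_ bi] := clamp_itv (v i) ab.
  have ax : a <= x by apply: (le_trans ai); exact: ltW.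
  have xb : x <= b by apply: le_trans bi; exact: ltW.
  have lt1 w : clamp a b w < x -> w < x.
    by rewrite !ltNge; apply: contra => xw; rewrite -(clamp_id ax xb) clamp_mono.
  have lt2 w : x < clamp a b w -> x < w.
    by rewrite !ltNge; apply: contra => xw; rewrite -(clamp_id ax xb) clamp_mono.
  apply: triv => //; exists x; split; rewrite /= in_itv/=.
    by rewrite lt1// lt2.
  by rewrite lt1// lt2.
- apply: le_lt_trans duv; apply: ler_sum => i _; exact: clamp_lip.
Qed.

(** A finite union of half-open intervals is a disjoint union of such intervals. The same
    decomposition computes [mu] as a sum of lengths and [nu] as a sum of increments of W, which
    absolute continuity compares. *)
Lemma measure_ring_le (nu : {measure set TR -> \bar R}) (W : R -> R) d e :
  (forall x y, x <= y -> nu `]x, y]%classic = (W y - W x)%:E) ->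
  (forall x y, x <= y -> W x <= W y) ->
  (forall (T : finType) (u v : T -> R), (forall i, u i <= v i) ->
     trivIset setT (fun i => `]u i, v i[%classic) -> \sum_i (v i - u i) < d ->
     \sum_i `|W (v i) - W (u i)| < e) ->
  forall (I : nat -> set TR) n, (forall i, ocitv (I i)) ->
  (mu (\big[setU/set0]_(i < n) I i) < d%:E)%E -> (nu (\big[setU/set0]_(i < n) I i) <= e%:E)%E.
Proof.
move=> nuE Wmono Wac I n Iocitv.
set A := \big[setU/set0]_(i < n) I i.
have mA : (measurable (A : set (SetRing.type (ocitv_type R)))).
  by apply: bigsetU_measurable => i _; apply: SetRing.measurable_subring; exact: Iocitv.
have [B [finB B0 trivB mB AE]] := SetRing.ring_finite_set mA.
have {}AE : A = \bigcup_(X in B) X by [].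
have /choice[p Hp] : forall X : set R, exists p : R * R, B X -> p.1 < p.2 /\ X = `]p.1, p.2]%classic.
  move=> X; have [BX|] := pselect (B X); last by exists (0, 0).
  have := mB X (mem_set BX) => /ocitvP[X0|[x x12 XE]]; last by exists x.
  by have := B0 X BX; rewrite X0 => -[].
have mX X : B X -> measurable (X : set TR).
  by move=> BX; have [_ ->] := Hp X BX; exact: measurable_itv.
have sumE (m : {measure set TR -> \bar R}) (V : R -> R) :
    (forall x y, x <= y -> m `]x, y]%classic = (V y - V x)%:E) ->
    m A = (\sum_(X : fset_set B) (V (p (val X)).2 - V (p (val X)).1))%:E.
  move=> mE; rewrite AE measure_fin_bigcup//.
  rewrite fsbig_finite//= big_seq_fsetE/= -sumEFin; apply: eq_bigr => X _.
  have BX : B (val X) by have := valP X; rewrite in_fset_set// => /set_mem.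
  by have [h XE] := Hp _ BX; rewrite {1}XE mE// ltW.
have muE (x y : R) : x <= y -> mu `]x, y]%classic = (idfun y - idfun x)%:E.
  move=> xy; rewrite lebesgue_measure_itv/= lte_fin; case: ltP => // yx.
  by rewrite (_ : y = x) ?subrr//; apply/eqP; rewrite eq_le xy yx.
rewrite (sumE mu idfun muE) (sumE nu W nuE) lte_fin lee_fin => small.
apply: ltW; apply: le_lt_trans (Wac (fset_set B) (fun X => (p (val X)).1) (fun X => (p (val X)).2) _ _ small).
- by apply: ler_sum => X _; exact: ler_norm.
- by move=> X; have BX : B (val X) by [have := valP X; rewrite in_fset_set// => /set_mem]; exact: ltW (Hp _ BX).1.
move=> X Y _ _ [x [hx hy]]; apply/val_inj.
have BX : B (val X) by have := valP X; rewrite in_fset_set// => /set_mem.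
have BY : B (val Y) by have := valP Y; rewrite in_fset_set// => /set_mem.
apply: (trivB _ _ BX BY); exists x; split => /=.
  by have [_ ->] := Hp _ BX; move: hx; rewrite /= !in_itv/= => /andP[-> /ltW].
by have [_ ->] := Hp _ BY; move: hy; rewrite /= !in_itv/= => /andP[-> /ltW].
Qed.

(** A null set has covers of arbitrarily small total length. Finite parts of such a cover have small
    [nu] measure by [measure_ring_le], and continuity from below passes to the whole cover. *)
Lemma measure_null_of_abs_continuous (nu : {measure set TR -> \bar R}) (W : R -> R) :
  (forall x y, x <= y -> nu `]x, y]%classic = (W y - W x)%:E) ->
  (forall x y, x <= y -> W x <= W y) ->
  (forall e, 0 < e -> exists2 d, 0 < d & forall (T : finType) (u v : T -> R), (forall i, u i <= v i) ->
     trivIset setT (fun i => `]u i, v i[%classic) -> \sum_i (v i - u i) < d ->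
     \sum_i `|W (v i) - W (u i)| < e) ->
  forall N : set TR, measurable N -> mu N = 0%E -> nu N = 0%E.
Proof.
move=> nuE Wmono Wac N mN N0; apply/eqP; rewrite eq_le measure_ge0 andbT.
apply/lee_addgt0Pr => e e0; rewrite add0e; have [d d0 H] := Wac e e0.
have : (mu N < d%:E)%E by rewrite N0 lte_fin.
move/ereal_inf_lt => [_ [I [mI NI] <-] Id].
have mI' i : measurable (I i : set TR) by apply: sub_sigma_algebra; exact: mI.
pose A n := \big[setU/set0]_(i < n) (I i : set TR).
have mA n : measurable (A n) by exact: bigsetU_measurable.
have muA n : (mu (A n) < d%:E)%E.
  apply: le_lt_trans Id; apply: (@le_trans _ _ (\sum_(i < n) mu (I i))%E).
    exact: (content_subadditive mu).
  apply: (@le_trans _ _ (\sum_(0 <= i < n) wlength idfun (I i))%E).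
    rewrite big_mkord; apply: lee_sum => i _; rewrite le_eqVlt; apply/orP; left; apply/eqP.
    exact: measurable_mu_extE.
  by apply: nneseries_lim_ge => i _ _; exact: wlength_ge0.
have nuA n : (nu (A n) <= e%:E)%E by apply: (measure_ring_le nuE Wmono H) => //; exact: muA.
have UA : \bigcup_n I n = \bigcup_n A n.
  apply/seteqP; split=> x [n _ Inx]; first by exists n.+1 => //; rewrite /A big_ord_recr; right.
  by move: Inx; rewrite /A -bigcup_mkord => -[i _ Ix]; exists i.
have mUA : measurable (\bigcup_n A n) by apply: bigcupT_measurable; exact: mA.
apply: (@le_trans _ _ (nu (\bigcup_n A n))).
  apply: le_measure; first exact: mem_set.
  - exact: mem_set.
  - by move: NI; rewrite -UA.
have ndA : nondecreasing_seq A.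
  move=> l n ln; apply/subsetPset => x; rewrite /A -!bigcup_mkord => -[i /= il Ix].
  by exists i => //=; exact: leq_trans ln.
have cvA := @nondecreasing_cvg_mu _ _ _ nu A mA mUA ndA.
rewrite -(cvg_lim _ cvA)//; apply: lime_le; first by apply/cvg_ex; eexists; exact: cvA.
by apply: nearW => n; exact: nuA.
Qed.

Lemma monotone_density a b (W : R -> R) : a < b -> abs_continuous a b W ->
  (forall x y, a <= x -> x <= y -> y <= b -> W x <= W y) ->
  exists g : TR -> R, [/\ measurable_fun setT g, mu.-integrable setT (EFin \o g) &
    forall x y, a <= x -> x <= y -> y <= b -> (W y - W x)%:E = (\int[mu]_(z in `[x, y]) (g z)%:E)%E].
Proof.
move=> ab Wac Wmono; pose V := W \o clamp a b.
have Vac := abs_continuous_clamp (ltW ab) Wac.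
have Vmono x y : x <= y -> V x <= V y.
  move=> xy; have /andP[h1 _] := clamp_itv x (ltW ab); have /andP[_ h2] := clamp_itv y (ltW ab).
  by apply: Wmono => //; exact: clamp_mono.
have Vrc : right_continuous V.
  move=> x; apply/cvgrPdist_lt => e e0; have [d d0 H] := Vac e e0.
  near=> y.
  have xy : x <= y by near: y; exact: nbhs_right_ge.
  have := H 'I_1 (fun _ => x) (fun _ => y).
  rewrite !big_ord1 distrC; apply => //; first by move=> i j _ _ _; rewrite !ord1.
  by near: y; exact: nbhs_right_ltDr.
pose Vc : cumulative R R := HB.pack V (isCumulative.Build R _ R V Vmono Vrc).
pose nu := lebesgue_stieltjes_measure Vc.
have nuE x y : x <= y -> nu `]x, y]%classic = (V y - V x)%:E.
  move=> xy; rewrite /nu /lebesgue_stieltjes_measure /measure_extension measurable_mu_extE; last exact: is_ocitv.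
  exact: wlength_itv_bnd.
(* Restricting to ]a, b] gives a finite measure for Radon-Nikodym and keeps all the increments
   inside [a, b]. *)
have mD : measurable (`]a, b]%classic : set TR) by exact: measurable_itv.
have finD : (nu `]a, b]%classic < +oo)%E by rewrite nuE ?(ltW ab)// ltry.
pose nu' := mfrestr mD finD.
have nu'mu : nu' `<< mu.
  apply/null_content_dominatesP => A mA A0.
  apply/eqP; rewrite eq_le measure_ge0 andbT.
  rewrite -(measure_null_of_abs_continuous nuE Vmono Vac mA A0).
  change (nu (A `&` `]a, b]%classic) <= nu A)%E.
  apply: le_measure; last exact: subIsetl.
  - by apply: mem_set; apply: measurableI.
  - exact: mem_set.
have [f [f0 ffin fint fE]] := @radon_nikodym_sigma_finite _ _ _ mu nu' nu'mu.
exists (fine \o f); have fK : EFin \o (fine \o f) = f by apply/funext => x /=; rewrite fineK.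
split.
- by apply: measurableT_comp => //; exact: measurable_int fint.
- by rewrite fK.
move=> x y ax xy yb.
have -> : (\int[mu]_(z in `[x, y]) ((fine \o f) z)%:E = \int[mu]_(z in `[x, y]) f z)%E.
  by apply: eq_integral => z _; rewrite /= fineK.
rewrite -integral_itv_obnd_cbnd; last by apply: measurable_funTS; exact: measurable_int fint.
rewrite -fE; last exact: measurable_itv.
change ((W y - W x)%:E = nu (`]x, y]%classic `&` `]a, b]%classic)); rewrite setIidl; last first.
  by move=> z; rewrite /= !in_itv/= => /andP[xz zy]; rewrite (le_lt_trans ax xz) (le_trans zy yb).
by rewrite nuE// /V /= !clamp_id// ?(le_trans ax xy) ?(le_trans xy yb).
Unshelve. all: by end_near. Qed.

Lemma abs_continuous_density a b f : a < b -> abs_continuous a b f ->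
  exists g : TR -> R, [/\ measurable_fun setT g, mu.-integrable setT (EFin \o g) &
    forall x y, a <= x -> x <= y -> y <= b -> f y - f x = (\int[mu]_(z in `[x, y]) g z)%R].
Proof.
move=> ab fac; have [W1 [W2 [W1ac W2ac Wmono fE]]] := abs_continuous_jordan fac.
have [g1 [mg1 ig1 g1E]] := monotone_density ab W1ac (fun x y ax xy yb => (Wmono x y ax xy yb).1).
have [g2 [mg2 ig2 g2E]] := monotone_density ab W2ac (fun x y ax xy yb => (Wmono x y ax xy yb).2).
have iB : mu.-integrable setT (EFin \o (fun x => g1 x - g2 x)).
  by have := integrableB measurableT ig1 ig2; apply: eq_integrable.
exists (fun x => (g1 x - g2 x) / 2); split.
- by apply: measurable_funM => //; exact: measurable_funB.
- have := integrableZl measurableT 2^-1 iB; apply: eq_integrable => // x _ /=.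
  by rewrite -EFinM mulrC.
move=> x y ax xy yb.
have mxy : measurable (`[x, y]%classic : set TR) by exact: measurable_itv.
have i1 : mu.-integrable `[x, y] (EFin \o g1) by apply: integrableS ig1.
have i2 : mu.-integrable `[x, y] (EFin \o g2) by apply: integrableS ig2.
have -> : \int[mu]_(z in `[x, y]) ((g1 z - g2 z) / 2) = 2^-1 * (\int[mu]_(z in `[x, y]) g1 z - \int[mu]_(z in `[x, y]) g2 z).
  rewrite -RintegralB// -RintegralZl//; last by have := integrableB mxy i1 i2; apply: eq_integrable.
  by apply: eq_Rintegral => z _; rewrite mulrC.
by rewrite /Rintegral -g1E// -g2E//= !fE; field.
Qed.

(** Lebesgue's differentiation theorem for the indefinite integral of the density identifies the
    density with the derivative almost everywhere. *)
Lemma abs_continuous_derive1 a b f : a < b -> abs_continuous a b f ->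
  exists g : TR -> R, [/\ measurable_fun setT g, mu.-integrable setT (EFin \o g),
    forall x y, a <= x -> x <= y -> y <= b -> f y - f x = (\int[mu]_(z in `[x, y]) g z)%R &
    {ae mu, forall x, a < x < b -> derive1 f x = g x}].
Proof.
move=> ab fac; have [g [mg ig gE]] := abs_continuous_density ab fac; exists g; split => //.
have ig' y : mu.-integrable [set` Interval (BLeft a) (BRight y)] (EFin \o g) by apply: integrableS ig.
have lg : locally_integrable [set: R] g.
  split => //; first exact: openT.
  move=> K _ cK; have : mu.-integrable (K : set TR) (EFin \o g) by apply: integrableS ig => //; exact: compact_measurable.
  by move=> /integrableP[_].
apply: (@filterS _ _ (ae_filter_ringOfSetsType mu) _ _ _ (FTC1 ig' lg)) => x Hx /andP[ax xb].
have [|dF FE] := Hx; first by rewrite lte_fin.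
rewrite -FE.
set F := (fun x => _) in dF FE *.
have -> : derive1 f x = derive1 (cst (f a) + F) x.
  rewrite !derive1E; apply: near_eq_derive.
  near=> y.
  have /andP[/ltW ay /ltW yb] : a < y < b.
    have : y \in `]a, b[ by near: y; apply: near_in_itvoo; rewrite inE/=; apply/andP.
    by rewrite in_itv.
  by rewrite /= -(subrK (f a) (f y)) gE// addrC.
rewrite !derive1E deriveD; [by rewrite derive_cst add0r|exact: derivable_cst|exact: dF].
Unshelve. all: by end_near. Qed.

End density.

(** * Taylor's formula and the direct estimate *)

Section taylor.
Context {R : realType}.
Local Notation mu := (@lebesgue_measure R).
Local Notation TR := (measurableTypeR R).
Implicit Types (G H h : R -> R).

Lemma ACloc_continuous H x : ACloc H -> -1 < x -> x < 1 -> {for x, continuous H}.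
Proof.
move=> Hac x1 x2; pose a := (x - 1) / 2; pose b := (x + 1) / 2.
have Ha : abs_continuous a b H by apply: Hac; rewrite /a /b; real_lra.
have xab : x \in `]a, b[ by rewrite in_itv/= /a /b; apply/andP; split; real_lra.
apply/cvgrPdist_lt => e e0; have [d d0 {}Ha] := Ha e e0.
near=> y.
have yd : `|x - y| < d by near: y; exists d.
have : y \in `]a, b[ by near: y; exact: (near_in_itvoo xab).
rewrite in_itv/= => /andP[ay yb].
have ax : a < x by rewrite /a; real_lra.
have xb : x < b by rewrite /b; real_lra.
have [xy|/ltW yx] := leP x y.
- have := Ha 1%N (fun _ => x) (fun _ => y); rewrite !big_ord1 distrC; apply.
  + by move=> _; split; [exact: ltW|split; [exact: xy|exact: ltW]].
  + by move=> i j _ _ _; rewrite !ord1.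
  + by move: yd; rewrite distrC ger0_norm ?subr_ge0.
- have := Ha 1%N (fun _ => y) (fun _ => x); rewrite !big_ord1; apply.
  + by move=> _; split; [exact: ltW|split; [exact: yx|exact: ltW]].
  + by move=> i j _ _ _; rewrite !ord1.
  + by move: yd; rewrite ger0_norm ?subr_ge0.
Unshelve. all: by end_near. Qed.

Lemma ACloc_increment_le H h c d : ACloc H -> measurable_fun setT h ->
  {ae mu, forall x, -1 < x < 1 -> derive1 H x = h x} -> -1 < c -> c <= d -> d < 1 ->
  (`|H d - H c|%:E <= \int[mu]_(u in `]c, d[) `|h u|%:E)%E.
Proof.
move=> Hac mh Hh c1 cd d1; pose a := (c - 1) / 2; pose b := (d + 1) / 2.
have ab : a < b by rewrite /a /b; real_lra.
have Ha : abs_continuous a b H by apply: Hac; rewrite /a /b; real_lra.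
have [g [mg ig gE Hg]] := abs_continuous_derive1 ab Ha.
have ac : a <= c by rewrite /a; real_lra.
have db : d <= b by rewrite /b; real_lra.
rewrite gE//.
have mD : measurable (`[c, d]%classic : set TR) by exact: measurable_itv.
have igD : mu.-integrable `[c, d] (EFin \o g) by apply: integrableS ig.
have -> : (\int[mu]_(u in `]c, d[) `|h u|%:E = \int[mu]_(u in `[c, d]) `|h u|%:E)%E.
  rewrite [RHS]integral_itv_bndoo//.
  by apply: measurable_funTS; apply/measurable_EFinP; exact: measurableT_comp.
have -> : (\int[mu]_(u in `[c, d]) `|h u|%:E = \int[mu]_(u in `[c, d]) `|g u|%:E)%E.
  apply: ge0_ae_eq_integral => //.
  - by apply: measurable_funTS; apply/measurable_EFinP; exact: measurableT_comp.
  - by apply: measurable_funTS; apply/measurable_EFinP; exact: measurableT_comp.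
  - apply: (@filterS2 _ _ (ae_filter_ringOfSetsType mu) _ _ _ _ Hh Hg) => x h1 h2.
    rewrite /= in_itv/= => /andP[cx xd]; rewrite -h1; last by rewrite (lt_le_trans c1 cx) (le_lt_trans xd d1).
    rewrite h2// /a /b; apply/andP; split; real_lra.
have fing := integrable_fin_num mD igD.
rewrite /Rintegral -abse_EFin fineK; last exact: fing.
by apply: le_abse_integral => //; exact: measurable_int igD.
Qed.

Lemma increment_le_derivative G H c d : -1 < c -> c <= d -> d < 1 ->
  (forall x, -1 < x < 1 -> derivable G x 1) ->
  (forall x, -1 < x < 1 -> {for x, continuous H}) ->
  (forall x, -1 < x < 1 -> derive1 G x = H x) ->
  (`|G d - G c|%:E <= \int[mu]_(w in `[c, d]) `|H w|%:E)%E.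
Proof.
move=> c1; rewrite le_eqVlt => /predU1P[<- _ _ _ _|cd d1 dG cH GH].
  by rewrite subrr normr0; exact: integral_ge0.
have cG x : -1 < x < 1 -> {for x, continuous G}.
  by move=> x1; apply: differentiable_continuous; apply/derivable1_diffP; exact: dG.
have itvP x : c <= x -> x <= d -> -1 < x < 1 by move=> cx xd; rewrite (lt_le_trans c1 cx) (le_lt_trans xd d1).
have wH : {within `[c, d], continuous H}.
  apply: continuous_in_subspaceT => x; rewrite inE/= in_itv/= => /andP[cx xd].
  by apply: cH; exact: itvP.
have mD : measurable (`[c, d]%classic : set TR) by exact: measurable_itv.
rewrite -abse_EFin EFinB -(@continuous_FTC2 _ H G c d cd wH).
- apply: le_abse_integral => //; apply/measurable_EFinP.
  exact: subspace_continuous_measurable_fun.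
- split.
  + by move=> x; rewrite in_itv/= => /andP[cx xd]; apply: dG; apply: itvP; exact: ltW.
  + by apply: cvg_at_right_filter; apply: cG; apply: itvP => //; exact: ltW.
  + by apply: cvg_at_left_filter; apply: cG; apply: itvP => //; exact: ltW.
- by move=> x; rewrite in_itv/= => /andP[cx xd]; apply: GH; apply: itvP; exact: ltW.
Qed.

Lemma between_trans (x z w u : R) : Num.min x z <= w <= Num.max x z ->
  Num.min x w < u < Num.max x w ->
  [/\ Num.min x z < u < Num.max x z, Num.min u z <= w <= Num.max u z & `|w - u| <= `|z - u|].
Proof.
have [xz|zx] := leP x z => /andP[h1 h2]; have [xw|wx] := leP x w => /andP[h3 h4]; try real_lra.
- have uz : u <= z by real_lra.
  by rewrite (min_idPl uz) (max_idPr uz) !ger0_norm; try split; try (apply/andP; split); real_lra.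
- have zu : z <= u by real_lra.
  by rewrite (min_idPr zu) (max_idPl zu) !ler0_norm; try split; try (apply/andP; split); real_lra.
Qed.

(** Induction on k applied to G': an antiderivative of its polynomial approximates G, and the bound
    is integrated from x to z. Constants are not tracked, so the factor 1 / k! does not appear. *)
Lemma taylor_remainder k G h x : measurable_fun setT h ->
  (forall j y, (j < k)%N -> -1 < y < 1 -> derivable (derive1n j G) y 1) ->
  ACloc (derive1n k G) ->
  {ae mu, forall y, -1 < y < 1 -> derive1n k.+1 G y = h y} -> -1 < x < 1 ->
  exists2 P : {poly R}, (size P <= k.+1)%N & forall z, -1 < z < 1 ->
    (`|G z - P.[z]|%:E <= \int[mu]_(u in `]Num.min x z, Num.max x z[) (`|z - u| ^+ k * `|h u|)%:E)%E.
Proof.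
move=> mh; elim: k G => [|k IH] G dG Gac Gh x1.
  exists (G x)%:P; first by rewrite size_polyC; case: eqP.
  move=> z /andP[z1 z2]; have /andP[x2 x3] := x1; rewrite hornerC.
  under eq_integral do rewrite expr0 mul1r.
  have [xz|/ltW zx] := leP x z; first exact: ACloc_increment_le.
  by rewrite distrC; exact: ACloc_increment_le.
have dSn j : derive1n j (derive1 G) = derive1n j.+1 G by rewrite /derive1n iterSr.
have [||||P sP HP] := IH (derive1 G).
- by move=> j y jk y1; rewrite dSn; exact: dG.
- by rewrite dSn.
- by rewrite dSn.
- by [].
pose Q := polyprim P + (G x - (polyprim P).[x])%:P.
have sQ : (size Q <= k.+2)%N.
  rewrite /Q (leq_trans (size_polyD _ _))// geq_max (leq_trans (size_polyprim P)) ?ltnS//.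
  by rewrite size_polyC; case: eqP.
exists Q => // z z1.
have Qx : Q.[x] = G x by rewrite /Q hornerD hornerC addrC subrK.
have Q' : Q^`() = P by rewrite /Q derivD derivC addr0 deriv_polyprim.
have cG' y : -1 < y < 1 -> {for y, continuous (derive1 G)}.
  move=> y1; have /andP[y2 y3] := y1; case: k dG Gac {IH Gh dSn HP sP sQ} => [|k] dG Gac.
    exact: (ACloc_continuous Gac).
  by apply: differentiable_continuous; apply/derivable1_diffP; exact: (dG 1%N).
pose c := Num.min x z; pose d := Num.max x z.
have /andP[x2 x3] := x1; have /andP[z2 z3] := z1.
have c1 : -1 < c by rewrite lt_min x2 z2.
have d1 : d < 1 by rewrite gt_max x3 z3.
have cd : c <= d by rewrite le_max ge_min lexx.
have cH y : -1 < y < 1 -> {for y, continuous (fun w => derive1 G w - P.[w])}.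
  by move=> y1; apply: cvgB; [exact: cG'|exact: continuous_horner].
have key : (`|G z - Q.[z]|%:E <= \int[mu]_(w in `[c, d]) `|derive1 G w - P.[w]|%:E)%E.
  have dGQ y : -1 < y < 1 -> derivable (G - horner Q) y 1.
    by move=> y1; apply: derivableB; [exact: (dG 0%N)|exact: derivable_horner].
  have GQ' y : -1 < y < 1 -> derive1 (G - horner Q) y = derive1 G y - P.[y].
    move=> y1; rewrite !derive1E deriveB; [|exact: (dG 0%N)|exact: derivable_horner].
    by congr (_ - _); rewrite -(derive1E (horner Q)) -derivE Q'.
  have := increment_le_derivative c1 cd d1 dGQ cH GQ'; apply: le_trans; rewrite lee_fin.
  rewrite /c /d; have [xz|zx] := leP x z; rewrite !fctE Qx subrr ?subr0 ?sub0r ?normrN//.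
apply: (le_trans key).
(* The indicator encodes the region where u lies strictly between x and w. Once the integrals are
   exchanged, w runs between u and z, and its length |z - u| supplies the additional power. *)
pose K (p : TR * TR) : R :=
  (if (Num.min x p.1 < p.2) && (p.2 < Num.max x p.1) then 1 else 0) * (`|p.1 - p.2| ^+ k * `|h p.2|).
have mK : measurable_fun setT K.
  apply: measurable_funM; last first.
    apply: measurable_funM; last by apply: measurableT_comp => //; apply: measurableT_comp => //.
    by apply: measurable_funX; apply: measurableT_comp => //; exact: measurable_funB.
  apply: measurable_fun_if => //; apply: measurable_and.
  - by apply: measurable_fun_ltr => //; exact: measurable_minr.
  - by apply: measurable_fun_ltr => //; exact: measurable_maxr.
have K0 p : 0 <= K p by rewrite /K; case: ifP => _; rewrite ?mul1r ?mul0r// mulr_ge0// exprn_ge0.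
have mcd : measurable (`[c, d]%classic : set TR) by exact: measurable_itv.
have mcd' : measurable (`]c, d[%classic : set TR) by exact: measurable_itv.
apply: (@le_trans _ _ (\int[mu]_(w in `[c, d]) \int[mu]_(u in `]c, d[) (K (w, u))%:E)%E).
  apply: ge0_le_integral => //.
  - apply/measurable_EFinP; apply: measurableT_comp => //.
    apply: subspace_continuous_measurable_fun => //; apply: continuous_in_subspaceT => w.
    rewrite inE/= in_itv/= => /andP[cw wd].
    by apply: cH; rewrite (lt_le_trans c1 cw) (le_lt_trans wd d1).
  - by apply: measurable_funTS; exact: measurable_inner.
  move=> w; rewrite /= in_itv/= => /andP[cw wd].
  have w1 : -1 < w < 1 by rewrite (lt_le_trans c1 cw) (le_lt_trans wd d1).
  apply: (le_trans (HP w w1)).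
  have mw : measurable_fun setT (fun u : TR => `|w - u| ^+ k * `|h u|).
    apply: measurable_funM; last exact: measurableT_comp.
    by apply: measurable_funX; apply: measurableT_comp => //; exact: measurable_funB.
  apply: le_integral_fin => //; first exact: measurable_section mK.
  move=> u; rewrite /= in_itv/= => /andP[h1 h2]; left; rewrite in_itv/= /K/= h1 h2 mul1r lexx; split => //.
  have cwd : c <= w <= d by rewrite cw.
  have hu : Num.min x w < u < Num.max x w by rewrite h1.
  by have [] := between_trans cwd hu.
rewrite tonelli//.
apply: ge0_le_integral => //.
- by move=> u _; apply: integral_ge0 => w _; rewrite lee_fin K0.
- by apply: measurable_funTS; apply: (measurable_inner (G := fun q => K (q.2, q.1))) => //; apply: measurableT_comp => //; exact: measurable_swap.
- apply: measurable_funTS; apply/measurable_EFinP; apply: measurable_funM; last exact: measurableT_comp.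
  by apply: measurable_funX; apply: measurableT_comp => //; exact: measurable_funB.
move=> u; rewrite /= in_itv/= => /andP[cu ud].
apply: (@le_trans _ _ (\int[mu]_(w in `[Num.min u z, Num.max u z]) (cst (`|z - u| ^+ k * `|h u|) w)%:E)%E).
  apply: le_integral_fin => //.
  - exact: measurable_section2 mK.
  - by move=> w; rewrite /= mulr_ge0// exprn_ge0.
  move=> w; rewrite /= in_itv/= => /andP[cw wd]; rewrite in_itv/= /K/=.
  case: ifPn => [/andP[h1 h2]|_]; last by right; rewrite mul0r.
  have cwd : c <= w <= d by rewrite cw.
  have hu : Num.min x w < u < Num.max x w by rewrite h1.
  have [_ uw wz] := between_trans cwd hu.
  by left; rewrite mul1r; split => //; rewrite ler_wpM2r// lerXn2r ?nnegrE.
rewrite (_ : (\int[mu]_(w in _) _)%E = (\int[mu]_(w in `[Num.min u z, Num.max u z]) cst (`|z - u| ^+ k * `|h u|)%:E w)%E)//.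
rewrite integral_cst//= itv_measureE; last by rewrite le_max ge_min lexx.
have -> : Num.max u z - Num.min u z = `|z - u|.
  by have [uz|zu] := leP u z; [rewrite ger0_norm ?subr_ge0|rewrite ltr0_norm ?subr_lt0 ?opprB].
by rewrite -EFinM lee_fin exprSr mulrAC.
Qed.

(** The difference annihilates the Taylor polynomial at the centre x. If u lies between x and a node
    z, then |z - u| = |z - x| - |u - x| <= k s / 2 - |u - x|; this vanishing at the ends of the
    interval is what later compensates the smallness of phi. *)
Lemma nab_le_derivative k G h s x : (0 < k)%N -> measurable_fun setT h ->
  (forall j y, (j < k.-1)%N -> -1 < y < 1 -> derivable (derive1n j G) y 1) ->
  ACloc (derive1n k.-1 G) ->
  {ae mu, forall y, -1 < y < 1 -> derive1n k G y = h y} ->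
  0 < s -> -1 < x - k%:R * s / 2 -> x + k%:R * s / 2 < 1 ->
  (`|nab k s G (x - k%:R * s / 2)|%:E <= (k.+1%:R * 2 ^+ k)%:E *
   \int[mu]_(u in `](x - k%:R * s / 2)%R, (x + k%:R * s / 2)%R[)
     ((k%:R * s / 2 - `|u - x|) ^+ k.-1 * `|h u|)%:E)%E.
Proof.
case: k => // k _ mh dG Gac Gh s0 x1 x2; set r := k.+1%:R * s / 2 in x1 x2 *.
have r0 : 0 < r by rewrite /r divr_gt0// mulr_gt0.
have x3 : -1 < x < 1 by apply/andP; split; real_lra.
have [P sP HP] := taylor_remainder mh dG Gac Gh x3.
have -> : nab k.+1 s G (x - r) = nab k.+1 s (fun y => G y - P.[y]) (x - r).
  by rewrite nabB (nab_poly _ _ sP) subr0.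
(* Truncation at 0 makes the integrand nonnegative everywhere and leaves it unchanged on the
   interval. *)
pose J := (\int[mu]_(u in `](x - r)%R, (x + r)%R[) (Num.max 0 (r - `|u - x|) ^+ k * `|h u|)%:E)%E.
have mJ : measurable_fun setT (fun u : TR => Num.max 0 (r - `|u - x|) ^+ k * `|h u|).
  apply: measurable_funM; last exact: measurableT_comp.
  apply: measurable_funX; apply: measurable_maxr => //.
  by apply: measurable_funB => //; apply: measurableT_comp => //; exact: measurable_funB.
have -> : (\int[mu]_(u in `](x - r)%R, (x + r)%R[) ((r - `|u - x|) ^+ k * `|h u|)%:E = J)%E.
  apply: eq_integral => u; rewrite inE/= in_itv/= => /andP[u1 u2]; congr (_ ^+ _ * _)%:E.
  by rewrite max_r// subr_ge0 ler_norml; apply/andP; split; real_lra.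
have ptw (i : 'I_k.+2) : (`|G (x - r + i%:R * s) - P.[x - r + i%:R * s]|%:E <= J)%E.
  set z := x - r + i%:R * s.
  have i0 : 0 <= i%:R * s by rewrite mulr_ge0// ltW.
  have i1 : i%:R * s <= 2 * r.
    by rewrite /r mulrCA divff// mulr1 ler_wpM2r ?(ltW s0)// ler_nat -ltnS.
  have z1 : -1 < z < 1 by rewrite /z; apply/andP; split; real_lra.
  apply: (le_trans (HP z z1)); apply: le_integral_fin => //.
  - apply: measurable_funM; last exact: measurableT_comp.
    by apply: measurable_funX; apply: measurableT_comp => //; exact: measurable_funB.
  - by move=> u; rewrite mulr_ge0// exprn_ge0// le_max lexx.
  move=> u; rewrite /= in_itv/= => /andP[u1 u2]; left; rewrite in_itv/=.
  have zr : x - r <= z <= x + r by rewrite /z; apply/andP; split; real_lra.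
  clearbody z r; clear - r0 zr u1 u2.
  have /andP[zr1 zr2] := zr; split.
    by move: u1 u2; have [xz|zx] := leP x z => u1 u2; apply/andP; split; real_lra.
  rewrite ler_wpM2r// lerXn2r ?nnegrE// ?le_max ?lexx//; apply/orP; right.
  by move: u1 u2; have [xz|zx] := leP x z => u1 u2; [rewrite !ger0_norm|rewrite !ler0_norm]; real_lra.
have J0 : (0 <= J)%E by apply: integral_ge0 => u _; rewrite lee_fin mulr_ge0// exprn_ge0// le_max lexx.
have nle := nab_norm_le k.+1 s (fun y => G y - P.[y]) (x - r).
rewrite -lee_fin in nle; apply: (le_trans nle).
rewrite [leLHS]EFinM (_ : (_ * 2 ^+ _)%:E = (2 ^+ k.+1)%:E * k.+2%:R%:E)%E; last by rewrite mulrC EFinM.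
rewrite -muleA; apply: lee_wpmul2l; first by rewrite lee_fin exprn_ge0.
by rewrite -sumEFin -sume_cst//; apply: lee_sum => i _; exact: ptw.
Qed.

End taylor.

(** * The kernel 1 / (theta phi(u)) and its marginals *)

Section schur.
Context {R : realType}.
Local Notation mu := (@lebesgue_measure R).
Local Notation TR := (measurableTypeR R).
Implicit Types (Phi G h : R -> R).

Lemma measurable_inv_ge0 d (T : measurableType d) (f : T -> R) : measurable_fun setT f ->
  (forall x, 0 <= f x) -> measurable_fun setT (fun x => (f x)^-1).
Proof.
move=> mf f0; rewrite (_ : (fun x => (f x)^-1) = (fun x => f x `^ (-1))).
  exact: measurableT_comp (measurable_powR _) mf.
by apply/funext => x; rewrite powR_inv1.
Qed.

Lemma measurable_inv_sqrt : measurable_fun setT (fun y : TR => (Num.sqrt y)^-1 : R).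
Proof.
apply: measurable_inv_ge0; last by move=> y; exact: sqrtr_ge0.
by apply: continuous_measurable_fun; exact: sqrt_continuous.
Qed.

Lemma integral_inv_sqrt_cc (e r : R) : 0 < e -> e < r ->
  (\int[mu]_(y in `[e, r]) ((Num.sqrt y)^-1)%:E <= (2 * Num.sqrt r)%:E)%E.
Proof.
move=> e0 er.
have csqrt (y : R) : 0 < y -> is_derive y 1 (fun y => 2 * Num.sqrt y) (Num.sqrt y)^-1.
  move=> y0; have d1 := is_derive1_sqrt y0.
  rewrite (_ : (fun y => 2 * Num.sqrt y) = 2 \*: Num.sqrt)// (_ : (Num.sqrt y)^-1 = 2 *: (2 * Num.sqrt y)^-1).
    exact: is_deriveZ.
  by rewrite /GRing.scale/= invfM mulrA divff ?mul1r.
have cont (y : R) : 0 < y -> {for y, continuous (fun y => 2 * Num.sqrt y)}.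
  by move=> /csqrt yd; apply: differentiable_continuous; apply/derivable1_diffP; exact: ex_derive.
rewrite (@continuous_FTC2 _ (fun y => (Num.sqrt y)^-1) (fun y => 2 * Num.sqrt y) e r er).
- by rewrite -EFinB lee_fin lerBlDr lerDl mulr_ge0// sqrtr_ge0.
- apply: continuous_in_subspaceT => y; rewrite inE/= in_itv/= => /andP[ey yr].
  have y0 : 0 < y by exact: lt_le_trans ey.
  by apply: cvgV; [rewrite gt_eqF// sqrtr_gt0|exact: sqrt_continuous].
- split.
  + by move=> y; rewrite in_itv/= => /andP[ey yr]; have := csqrt y (lt_trans e0 ey) => yd; exact: ex_derive.
  + by apply: cvg_at_right_filter; exact: cont.
  + by apply: cvg_at_left_filter; apply: cont; exact: lt_trans er.
- move=> y; rewrite in_itv/= => /andP[ey yr]; rewrite derive1E.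
  by have := csqrt y (lt_trans e0 ey) => yd; exact: derive_val.
Qed.

(** Monotone convergence from [r / (n + 2), r]; at 0 the integrand is 0 by the convention on
    inverses. *)
Lemma integral_inv_sqrt (r : R) : 0 < r ->
  (\int[mu]_(y in `[0%R, r]) ((Num.sqrt y)^-1)%:E <= (2 * Num.sqrt r)%:E)%E.
Proof.
move=> r0; pose F n : set TR := `[(r / n.+2%:R)%R, r]%classic.
have mF n : measurable (F n) by exact: measurable_itv.
have mU : measurable (\bigcup_n F n) by exact: bigcupT_measurable.
have ndF : nondecreasing_seq F.
  move=> m n mn; apply/subsetPset => y; rewrite /F/= !in_itv/= => /andP[h ->]; rewrite andbT.
  by apply: le_trans h; rewrite ler_pM2l// lef_pV2 ?posrE// ler_nat !ltnS.
have f0 y : 0 <= (Num.sqrt y)^-1 :> R by rewrite invr_ge0 sqrtr_ge0.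
apply: (@le_trans _ _ (\int[mu]_(y in \bigcup_n F n) ((Num.sqrt y)^-1)%:E)%E).
  apply: le_integral_fin => //; [exact: measurable_inv_sqrt|exact: measurable_inv_sqrt|].
  move=> y; rewrite /= in_itv/= => /andP[]; rewrite le_eqVlt => /predU1P[<- _|y0 yr].
    by right; rewrite sqrtr0 invr0.
  left; split => //; exists (Num.bound (r / y)) => //; rewrite /F/= in_itv/= yr andbT.
  rewrite ler_pdivrMr// mulrC -ler_pdivrMr//.
  have h := archi_boundP (ltW (divr_gt0 r0 y0)); apply: (le_trans (ltW h)).
  by rewrite ler_nat; exact: leq_trans (leqnSn _) (leqnSn _).
have := @ge0_nondecreasing_set_cvg_integral _ TR R F (fun y => ((Num.sqrt y)^-1)%:E) mu ndF mF.
have mf n : measurable_fun (F n) (fun y : TR => ((Num.sqrt y)^-1)%:E).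
  by apply: measurable_funTS; apply/measurable_EFinP; exact: measurable_inv_sqrt.
have f0' n x : F n x -> (0 <= ((Num.sqrt x)^-1)%:E)%E by rewrite lee_fin.
move=> /(_ mf f0') cv; rewrite -(cvg_lim _ cv)//.
apply: lime_le; first by apply/cvg_ex; eexists; exact: cv.
apply: nearW => n; apply: integral_inv_sqrt_cc; first by rewrite divr_gt0.
by rewrite ltr_pdivrMr// ltr_pMr// ltr1n.
Qed.

Lemma integral_inv_sqrt_left (c r : R) : 0 < r ->
  (\int[mu]_(y in `[c, (c + r)%R]) ((Num.sqrt (y - c))^-1)%:E <= (2 * Num.sqrt r)%:E)%E.
Proof.
move=> r0; have := @ge0_integral_affine R (fun y => ((Num.sqrt (y - c))^-1)%:E) c 1 0 r ltr01.
rewrite mul1e mulr0 addr0 mul1r => <-.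
- under eq_integral do rewrite mul1r addrAC subrr add0r; exact: integral_inv_sqrt.
- apply/measurable_EFinP; apply: (measurableT_comp measurable_inv_sqrt); exact: measurable_funB.
- by move=> y; rewrite lee_fin invr_ge0 sqrtr_ge0.
Qed.

Lemma integral_inv_sqrt_right (d r : R) : 0 < r ->
  (\int[mu]_(y in `[(d - r)%R, d]) ((Num.sqrt (d - y))^-1)%:E <= (2 * Num.sqrt r)%:E)%E.
Proof.
move=> r0; apply: le_trans (integral_inv_sqrt_left (- d) r0).
have m1 : measurable_fun setT (fun y : TR => (Num.sqrt (y + d))^-1 : R).
  by apply: (measurableT_comp measurable_inv_sqrt); exact: measurable_funD.
have := @ge0_integral_reflect R (fun y => (Num.sqrt (y + d))^-1) (d - r) d m1.
rewrite opprB [r - d]addrC; under eq_integral do rewrite addrC.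
move=> H; under [leRHS]eq_integral do rewrite opprK.
by apply: H => y; rewrite invr_ge0 sqrtr_ge0.
Qed.

(** This is concavity of 1 - x^2 on the segment from x to x + r or x - r: at the far end this
    function is nonnegative, so at u at least the fraction 1 - |u - x| / r of its value at x
    remains. *)
Lemma phi_lower (x u r : R) : 0 < r -> -1 <= x - r -> x + r <= 1 -> `|u - x| <= r ->
  phi x ^+ 2 * (r - `|u - x|) <= r * phi u ^+ 2.
Proof.
move=> r0 x1 x2 ux.
have x3 : -1 <= x <= 1 by apply/andP; split; real_lra.
move: (ux); rewrite ler_norml => /andP[u1 u2].
have u3 : -1 <= u <= 1 by apply/andP; split; real_lra.
have /andP[x4 x5] := x3; have /andP[u4 u5] := u3.
rewrite !sqr_phi//; have [xu|/ltW ux'] := leP x u.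
  rewrite ger0_norm ?subr_ge0//; clear ux u1 u3 x3.
  have h1 : (1 - x) * (r - (u - x)) <= r * (1 - u) by nra.
  have h2 : (1 + x) * ((1 - x) * (r - (u - x))) <= (1 + x) * (r * (1 - u)) by rewrite ler_wpM2l//; real_lra.
  have h3 : (1 + x) * (r * (1 - u)) <= (1 + u) * (r * (1 - u)).
    by rewrite ler_wpM2r ?mulr_ge0//; real_lra.
  real_lra.
rewrite ler0_norm ?subr_le0//; clear ux u2 u3 x3.
have h1 : (1 + x) * (r + (u - x)) <= r * (1 + u) by nra.
have h2 : (1 - x) * ((1 + x) * (r + (u - x))) <= (1 - x) * (r * (1 + u)) by rewrite ler_wpM2l//; real_lra.
have h3 : (1 - x) * (r * (1 + u)) <= (1 - u) * (r * (1 + u)).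
  by rewrite ler_wpM2r ?mulr_ge0//; real_lra.
real_lra.
Qed.

(** With rho = r - |u - x| <= r, [phi_lower] gives phi(x) rho <= r phi(u), and 2 r = theta phi(x).
    It turns the powers of rho from Taylor's formula into powers of theta phi(u). *)
Lemma phi_lower_lin (theta x u : R) (r := theta * phi x / 2) : 0 < theta -> 0 < phi x ->
  -1 <= x - r -> x + r <= 1 -> `|u - x| <= r -> r - `|u - x| <= theta * phi u.
Proof.
move=> t0 px x1 x2 ux; have r0 : 0 < r by rewrite divr_gt0// mulr_gt0.
have h := phi_lower r0 x1 x2 ux; have n0 := normr_ge0 (u - x).
have rE : 2 * r = theta * phi x by rewrite /r mulrC divfK.
clearbody r; set rho := r - `|u - x| in h *; have rho0 : 0 <= rho by rewrite /rho subr_ge0.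
have rhor : rho <= r by rewrite /rho gerBl.
have pu := phi_ge0 u; clearbody rho; clear - t0 px r0 h rE rho0 rhor pu.
have h2 : (phi x * rho) ^+ 2 <= (r * phi u) ^+ 2.
  have a1 : phi x ^+ 2 * rho * rho <= r * phi u ^+ 2 * rho by rewrite ler_wpM2r.
  have a2 : r * phi u ^+ 2 * rho <= r * phi u ^+ 2 * r by rewrite ler_wpM2l// mulr_ge0 ?sqr_ge0// ltW.
  by rewrite (_ : _ ^+ 2 = phi x ^+ 2 * rho * rho); [rewrite (_ : (r * _) ^+ 2 = r * phi u ^+ 2 * r); [real_lra|ring]|ring].
have h3 : phi x * rho <= r * phi u.
  by move: h2; rewrite ler_pXn2r// nnegrE mulr_ge0// ltW.
have : phi x * (2 * rho) <= phi x * (theta * phi u) by nra.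
by rewrite ler_pM2l// => h4; nra.
Qed.

(** First marginal. By [phi_lower], 1 / phi(u) is bounded by an inverse square root of the distance
    from u to the end of the interval on its side of x, which is integrable; the scales cancel
    because 2 r = theta phi(x). *)
Lemma kernel_row (theta x : R) (r := theta * phi x / 2) : 0 < theta -> 0 < phi x ->
  -1 <= x - r -> x + r <= 1 ->
  (\int[mu]_(u in `](x - r)%R, (x + r)%R[) ((theta * phi u)^-1)%:E <= 4%:E)%E.
Proof.
move=> t0 px x1 x2; have r0 : 0 < r by rewrite divr_gt0// mulr_gt0.
have rE : 2 * r = theta * phi x by rewrite /r mulrC divfK.
clearbody r.
pose q := Num.sqrt r / (theta * phi x).
have q0 : 0 <= q by rewrite divr_ge0 ?sqrtr_ge0// mulr_ge0// ltW.
pose f1 (u : R) := (Num.sqrt (u - (x - r)))^-1.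
pose f2 (u : R) := (Num.sqrt (x + r - u))^-1.
have f10 u : 0 <= f1 u by rewrite invr_ge0 sqrtr_ge0.
have f20 u : 0 <= f2 u by rewrite invr_ge0 sqrtr_ge0.
have mf1 : measurable_fun setT (f1 : TR -> R).
  by apply: (measurableT_comp measurable_inv_sqrt); exact: measurable_funB.
have mf2 : measurable_fun setT (f2 : TR -> R).
  by apply: (measurableT_comp measurable_inv_sqrt); exact: measurable_funB.
have mphi : measurable_fun setT (fun u : TR => (theta * phi u)^-1).
  by apply: measurable_inv_ge0; [apply: measurable_funM => //; exact: measurable_phi|move=> u; rewrite mulr_ge0 ?phi_ge0// ltW].
apply: (@le_trans _ _ (\int[mu]_(u in `[(x - r)%R, (x + r)%R]) (q * f1 u + q * f2 u)%:E)%E).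
  apply: le_integral_fin => //.
  - by apply: measurable_funD; apply: measurable_funM.
  - by move=> u; rewrite invr_ge0 mulr_ge0 ?phi_ge0// ltW.
  - by move=> u; rewrite addr_ge0// mulr_ge0.
  move=> u; rewrite /= in_itv/= => /andP[u1 u2]; left; rewrite in_itv/= (ltW u1) (ltW u2); split => //.
  have ux : `|u - x| <= r by rewrite ler_norml; apply/andP; split; real_lra.
  have h := phi_lower r0 x1 x2 ux.
  have key e : 0 < e -> phi x ^+ 2 * e <= r * phi u ^+ 2 -> (theta * phi u)^-1 <= q * (Num.sqrt e)^-1.
    move=> e0 he; have se : 0 < Num.sqrt e by rewrite sqrtr_gt0.
    have sr : 0 < Num.sqrt r by rewrite sqrtr_gt0.
    have le1 : phi x * Num.sqrt e <= Num.sqrt r * phi u.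
      rewrite -(@ler_pXn2r _ 2)// ?nnegrE ?mulr_ge0 ?phi_ge0 ?sqrtr_ge0//.
      by rewrite 2!exprMn (sqr_sqrtr (ltW e0)) (sqr_sqrtr (ltW r0)).
    have pu : 0 < phi u by move: le1 (mulr_gt0 px se); have := phi_ge0 u; rewrite le_eqVlt => /predU1P[<-|//]; rewrite mulr0; real_lra.
    rewrite /q -[leRHS]mulrA -invfM [leRHS]mulrC ler_pdivlMl; last by rewrite !mulr_gt0.
    by rewrite ler_pdivrMr ?mulr_gt0// -mulrA [leRHS]mulrCA ler_pM2l.
  have [xu|/ltW ux'] := leP x u.
    apply: (@le_trans _ _ (q * f2 u)); last by rewrite lerDr mulr_ge0.
    by apply: key; [real_lra|move: h; rewrite ger0_norm ?subr_ge0// opprB addrA (addrC r)].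
  apply: (@le_trans _ _ (q * f1 u)); last by rewrite lerDl mulr_ge0.
  apply: key; first real_lra.
  by move: h; rewrite ler0_norm ?subr_le0// opprK (_ : u - (x - r) = r + (u - x)); last ring.
have e1 (f : R -> R) : measurable_fun setT (f : TR -> R) -> (forall u, 0 <= f u) ->
    (\int[mu]_(u in `[(x - r)%R, (x + r)%R]) (f u)%:E <= (2 * Num.sqrt (2 * r))%:E)%E ->
    (\int[mu]_(u in `[(x - r)%R, (x + r)%R]) (q * f u)%:E <= (q * (2 * Num.sqrt (2 * r)))%:E)%E.
  move=> mf f0 H; under eq_integral do rewrite EFinM.
  rewrite ge0_integralZl//; last 2 first.
  - by apply: measurable_funTS; exact/measurable_EFinP.
  - by move=> u _; rewrite lee_fin.
  rewrite [leRHS]EFinM; apply: lee_wpmul2l; last exact: H.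
  by rewrite lee_fin.
under eq_integral do rewrite EFinD.
rewrite ge0_integralD//; last 4 first.
- by move=> u _; rewrite lee_fin mulr_ge0.
- by apply: measurable_funTS; apply/measurable_EFinP; exact: measurable_funM.
- by move=> u _; rewrite lee_fin mulr_ge0.
- by apply: measurable_funTS; apply/measurable_EFinP; exact: measurable_funM.
have r2 : 0 < 2 * r by rewrite mulr_gt0.
have h1 := e1 _ mf1 f10; have h2 := e1 _ mf2 f20.
apply: (@le_trans _ _ (q * (2 * Num.sqrt (2 * r)) + q * (2 * Num.sqrt (2 * r)))%:E).
  rewrite EFinD; apply: leeD.
  - by apply: h1; rewrite (_ : x + r = x - r + 2 * r); [exact: integral_inv_sqrt_left|ring].
  - by apply: h2; rewrite (_ : x - r = x + r - 2 * r); [exact: integral_inv_sqrt_right|ring].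
rewrite lee_fin.
have s2 : Num.sqrt (2 * r) <= 2 * Num.sqrt r.
  rewrite -(@ler_pXn2r _ 2)// ?nnegrE ?mulr_ge0 ?sqrtr_ge0//.
  by rewrite exprMn !sqr_sqrtr// ?(ltW r0)// ?(ltW r2)//; nra.
have q2 : q * Num.sqrt r = 2^-1.
  rewrite /q mulrAC -expr2 sqr_sqrtr ?(ltW r0)// -rE invfM mulrCA divff ?mulr1//; exact: lt0r_neq0.
clear - q0 s2 q2.
have : q * Num.sqrt (2 * r) <= q * (2 * Num.sqrt r) by rewrite ler_wpM2l.
real_lra.
Qed.

(** For theta > 0 it differs from [Ddom] by at most two points; strictness keeps all nodes of the
    difference inside the open interval (-1, 1). *)
Definition strict_domain (theta x : R) : bool := `|x| < 1 - theta * phi x / 2.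

Lemma strict_domain_bounds (theta x : R) (r := theta * phi x / 2) : 0 < theta -> strict_domain theta x ->
  [/\ -1 < x < 1, 0 < phi x, 0 < r, -1 < x - r & x + r < 1].
Proof.
rewrite /strict_domain -/r => t0; rewrite ltr_norml => /andP[x1 x2].
have r0 : 0 <= r by rewrite divr_ge0// mulr_ge0 ?phi_ge0// ltW.
have px : 0 < phi x by apply: phi_gt0; real_lra.
have r1 : 0 < r by rewrite divr_gt0// mulr_gt0.
by split => //; try (apply/andP; split); real_lra.
Qed.

Lemma column_phi_le (theta x u : R) : 0 < theta -> strict_domain theta x ->
  theta <= phi u -> -1 < u < 1 -> `|x - u| <= theta * phi x / 2 -> `|x - u| <= theta * phi u.
Proof.
move=> t0 /(strict_domain_bounds t0)[/andP[x1 x2] px _ _ _] tu /andP[u1 u2] xu; apply: (le_trans xu).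
have px2 := sqr_phi (ltW x1) (ltW x2); have pu2 := sqr_phi (ltW u1) (ltW u2).
move: xu; rewrite ler_norml => /andP[h1 h2].
have : phi x <= 2 * phi u.
  rewrite leNgt; apply/negP => lt; move: px px2 pu2 lt tu h1 h2.
  move: (phi x) (phi u) => q w q0 qE wE lt tu h1 h2.
  have e1 : q ^+ 2 - w ^+ 2 = (u - x) * (u + x) by rewrite qE wE; ring.
  have e2 : (u - x) * (u + x) <= theta * q by nra.
  nra.
nra.
Qed.

(** On the domain theta phi(x) <= 2 (1 - x), hence theta x <= phi(x), so theta phi decreases with
    slope at most 1 in absolute value. The map x + theta phi(x) / 2 therefore has slope at least
    1/2. *)
Lemma strict_domain_expansion (theta x y : R) (Y := fun x => 1 - x - theta * phi x / 2) : 0 < theta ->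
  strict_domain theta x -> strict_domain theta y -> x <= y -> (y - x) / 2 <= Y x - Y y.
Proof.
move=> t0 Dx Dy; rewrite le_eqVlt => /predU1P[<-|xy]; first by rewrite !subrr mul0r.
have [/andP[x1 x2] px _ _ x3] := strict_domain_bounds t0 Dx.
have [/andP[y1 y2] py _ _ y3] := strict_domain_bounds t0 Dy.
have px2 := sqr_phi (ltW x1) (ltW x2); have py2 := sqr_phi (ltW y1) (ltW y2).
have tx : theta * x <= phi x.
  have h : theta * phi x ^+ 2 <= 2 * (1 - x) * phi x by rewrite expr2 mulrA ler_pM2r//; real_lra.
  have : theta * (1 + x) <= 2 * phi x by rewrite -(ler_pM2r (_ : 0 < 1 - x)); [rewrite px2 in h; real_lra|real_lra].
  nra.
have ty : theta * y <= phi y.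
  have h : theta * phi y ^+ 2 <= 2 * (1 - y) * phi y by rewrite expr2 mulrA ler_pM2r//; real_lra.
  have : theta * (1 + y) <= 2 * phi y by rewrite -(ler_pM2r (_ : 0 < 1 - y)); [rewrite py2 in h; real_lra|real_lra].
  nra.
have e1 : (phi x - phi y) * (phi x + phi y) = (y - x) * (x + y).
  by rewrite -subr_sqr px2 py2; ring.
have : theta * (phi x - phi y) <= y - x.
  rewrite -(ler_pM2r (addr_gt0 px py)) -mulrA e1; nra.
rewrite /Y; real_lra.
Qed.

Lemma strict_domainN (theta x : R) : strict_domain theta (- x) = strict_domain theta x.
Proof. by rewrite /strict_domain normrN phiN. Qed.

(** Both intervals reach u, so 1 - x - theta phi(x) / 2 <= 1 - u, while the same expression at y is
    positive; by expansion (y - x) / 2 <= 1 - u <= phi(u)^2 <= theta phi(u), since phi(u) <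
    theta. *)
Lemma column_diameter_end (theta x y u : R) : 0 < theta -> 0 <= u -> u < 1 -> phi u < theta ->
  strict_domain theta x -> strict_domain theta y ->
  `|x - u| <= theta * phi x / 2 -> `|y - u| <= theta * phi y / 2 -> x <= y -> y - x <= 2 * (theta * phi u).
Proof.
move=> t0 u0 u1 pu Dx Dy xu yu xy; have h := strict_domain_expansion t0 Dx Dy xy.
have [_ _ _ _ x3] := strict_domain_bounds t0 Dx.
have [_ _ _ _ y3] := strict_domain_bounds t0 Dy.
have u2 : -1 <= u by real_lra.
have pu2 := sqr_phi u2 (ltW u1).
have e : 1 - u <= phi u ^+ 2 by rewrite pu2; nra.
have pu0 := phi_ge0 u.
have e2 : phi u ^+ 2 <= theta * phi u by rewrite expr2; nra.
move: xu; rewrite ler_norml => /andP[h1 h2].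
real_lra.
Qed.

Lemma column_diameter (theta x y u : R) : 0 < theta -> -1 < u < 1 ->
  strict_domain theta x -> strict_domain theta y ->
  `|x - u| <= theta * phi x / 2 -> `|y - u| <= theta * phi y / 2 -> `|x - y| <= 2 * (theta * phi u).
Proof.
move=> t0 /andP[u1 u2] Dx Dy xu yu; have [tu|tu] := leP theta (phi u).
  have u3 : -1 < u < 1 by rewrite u1.
  have h1 := column_phi_le t0 Dx tu u3 xu; have h2 := column_phi_le t0 Dy tu u3 yu.
  rewrite (_ : x - y = (x - u) - (y - u)); last ring.
  by apply: (le_trans (ler_normB _ _)); real_lra.
wlog xy : x y Dx Dy xu yu / x <= y.
  by move=> H; have [xy|/ltW xy] := leP x y; [|rewrite distrC]; exact: H.
rewrite distrC ger0_norm ?subr_ge0//; have [u0|/ltW u0] := leP 0 u; first exact: column_diameter_end.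
have := @column_diameter_end theta (- y) (- x) (- u) t0; rewrite !strict_domainN !phiN => H.
have := H _ _ tu Dy Dx; rewrite !opprK => H'.
by rewrite addrC; apply: H'; [real_lra|real_lra|rewrite addrC distrC|rewrite addrC distrC|real_lra].
Qed.

Lemma measurable_strict_domain (theta : R) : measurable_fun setT (fun x : TR => strict_domain theta x).
Proof.
apply: (@measurable_fun_ltr _ _ R setT (fun x : TR => `|x : R|) (fun x : TR => 1 - theta * phi x / 2)); first exact: normr_measurable.
apply: measurable_funB => //; apply: measurable_funM => //; apply: measurable_funM => //.
exact: measurable_phi.
Qed.

(** Second marginal: the points x whose interval contains u lie within 2 theta phi(u) of one
    another, and the kernel does not depend on x there. *)
Lemma kernel_column (theta u : R) : 0 < theta -> -1 < u < 1 ->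
  (\int[mu]_(x in `[(-1)%R, 1%R])
    (if strict_domain theta x && (`|u - x| < theta * phi x / 2) then (theta * phi u)^-1 else 0)%:E <= 4%:E)%E.
Proof.
move=> t0 /andP[u1 u2]; have pu := phi_gt0 u1 u2; have tp : 0 < theta * phi u by rewrite mulr_gt0.
pose D x := strict_domain theta x && (`|u - x| < theta * phi x / 2).
have mD : measurable_fun setT (fun x : TR => D x).
  apply: measurable_and; first exact: measurable_strict_domain.
  apply: measurable_fun_ltr; first by apply: measurableT_comp => //; exact: measurable_funB.
  by apply: measurable_funM => //; apply: measurable_funM => //; exact: measurable_phi.
have mf : measurable_fun setT (fun x : TR => if D x then (theta * phi u)^-1 else 0).
  by apply: measurable_fun_if.
have [[x0 Dx0]|noD] := pselect (exists x0, D x0); last first.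
  rewrite (_ : (\int[mu]_(x in _) _)%E = 0%E); first by rewrite lee_fin.
  apply: integral0_eq => x _; case: ifPn => // Dx; exfalso; apply: noD; by exists x.
pose d := 2 * (theta * phi u).
apply: (@le_trans _ _ (\int[mu]_(x in `[(x0 - d)%R, (x0 + d)%R]) (cst (theta * phi u)^-1%:E x))%E).
  apply: (@le_integral_fin R _ _ _ (cst (theta * phi u)^-1)) => //.
  - by move=> x; case: ifP => // _; rewrite invr_ge0 ltW.
  - by move=> x; rewrite /= invr_ge0 ltW.
  move=> x _; case: ifPn => [/andP[Dx ux]|_]; last by right.
  left; split => //; have /andP[Dx0' ux0] := Dx0.
  rewrite /= in_itv/= -ler_distl distrC; apply: column_diameter => //; first by rewrite u1.
  - by rewrite distrC ltW.
  - by rewrite distrC ltW.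
rewrite integral_cst//= itv_measureE; last by rewrite /d; real_lra.
rewrite -EFinM lee_fin /d (_ : x0 + _ - _ = 4 * (theta * phi u)); last ring.
by rewrite mulrCA mulVf ?mulr1// gt_eqF.
Qed.

End schur.

Section direct.
Context {R : realType}.
Local Notation mu := (@lebesgue_measure R).
Local Notation TR := (measurableTypeR R).
Implicit Types (Phi G h : R -> R).

(** h is a version of the k-th derivative of G on (-1, 1); in applications it is Borel, which
    [derive1n k G] need not be. *)
Definition derivative_density k G h : Prop :=
  [/\ forall j y, (j < k.-1)%N -> -1 < y < 1 -> derivable (derive1n j G) y 1,
      ACloc (derive1n k.-1 G) &
      {ae mu, forall y, -1 < y < 1 -> derive1n k G y = h y}].

(** The two factors of [Wdelta] are evaluated at the extreme nodes x + r and x - r, where each is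
    smallest on the interval; this is where nonnegative exponents enter. *)
Lemma Wdelta_le_wjac (a b theta x u : R) (r := theta * phi x / 2) : 0 <= a -> 0 <= b ->
  -1 <= x - r -> x + r <= 1 -> `|u - x| <= r -> Wdelta theta a b x <= wjac a b u.
Proof.
move=> a0 b0 x1 x2; rewrite ler_norml => /andP[u1 u2]; rewrite /Wdelta -/r /wjac.
by apply: ler_pM; rewrite ?powR_ge0//; apply: ge0_ler_powR; rewrite ?nnegrE//; real_lra.
Qed.

Lemma weighted_density_ge0 k (a b tau : R) h u : 0 <= tau ->
  0 <= tau ^+ k * wjac a b u * phi u ^+ k * `|h u|.
Proof.
move=> tau0; apply: mulr_ge0 => //; apply: mulr_ge0; last by rewrite exprn_ge0// phi_ge0.
by apply: mulr_ge0; [exact: exprn_ge0|exact: wjac_ge0].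
Qed.

Lemma measurable_weighted_density k (a b tau : R) h : measurable_fun setT h ->
  measurable_fun setT (fun u : TR => tau ^+ k * wjac a b u * phi u ^+ k * `|h u|).
Proof.
move=> mh; apply: measurable_funM; last exact: measurableT_comp.
apply: measurable_funM; last by apply: measurable_funX; exact: measurable_phi.
by apply: measurable_funM => //; exact: measurable_wjac.
Qed.

Lemma weighted_diff_le k (a b : R) G h (tau x : R) (theta := k%:R * tau) (r := theta * phi x / 2) :
  (0 < k)%N -> 0 <= a -> 0 <= b -> measurable_fun setT h -> derivative_density k G h -> 0 < tau ->
  strict_domain theta x ->
  (`|weighted_diff k a b G (tau, x)|%:E <= (k.+1%:R * 2 ^+ k * k%:R ^+ k)%:E *
    \int[mu]_(u in `](x - r)%R, (x + r)%R[)
      ((theta * phi u)^-1 * (tau ^+ k * wjac a b u * phi u ^+ k * `|h u|))%:E)%E.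
Proof.
move=> k0 a0 b0 mh [dG Gac Gh] tau0 Dx.
have k0' : 0 < k%:R :> R by rewrite ltr0n.
have t0 : 0 < theta by rewrite mulr_gt0.
have [x1 px r0 xr1 xr2] := strict_domain_bounds t0 Dx.
have s0 : 0 < tau * phi x by rewrite mulr_gt0.
have rE : k%:R * (tau * phi x) / 2 = r by rewrite mulrA.
rewrite -/r in r0 xr1 xr2.
have := @nab_le_derivative R k G h (tau * phi x) x k0 mh dG Gac Gh s0.
rewrite rE => /(_ xr1 xr2) H.
have W0 : 0 <= Wdelta theta a b x by rewrite mulr_ge0 ?powR_ge0.
rewrite /weighted_diff/= -/theta rE normrM (ger0_norm W0) EFinM.
apply: (le_trans (lee_wpmul2l _ H)); first by rewrite lee_fin.
have mD : measurable (`](x - r)%R, (x + r)%R[%classic : set TR) by exact: measurable_itv.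
have m1 : measurable_fun setT (fun u : TR => (r - `|u - x|) ^+ k.-1 * `|h u|).
  apply: measurable_funM; last exact: measurableT_comp.
  apply: measurable_funX; apply: measurable_funB => //; apply: measurableT_comp => //; exact: measurable_funB.
have m2 : measurable_fun setT (fun u : TR => (theta * phi u)^-1 * (tau ^+ k * wjac a b u * phi u ^+ k * `|h u|)).
  apply: measurable_funM.
    apply: measurable_inv_ge0; first by apply: measurable_funM => //; exact: measurable_phi.
    by move=> u; rewrite mulr_ge0 ?phi_ge0// ltW.
  exact: measurable_weighted_density.
have i1 u : `](x - r)%R, (x + r)%R[%classic u -> `|u - x| < r.
  by rewrite /= in_itv/= ltr_norml => /andP[h1 h2]; apply/andP; split; real_lra.
have n1 u : `](x - r)%R, (x + r)%R[%classic u -> (0 <= ((r - `|u - x|) ^+ k.-1 * `|h u|)%:E)%E.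
  by move=> /i1 h1; rewrite lee_fin mulr_ge0// exprn_ge0// subr_ge0 ltW.
have n2 u : 0 <= (theta * phi u)^-1 * (tau ^+ k * wjac a b u * phi u ^+ k * `|h u|).
  rewrite mulr_ge0 ?invr_ge0//; first by rewrite mulr_ge0 ?phi_ge0// ltW.
  by apply: weighted_density_ge0; exact: ltW.
rewrite muleCA [in leRHS]EFinM -muleA; apply: lee_wpmul2l; first by rewrite lee_fin mulr_ge0// exprn_ge0.
rewrite -ge0_integralZl//; last by apply: measurable_funTS; exact/measurable_EFinP.
rewrite -ge0_integralZl//; last 2 first.
- by apply: measurable_funTS; exact/measurable_EFinP.
- by move=> u _; rewrite lee_fin.
apply: ge0_le_integral => //.
- by move=> u /n1 h1; rewrite mule_ge0// lee_fin.
- by apply: measurable_funTS; apply/measurable_EFinP; exact: measurable_funM.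
- by apply: measurable_funTS; apply/measurable_EFinP; exact: measurable_funM.
move=> u Du; have uxr := i1 u Du; rewrite -!EFinM lee_fin.
have v0 : 0 <= wjac a b u by exact: wjac_ge0.
have Wv : Wdelta theta a b x <= wjac a b u by apply: Wdelta_le_wjac => //; rewrite -/r ltW.
have /andP[u1 u2] : -1 < u < 1.
  by move: uxr; rewrite ltr_norml => /andP[h1 h2]; apply/andP; split; real_lra.
have pu := phi_gt0 u1 u2; have tp : 0 < theta * phi u by rewrite mulr_gt0.
have rho : r - `|u - x| <= theta * phi u by apply: phi_lower_lin => //; rewrite -/r ltW.
have rho0 : 0 <= r - `|u - x| by rewrite subr_ge0 ltW.
apply: (@le_trans _ _ (wjac a b u * ((theta * phi u) ^+ k.-1 * `|h u|))).
  apply: ler_pM => //; first by rewrite mulr_ge0// exprn_ge0.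
  by rewrite ler_wpM2r// lerXn2r// nnegrE// ltW.
rewrite le_eqVlt; apply/orP; left; apply/eqP.
(* k - 1 powers of theta phi(u) equal k powers divided by one: the division produces the kernel, and
   theta^k = k^k tau^k explains the factor k^k. *)
have eK : (theta * phi u) ^+ k.-1 = (theta * phi u)^-1 * (k%:R ^+ k * tau ^+ k * phi u ^+ k).
  by rewrite -!exprMn -/theta -[in RHS](prednK k0) exprS mulKf ?gt_eqF// prednK.
by rewrite eK; ring.
Qed.

Lemma weighted_diff_ext k (a b theta tau x : R) F G : theta = k%:R * tau -> 0 < theta -> 0 <= tau ->
  (forall y, -1 < y < 1 -> F y = G y) ->
  strict_domain theta x -> weighted_diff k a b F (tau, x) = weighted_diff k a b G (tau, x).
Proof.
move=> tE t0 tau0 FG Dx; have [x1 px r0 xr1 xr2] := strict_domain_bounds t0 Dx.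
rewrite /weighted_diff/=; congr (_ * _); apply: eq_nab => i ik; apply: FG.
have rE : k%:R * (tau * phi x) / 2 = theta * phi x / 2 by rewrite tE mulrA.
have s0 : 0 <= tau * phi x by rewrite mulr_ge0// ltW.
have h1 : 0 <= i%:R * (tau * phi x) by rewrite mulr_ge0.
have h2 : i%:R * (tau * phi x) <= k%:R * (tau * phi x) by rewrite ler_wpM2r// ler_nat.
rewrite rE; apply/andP; split; real_lra.
Qed.

(** Schur's test for modulars: Jensen's inequality uses the row bound 4, which enters the constant
    C1 * 4, and after exchanging integrals the column bound 4 cancels the factor 4 in front. G
    carries the derivatives, G0 is its Borel version. *)
Theorem direct_estimate k (a b : R) : (0 < k)%N -> 0 <= a -> 0 <= b ->
  exists2 C : R, 0 < C & forall Phi G G0 h (tau : R), convmod Phi ->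
  measurable_fun setT G0 -> (forall x, -1 < x < 1 -> G x = G0 x) -> measurable_fun setT h -> derivative_density k G h -> 0 < tau ->
  (\int[mu]_(x in `[(-1)%R, 1%R]) (if strict_domain (k%:R * tau) x
     then Phi (`|weighted_diff k a b G0 (tau, x)| / C) else 0)%:E <=
   \int[mu]_(x in `[(-1)%R, 1%R]) (Phi (tau ^+ k * wjac a b x * phi x ^+ k * `|h x|))%:E)%E.
Proof.
move=> k0 a0 b0; pose C1 : R := k.+1%:R * 2 ^+ k * k%:R ^+ k.
have C1E : C1 = k.+1%:R * 2 ^+ k * k%:R ^+ k by [].
have C10 : 0 < C1 by rewrite /C1 !mulr_gt0 ?exprn_gt0 ?ltr0n.
clearbody C1; exists (C1 * 4); first by rewrite mulr_gt0.
move=> Phi G G0 h tau cm mG GG0 mh dG tau0; set theta := k%:R * tau.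
have t0 : 0 < theta by rewrite mulr_gt0 ?ltr0n.
pose psi (u : R) : R := tau ^+ k * wjac a b u * phi u ^+ k * `|h u|.
have psi0 u : 0 <= psi u.
  by apply: weighted_density_ge0; exact: ltW.
have mpsi : measurable_fun setT (psi : TR -> R).
  exact: measurable_weighted_density.
have mPsi : measurable_fun setT (fun u : TR => Phi (psi u)) by apply: measurableT_comp => //; exact: cm_meas cm.
have Psi0 u : 0 <= Phi (psi u) by exact: cm_ge0.
pose K (p : TR * TR) : R := if strict_domain theta p.1 && (`|p.2 - p.1| < theta * phi p.1 / 2)
  then (theta * phi p.2)^-1 else 0.
have K0 p : 0 <= K p by rewrite /K; case: ifP => // _; rewrite invr_ge0 mulr_ge0 ?phi_ge0// ltW.
have mphi2 : measurable_fun setT (fun p : TR * TR => phi p.2).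
  by apply: (measurableT_comp measurable_phi); exact: measurable_snd.
have mphi1 : measurable_fun setT (fun p : TR * TR => phi p.1).
  by apply: (measurableT_comp measurable_phi); exact: measurable_fst.
have mK : measurable_fun setT K.
  apply: measurable_fun_if => //.
  - apply: measurable_and; first exact: (measurableT_comp (measurable_strict_domain theta) measurable_fst).
    apply: measurable_fun_ltr; first by apply: measurableT_comp => //; exact: measurable_funB.
    by apply: measurable_funM => //; exact: measurable_funM.
  - apply: measurable_funTS; apply: measurable_inv_ge0; first exact: measurable_funM.
    by move=> p; rewrite mulr_ge0 ?phi_ge0// ltW.
pose f (x : TR) : R := if strict_domain theta x then Phi (`|weighted_diff k a b G0 (tau, x)| / (C1 * 4)) else 0.
have f0 x : 0 <= f x by rewrite /f; case: ifP => // _; apply: cm_ge0 => //; rewrite divr_ge0// mulr_ge0// ltW.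
have mf : measurable_fun setT f.
  apply: measurable_fun_if => //; first exact: measurable_strict_domain.
  apply: measurable_funTS; apply: measurableT_comp; first exact: cm_meas cm.
  apply: measurable_funM => //; apply: measurableT_comp => //.
  exact: (measurable_section (G := weighted_diff k a b G0) tau (measurable_weighted_diff k a b mG)).
have mI : measurable (`[(-1)%R, 1%R]%classic : set TR) by exact: measurable_itv.
rewrite -(@lee_pmul2l _ 4%:E)//.
rewrite -ge0_integralZl//; last 2 first.
- by apply: measurable_funTS; exact/measurable_EFinP.
- by move=> x _; rewrite lee_fin f0.
apply: (@le_trans _ _ (\int[mu]_(x in `[(-1)%R, 1%R]) \int[mu]_(u in `[(-1)%R, 1%R]) (K (x, u) * Phi (psi u))%:E)%E).
  apply: ge0_le_integral => //.
  - by move=> x _; rewrite mule_ge0// lee_fin f0.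
  - by apply: measurable_funTS; apply/measurable_EFinP; exact: measurable_funM.
  - apply: measurable_funTS; apply: (measurable_inner (G := fun p => K p * Phi (psi p.2))) => //.
      by apply: measurable_funM => //; exact: (measurableT_comp mPsi measurable_snd).
    by move=> p; rewrite mulr_ge0.
  move=> x _; rewrite -EFinM /f; case: ifPn => Dx; last first.
    by rewrite mulr0; apply: integral_ge0 => u _; rewrite lee_fin mulr_ge0.
  have [x1 px r0 xr1 xr2] := strict_domain_bounds t0 Dx.
  rewrite invfM mulrA; set E := _ / C1.
  have E0 : 0 <= E by rewrite divr_ge0// ltW.
  have mKx : measurable_fun setT (fun u : TR => K (x, u)) by exact: measurable_section.
  apply: (jensen (mu := mu) (K := fun u => K (x, u)) (psi := psi) cm) => //.
  - exact: measurable_funTS.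
  - exact: measurable_funTS.
  - apply: le_trans (kernel_row t0 px (ltW xr1) (ltW xr2)).
    apply: le_integral_fin => //.
    + apply: measurable_inv_ge0; first by apply: measurable_funM => //; exact: measurable_phi.
      by move=> u; rewrite mulr_ge0 ?phi_ge0// ltW.
    + by move=> u; rewrite invr_ge0 mulr_ge0 ?phi_ge0// ltW.
    move=> u _; rewrite /K/=; case: ifPn => [/andP[_]|_]; last by right.
    by rewrite ltr_norml => /andP[h1 h2]; left; split => //; rewrite /= in_itv/=; apply/andP; split; real_lra.
  - have := weighted_diff_le k0 a0 b0 mh dG tau0 Dx.
    rewrite -C1E -/theta (weighted_diff_ext (G := G0) a b erefl t0 (ltW tau0))// => H.
    rewrite /E mulrC EFinM lee_pdivrMl//; apply: (le_trans H); apply: lee_wpmul2l; first by rewrite lee_fin ltW.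
    apply: le_integral_fin => //.
    + apply: measurable_funM => //; apply: measurable_inv_ge0; first by apply: measurable_funM => //; exact: measurable_phi.
      by move=> u; rewrite mulr_ge0 ?phi_ge0// ltW.
    + exact: measurable_funM.
    + by move=> u; apply: mulr_ge0; [rewrite invr_ge0 mulr_ge0 ?phi_ge0// ltW|exact: psi0].
    + by move=> u; apply: mulr_ge0; [exact: K0|exact: psi0].
    move=> u; rewrite /= in_itv/= => /andP[h1 h2]; left; split.
      by have /andP[x2 x3] := x1; rewrite in_itv/=; apply/andP; split; real_lra.
    by rewrite /K/= Dx ifT// ltr_norml; apply/andP; split; real_lra.
rewrite (tonelli (G := fun p => K p * Phi (psi p.2)))//; last 2 first.
- by apply: measurable_funM => //; exact: (measurableT_comp mPsi measurable_snd).
- by move=> p; rewrite mulr_ge0.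
rewrite -ge0_integralZl//; last 2 first.
- by apply: measurable_funTS; exact/measurable_EFinP.
- by move=> x _; rewrite lee_fin Psi0.
apply: ge0_le_integral => //.
- by move=> u _; apply: integral_ge0 => x _; rewrite lee_fin mulr_ge0.
- apply: measurable_funTS; apply: (measurable_inner (G := fun p => K (p.2, p.1) * Phi (psi p.1))) => //.
    apply: measurable_funM; first by apply: measurableT_comp => //; exact: measurable_swap.
    exact: (measurableT_comp mPsi measurable_fst).
  by move=> p; rewrite mulr_ge0.
- by apply: measurable_funTS; apply/measurable_EFinP; exact: measurable_funM.
move=> u; rewrite /= in_itv/= => /andP[u1 u2].
under eq_integral do rewrite mulrC EFinM.
rewrite ge0_integralZl//; last 3 first.
- by apply: measurable_funTS; apply/measurable_EFinP; exact: (measurable_section2 u mK).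
- by move=> x _; rewrite lee_fin.
- by rewrite lee_fin.
rewrite muleC; apply: lee_wpmul2r; first by rewrite lee_fin.
have [u3|] := boolP (-1 < u < 1); first exact: kernel_column.
(* At u = 1 and u = -1 phi vanishes and the kernel is 0, by the convention that the inverse of 0 is
   0. *)
rewrite negb_and -!leNgt => ue.
have pu : phi u = 0.
  have -> : u = 1 \/ u = -1 -> phi u = 0 by move=> [->|->]; rewrite /phi ?sqrrN expr1n subrr sqrtr0.
    by [].
  by case/orP: ue => ue; [right|left]; apply/eqP; rewrite eq_le ?u1 ?u2 ?ue.
rewrite integral0_eq// => x _; rewrite /K/= pu mulr0 invr0; case: ifP => //.
Qed.

End direct.

(** * Weighted differences controlled by the weighted function *)

Section bounded.
Context {R : realType}.
Local Notation mu := (@lebesgue_measure R).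
Local Notation TR := (measurableTypeR R).
Implicit Types (Phi F : R -> R).

Lemma strict_domain_lipschitz (theta x y : R) : 0 < theta -> strict_domain theta x -> strict_domain theta y ->
  `|theta * phi x - theta * phi y| <= `|x - y|.
Proof.
move=> t0; wlog xy : x y / x <= y.
  move=> H Dx Dy; have [xy|/ltW yx] := leP x y; first exact: H.
  by rewrite distrC (distrC x); exact: H.
move=> Dx Dy; have h1 := strict_domain_expansion t0 Dx Dy xy.
have := @strict_domain_expansion _ theta (- y) (- x) t0; rewrite !strict_domainN !phiN lerN2.
move=> /(_ Dy Dx xy) h2; rewrite (ler0_norm (_ : x - y <= 0)) ?subr_le0// ler_norml.
apply/andP; split; real_lra.
Qed.

(* The nodes of the k-th difference at x with step tau * phi x are the points
   [sample (k * tau) c x] with c = 2 i / k - 1, hence `|c| <= 1. *)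
Definition sample (theta c x : R) : R := x + c * (theta * phi x / 2).

Lemma measurable_sample (theta c : R) : measurable_fun setT (sample theta c : TR -> TR).
Proof.
apply: measurable_funD => //; apply: measurable_funM => //; apply: measurable_funM => //.
by apply: measurable_funM => //; exact: measurable_phi.
Qed.

(** theta phi is 1-Lipschitz on the strict domain, so moving a node by c theta phi(x) / 2 changes
    distances by at most half. *)
Lemma sample_expansion (theta c x y : R) : 0 < theta -> `|c| <= 1 -> strict_domain theta x ->
  strict_domain theta y -> 2^-1 * `|x - y| <= `|sample theta c x - sample theta c y|.
Proof.
move=> t0 c1 Dx Dy; have h := strict_domain_lipschitz t0 Dx Dy.
have -> : sample theta c x - sample theta c y = (x - y) - (- (c / 2) * (theta * phi x - theta * phi y)).
  by rewrite /sample; field.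
apply: le_trans (lerB_dist _ _).
have : `|- (c / 2) * (theta * phi x - theta * phi y)| <= 2^-1 * `|x - y|.
  rewrite normrM normrN normrM (ger0_norm (_ : 0 <= 2^-1)) ?invr_ge0//.
  by apply: ler_pM => //; rewrite ?mulr_ge0//; have := normr_ge0 c; real_lra.
real_lra.
Qed.

Lemma sample_itv (theta c x : R) : 0 < theta -> `|c| <= 1 -> strict_domain theta x ->
  `|sample theta c x - x| <= theta * phi x / 2 /\ -1 < sample theta c x < 1.
Proof.
move=> t0 c1 Dx; have [x1 px r0 xr1 xr2] := strict_domain_bounds t0 Dx.
have h : `|sample theta c x - x| <= theta * phi x / 2.
  by rewrite /sample addrAC subrr add0r normrM (gtr0_norm r0) ler_piMl// ltW.
by split => //; move: h; rewrite ler_norml => /andP[h1 h2]; apply/andP; split; real_lra.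
Qed.

Lemma sample_integral_le (theta c : R) (g : TR -> R) : 0 < theta -> `|c| <= 1 ->
  measurable_fun setT g -> (forall x, 0 <= g x) ->
  (\int[mu]_(x in `[(-1)%R, 1%R]) (if strict_domain theta x then g (sample theta c x) else 0)%:E <=
   2%:E * \int[mu]_(x in `[(-1)%R, 1%R]) (g x)%:E)%E.
Proof.
move=> t0 c1 mg g0; pose D : set TR := [set x | strict_domain theta x].
have mD : measurable D.
  rewrite (_ : D = setT `&` strict_domain theta @^-1` [set true]); last by rewrite setTI.
  exact: measurable_strict_domain.
have mI : measurable (`[(-1)%R, 1%R]%classic : set TR) by exact: measurable_itv.
have ms := measurable_sample theta c.
have mgs : measurable_fun setT (fun x : TR => g (sample theta c x)) by exact: measurableT_comp.
apply: (@le_trans _ _ (\int[mu]_(x in D) (g (sample theta c x))%:E)%E).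
  apply: le_integral_fin => //.
  - by apply: measurable_fun_if => //; [exact: measurable_strict_domain|exact: measurable_funTS].
  - by move=> x; case: ifP.
  by move=> x _; case: ifPn => Dx; [left|right].
have := @ge0_integral_expansion R D (sample theta c) 2^-1 `[(-1)%R, 1%R] (fun x => (g x)%:E) mD mI ms.
rewrite lee_pdivrMl// => H; apply: H => //.
- by move=> x y; exact: sample_expansion.
- by move=> x /(sample_itv t0 c1)[_ /andP[h1 h2]]; rewrite /= in_itv/= !ltW.
- exact/measurable_EFinP.
Qed.

Definition sample_ratio k i : R := 2 * i%:R / k%:R - 1.

Lemma sample_ratio_le1 k i : (i <= k)%N -> (0 < k)%N -> `|sample_ratio k i| <= 1.
Proof.
move=> ik k0; rewrite /sample_ratio ler_norml.
have h1 : 0 <= 2 * i%:R / k%:R :> R by rewrite divr_ge0// mulr_ge0.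
have h2 : 2 * i%:R / k%:R <= 2 :> R by rewrite ler_pdivrMr ?ltr0n// ler_wpM2l// ler_nat.
by apply/andP; split; real_lra.
Qed.

Lemma node_sampleE k i (tau x : R) : (0 < k)%N ->
  x - k%:R * (tau * phi x) / 2 + i%:R * (tau * phi x) = sample (k%:R * tau) (sample_ratio k i) x.
Proof.
move=> k0; have k0' : k%:R != 0 :> R by rewrite pnatr_eq0 -lt0n.
by rewrite /sample /sample_ratio; field.
Qed.

(** The weight [Wdelta] is at most the Jacobi weight at each of the k + 1 nodes, and composition
    with each node map at most doubles an integral. *)
Lemma bounded_estimate k (a b : R) Phi F (tau : R) : (0 < k)%N -> 0 <= a -> 0 <= b -> convmod Phi ->
  measurable_fun setT F -> 0 < tau ->
  (\int[mu]_(x in `[(-1)%R, 1%R]) (if strict_domain (k%:R * tau) x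
     then Phi (`|weighted_diff k a b F (tau, x)| / (k.+1%:R * 2 ^+ k)) else 0)%:E <=
   (k.+1%:R * 2)%:E * \int[mu]_(x in `[(-1)%R, 1%R]) (Phi (wjac a b x * `|F x|))%:E)%E.
Proof.
move=> k0 a0 b0 cm mF tau0; set theta := k%:R * tau.
have t0 : 0 < theta by rewrite mulr_gt0 ?ltr0n.
pose g x : R := Phi (wjac a b x * `|F x|).
have g0 x : 0 <= g x by apply: (cm_ge0 cm); apply: mulr_ge0 => //; exact: wjac_ge0.
have mg : measurable_fun setT (g : TR -> R).
  apply: measurableT_comp; first exact: cm_meas cm.
  by apply: measurable_funM; [exact: measurable_wjac|exact: measurableT_comp].
pose gi (i : 'I_k.+1) x : R := if strict_domain theta x then g (sample theta (sample_ratio k i) x) else 0.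
have gi0 i x : 0 <= gi i x by rewrite /gi; case: ifP.
have mgi i : measurable_fun setT (gi i : TR -> R).
  apply: measurable_fun_if => //; first exact: measurable_strict_domain.
  by apply: measurable_funTS; apply: measurableT_comp => //; exact: measurable_sample.
have ci (i : 'I_k.+1) : `|sample_ratio k i| <= 1 by apply: sample_ratio_le1 => //; rewrite -ltnS.
have mI : measurable (`[(-1)%R, 1%R]%classic : set TR) by exact: measurable_itv.
have sc0 : 0 < k.+1%:R * 2 ^+ k :> R by rewrite mulr_gt0 ?exprn_gt0 ?ltr0n.
apply: (@le_trans _ _ (\int[mu]_(x in `[(-1)%R, 1%R]) (\sum_(i < k.+1) gi i x)%:E)%E).
  apply: le_integral_fin => //.
  - apply: measurable_fun_if => //; first exact: measurable_strict_domain.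
    apply: measurable_funTS; apply: measurableT_comp; first exact: cm_meas cm.
    apply: measurable_funM => //; apply: measurableT_comp => //.
    exact: (measurable_section (G := weighted_diff k a b F) tau (measurable_weighted_diff k a b mF)).
  - exact: measurable_sum.
  - by move=> x; case: ifP => // _; apply: cm_ge0 => //; rewrite divr_ge0// ltW.
  - by move=> x; exact: sumr_ge0.
  move=> x x1; left; split => //; rewrite /gi; case: ifPn => Dx; last by rewrite sumr_ge0.
  rewrite [X in _ / X]mulrC invfM mulrA.
  have p2 : 0 < 2 ^+ k :> R by rewrite exprn_gt0.
  have W0 : 0 <= Wdelta theta a b x by rewrite mulr_ge0 ?powR_ge0.
  apply: (@cm_sum R Phi k.+1 (fun i => wjac a b (sample theta (sample_ratio k i) x) * `|F (sample theta (sample_ratio k i) x)|)) => //.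
  - by move=> i; apply: mulr_ge0 => //; exact: wjac_ge0.
  rewrite ler_pdivrMr// /weighted_diff/= -/theta normrM (ger0_norm W0).
  apply: (le_trans (ler_wpM2l W0 (nab_norm_le _ _ _ _))); rewrite mulrCA [leRHS]mulrC ler_pM2l// mulr_sumr.
  apply: ler_sum => i _; rewrite node_sampleE// -/theta ler_wpM2r//.
  have [x2 px r0 xr1 xr2] := strict_domain_bounds t0 Dx.
  by apply: Wdelta_le_wjac => //; [exact: ltW|exact: ltW|exact: (sample_itv t0 (ci i) Dx).1].
under eq_integral do rewrite -sumEFin.
rewrite ge0_integral_sum//; last 2 first.
- by move=> i; apply: measurable_funTS; exact/measurable_EFinP.
- by move=> i x _; rewrite lee_fin.
rewrite EFinM -muleA -sume_cst; last by rewrite mule_ge0// integral_ge0// => x _; rewrite lee_fin g0.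
by apply: lee_sum => i _; apply: sample_integral_le.
Qed.

End bounded.

(** * Norms, moduli and the K-functional *)

Section norms.
Import HBNNSimple.
Context {R : realType}.
Local Notation mu := (@lebesgue_measure R).
Local Notation TR := (measurableTypeR R).
Implicit Types (f g u : R -> R) (p : \bar R) (I : set R).

Lemma le_integral_pointwise (D : set TR) (f g : TR -> \bar R) :
  (forall x, 0 <= f x)%E -> (forall x, 0 <= g x)%E -> (forall x, D x -> f x <= g x)%E ->
  (\int[mu]_(x in D) f x <= \int[mu]_(x in D) g x)%E.
Proof.
move=> f0 g0 fg; rewrite !ge0_integralE//; apply: le_ereal_sup => _ [h hf <-]; exists h => // x.
apply: (le_trans (hf x)); rewrite /patch; case: ifPn => // xD; apply: fg; exact: set_mem xD.
Qed.

(** The integral of f is a supremum over Borel simple functions below f. Such a function is almost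
    everywhere below g; conversely g cut off on a Borel null set is below f everywhere. *)
Lemma integral_ae_nonmeasurable (D : set TR) f g : measurable D -> measurable_fun setT g ->
  (forall x, 0 <= f x) -> (forall x, 0 <= g x) -> {ae mu, forall x, D x -> f x = g x} ->
  (\int[mu]_(x in D) (f x)%:E = \int[mu]_(x in D) (g x)%:E)%E.
Proof.
move=> mD mg f0 g0 ae; apply/eqP; rewrite eq_le; apply/andP; split.
  rewrite ge0_integralE//; last by move=> x _; rewrite lee_fin.
  apply: ge_ereal_sup => _ [h hf <-]; rewrite -integralT_nnsfun [leRHS]integral_mkcond.
  apply: ae_ge0_le_integral => //.
  - by move=> x _; rewrite lee_fin; exact: fun_ge0.
  - by apply/measurable_EFinP; exact: measurable_funP.
  - by move=> x _; rewrite /patch; case: ifP => // _; rewrite lee_fin.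
  - by apply/(measurable_restrictT _ mD); apply/measurable_EFinP; exact: measurable_funTS.
  apply: (@filterS _ _ (ae_filter_ringOfSetsType mu) _ _ _ ae) => x Hx _; apply: (le_trans (hf x)).
  by rewrite /patch; case: ifPn => // xD; rewrite Hx//; exact: set_mem xD.
have [N [mN N0 subN]] := ae.
have mi : measurable_fun setT (\1_(~` N) : TR -> R) by apply: measurable_indic; exact: measurableC.
have -> : (\int[mu]_(x in D) (g x)%:E = \int[mu]_(x in D) (g x * \1_(~` N) x)%:E)%E.
  apply: ge0_ae_eq_integral => //.
  - by apply: measurable_funTS; exact/measurable_EFinP.
  - by apply: measurable_funTS; apply/measurable_EFinP; exact: measurable_funM.
  - by move=> x _; rewrite lee_fin.
  - by move=> x _; rewrite lee_fin mulr_ge0// indicE.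
  exists N; split => // x /= Hx; apply: contrapT => xN; apply: Hx => _.
  by rewrite indicE mem_set// mulr1.
apply: le_integral_pointwise => [x|x|x Dx]; rewrite ?lee_fin//; first by rewrite mulr_ge0// indicE.
rewrite indicE; have [xN|xN] := pselect (N x); first by rewrite memNset ?mulr0//; apply.
rewrite mem_set// mulr1; have [<-//|nfg] := pselect (f x = g x).
by exfalso; apply: xN; apply: subN => /= H; apply: nfg; exact: H.
Qed.

(** For every rational q the set where u < q is Borel up to a Borel null set. Off the countable
    union of these null sets all sublevel sets are Borel. *)
Lemma lebesgue_measurable_representative u : lebesgue_measurable_fun `[(-1), 1] u ->
  exists2 u0 : TR -> R, measurable_fun setT u0 & {ae mu, forall x, -1 <= x <= 1 -> u x = u0 x}.
Proof.
move=> mu_; set I : set R := `[(-1), 1]%classic.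
have mI : measurable (I : set TR) by exact: measurable_itv.
have mI' : measurable (I : set (g_sigma_algebraType (completed_algebra_gen mu))).
  by apply: sub_sigma_algebra; exists I => //; exists set0; [exact: negligible_set0|rewrite setU0].
pose rt (n : nat) : rat := odflt 0 (unpickle n).
have rtK q : rt (pickle q) = q by rewrite /rt pickleK.
(* A.1 is the Borel model of the sublevel set at the n-th rational and A.2 a Borel null set outside
   which they agree. *)
have /choice[A HA] : forall n : nat, exists A : set TR * set TR,
    [/\ measurable A.1, measurable A.2, mu A.2 = 0%E & forall x, I x -> ~ A.2 x -> A.1 x <-> u x < ratr (rt n)].
  move=> n; have := mu_ mI' `]-oo, ratr (rt n)[%classic (measurable_itv _).
  rewrite g_sigma_completed_algebra_genE => -[A mA [N [N' [mN' N'0 NN']]] AN].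
  exists (A, N'); split => //= x Ix N'x; split.
    move=> Ax; have : (A `|` N) x by left.
    by rewrite AN => -[_]; rewrite /= in_itv.
  move=> uq; have : (I `&` u @^-1` `]-oo, ratr (rt n)[%classic) x by split => //; rewrite /= in_itv/=.
  by rewrite -AN => -[//|/NN'].
pose N := \bigcup_n (A n).2.
have mN : measurable N by apply: bigcupT_measurable => n; have [] := HA n.
have N0 : mu N = 0%E.
  apply/negligibleP => //; apply: negligible_bigcup => n.
  by apply/negligibleP; have [] := HA n.
have mIN : measurable (I `\` N : set TR) by exact: measurableD.
exists (u \_ (I `\` N)).
  apply/(measurable_restrictT _ mIN).
  apply: (measurability (@RGenInftyO.G R)); first exact: RGenInftyO.measurableE.
  move=> _ [_ [y ->] <-].
  rewrite (_ : _ `&` _ = (I `\` N) `&` \bigcup_(n in [set n | ratr (rt n) <= y]) (A n).1).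
    apply: measurableI => //; apply: bigcup_measurable => n _.
    by have [] := HA n.
  apply/seteqP; split => x [[Ix Nx]].
    rewrite /= in_itv/= => uy; split => //.
    have [q] := rat_in_itvoo uy; rewrite in_itv/= => /andP[uq qy].
    exists (pickle q); first by rewrite /= rtK ltW.
    by have [_ _ _ H] := HA (pickle q); apply/H; rewrite ?rtK// => xN; apply: Nx; exists (pickle q).
  move=> [n /= qy Ax]; split => //; rewrite /= in_itv/=; apply: lt_le_trans qy.
  by have [_ _ _ H] := HA n; apply/H => // xN; apply: Nx; exists n.
exists N; split => // x /= Hx; apply: contrapT => Nx; apply: Hx => x1.
by rewrite /patch mem_set//; split => //; rewrite /I/= in_itv.
Qed.

Lemma lebesgue_measurable_of_borel I u : measurable (I : set TR) -> measurable_fun setT (u : TR -> R) ->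
  lebesgue_measurable_fun I u.
Proof.
move=> mI mu_ _ B mB; apply: sub_sigma_algebra; exists (I `&` u @^-1` B).
  by apply: measurableI => //; rewrite -[X in measurable X]setTI; exact: mu_.
by exists set0; [exact: negligible_set0|rewrite setU0].
Qed.

Lemma Lpnorm_finE I (q : R) u :
  Lpnorm I q%:E u = ((\int[mu]_x (`|(u \_ I) x| `^ q)%:E) `^ q^-1)%E.
Proof. by rewrite /Lpnorm unlock. Qed.

Lemma Lpnorm_fin I (q : R) u : measurable (I : set TR) -> 1 <= q ->
  Lpnorm I q%:E u = ((\int[mu]_(x in I) (`|u x| `^ q)%:E) `^ q^-1)%E.
Proof.
move=> mI q1; rewrite Lpnorm_finE [in RHS]integral_mkcond; congr (poweR _ _).
apply: eq_integral => x _; rewrite /patch/=; case: ifP => // _.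
by change ((`|0 : R| `^ q)%:E = 0%:E); rewrite normr0 powR0// gt_eqF//; real_lra.
Qed.

Lemma measure_setT_gt0 : (0 < mu setT)%E.
Proof.
apply: (@lt_le_trans _ _ (mu `[0%R, 1%R]%classic)); last by apply: le_measure => //; rewrite inE.
by rewrite lebesgue_measure_itv/= lte01 sube0 lte_fin.
Qed.

Lemma Lpnorm_oo I u : Lpnorm I +oo%E u = ess_sup mu (fun x => `|(u \_ I) x|%:E).
Proof. by rewrite /Lpnorm unlock measure_setT_gt0. Qed.

Lemma Lpnorm_ge0 I p u : (0 <= Lpnorm I p u)%E.
Proof. exact: Lnorm_ge0. Qed.

Lemma Lpnorm_ae I J p u v : measurable (J : set TR) -> (1 <= p)%E -> measurable_fun setT (v : TR -> R) ->
  {ae mu, forall x, (u \_ I) x = (v \_ J) x} -> Lpnorm I p u = Lpnorm J p v.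
Proof.
move=> mJ + mv ae; case: p => [q|_|//].
  rewrite lee_fin => q1; rewrite !Lpnorm_finE; apply: (congr1 (fun X => (X `^ q^-1)%E)).
  have mvJ : measurable_fun setT (v \_ J : TR -> R).
    by apply/(measurable_restrictT _ mJ); exact: measurable_funTS.
  apply: integral_ae_nonmeasurable => //.
    apply: (@measurableT_comp _ _ _ _ _ _ ((@powR R)^~ q)); first exact: measurable_powR.
    exact: measurableT_comp.
  by apply: (@filterS _ _ (ae_filter_ringOfSetsType mu) _ _ _ ae) => x /= ->.
rewrite !Lpnorm_oo; apply: eq_ess_sup.
by apply: (@filterS _ _ (ae_filter_ringOfSetsType mu) _ _ _ ae) => x /= ->.
Qed.

(** Young's inequality with exponents q and q / (q - 1), applied to s and m^(q-1). *)
Lemma powR_tangent (q m s : R) : 1 <= q -> 0 <= m -> 0 <= s ->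
  m `^ q + q * m `^ (q - 1) * (s - m) <= s `^ q.
Proof.
move=> q1 m0 s0; move: q1; rewrite le_eqVlt => /predU1P[<-|q1].
  by rewrite subrr !powRr1// powRr0; real_lra.
have q0 : 0 < q by real_lra.
have := @conjugate_powR R s (m `^ (q - 1)) q (q / (q - 1)) s0 (powR_ge0 _ _).
have h : 0 < q / (q - 1) by rewrite divr_gt0//; real_lra.
have e : q^-1 + (q / (q - 1))^-1 = 1 by rewrite invf_div; field; real_lra.
move=> /(_ q0 h e); rewrite -powRrM.
have -> : (q - 1) * (q / (q - 1)) = q by field; real_lra.
have mq : m `^ (q - 1) * m = m `^ q.
  have [->|mn0] := eqVneq m 0; first by rewrite mulr0 powR0// gt_eqF.
  by rewrite -[X in _ * X](powRr1 m0) -powRD ?subrK// mn0 implybT.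
have -> : m `^ q / (q / (q - 1)) = m `^ q * (q - 1) / q by rewrite invf_div mulrA.
move=> H; have {}H : q * (s * m `^ (q - 1)) <= q * (s `^ q / q + m `^ q * (q - 1) / q) by rewrite ler_pM2l.
have e2 : q * (s `^ q / q + m `^ q * (q - 1) / q) = s `^ q + m `^ q * (q - 1) by field; real_lra.
rewrite e2 in H; rewrite mulrBr -[in X in _ - X]mulrA mq; real_lra.
Qed.

Lemma poweR_mono (q : R) (X Y : \bar R) : 0 <= q -> (0 <= X)%E -> (X <= Y)%E -> (X `^ q <= Y `^ q)%E.
Proof.
move=> q0 X0 XY; have Y0 := le_trans X0 XY.
by apply: (gt0_ler_poweR q0 _ _ XY); rewrite in_itv/= ?X0 ?Y0 leey.
Qed.

(* For p = +oo the norm of u is at most M iff the integral of [modular p M `|u|] is at most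
   [level p M] = 0. *)
Definition modular p (M s : R) : R := if p is q%:E then `|s| `^ q else Num.max 0 (s - M).

Definition level p (M : R) : R := if p is q%:E then M `^ q else 0.

Lemma convmod_modular p M : (1 <= p)%E -> 0 <= M -> convmod (modular p M).
Proof.
move=> + M0; case: p => [q|_|//]; last first.
  split; rewrite /modular.
  - by apply: measurable_maxr => //; exact: measurable_funB.
  - by apply/max_idPl; rewrite sub0r oppr_le0.
  move=> m m0; have [mM|Mm] := leP m M.
    by exists 0 => // s s0; rewrite mul0r addr0 (max_idPl _) ?subr_le0// le_max lexx.
  exists 1 => // s s0; rewrite mul1r (max_idPr _) ?subr_ge0 ?(ltW Mm)//.
  by rewrite le_max; apply/orP; right; real_lra.
rewrite lee_fin => q1; have q0 : 0 < q by real_lra.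
split; rewrite /modular.
- apply: (@measurableT_comp _ _ _ _ _ _ ((@powR R)^~ q)); first exact: measurable_powR.
  exact: normr_measurable.
- by rewrite normr0 powR0// gt_eqF.
move=> m m0; exists (q * m `^ (q - 1)); first by rewrite mulr_ge0 ?powR_ge0// ltW.
by move=> s s0; rewrite !ger0_norm//; exact: powR_tangent.
Qed.

Lemma Lpnorm_modular I p M u : measurable (I : set TR) -> (1 <= p)%E -> 0 <= M ->
  measurable_fun setT (u : TR -> R) ->
  (Lpnorm I p u <= M%:E)%E <-> (\int[mu]_(x in I) (modular p M `|u x|)%:E <= (level p M)%:E)%E.
Proof.
move=> mI + M0 mu_; case: p => [q|_|//].
  rewrite lee_fin => q1; have q0 : 0 < q by real_lra.
  rewrite Lpnorm_fin// /modular /level; under [X in _ <-> (X <= _)%E]eq_integral do rewrite normr_id.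
  set X := integral _ _ _; have X0 : (0 <= X)%E by apply: integral_ge0 => x _; rewrite lee_fin powR_ge0.
  split => H.
    have : ((X `^ q^-1) `^ q <= M%:E `^ q)%E by apply: poweR_mono; rewrite ?poweR_ge0// ltW.
    by rewrite -poweRrM mulVf ?gt_eqF// poweRe1.
  have : (X `^ q^-1 <= (M `^ q)%:E `^ q^-1)%E by apply: poweR_mono; rewrite ?invr_ge0// ltW.
  by rewrite poweR_EFin -powRrM mulfV ?gt_eqF// powRr1.
rewrite Lpnorm_oo /modular /level.
have mf : measurable_fun I (fun x : TR => (Num.max 0 (`|u x| - M))%:E).
  apply: measurable_funTS; apply/measurable_EFinP; apply: measurable_maxr => //.
  by apply: measurable_funB => //; exact: measurableT_comp.
have f0 x : 0 <= Num.max 0 (`|u x| - M) by rewrite le_max lexx.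
split => [/ess_supP ae|H].
  rewrite (_ : (\int[mu]_(x in I) _)%E = (\int[mu]_(x in I) 0%:E)%E); first by rewrite integral0.
  apply: ge0_ae_eq_integral => //; first by move=> x _; rewrite lee_fin.
  apply: (@filterS _ _ (ae_filter_ringOfSetsType mu) _ _ _ ae) => x /= h Ix; congr EFin.
  by apply/max_idPl; move: h; rewrite /patch mem_set// lee_fin; real_lra.
apply/ess_supP.
have : (\int[mu]_(x in I) `|(Num.max 0 (`|u x| - M))%:E| = 0)%E.
  apply/eqP; rewrite eq_le integral_ge0 ?andbT; last by move=> x _.
  by apply: le_trans H; rewrite le_eqVlt; apply/orP; left; apply/eqP; apply: eq_integral => x _; rewrite abse_EFin ger0_norm.
move/(ae_eq_integral_abs mu mI mf); apply: filterS => x /= H'; rewrite lee_fin /patch.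
case: ifPn => [xI|_]; last by rewrite normr0.
have [h] := H' (set_mem xI); have : `|u x| - M <= Num.max 0 (`|u x| - M) by rewrite le_max lexx orbT.
by rewrite h; real_lra.
Qed.

(** The outer constant K becomes a factor of the norm: for finite p because K <= K^p, and for p =
    +oo because the level is 0. *)
Lemma Lpnorm_le_of_modular I p M C K u : measurable (I : set TR) -> (1 <= p)%E -> 0 <= M -> 0 < C -> 1 <= K ->
  measurable_fun setT (u : TR -> R) ->
  (\int[mu]_(x in I) (modular p M (`|u x| / C))%:E <= K%:E * (level p M)%:E)%E ->
  (Lpnorm I p u <= (C * K * M)%:E)%E.
Proof.
move=> mI p1 M0 C0 K1 mu_ H; have CK0 : 0 <= C * K * M by rewrite !mulr_ge0//; real_lra.
apply/Lpnorm_modular => //.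
have muC : measurable_fun setT (fun x : TR => modular p M (`|u x| / C)).
  apply: measurableT_comp; first exact: cm_meas (convmod_modular p1 M0).
  by apply: measurable_funM => //; exact: measurableT_comp.
have muC0 x : 0 <= modular p M (`|u x| / C).
  by apply: (cm_ge0 (convmod_modular p1 M0)); rewrite divr_ge0// ltW.
case: p p1 H muC muC0 => [q p1 H muC muC0|_ H muC muC0|//]; rewrite /modular /level in H muC muC0 *.
  rewrite lee_fin in p1.
  have q0 : 0 < q by real_lra.
  have -> : (\int[mu]_(x in I) (`|(`|u x|)| `^ q)%:E = (C `^ q)%:E * \int[mu]_(x in I) (`|(`|u x| / C)| `^ q)%:E)%E.
    rewrite -ge0_integralZl//; last 2 first.
    - by apply: measurable_funTS; exact/measurable_EFinP.
    - by rewrite lee_fin powR_ge0.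
    apply: eq_integral => x _; rewrite -EFinM -powRM ?(ltW C0)//; congr (_ `^ _)%:E.
    by rewrite normrM normr_id (gtr0_norm (_ : 0 < C^-1)) ?invr_gt0// mulrCA divff ?mulr1// gt_eqF.
  apply: (@le_trans _ _ ((C `^ q)%:E * (K%:E * (M `^ q)%:E))%E).
    by apply: lee_wpmul2l => //; rewrite lee_fin powR_ge0.
  rewrite -!EFinM lee_fin mulrA.
  have K0 : 0 <= K by real_lra.
  rewrite powRM// ?mulr_ge0 ?(ltW C0)// powRM ?(ltW C0)// ler_wpM2r ?powR_ge0// ler_wpM2l ?powR_ge0//.
  by rewrite -[leLHS]powRr1// ler_powR.
apply: (@le_trans _ _ (\int[mu]_(x in I) (C * Num.max 0 (`|u x| / C - M))%:E)%E).
  apply: le_integral_fin => //.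
  - by apply: measurable_maxr => //; apply: measurable_funB => //; exact: measurableT_comp.
  - exact: measurable_funM.
  - by move=> x; rewrite le_max lexx.
  - by move=> x; rewrite mulr_ge0// ltW.
  move=> x Ix; left; split => //; rewrite ge_max mulr_ge0 ?(ltW C0)//=.
  apply: (@le_trans _ _ (C * (`|u x| / C - M))); last by rewrite ler_pM2l// le_max lexx orbT.
  rewrite mulrBr mulrCA divff ?gt_eqF// mulr1 lerB// -mulrA ler_pM2l//.
  by rewrite ler_peMl.
under eq_integral do rewrite EFinM.
rewrite ge0_integralZl//; try by [rewrite lee_fin ltW|apply: measurable_funTS; exact/measurable_EFinP|move=> x _; rewrite lee_fin; exact: muC0].
by move: H; rewrite mule0 => /(lee_wpmul2l (_ : (0 <= C%:E)%E)); rewrite mule0; apply; rewrite lee_fin ltW.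
Qed.

Lemma Lpnorm_scale I p c M u : measurable (I : set TR) -> (1 <= p)%E -> 0 <= M -> 0 < c ->
  measurable_fun setT (u : TR -> R) ->
  (Lpnorm I p (fun x => c * u x)%R <= M%:E)%E <-> (c%:E * Lpnorm I p u <= M%:E)%E.
Proof.
move=> mI p1 M0 c0 mu_.
have half (d : R) (v : R -> R) (N : R) : 0 <= N -> 0 < d -> measurable_fun setT (v : TR -> R) ->
    (Lpnorm I p (fun x => d * v x)%R <= N%:E)%E -> (Lpnorm I p v <= (d^-1 * N)%:E)%E.
  move=> N0 d0 mv /Lpnorm_modular H.
  have {}H := H mI p1 N0 (measurable_funM (measurable_cst d) mv).
  rewrite -[d^-1]mulr1; apply: Lpnorm_le_of_modular => //; first by rewrite invr_gt0.
  rewrite mul1e; apply: le_trans H; rewrite le_eqVlt; apply/orP; left; apply/eqP.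
  by apply: eq_integral => x _; rewrite invrK normrM (gtr0_norm d0) mulrC.
split => [/(half _ _ _ M0 c0 mu_) H|].
  by rewrite -lee_pdivlMl// -EFinM; exact: H.
rewrite -lee_pdivlMl// -EFinM => H.
have := half c^-1 (fun x => c * u x) (c^-1 * M); rewrite invrK mulrA divff ?gt_eqF// mul1r; apply.
- by rewrite mulr_ge0// invr_ge0 ltW.
- by rewrite invr_gt0.
- exact: measurable_funM.
by apply: le_trans H; under eq_fun do rewrite mulrA mulVf ?gt_eqF// mul1r.
Qed.

End norms.

(** * Moduli expressed with Borel representatives *)

Section moduli.
Context {R : realType}.
Local Notation mu := (@lebesgue_measure R).
Local Notation TR := (measurableTypeR R).
Local Notation I := (`[(-1)%R, 1%R]%classic : set R).
Implicit Types (F : R -> R) (p : \bar R).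

Lemma Ddom_boundary (theta x : R) : 0 < theta -> -1 < x < 1 -> `|x| = 1 - theta * phi x / 2 ->
  `|x| = (4 - theta ^+ 2) / (4 + theta ^+ 2).
Proof.
move=> t0 /andP[x1 x2] xE; have px := phi_gt0 x1 x2.
have sq := sqr_phi (ltW x1) (ltW x2).
have sx : (1 - x) * (1 + x) = (1 - `|x|) * (1 + `|x|).
  have e (z : R) : (1 - z) * (1 + z) = 1 - z ^+ 2 by ring.
  by rewrite !e real_normK// num_real.
rewrite sx in sq.
have e1 : 4 * (1 - `|x|) ^+ 2 = theta ^+ 2 * phi x ^+ 2 by rewrite {1}xE; field.
have y0 : 0 < 1 - `|x| by rewrite xE; have := mulr_gt0 t0 px; real_lra.
move: sq e1 y0; move: (`|x|) => y -> e1 y0.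
have e2 : 4 * (1 - y) = theta ^+ 2 * (1 + y).
  by apply: (mulfI (lt0r_neq0 y0)); move: e1; rewrite expr2; real_lra.
have d0 : 4 + theta ^+ 2 != 0 by rewrite gt_eqF// ltr_wpDr ?sqr_ge0.
apply: (mulIf d0); rewrite divfK//; real_lra.
Qed.

Lemma negligible_boundary (theta : R) : 0 < theta ->
  {ae mu, forall x, -1 < x < 1 -> `|x| <> 1 - theta * phi x / 2}.
Proof.
move=> t0; pose e : R := (4 - theta ^+ 2) / (4 + theta ^+ 2).
exists ([set e] `|` [set - e]); split.
- by apply: measurableU; exact: measurable_set1.
- have n1 (y : R) : mu.-negligible ([set y] : set TR).
    by apply/negligibleP; [exact: measurable_set1|exact: lebesgue_measure_set1].
  apply/negligibleP; first by apply: measurableU; exact: measurable_set1.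
  exact: negligibleU.
move=> x /= Hx; apply: contrapT => xe; apply: Hx => x1 xE.
have := Ddom_boundary t0 x1 xE; rewrite -/e => ye; apply: xe.
have [x0|x0] := leP 0 x; [left|right]; rewrite /= -ye.
  by rewrite ger0_norm.
by rewrite ltr0_norm// opprK.
Qed.

Lemma Ddom_strict (theta x : R) : 0 < theta -> (-1 < x < 1 -> `|x| <> 1 - theta * phi x / 2) ->
  Ddom theta x <-> strict_domain theta x.
Proof.
move=> t0 Hx; rewrite /Ddom /strict_domain; split => [[/= h1 h2]|h].
  have hp : 0 <= theta * phi x by rewrite mulr_ge0 ?phi_ge0// ltW.
  have x1 : `|x| <= 1 by real_lra.
  have xb : -1 < x < 1.
    move: x1; rewrite ler_norml !le_eqVlt => /andP[/predU1P[x1|x1] /predU1P[x2|x2]].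
    - by exfalso; apply: h2; left.
    - by exfalso; apply: h2; right.
    - by exfalso; apply: h2; left.
    - by rewrite x1 x2.
  by rewrite lt_neqAle h1 andbT; apply/eqP; exact: Hx.
have [/andP[x1 x2] _ _ _ _] := strict_domain_bounds t0 h.
split; first exact: ltW.
by move=> [xE|xE]; [move: x2|move: x1]; rewrite xE ltxx.
Qed.

(** Borel stand-in for [wdiff]: the fixed interval [-1, 1] replaces the varying domain, and the
    value is 0 off the strict domain. *)
Definition strict_wdiff k (a b : R) F (tau x : R) : R :=
  if strict_domain (k%:R * tau) x then weighted_diff k a b F (tau, x) else 0.

Lemma measurable_strict_wdiff2 k (a b : R) F : measurable_fun setT F ->
  measurable_fun setT (fun q : TR * TR => strict_wdiff k a b F q.1 q.2).
Proof.
move=> mF; have mphi2 : measurable_fun setT (fun q : TR * TR => phi q.2).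
  by apply: (measurableT_comp measurable_phi); exact: measurable_snd.
apply: measurable_fun_if => //.
  apply: measurable_fun_ltr; first by apply: measurableT_comp => //; exact: measurable_snd.
  apply: measurable_funB => //; apply: measurable_funM => //; apply: measurable_funM => //.
  by apply: measurable_funM => //; exact: measurable_fst.
apply: measurable_funTS; have -> : (fun q : TR * TR => weighted_diff k a b F (q.1, q.2)) = weighted_diff k a b F.
  by apply/funext => -[].
exact: measurable_weighted_diff.
Qed.

Lemma measurable_strict_wdiff k (a b tau : R) F : measurable_fun setT F ->
  measurable_fun setT (strict_wdiff k a b F tau : TR -> R).
Proof.
by move=> mF; exact: (measurable_section (G := fun q => strict_wdiff k a b F q.1 q.2) tau (measurable_strict_wdiff2 k a b mF)).
Qed.

Lemma nab_step0 k F (w y : R) : (0 < k)%N -> w = 0 -> nab k w F y = 0.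
Proof.
move=> k0 ->; rewrite (@eq_nab _ k 0 F (horner (F y)%:P)) => [|i _]; last by rewrite mulr0 addr0 hornerC.
by apply: nab_poly; rewrite (leq_trans _ k0)// size_polyC; case: eqP.
Qed.

Lemma strict_wdiff0 k (a b : R) F x : (0 < k)%N -> strict_wdiff k a b F 0 x = 0.
Proof.
by move=> k0; rewrite /strict_wdiff /weighted_diff/=; case: ifP => // _; rewrite nab_step0 ?mul0r ?mulr0.
Qed.

Lemma fdiffE k h F x : `[x - k%:R * h / 2, x + k%:R * h / 2] `<=` `[(-1 : R), 1] ->
  fdiff k h F x = nab k h F (x - k%:R * h / 2).
Proof. by move=> H; rewrite /fdiff asboolT. Qed.

Lemma wdiff0 k r (alpha beta : R) F x : (0 < k)%N -> wdiff k r alpha beta F 0 x = 0.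
Proof.
move=> k0; rewrite /wdiff /fdiff; case: ifP => _; last by rewrite mulr0.
have := @nab_step0 k F (0 * phi x) (x - k%:R * (0 * phi x) / 2) k0 (mul0r _).
by rewrite /nab => ->; rewrite mulr0.
Qed.

(** Node maps expand distances by at least 1/2, so the preimage of a null set is null: the indicator
    is integrated with [sample_integral_le]. *)
Lemma sample_ae (theta c : R) F (F0 : R -> R) : 0 < theta -> `|c| <= 1 ->
  {ae mu, forall x, -1 < x < 1 -> F x = F0 x} ->
  {ae mu, forall x, strict_domain theta x -> F (sample theta c x) = F0 (sample theta c x)}.
Proof.
move=> t0 c1 [N [mN N0 subN]].
have mi : measurable_fun setT (\1_N : TR -> R) by exact: measurable_indic.
have i0 (x : TR) : 0 <= \1_N x :> R by rewrite indicE.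
have mI : measurable (I : set TR) by exact: measurable_itv.
have H := sample_integral_le t0 c1 mi i0.
have eN : (\int[mu]_(x in I) (\1_N x)%:E = 0)%E.
  rewrite integral_indic//; apply: (subset_measure0 _ mN _ N0); last exact: subIsetl.
  exact: measurableI.
rewrite eN mule0 in H.
pose g (x : TR) : R := if strict_domain theta x then \1_N (sample theta c x) else 0.
have g0 x : 0 <= g x by rewrite /g; case: ifP.
have mg : measurable_fun setT g.
  apply: measurable_fun_if => //; first exact: measurable_strict_domain.
  by apply: measurable_funTS; apply: measurableT_comp => //; exact: measurable_sample.
have : (\int[mu]_(x in I) `|(g x)%:E| = 0)%E.
  apply/eqP; rewrite eq_le integral_ge0 ?andbT//.
  by apply: le_trans H; rewrite le_eqVlt; apply/orP; left; apply/eqP; apply: eq_integral => x _; rewrite abse_EFin ger0_norm.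
have mgI : measurable_fun I (fun x : TR => (g x)%:E) by apply: measurable_funTS; exact/measurable_EFinP.
move/(ae_eq_integral_abs mu mI mgI).
apply: (@filterS _ _ (ae_filter_ringOfSetsType mu)) => x /= Hx Dx.
have [/andP[x1 x2] _ _ _ _] := strict_domain_bounds t0 Dx.
have [_ s1] := sample_itv t0 c1 Dx.
have : g x = 0 by have := Hx; rewrite /= in_itv/= !ltW// => /(_ isT)[].
rewrite /g Dx indicE; apply: contraPP => nFF; rewrite mem_set; first by move/eqP; rewrite oner_eq0.
by apply: subN => /= /(_ s1).
Qed.

Lemma wdiff_ae k r (alpha beta tau : R) F (F0 : R -> R) (a := r%:R / 2 + alpha) (b := r%:R / 2 + beta) :
  (0 < k)%N -> 0 < tau -> {ae mu, forall x, -1 < x < 1 -> F x = F0 x} ->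
  {ae mu, forall x, (wdiff k r alpha beta F tau \_ (Ddom (k%:R * tau))) x = (strict_wdiff k a b F0 tau \_ I) x}.
Proof.
move=> k0 tau0 FF0; set theta := k%:R * tau; have t0 : 0 < theta by rewrite mulr_gt0 ?ltr0n.
have h1 := negligible_boundary t0.
have h2 : {ae mu, forall x, forall i, (i <= k)%N -> strict_domain theta x ->
    F (sample theta (sample_ratio k i) x) = F0 (sample theta (sample_ratio k i) x)}.
  apply/ae_foralln => i; have [ik|ki] := leqP i k; last by apply: aeW.
  have := sample_ae t0 (sample_ratio_le1 ik k0) FF0.
  by apply: (@filterS _ _ (ae_filter_ringOfSetsType mu)) => x Hx _.
apply: (@filterS2 _ _ (ae_filter_ringOfSetsType mu) _ _ _ _ h1 h2) => x Hx1 Hx2.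
have DS := Ddom_strict t0 Hx1; rewrite /patch /strict_wdiff -/theta.
have [Dx|nDx] := boolP (strict_domain theta x); last first.
  by rewrite memNset; [case: ifP|move/DS; rewrite (negbTE nDx)].
have [/andP[x1 x2] px r0 xr1 xr2] := strict_domain_bounds t0 Dx.
rewrite mem_set; last exact/DS.
rewrite mem_set; last by rewrite /= in_itv/= !ltW.
rewrite /wdiff /weighted_diff/= -/theta -/a -/b; congr (_ * _).
have rE : k%:R * (tau * phi x) / 2 = theta * phi x / 2 by rewrite mulrA.
rewrite fdiffE; last first.
  move=> y; rewrite /= !in_itv/= rE => /andP[y1 y2]; apply/andP; split; real_lra.
by apply: eq_nab => i ik; rewrite node_sampleE// -/theta Hx2.
Qed.

Lemma Lpnorm_wdiff k r (alpha beta tau : R) F (F0 : R -> R) p (a := r%:R / 2 + alpha) (b := r%:R / 2 + beta) :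
  (0 < k)%N -> 0 < tau -> (1 <= p)%E -> measurable_fun setT F0 -> {ae mu, forall x, -1 < x < 1 -> F x = F0 x} ->
  Lpnorm (Ddom (k%:R * tau)) p (wdiff k r alpha beta F tau) = Lpnorm I p (strict_wdiff k a b F0 tau).
Proof.
move=> k0 tau0 p1 mF0 FF0; apply: Lpnorm_ae => //.
- exact: measurable_strict_wdiff.
- exact: wdiff_ae.
Qed.

Lemma omega_star_finE k r (alpha beta t q : R) F (F0 : R -> R) (a := r%:R / 2 + alpha) (b := r%:R / 2 + beta) :
  (0 < k)%N -> 1 <= q -> measurable_fun setT F0 -> {ae mu, forall x, -1 < x < 1 -> F x = F0 x} ->
  omega_star k r F t alpha beta q%:E =
  (((t^-1)%:E * \int[mu]_(tau in `[0%R, t]) \int[mu]_(x in I) (`|strict_wdiff k a b F0 tau x| `^ q)%:E) `^ q^-1)%E.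
Proof.
move=> k0 q1 mF0 FF0; rewrite /omega_star.
suff -> : (\int[mu]_(tau in `[0%R, t]) \int[mu]_(x in Ddom (k%:R * tau)) (`|wdiff k r alpha beta F tau x| `^ q)%:E =
  \int[mu]_(tau in `[0%R, t]) \int[mu]_(x in I) (`|strict_wdiff k a b F0 tau x| `^ q)%:E)%E by [].
(* tau = 0 is treated apart: the domains are compared for positive steps only, and a difference with
   step 0 vanishes since k > 0. *)
apply: eq_integral => tau; rewrite inE/= in_itv/= => /andP[]; rewrite le_eqVlt => /predU1P[<- _|tau0 _].
  have q0 : q != 0 by rewrite gt_eqF//; real_lra.
  rewrite integral0_eq; last by move=> x _; rewrite wdiff0// normr0 powR0.
  by rewrite integral0_eq// => x _; rewrite strict_wdiff0// normr0 powR0.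
have := @Lpnorm_wdiff k r alpha beta tau F F0 q%:E k0 tau0; rewrite lee_fin => /(_ q1 mF0 FF0).
have mI : measurable (I : set TR) by exact: measurable_itv.
rewrite Lpnorm_finE (Lpnorm_fin _ mI q1) -/a -/b => /(congr1 (fun X => X `^ q)%E).
have q0 : q^-1 * q = 1 by rewrite mulVf// gt_eqF//; real_lra.
rewrite -!poweRrM q0 !poweRe1; last 2 first.
- by apply: integral_ge0 => x _; rewrite lee_fin powR_ge0.
- by apply: integral_ge0 => x _; rewrite lee_fin powR_ge0.
move=> <-; rewrite integral_mkcond; apply: eq_integral => x _; rewrite /patch; case: ifP => // _.
by change (0%:E = (`|0 : R| `^ q)%:E); rewrite normr0 powR0// gt_eqF//; real_lra.
Qed.

Lemma local_modulus_strict Phi k (a b t : R) (F0 : R -> R) : (0 < k)%N -> convmod Phi -> measurable_fun setT F0 ->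
  local_modulus Phi k a b F0 t (-1) 1 =
  (\int[mu]_(tau in `[0%R, t]) \int[mu]_(x in I) (Phi `|strict_wdiff k a b F0 tau x|)%:E)%E.
Proof.
move=> k0 cm mF0; rewrite /local_modulus; apply: eq_integral => tau.
rewrite inE/= in_itv/= => /andP[]; rewrite le_eqVlt => /predU1P[<- _|tau0 _].
  rewrite integral0_eq; last first.
    move=> x _; rewrite /modulus_integrand /weighted_diff/= nab_step0 ?mul0r// mulr0 normr0 (cm_0 cm).
    by case: ifP.
  by rewrite integral0_eq// => x _; rewrite strict_wdiff0// normr0 (cm_0 cm).
set theta := k%:R * tau; have t0 : 0 < theta by rewrite mulr_gt0 ?ltr0n.
have m1 : measurable_fun setT (fun x : TR => modulus_integrand Phi k a b F0 (tau, x)).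
  by apply: measurable_section; exact: measurable_modulus_integrand.
have m2 : measurable_fun setT (fun x : TR => Phi `|strict_wdiff k a b F0 tau x|).
  apply: measurableT_comp; first exact: cm_meas cm.
  by apply: measurableT_comp => //; exact: measurable_strict_wdiff.
apply: ge0_ae_eq_integral => //.
- by apply: measurable_funTS; exact/measurable_EFinP.
- by apply: measurable_funTS; exact/measurable_EFinP.
- by move=> x _; rewrite lee_fin modulus_integrand_ge0.
- by move=> x _; rewrite lee_fin (cm_ge0 cm).
apply: (@filterS _ _ (ae_filter_ringOfSetsType mu) _ _ _ (negligible_boundary t0)) => x Hx _.
rewrite /modulus_integrand /strict_wdiff -/theta /in_domain/= -/theta; congr EFin.
have [Dx|nDx] := boolP (strict_domain theta x).
  have [/andP[x1 x2] _ _ _ _] := strict_domain_bounds t0 Dx.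
  by rewrite x1 x2/= ifT// ltW.
rewrite normr0 (cm_0 cm); case: ifP => // /and3P[x1 x2 x3]; exfalso; apply: (negP nDx).
by rewrite /strict_domain lt_neqAle x3 andbT; apply/eqP; apply: Hx; rewrite x1.
Qed.

Lemma Lpnorm_wdiff_le_omega k r (alpha beta t tau : R) F p : 0 < tau -> tau <= t ->
  (Lpnorm (Ddom (k%:R * tau)) p (wdiff k r alpha beta F tau) <= omega k r F t alpha beta p)%E.
Proof.
by move=> tau0 taut; apply: ereal_sup_ubound; exists tau => //; rewrite /= in_itv/= tau0.
Qed.

Lemma omega_ge0 k r (alpha beta t : R) F p : 0 < t -> (0 <= omega k r F t alpha beta p)%E.
Proof. by move=> t0; apply: le_trans (Lpnorm_wdiff_le_omega _ _ _ _ _ _ t0 (lexx t)); exact: Lpnorm_ge0. Qed.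

Lemma modular_wdiff_le_omega k r (alpha beta t M : R) F (F0 : R -> R) p (a := r%:R / 2 + alpha) (b := r%:R / 2 + beta) :
  (0 < k)%N -> (1 <= p)%E -> 0 <= M -> measurable_fun setT F0 -> {ae mu, forall x, -1 < x < 1 -> F x = F0 x} ->
  (omega k r F t alpha beta p <= M%:E)%E -> forall tau, 0 <= tau <= t ->
  (\int[mu]_(x in I) (modular p M `|strict_wdiff k a b F0 tau x|)%:E <= (level p M)%:E)%E.
Proof.
move=> k0 p1 M0 mF0 FF0 H tau /andP[]; rewrite le_eqVlt => /predU1P[<- _|tau0 taut].
  rewrite integral0_eq; last by move=> x _; rewrite strict_wdiff0// normr0 (cm_0 (convmod_modular p1 M0)).
  by case: p {p1 H} => [q||]; rewrite lee_fin /level ?powR_ge0.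
apply/Lpnorm_modular => //; first exact: measurable_strict_wdiff.
rewrite -(@Lpnorm_wdiff k r alpha beta tau F F0 p)//; apply: le_trans H; exact: Lpnorm_wdiff_le_omega.
Qed.

Lemma omega_star_modular k r (alpha beta t M : R) F (F0 : R -> R) p (a := r%:R / 2 + alpha) (b := r%:R / 2 + beta) :
  (0 < k)%N -> (1 <= p)%E -> 0 < t -> 0 <= M -> measurable_fun setT F0 ->
  {ae mu, forall x, -1 < x < 1 -> F x = F0 x} -> (omega_star k r F t alpha beta p <= M%:E)%E ->
  (local_modulus (modular p M) k a b F0 t (-1) 1 <= (t * level p M)%:E)%E.
Proof.
move=> k0 p1 t0 M0 mF0 FF0 H; rewrite local_modulus_strict//; last exact: convmod_modular.
case: p p1 H => [q p1 H|p1 H|//]; last first.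
  have inner tau := @modular_wdiff_le_omega k r alpha beta t M F F0 +oo%E k0 p1 M0 mF0 FF0 H tau.
  rewrite integral0_eq ?mulr0//= => tau; rewrite /= in_itv/= => ht.
  apply/eqP; rewrite eq_le (inner tau ht)/=; apply: integral_ge0 => x _.
  by rewrite lee_fin; apply: (cm_ge0 (convmod_modular p1 M0)).
rewrite lee_fin in p1; move: H; rewrite (omega_star_finE _ _ _ _ k0 p1 mF0 FF0) -/a -/b /modular /level => H.
have -> : (\int[mu]_(tau in `[0%R, t]) \int[mu]_(x in I) (`|(`|strict_wdiff k a b F0 tau x|)| `^ q)%:E =
    \int[mu]_(tau in `[0%R, t]) \int[mu]_(x in I) (`|strict_wdiff k a b F0 tau x| `^ q)%:E)%E.
  by apply: eq_integral => tau _; apply: eq_integral => x _; rewrite normr_id.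
move: H; set X := integral _ _ _ => H; have X0 : (0 <= X)%E.
  by apply: integral_ge0 => tau _; apply: integral_ge0 => x _; rewrite lee_fin powR_ge0.
have q0 : 0 < q by real_lra.
have tX0 : (0 <= (t^-1)%:E * X)%E by rewrite mule_ge0// lee_fin invr_ge0 ltW.
have : ((((t^-1)%:E * X) `^ q^-1) `^ q <= M%:E `^ q)%E by apply: poweR_mono; rewrite ?poweR_ge0// ltW.
by rewrite -poweRrM mulVf ?gt_eqF// poweRe1// poweR_EFin EFinM lee_pdivrMl.
Qed.

Lemma omega_star_le_omega k r (alpha beta t : R) F (F0 : R -> R) p :
  (0 < k)%N -> (1 <= p)%E -> 0 < t -> measurable_fun setT F0 ->
  {ae mu, forall x, -1 < x < 1 -> F x = F0 x} ->
  (omega_star k r F t alpha beta p <= omega k r F t alpha beta p)%E.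
Proof.
move=> k0 + t0 mF0 FF0; case: p => [q p1|//|//].
have o0 := @omega_ge0 k r alpha beta t F q%:E t0.
have [|ofin] := eqVneq (omega k r F t alpha beta q%:E) +oo%E; first by move=> ->; rewrite leey.
have [M ME] : exists M, omega k r F t alpha beta q%:E = M%:E.
  by move: o0 ofin; case: (omega _ _ _ _ _ _ _) => // M _ _; exists M.
rewrite ME in o0 *; rewrite lee_fin in o0.
have H : (omega k r F t alpha beta q%:E <= M%:E)%E by rewrite ME.
have inner tau := @modular_wdiff_le_omega k r alpha beta t M F F0 q%:E k0 p1 o0 mF0 FF0 H tau.
have q1 := p1; rewrite lee_fin in q1; have q0 : 0 < q by real_lra.
rewrite (omega_star_finE _ _ _ _ k0 q1 mF0 FF0).
set a := r%:R / 2 + alpha in inner *; set b := r%:R / 2 + beta in inner *.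
pose G (z : TR * TR) : R := `|strict_wdiff k a b F0 z.1 z.2| `^ q.
have mG : measurable_fun setT G.
  apply: (@measurableT_comp _ _ _ _ _ _ ((@powR R)^~ q)); first exact: measurable_powR.
  by apply: measurableT_comp => //; exact: measurable_strict_wdiff2.
have mI : measurable (I : set TR) by exact: measurable_itv.
have X1 : (\int[mu]_(tau in `[0%R, t]) \int[mu]_(x in I) (`|strict_wdiff k a b F0 tau x| `^ q)%:E <=
    (t * M `^ q)%:E)%E.
  apply: (@le_trans _ _ (\int[mu]_(tau in `[0%R, t]) (cst (M `^ q)%:E tau))%E).
    apply: ge0_le_integral => //.
    - by move=> tau _; apply: integral_ge0 => x _; rewrite lee_fin powR_ge0.
    - by apply: measurable_funTS; apply: (measurable_inner (G := G)) => // z; exact: powR_ge0.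
    move=> tau; rewrite /= in_itv/= => /inner; rewrite /modular /level; apply: le_trans.
    by rewrite le_eqVlt; apply/orP; left; apply/eqP; apply: eq_integral => x _; rewrite normr_id.
  rewrite integral_cst//= lebesgue_measure_itv/= lte_fin t0 sube0.
  by rewrite -EFinM mulrC.
apply: (@le_trans _ _ ((M `^ q)%:E `^ q^-1)%E).
  apply: poweR_mono; first by rewrite invr_ge0 ltW.
    rewrite mule_ge0 ?lee_fin ?invr_ge0 ?(ltW t0)//.
    by apply: integral_ge0 => tau _; apply: integral_ge0 => x _; rewrite lee_fin powR_ge0.
  by rewrite lee_pdivrMl// -EFinM.
by rewrite poweR_EFin -powRrM mulfV ?gt_eqF// powRr1.
Qed.

End moduli.

(** * The K-functional is bounded by the averaged modulus *)

Section equivalence.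
Context {R : realType}.
Local Notation mu := (@lebesgue_measure R).
Local Notation TR := (measurableTypeR R).
Local Notation I := (`[(-1)%R, 1%R]%classic : set R).
Implicit Types (F f g : R -> R) (p : \bar R).

Lemma wjac_phi r (alpha beta x : R) : -1 < x < 1 ->
  wjac (r%:R / 2 + alpha) (r%:R / 2 + beta) x = wjac alpha beta x * phi x ^+ r.
Proof.
move=> /andP[x1 x2]; have u0 : 0 < 1 - x by real_lra.
have w0 : 0 < 1 + x by real_lra.
have pE : phi x ^+ r = (1 - x) `^ (r%:R / 2) * (1 + x) `^ (r%:R / 2).
  rewrite -powR_mulrn ?phi_ge0//.
  have -> : phi x = (1 - x) `^ 2^-1 * (1 + x) `^ 2^-1.
    rewrite -powRM; [|exact: ltW|exact: ltW].
    rewrite powR12_sqrt; last by rewrite mulr_ge0// ltW.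
    by rewrite /phi; congr Num.sqrt; ring.
  by rewrite powRM ?powR_ge0// -!powRrM (mulrC 2^-1).
rewrite pE /wjac !powRD; first ring.
- by apply/implyP => _; rewrite gt_eqF.
- by apply/implyP => _; rewrite gt_eqF.
Qed.

Lemma ae_itv_interior (P : R -> Prop) : {ae mu, forall x, -1 < x < 1 -> P x} ->
  {ae mu, forall x, I x -> P x}.
Proof.
have e (y : R) : {ae mu, forall x, x <> y}.
  exists [set y]; split; [exact: measurable_set1|exact: lebesgue_measure_set1|].
  by move=> x /= /contrapT.
move=> H; have h1 := e 1; have h2 := e (-1).
apply: (@filterS3 _ _ (ae_filter_ringOfSetsType mu) _ _ _ _ _ H h1 h2) => x Hx x1 x2.
rewrite /= in_itv/= !le_eqVlt => /andP[/predU1P[xE|a] /predU1P[xE'|b]]; [exfalso; exact: x1|exfalso; exact: x2|exfalso; exact: x1|].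
by apply: Hx; rewrite a b.
Qed.

Lemma Lpnorm_ae_itv p (u v : R -> R) : (1 <= p)%E -> measurable_fun setT (v : TR -> R) ->
  {ae mu, forall x, -1 < x < 1 -> u x = v x} -> Lpnorm I p u = Lpnorm I p v.
Proof.
move=> p1 mv /ae_itv_interior ae; apply: Lpnorm_ae => //.
apply: (@filterS _ _ (ae_filter_ringOfSetsType mu) _ _ _ ae) => x Hx.
by rewrite /patch; case: ifPn => // xI; apply: Hx; exact: set_mem xI.
Qed.

Lemma ae_interior (P : R -> Prop) : {ae mu, forall x, -1 <= x <= 1 -> P x} ->
  {ae mu, forall x, -1 < x < 1 -> P x}.
Proof.
apply: (@filterS _ _ (ae_filter_ringOfSetsType mu)) => x Hx /andP[x1 x2].
by apply: Hx; rewrite !ltW.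
Qed.

(** Measurability is assumed for phi^r f^(r); its Borel representative is divided by phi^r, which is
    positive inside (-1, 1). *)
Lemma Bspace_representative r p (alpha beta : R) f (a := r%:R / 2 + alpha) (b := r%:R / 2 + beta) :
  (1 <= p)%E -> Bspace r p (wjac alpha beta) f ->
  exists F0 : TR -> R, [/\ measurable_fun setT F0,
    {ae mu, forall x, -1 < x < 1 -> derive1n r f x = F0 x} &
    (Lpnorm I p (fun x => wjac a b x * F0 x)%R < +oo)%E].
Proof.
move=> p1 Bf; have [mF nF] : lebesgue_measurable_fun I (fun x => phi x ^+ r * derive1n r f x) /\
    (Lpnorm I p (fun x => wjac alpha beta x * (phi x ^+ r * derive1n r f x))%R < +oo)%E.
  case: r Bf {a b} => [[mf nf]|q [_ _ []]//].
  have -> : (fun x => phi x ^+ 0 * derive1n 0 f x) = f by apply/funext => x; rewrite expr0 mul1r.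
  split => //; apply: le_lt_trans nf; rewrite le_eqVlt; apply/orP; left; apply/eqP; congr Lpnorm.
  by apply/funext => x; rewrite expr0 mul1r.
have [u0 mu0 /ae_interior aeu] := lebesgue_measurable_representative mF.
have mphi : measurable_fun setT (fun x : TR => (phi x ^+ r)^-1).
  apply: measurable_inv_ge0; first by apply: measurable_funX; exact: measurable_phi.
  by move=> x; rewrite exprn_ge0// phi_ge0.
have mF0 : measurable_fun setT (fun x : TR => (phi x ^+ r)^-1 * u0 x) by exact: measurable_funM.
have aeF : {ae mu, forall x, -1 < x < 1 -> derive1n r f x = (phi x ^+ r)^-1 * u0 x}.
  apply: (@filterS _ _ (ae_filter_ringOfSetsType mu) _ _ _ aeu) => x Hx x1.
  rewrite -Hx// mulrA mulVf ?mul1r// gt_eqF// exprn_gt0//; by have /andP[x2 x3] := x1; exact: phi_gt0.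
exists (fun x => (phi x ^+ r)^-1 * u0 x); split => //.
apply: le_lt_trans nF; rewrite le_eqVlt; apply/orP; left; apply/eqP; symmetry.
apply: Lpnorm_ae_itv => //; first by apply: measurable_funM => //; exact: measurable_wjac.
apply: (@filterS _ _ (ae_filter_ringOfSetsType mu) _ _ _ aeF) => x Hx x1.
by rewrite -Hx// /a /b wjac_phi// mulrA.
Qed.

Lemma le_modular p (M s : R) : (1 <= p)%E -> 0 <= M -> 0 <= s -> s <= 1 + M + modular p M s.
Proof.
case: p => [q||//] + M0 s0; rewrite /modular; last first => [_|].
  have : s - M <= Num.max 0 (s - M) by rewrite le_max lexx orbT.
  real_lra.
rewrite lee_fin => q1; rewrite ger0_norm//; have [s1|s1] := leP s 1.
  by have := powR_ge0 s q; real_lra.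
have : s <= s `^ q by rewrite -[leLHS]powRr1// ler_powR// ltW.
real_lra.
Qed.

Lemma weighted_integrable p (a b c d : R) (F0 : TR -> R) : (1 <= p)%E -> 0 <= a -> 0 <= b ->
  measurable_fun setT F0 -> (Lpnorm I p (fun x => wjac a b x * F0 x)%R < +oo)%E ->
  -1 < c -> d < 1 -> mu.-integrable `[c, d] (EFin \o F0).
Proof.
move=> p1 a0 b0 mF nF c1 d1; have mv := @measurable_wjac R a b.
have mvF : measurable_fun setT (fun x : TR => wjac a b x * F0 x) by exact: measurable_funM.
have [M M0 nM] : exists2 M : R, 0 <= M & (Lpnorm I p (fun x => wjac a b x * F0 x)%R <= M%:E)%E.
  move: nF (Lpnorm_ge0 I p (fun x => wjac a b x * F0 x)).
  by case: (Lpnorm _ _ _) => // M _ M0; exists M; rewrite ?lexx// -lee_fin.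
have mI : measurable (I : set TR) by exact: measurable_itv.
have /(Lpnorm_modular mI p1 M0 mvF) H := nM.
have cm := convmod_modular p1 M0.
(* A lower bound of the weight on [c, d]; integrability then follows from s <= 1 + M +
   [modular p M s], uniformly in p. *)
pose m := (1 - d) `^ a * (1 + c) `^ b.
have m0 : 0 < m by apply: mulr_gt0; apply: powR_gt0; real_lra.
have mlev : 0 <= level p M by case: p {p1 nF nM H cm} => [q||]; rewrite /level ?powR_ge0.
apply/integrableP; split; first by apply: measurable_funTS; exact/measurable_EFinP.
have mMod : measurable_fun setT (fun x : TR => modular p M `|wjac a b x * F0 x|).
  by apply: measurableT_comp; [exact: cm_meas cm|exact: measurableT_comp].
have Mod0 x : 0 <= modular p M `|wjac a b x * F0 x| by exact: (cm_ge0 cm).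
apply: (@le_lt_trans _ _ (\int[mu]_(x in I) (m^-1 * (1 + M) + m^-1 * modular p M `|wjac a b x * F0 x|)%:E)%E).
  apply: le_integral_fin => //.
  - exact: measurableT_comp.
  - by apply: measurable_funD => //; exact: measurable_funM.
  - by move=> x; rewrite addr_ge0 ?mulr_ge0 ?invr_ge0 ?(ltW m0)//; real_lra.
  move=> x; rewrite /= in_itv/= => /andP[cx xd]; left; split; first by rewrite in_itv/=; apply/andP; split; real_lra.
  rewrite -mulrDr ler_pdivlMl//; apply: le_trans (le_modular p1 M0 (normr_ge0 _)).
  rewrite normrM ger0_norm ?wjac_ge0// ler_wpM2r//.
  by apply: ler_pM; rewrite ?powR_ge0//; apply: ge0_ler_powR; rewrite ?nnegrE//; real_lra.
under eq_integral do rewrite EFinD EFinM.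
have mi0 : 0 <= m^-1 by rewrite invr_ge0 ltW.
have M1 : 0 <= 1 + M by real_lra.
rewrite ge0_integralD//; try by [move=> x _; rewrite ?mule_ge0 ?lee_fin ?mulr_ge0|apply: measurable_funTS; apply/measurable_EFinP; exact: measurable_funM].
under [X in (_ + X)%E]eq_integral do rewrite EFinM.
rewrite ge0_integralZl//; try by [rewrite lee_fin|move=> x _; rewrite lee_fin|apply: measurable_funTS; exact/measurable_EFinP].
rewrite lte_add_pinfty//.
  apply: lte_mul_pinfty; rewrite ?lee_fin//.
  have : (\int[mu]_(x in I) (cst (1 + M)%:E x) < +oo)%E.
    by rewrite integral_cst//= lebesgue_measure_itv/= lte_fin ifT ?ltrN10// -EFinB -EFinM ltry.
  exact.
rewrite ge0_integralZl//; try by [rewrite lee_fin|move=> x _; rewrite lee_fin|apply: measurable_funTS; exact/measurable_EFinP].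
by apply: lte_mul_pinfty; rewrite ?lee_fin//; apply: (le_lt_trans H); rewrite ltry.
Qed.

Lemma spline_wf_iter (K j : nat) (s : seq (R * {poly R})) : spline_wf (j + K) s -> spline_wf K (iter j spline_deriv s).
Proof.
elim: j K s => [//|j IH] K s; rewrite addSnnS => /IH /=; exact: spline_wf_deriv.
Qed.

Theorem Kfunctional_le_omega_star k r p (alpha beta : R) (a := r%:R / 2 + alpha) (b := r%:R / 2 + beta) :
  (0 < k)%N -> (1 <= p)%E -> 0 <= a -> 0 <= b ->
  exists2 C : R, 0 < C & forall f t, Bspace r p (wjac alpha beta) f -> 0 < t -> t <= 2 ->
    (Kfunctional k r (derive1n r f) (t ^+ k) alpha beta p <=
     C%:E * omega_star k r (derive1n r f) t alpha beta p)%E.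
Proof.
move=> k0 p1 a0 b0; have [C C1 HC] := @spline_approximation R k a b k0 a0 b0.
have C0 : 0 < C by real_lra.
exists (2 * (C * C)); first by rewrite !mulr_gt0.
move=> f t Bf t0 t2; have [F0 [mF0 aeF nF]] := Bspace_representative p1 Bf.
set F := derive1n r f in aeF *.
have CC0 : (0 < (2 * (C * C))%:E)%E by rewrite lte_fin !mulr_gt0.
have os0 : (0 <= omega_star k r F t alpha beta p)%E.
  case: p p1 {Bf nF} => [q q1|_|//]; first exact: poweR_ge0.
  exact: omega_ge0.
have [->|ofin] := eqVneq (omega_star k r F t alpha beta p) +oo%E; first by rewrite gt0_muley// leey.
(* M is the value of omega* itself: the modular of level M converts the bound into an integral
   estimate and the conclusion back into a norm. *)
have [M ME] : exists M, omega_star k r F t alpha beta p = M%:E.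
  by move: os0 ofin; case: (omega_star _ _ _ _ _ _ _) => // M _ _; exists M.
rewrite ME in os0 *; rewrite lee_fin in os0.
have H : (omega_star k r F t alpha beta p <= M%:E)%E by rewrite ME.
have {}H := omega_star_modular k0 p1 t0 os0 mF0 aeF H; rewrite -/a -/b in H.
have cm := convmod_modular p1 os0.
have [P [s [swf H1 H2]]] := HC _ F0 t cm mF0 (fun c d => weighted_integrable p1 a0 b0 mF0 nF) t0 t2.
have lev : ((C / t)%:E * local_modulus (modular p M) k a b F0 t (-1) 1 <= C%:E * (level p M)%:E)%E.
  apply: (@le_trans _ _ ((C / t)%:E * (t * level p M)%:E)%E).
    by apply: lee_wpmul2l => //; rewrite lee_fin divr_ge0// ltW.
  by rewrite -!EFinM lee_fin mulrA divfK// gt_eqF.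
(* Integrating the spline r times raises the order of its jumps to r + k + 2, so g has the
   derivatives required of a competitor. *)
have [P' [s' [s'wf P'P s's]]] := spline_iter_antiderivative r P swf.
pose g := spline P' s'.
have dgr : derive1n r g = spline P s.
  by rewrite (derive1n_spline P' s'wf) ?P'P ?s's// -addn1 leq_add2l.
have dgkr : derive1n (k + r) g = spline P^`(k) (iter k spline_deriv s).
  rewrite /derive1n iterD -/(derive1n r g) dgr -/(derive1n k _).
  by apply: (derive1n_spline P swf).
pose S := spline P s; pose Sk := spline P^`(k) (iter k spline_deriv s).
have mS : measurable_fun setT (S : TR -> R) by exact: measurable_spline.
have mSk : measurable_fun setT (Sk : TR -> R) by exact: measurable_spline.
have mI : measurable (I : set TR) by exact: measurable_itv.
have mv := @measurable_wjac R a b.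
have v0 x : 0 <= wjac a b x by exact: wjac_ge0.
have m1 : measurable_fun setT (fun x : TR => wjac a b x * (F0 x - S x)).
  by apply: measurable_funM => //; exact: measurable_funB.
have mk : measurable_fun setT (fun x : TR => wjac a b x * phi x ^+ k * Sk x).
  apply: measurable_funM => //; apply: measurable_funM => //.
  by apply: measurable_funX; exact: measurable_phi.
have N1 : (Lpnorm I p (fun x => wjac a b x * (F0 x - S x))%R <= (C * C * M)%:E)%E.
  apply: Lpnorm_le_of_modular => //; apply: le_trans lev; apply: le_trans H1.
  rewrite le_eqVlt; apply/orP; left; apply/eqP; apply: eq_integral => x _.
  by rewrite normrM (ger0_norm (v0 x)).
have tk0 : 0 < t ^+ k by rewrite exprn_gt0.
have N2 : ((t ^+ k)%:E * Lpnorm I p (fun x => wjac a b x * phi x ^+ k * Sk x)%R <= (C * C * M)%:E)%E.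
  apply/Lpnorm_scale => //; first by rewrite !mulr_ge0// ltW.
  apply: Lpnorm_le_of_modular => //; first exact: measurable_funM.
  apply: le_trans lev; apply: le_trans H2.
  rewrite le_eqVlt; apply/orP; left; apply/eqP; apply: eq_integral => x _; congr (modular _ _ (_ / _))%:E.
  have w0 : 0 <= t ^+ k * wjac a b x * phi x ^+ k.
    exact: mulr_ge0 (mulr_ge0 (ltW tk0) (v0 x)) (exprn_ge0 k (phi_ge0 x)).
  by rewrite -(ger0_norm w0) -normrM !mulrA.
have E1 : Lpnorm I p (fun x => wjac alpha beta x * phi x ^+ r * (F x - derive1n r g x))%R =
    Lpnorm I p (fun x => wjac a b x * (F0 x - S x))%R.
  apply: Lpnorm_ae_itv => //.
  apply: (@filterS _ _ (ae_filter_ringOfSetsType mu) _ _ _ aeF) => x Hx x1.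
  by rewrite dgr Hx// /a /b wjac_phi.
have E2 : Lpnorm I p (fun x => wjac alpha beta x * phi x ^+ (k + r) * derive1n (k + r) g x)%R =
    Lpnorm I p (fun x => wjac a b x * phi x ^+ k * Sk x)%R.
  apply: Lpnorm_ae_itv => //; apply: aeW => x x1.
  by rewrite dgkr /a /b wjac_phi// exprD; congr (_ * _); rewrite -mulrA (mulrC (phi x ^+ r)).
have nk : (Lpnorm I p (fun x => wjac a b x * phi x ^+ k * Sk x)%R < +oo)%E.
  move: N2; rewrite -lee_pdivlMl// => N2; apply: (le_lt_trans N2); by rewrite -EFinM ltry.
have Bg : Bspace (k + r) p (wjac alpha beta) g.
  have kr : (0 < k + r)%N by rewrite addn_gt0 k0.
  have sp j : (j < k + r)%N -> exists P'' s'', spline_wf 2 s'' /\ derive1n j g = spline P'' s''.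
    move=> jkr; exists P'^`(j), (iter j spline_deriv s'); split.
      apply: spline_wf_iter; apply: spline_wf_le s'wf.
      by rewrite addn2 addnS addnS !ltnS addnC ltnW.
    apply: (derive1n_spline P' s'wf); apply: (leq_trans jkr).
    by rewrite addnC leq_add2l; exact: leqW (leqnSn _).
  have Lg : Lspace_wp (wjac alpha beta) p (fun x => phi x ^+ (k + r) * derive1n (k + r) g x).
    split.
      apply: lebesgue_measurable_of_borel => //; rewrite dgkr; apply: measurable_funM => //.
      by apply: measurable_funX; exact: measurable_phi.
    by under [X in Lpnorm _ _ X]eq_fun do rewrite mulrA; rewrite E2.
  move: kr sp Lg; case: (k + r)%N => // q _ sp Lg; split => //.
  - move=> j x jq x1; have [P'' [s'' [wf'' ->]]] := sp j (ltnW jq).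
    by have := is_derive_spline P'' x wf'' => ?; exact: ex_derive.
  - by have [P'' [s'' [wf'' ->]]] := sp q (ltnSn q); exact: ACloc_spline.
apply: (@le_trans _ _ (Lpnorm I p (fun x => wjac alpha beta x * phi x ^+ r * (F x - derive1n r g x))%R +
   (t ^+ k)%:E * Lpnorm I p (fun x => wjac alpha beta x * phi x ^+ (k + r) * derive1n (k + r) g x)%R)%E).
  by apply: ereal_inf_lbound; exists g.
rewrite E1 E2 -EFinM (_ : 2 * (C * C) * M = C * C * M + C * C * M); last ring.
by rewrite EFinD; exact: leeD.
Qed.

End equivalence.

(** * The modulus is bounded by the K-functional *)

Section direct_inequality.
Context {R : realType}.
Local Notation mu := (@lebesgue_measure R).
Local Notation TR := (measurableTypeR R).
Local Notation I := (`[(-1)%R, 1%R]%classic : set R).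
Implicit Types (F f g : R -> R) (p : \bar R).

Lemma derive1n_add (j r : nat) g : derive1n j (derive1n r g) = derive1n (j + r) g.
Proof. by rewrite /derive1n iterD. Qed.

Lemma Bspace_derivative_density k r p w g (h : R -> R) : (0 < k)%N -> Bspace (k + r) p w g ->
  {ae mu, forall x, -1 < x < 1 -> derive1n (k + r) g x = h x} -> derivative_density k (derive1n r g) h.
Proof.
case: k => // k _; rewrite addSn => -[dg gac _] ae; split => /=.
- by move=> j y jk y1; rewrite derive1n_add; apply: dg => //; rewrite ltn_add2r.
- by rewrite derive1n_add.
- by move: ae; rewrite -addSn -derive1n_add.
Qed.

Lemma derivative_density_continuous k (G h : R -> R) (x : R) : (0 < k)%N -> derivative_density k G h ->
  -1 < x < 1 -> {for x, continuous G}.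
Proof.
case: k => // -[|k] _ [dG Gac _] x1.
  by have /andP[x2 x3] := x1; exact: (ACloc_continuous Gac).
by apply: differentiable_continuous; apply/derivable1_diffP; exact: (dG 0%N).
Qed.

Lemma continuous_representative (G : R -> R) : (forall x, -1 < x < 1 -> {for x, continuous G}) ->
  exists2 G0 : TR -> R, measurable_fun setT G0 & forall x, -1 < x < 1 -> G x = G0 x.
Proof.
move=> cG; have mJ : measurable (`](-1)%R, 1%R[%classic : set TR) by exact: measurable_itv.
exists (G \_ `](-1)%R, 1%R[).
  apply/(measurable_restrictT _ mJ); apply: open_continuous_measurable_fun; first exact: interval_open.
  by move=> x; rewrite inE/= in_itv/=; exact: cG.
by move=> x x1; rewrite /patch mem_set//= in_itv.
Qed.

Lemma strict_wdiff_modular_le k p (a b tau C1 C2 K M : R) (F0 G0 : TR -> R) : (0 < k)%N -> (1 <= p)%E ->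
  0 <= M -> 0 < C1 -> 0 < C2 -> 0 <= K -> measurable_fun setT F0 -> measurable_fun setT G0 ->
  (\int[mu]_(x in I) (if strict_domain (k%:R * tau) x
     then modular p M (`|weighted_diff k a b (fun y => F0 y - G0 y)%R (tau, x)| / C1) else 0)%:E <= (K * level p M)%:E)%E ->
  (\int[mu]_(x in I) (if strict_domain (k%:R * tau) x
     then modular p M (`|weighted_diff k a b G0 (tau, x)| / C2) else 0)%:E <= (level p M)%:E)%E ->
  (\int[mu]_(x in I) (modular p M (`|strict_wdiff k a b F0 tau x| / ((C1 + C2) * 2)))%:E <= (K + 1)%:E * (level p M)%:E)%E.
Proof.
move=> k0 p1 M0 C10 C20 K0 mF mG H1 H2; have cm := convmod_modular p1 M0.
have C0 : 0 < C1 + C2 by rewrite addr_gt0.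
have mI : measurable (I : set TR) by exact: measurable_itv.
have mwd (F : TR -> R) : measurable_fun setT F -> measurable_fun setT (fun x : TR => weighted_diff k a b F (tau, x)).
  by move=> m; exact: (measurable_section (G := weighted_diff k a b F) tau (measurable_weighted_diff k a b m)).
have mFG : measurable_fun setT (fun y : TR => F0 y - G0 y) by exact: measurable_funB.
pose f1 (x : TR) : R := if strict_domain (k%:R * tau) x
     then modular p M (`|weighted_diff k a b (fun y => F0 y - G0 y)%R (tau, x)| / C1) else 0.
pose f2 (x : TR) : R := if strict_domain (k%:R * tau) x
     then modular p M (`|weighted_diff k a b G0 (tau, x)| / C2) else 0.
have mf1 : measurable_fun setT f1.
  apply: measurable_fun_if => //; first exact: measurable_strict_domain.
  apply: measurable_funTS; apply: measurableT_comp; first exact: cm_meas cm.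
  by apply: measurable_funM => //; apply: measurableT_comp => //; exact: mwd.
have mf2 : measurable_fun setT f2.
  apply: measurable_fun_if => //; first exact: measurable_strict_domain.
  apply: measurable_funTS; apply: measurableT_comp; first exact: cm_meas cm.
  by apply: measurable_funM => //; apply: measurableT_comp => //; exact: mwd.
have f10 x : 0 <= f1 x by rewrite /f1; case: ifP => // _; apply: (cm_ge0 cm); rewrite divr_ge0// ltW.
have f20 x : 0 <= f2 x by rewrite /f2; case: ifP => // _; apply: (cm_ge0 cm); rewrite divr_ge0// ltW.
apply: (@le_trans _ _ (\int[mu]_(x in I) (f1 x + f2 x)%:E)%E).
  apply: le_integral_fin => //.
  - apply: measurableT_comp; first exact: cm_meas cm.
    by apply: measurable_funM => //; apply: measurableT_comp => //; exact: measurable_strict_wdiff.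
  - exact: measurable_funD.
  - by move=> x; apply: (cm_ge0 cm); rewrite divr_ge0// mulr_ge0// ltW.
  - by move=> x; rewrite addr_ge0.
  move=> x x1; left; split => //; rewrite /f1 /f2 /strict_wdiff; case: ifPn => Dx; last first.
    by rewrite normr0 mul0r (cm_0 cm) addr0.
  rewrite invfM mulrA.
  set u1 := weighted_diff k a b (fun y => F0 y - G0 y) (tau, x).
  set u2 := weighted_diff k a b G0 (tau, x).
  have -> : weighted_diff k a b F0 (tau, x) = u1 + u2.
    by rewrite /u1 /u2 /weighted_diff/= nabB -mulrDr subrK.
  have d1 : 0 <= `|u1| / C1 by rewrite divr_ge0// ltW.
  have d2 : 0 <= `|u2| / C2 by rewrite divr_ge0// ltW.
  apply: (@cm_add R _ (`|u1| / C1) (`|u2| / C2)) => //; first by rewrite divr_ge0// ltW.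
  apply: (@le_trans _ _ ((`|u1| + `|u2|) / (C1 + C2))).
    by rewrite ler_wpM2r ?ler_normD// invr_ge0 ltW.
  rewrite mulrDl; apply: lerD; rewrite ler_wpM2l// lef_pV2 ?posrE// ?lerDl ?lerDr ltW//.
under eq_integral do rewrite EFinD.
rewrite ge0_integralD//; try by [move=> x _; rewrite lee_fin|apply: measurable_funTS; exact/measurable_EFinP].
by rewrite -EFinM mulrDl mul1r EFinD; apply: leeD.
Qed.

Theorem omega_le_Kfunctional k r p (alpha beta : R) (a := r%:R / 2 + alpha) (b := r%:R / 2 + beta) :
  (0 < k)%N -> (1 <= p)%E -> 0 <= a -> 0 <= b ->
  exists2 C : R, 0 < C & forall f t, Bspace r p (wjac alpha beta) f -> 0 < t ->
    (omega k r (derive1n r f) t alpha beta p <=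
     C%:E * Kfunctional k r (derive1n r f) (t ^+ k) alpha beta p)%E.
Proof.
move=> k0 p1 a0 b0; have [C2 C20 HC2] := @direct_estimate R k a b k0 a0 b0.
pose C1 : R := k.+1%:R * 2 ^+ k; pose K : R := k.+1%:R * 2.
have C1E : C1 = k.+1%:R * 2 ^+ k by [].
have C10 : 0 < C1 by rewrite /C1 mulr_gt0 ?exprn_gt0 ?ltr0n.
have KE : K = k.+1%:R * 2 by [].
have K0 : 0 <= K by rewrite /K mulr_ge0.
clearbody C1 K.
have Kp : 0 < K + 1 by real_lra.
have CC0 : 0 < (C1 + C2) * 2 * (K + 1) by apply: mulr_gt0 => //; apply: mulr_gt0 => //; exact: addr_gt0.
exists ((C1 + C2) * 2 * (K + 1)) => // f t Bf t0.
have [F0 [mF0 aeF _]] := Bspace_representative p1 Bf.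
set F := derive1n r f in aeF *.
apply: ge_ereal_sup => _ [tau tauI <-]; move: tauI; rewrite /= in_itv/= => /andP[tau0 taut].
rewrite (@Lpnorm_wdiff R k r alpha beta tau F F0 p k0 tau0 p1 mF0 aeF) -/a -/b -lee_pdivrMl//.
apply: le_ereal_inf_tmp => _ [g Bg <-]; rewrite lee_pdivrMl//.
set A := Lpnorm I p (fun x => wjac alpha beta x * _ * (F x - _))%R.
set B := Lpnorm I p (fun x => wjac alpha beta x * _ * _)%R.
have A0 : (0 <= A)%E by exact: Lpnorm_ge0.
have B0 : (0 <= B)%E by exact: Lpnorm_ge0.
have tk0 : 0 < t ^+ k by rewrite exprn_gt0.
have tB0 : (0 <= (t ^+ k)%:E * B)%E by rewrite mule_ge0// lee_fin ltW.
have T0 : (0 <= A + (t ^+ k)%:E * B)%E by rewrite adde_ge0.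
have [->|Tfin] := eqVneq (A + (t ^+ k)%:E * B)%E +oo%E; first by rewrite gt0_muley ?leey// lte_fin.
(* For a fixed competitor g, M is the whole K-functional expression, which bounds both of its terms
   at once. *)
have [M ME] : exists M, (A + (t ^+ k)%:E * B)%E = M%:E.
  by move: T0 Tfin; case: (A + (t ^+ k)%:E * B)%E => // M _ _; exists M.
have M0 : 0 <= M by rewrite -lee_fin -ME.
have AM : (A <= M%:E)%E by rewrite -ME leeDl.
have BM : ((t ^+ k)%:E * B <= M%:E)%E by rewrite -ME leeDr.
rewrite ME -EFinM; clear ME T0 Tfin tB0.
have [h [mh aeh _]] := Bspace_representative p1 Bg.
have dG := Bspace_derivative_density k0 Bg aeh.
set G := derive1n r g in A AM A0 dG *.
(* g^(r) is continuous on (-1, 1) since k > 0, so its Borel version agrees with it at every interior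
   point; the Taylor estimate needs equality at each node. *)
have [G0 mG0 GG0] := continuous_representative (fun x => derivative_density_continuous (x := x) k0 dG).
have mv := @measurable_wjac R a b.
have v0 x : 0 <= wjac a b x by exact: wjac_ge0.
have mI : measurable (I : set TR) by exact: measurable_itv.
have cm := convmod_modular p1 M0.
have mFG : measurable_fun setT (fun y : TR => F0 y - G0 y) by exact: measurable_funB.
have m1 : measurable_fun setT (fun x : TR => wjac a b x * (F0 x - G0 x)) by exact: measurable_funM.
have mh1 : measurable_fun setT (fun x : TR => wjac a b x * phi x ^+ k * h x).
  apply: measurable_funM => //; apply: measurable_funM => //.
  by apply: measurable_funX; exact: measurable_phi.
have AE : A = Lpnorm I p (fun x => wjac a b x * (F0 x - G0 x))%R.
  apply: Lpnorm_ae_itv => //.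
  apply: (@filterS _ _ (ae_filter_ringOfSetsType mu) _ _ _ aeF) => x Hx x1.
  by rewrite Hx// GG0// /a /b wjac_phi.
have BE : B = Lpnorm I p (fun x => wjac a b x * phi x ^+ k * h x)%R.
  apply: Lpnorm_ae_itv => //.
  apply: (@filterS _ _ (ae_filter_ringOfSetsType mu) _ _ _ aeh) => x Hx x1.
  by rewrite Hx// /a /b wjac_phi// exprD; congr (_ * _); rewrite -mulrA (mulrC (phi x ^+ r)).
rewrite AE in AM; rewrite BE in BM; clear A A0 AE B B0 BE.
have /(Lpnorm_modular mI p1 M0 m1) H1 := AM.
have /(Lpnorm_scale mI p1 M0 tk0 mh1) BM' := BM.
have mth : measurable_fun setT (fun x : TR => t ^+ k * (wjac a b x * phi x ^+ k * h x)) by exact: measurable_funM.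
have /(Lpnorm_modular mI p1 M0 mth) H2 := BM'.
have K1 : 1 <= K + 1 by real_lra.
apply: Lpnorm_le_of_modular => //.
- by rewrite mulr_gt0// addr_gt0.
- exact: measurable_strict_wdiff.
apply: (@strict_wdiff_modular_le k p a b tau C1 C2 K M F0 G0) => //.
  rewrite C1E EFinM KE; apply: (le_trans (bounded_estimate k0 a0 b0 cm mFG tau0)).
  apply: lee_wpmul2l; first by rewrite lee_fin mulr_ge0.
  apply: le_trans H1; rewrite le_eqVlt; apply/orP; left; apply/eqP; apply: eq_integral => x _.
  by rewrite normrM (ger0_norm (v0 x)).
apply: (le_trans (HC2 _ G G0 h tau cm mG0 GG0 mh dG tau0)); apply: le_trans H2.
apply: le_integral_fin => //.
- by apply: measurableT_comp; [exact: cm_meas cm|exact: measurable_weighted_density].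
- by apply: measurableT_comp; [exact: cm_meas cm|exact: measurableT_comp].
- by move=> x; apply: (cm_ge0 cm); apply: weighted_density_ge0; exact: ltW.
- by move=> x; exact: (cm_ge0 cm).
move=> x x1; left; split => //; apply: (cm_mono cm); first by apply: weighted_density_ge0; exact: ltW.
have vp : 0 <= wjac a b x * phi x ^+ k by exact: mulr_ge0 (v0 x) (exprn_ge0 k (phi_ge0 x)).
have -> : tau ^+ k * wjac a b x * phi x ^+ k * `|h x| = tau ^+ k * ((wjac a b x * phi x ^+ k) * `|h x|) by ring.
rewrite normrM (gtr0_norm tk0) normrM (ger0_norm vp).
apply: ler_wpM2r; first by apply: mulr_ge0.
by rewrite lerXn2r// nnegrE ltW.
Qed.

End direct_inequality.

Theorem corollary1p7 (R : realType) (k r : nat) (p : \bar R) (alpha beta : R)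
    (hk : (0 < k)%N) (hp : (1 <= p)%E)
    (halpha : 0 <= r%:R / 2 + alpha) (hbeta : 0 <= r%:R / 2 + beta) :
  exists c1 c2 c3 : R,
    (0 < c1 /\ 0 < c2 /\ 0 < c3) /\
    forall f : R -> R, Bspace r p (wjac alpha beta) f ->
    forall t : R, 0 < t -> t <= 2 / k%:R ->
      (Kfunctional k r (derive1n r f) (t ^+ k) alpha beta p
         <= c1%:E * omega_star k r (derive1n r f) t alpha beta p)%E /\
      (c1%:E * omega_star k r (derive1n r f) t alpha beta p
         <= c2%:E * omega k r (derive1n r f) t alpha beta p)%E /\
      (c2%:E * omega k r (derive1n r f) t alpha beta p
         <= c3%:E * Kfunctional k r (derive1n r f) (t ^+ k) alpha beta p)%E.
Proof.
have [C C0 HC] := Kfunctional_le_omega_star hk hp halpha hbeta.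
have [D D0 HD] := omega_le_Kfunctional hk hp halpha hbeta.
exists C, C, (C * D); split; first by rewrite mulr_gt0.
move=> f Bf t t0 tk.
(* The nodes are built for t <= 2, which contains the range t <= 2 / k. *)
have t2 : t <= 2.
  by apply: (le_trans tk); rewrite ler_pdivrMr ?ltr0n// ler_peMr// ler1n.
have [F0 [mF0 aeF _]] := Bspace_representative hp Bf.
split; first exact: HC.
have C0' : (0 <= C%:E)%E by rewrite lee_fin ltW.
split; first by apply: lee_wpmul2l => //; exact: (omega_star_le_omega _ _ _ hk hp t0 mF0 aeF).
by rewrite EFinM -muleA; apply: lee_wpmul2l => //; exact: HD.
Qed.
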